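(* Let $r_0,\mu,c_1,c_2,c_3,c_4>0$. There exist $\epsilon_0,C_0>0$ depending only on these parameters such that the following holds for every $0<\epsilon\le\epsilon_0$. Assume that $w_{0,\epsilon}\in L^\infty(\mathbb H)$ satisfies (i) $0\le \frac{w_{0,\epsilon}(x)}{r}<c_1\epsilon^{-2}$, (ii) $|M_0(w_{0,\epsilon})-\mu|<c_2|\log\epsilon|^{-1}$, (iii) $|M_2(w_{0,\epsilon})-r_0^2\mu|<c_3|\log\epsilon|^{-1}$, (iv) $\left|E(w_{0,\epsilon})-\frac{r_0\mu^2}{2\pi}|\log\epsilon|\right|<c_4$. Let $w_\epsilon(\cdot,t)$ be the corresponding solution of the axisymmetric Euler equation without swirl with initial datum $w_{0,\epsilon}$. Then for every $t\in\mathbb R$ there is a point $x_\epsilon^*(t)=(r_\epsilon^*(t),z_\epsilon^*(t))\in\mathbb H$ such that (a) $|r_\epsilon^*(t)-r_0|\le C_0|\log\epsilon|^{-1}$ and $\displaystyle\int_{|x-x_\epsilon^*(t)|\ge\epsilon^{1/2}}(1+r^2)\,w_\epsilon(x,t)\,dx\le C_0|\log\epsilon|^{-1}.$ If in addition (v) $A_{0,\epsilon}:=\int_{\mathbb H}\langle z\rangle r^2w_{0,\epsilon}(x)\,dx<+\infty$, then for all $t\in\mathbb R$ (b) $\displaystyle\left|z_\epsilon^*(t)-\frac{\mu}{4\pi r_0}|\log\epsilon|\,t\right|\le C_0\,(1+A_{0,\epsilon}+|t|).$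
   Context: $\mathbb H=\{x=(r,z): r>0,\ z\in\mathbb R\}$, $dx=dr\,dz$, and $\langle z\rangle=\sqrt{1+z^2}$. Axisymmetric Euler equation without swirl: $\partial_t w+\nabla\cdot(uw)=0$ on $\mathbb H$, where $\nabla\cdot(uw)=\partial_r(u^rw)+\partial_z(u^zw)$ and the velocity $u=(u^r,u^z)$ is $u(x,t)=\int_{\mathbb H}K(x,x')w(x',t)\,dx'$ with $$K(x,x')=\frac1{2\pi}F_1(s)\frac{(x-x')^\perp}{r\sqrt{rr'}}+\frac1{2\pi}F_2(s)\frac1r\sqrt{\frac{r'}{r}}\begin{pmatrix}0\\1\end{pmatrix},\quad s=\frac{|x-x'|}{\sqrt{rr'}},\quad (r,z)^\perp=(z,-r),$$ $$F_1(s)=\int_0^\pi\frac{\cos a}{(s^2+2-2\cos a)^{3/2}}da,\qquad F_2(s)=\int_0^\pi\frac{1-\cos a}{(s^2+2-2\cos a)^{3/2}}da.$$ Under hypotheses (i)--(iv), $w_{0,\epsilon}$ and $w_{0,\epsilon}/r$ belong to $L^1\cap L^\infty(\mathbb R^3)$ (viewed as axisymmetric functions), and ''the corresponding solution'' is the unique global solution with $w,\ w/r\in L^\infty_{loc}(\mathbb R;L^1\cap L^\infty(\mathbb R^3))$; existence and uniqueness are known, and $w/r$ is transported by the flow of $u$. Functionals: $M_0(w)=\int_{\mathbb H}w\,dx$, $M_2(w)=\int_{\mathbb H}r^2w\,dx$, and $$E(w)=\iint_{\mathbb H\times\mathbb H}\frac{\sqrt{rr'}}{2\pi}F\!\left(\frac{|x-x'|^2}{rr'}\right)w(x)w(x')\,dx\,dx',\qquad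 F(\sigma)=\int_0^\pi\frac{\cos a}{(\sigma+2-2\cos a)^{1/2}}da.$$ These are conserved by the solutions considered. *)

(* Defs.v *)
From HB Require Import structures.
From mathcomp Require Import all_boot all_order all_algebra.
From mathcomp Require Import all_classical all_reals all_analysis.

Set Implicit Arguments.
Unset Strict Implicit.
Unset Printing Implicit Defensive.

Import Order.TTheory GRing.Theory Num.Theory.
Import numFieldNormedType.Exports.

Local Open Scope classical_set_scope.
Local Open Scope ring_scope.

(* A point x = (r, z) of the meridian half-plane is a pair x : R * R with
   x.1 = r and x.2 = z.  Functions on the half-plane are total functions on
   R * R whose values outside of [halfplane] are irrelevant. *)

Notation leb2 := (lebesgue_measure \x lebesgue_measure)%E.

Section Defs.
Context {R : realType}.
Implicit Types (x y : R * R) (f phi : R * R -> R) (w : R -> R * R -> R).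

Definition halfplane : set (R * R) := [set x | 0 < x.1].

(* The Euclidean distance; the library norm on R * R is the sup norm. *)
Definition eucl_dist x y : R :=
  Num.sqrt ((x.1 - y.1) ^+ 2 + (x.2 - y.2) ^+ 2).

Definition japanese (z : R) : R := Num.sqrt (1 + z ^+ 2).

Definition F1 (s : R) : R :=
  \int[lebesgue_measure]_(a in `[0, pi])
    (cos a / (s ^+ 2 + 2 - 2 * cos a) `^ (3 / 2)).

Definition F2 (s : R) : R :=
  \int[lebesgue_measure]_(a in `[0, pi])
    ((1 - cos a) / (s ^+ 2 + 2 - 2 * cos a) `^ (3 / 2)).

Definition Fell (sigma : R) : R :=
  \int[lebesgue_measure]_(a in `[0, pi])
    (cos a / (sigma + 2 - 2 * cos a) `^ (1 / 2)).

Definition sdist x y : R := eucl_dist x y / Num.sqrt (x.1 * y.1).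

(* The two components of the Biot-Savart kernel K(x, y), with
   (r, z)^perp = (z, - r). *)
Definition Kr x y : R :=
  1 / (2 * pi) * F1 (sdist x y) * ((x.2 - y.2) / (x.1 * Num.sqrt (x.1 * y.1))).

Definition Kz x y : R :=
  1 / (2 * pi) * F1 (sdist x y)
    * (- (x.1 - y.1) / (x.1 * Num.sqrt (x.1 * y.1)))
  + 1 / (2 * pi) * F2 (sdist x y) * (1 / x.1) * Num.sqrt (y.1 / x.1).

Definition velr f x : R := \int[leb2]_(y in halfplane) (Kr x y * f y).
Definition velz f x : R := \int[leb2]_(y in halfplane) (Kz x y * f y).

(* The functionals are only used for functions which are nonnegative almost
   everywhere on the half-plane (Fell is nonnegative too), so that the
   extended-real integrals are the usual ones, possibly infinite. *)
Definition M0 f : \bar R := (\int[leb2]_(x in halfplane) (f x)%:E)%E.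

Definition M2 f : \bar R := (\int[leb2]_(x in halfplane) (x.1 ^+ 2 * f x)%:E)%E.

Definition energy f : \bar R :=
  (\int[leb2]_(x in halfplane) \int[leb2]_(y in halfplane)
    (Num.sqrt (x.1 * y.1) / (2 * pi)
     * Fell (eucl_dist x y ^+ 2 / (x.1 * y.1)) * f x * f y)%:E)%E.

Definition A0 f : \bar R :=
  (\int[leb2]_(x in halfplane) (japanese x.2 * x.1 ^+ 2 * f x)%:E)%E.

Definition in_Linfty f : Prop :=
  measurable_fun halfplane f /\
  exists M : R, {ae leb2, forall x, halfplane x -> `|f x| <= M}.

(* f, viewed as an axisymmetric function on R^3, has L^1 and L^oo norms at
   most M; the volume element of R^3 is 2 pi r dr dz. *)
Definition L1_Linfty_le f (M : R) : Prop :=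
  (\int[leb2]_(x in halfplane) (2 * pi * x.1 * `|f x|)%:E <= M%:E)%E /\
  {ae leb2, forall x, halfplane x -> `|f x| <= M}.

Definition loc_bounded_L1_Linfty w : Prop :=
  forall T : R, exists M : R, forall t : R, `|t| <= T -> L1_Linfty_le (w t) M.

Definition dr phi x : R := derive1 (fun r : R => phi (r, x.2)) x.1.
Definition dz phi x : R := derive1 (fun z : R => phi (x.1, z)) x.2.

Definition C1c_halfplane phi : Prop :=
  [/\ forall x, derivable (fun r : R => phi (r, x.2)) x.1 1 /\
                derivable (fun z : R => phi (x.1, z)) x.2 1,
      continuous (dr phi), continuous (dz phi) &
      exists2 A : set (R * R), compact A /\ A `<=` halfplane &
        forall x, ~ A x -> phi x = 0].

(* d_t w + div (u w) = 0 with u = K * w, tested against functions of x only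
   and integrated in time; this singles out the weakly continuous in time
   representative of w, which makes sense at every time t. *)
Definition weak_euler w : Prop :=
  forall phi, C1c_halfplane phi -> forall t1 t2 : R, t1 <= t2 ->
    \int[leb2]_(x in halfplane) (phi x * w t2 x)
    - \int[leb2]_(x in halfplane) (phi x * w t1 x)
    = \int[lebesgue_measure]_(t in `[t1, t2])
        (\int[leb2]_(x in halfplane)
          (w t x * (velr (w t) x * dr phi x + velz (w t) x * dz phi x))).

Definition flow_of_velocity w (X : R -> R * R -> R * R) : Prop :=
  [/\ forall x, halfplane x -> X 0 x = x,
      forall t, set_bij halfplane halfplane (X t) &
      forall x, halfplane x -> forall t : R,
        is_derive t (1 : R) (fun s : R => (X s x).1) (velr (w t) (X t x)) /\
        is_derive t (1 : R) (fun s : R => (X s x).2) (velz (w t) (X t x))].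

(* w / r is the transport of the almost everywhere class of w0 / r, i.e.
   (w t / r) \o X t = w0 / r.  The equality is required for each
   representative q of w0 / r, as it should be for a statement on classes
   (X t preserves the measure r dr dz, hence null sets). *)
Definition transported (w0 : R * R -> R) w (X : R -> R * R -> R * R) : Prop :=
  forall q : R * R -> R,
    {ae leb2, forall x, halfplane x -> q x = w0 x / x.1} ->
  forall t : R,
    {ae leb2, forall y, halfplane y ->
       forall x, halfplane x -> X t x = y -> w t y / y.1 = q x}.

(* The global solution, in the uniqueness class of the equation, with datum
   w0 at t = 0. *)
Definition euler_solution (w0 : R * R -> R) w : Prop :=
  [/\ measurable_fun (setT `*` halfplane) (fun p : R * (R * R) => w p.1 p.2),
      loc_bounded_L1_Linfty w /\
      loc_bounded_L1_Linfty (fun t x => w t x / x.1),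
      {ae leb2, forall x, halfplane x -> w 0 x = w0 x},
      weak_euler w &
      exists2 X, flow_of_velocity w X & transported w0 w X].

End Defs.

(* Main.v *)
(* Write L for |log eps|, d for the distance of two points and m = sqrt (r r').

   Localisation.  The energy kernel G is at most
   (m / 2 pi) (L (1 - 1_{d >= sqrt eps} / 2) + O(1 + m)), up to a part supported
   in d < eps which w <= c1 eps^-2 r makes harmless.  Hence (iv) yields
   S^2 - F / 2 >= r0 mu^2 - O(1 / L), where S is the integral of sqrt r w and F
   that of m w w' over d >= sqrt eps.  Since (r - r0)^2 <= r^2 - 4 r0^(3/2) sqrt r
   + 3 r0^2, the mass and the second moment bound S from above, so that F and the
   integral of (r - r0)^2 w are both O(1 / L); the centre is found by averaging F.

   Velocity.  Test the equation with r^2 h(z).  The velocity satisfies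
   r u = rot G[w], and after symmetrisation in x and x' the singular part of the
   flux gains a factor d^2 and is bounded, while G / 2 remains: by localisation
   the flux is zeta times the integral of r^2 h' w up to O(1), with
   zeta = mu L / (4 pi r0), uniformly when r^2 and h are cut off.

   Time.  Only the weak equation and the bounds 0 <= w / r < c1 eps^-2 are used.
   Mass is conserved, and M2 does not increase.  For the energy one tests with
   G_e[w_a + w_b], where G_e is regularised; its flux by w_t is small for t in
   [a, b] because rot G[w] is orthogonal to grad G[w].  Finally the integral of
   r^2 h(z - zeta t) w_t, with h a truncation of <z>, moves with speed O(1), and
   it controls |z* - zeta t| because most of the mass is near the centre. *)

(* The weak form of the equation only admits test functions with compact support away from the axis,
   and no regularity of the flux in time is used. Hence every functional is cut off, and the class
   of tests is enlarged twice: to bounded gradients once mass is known to be conserved, and to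
   gradients growing like 1 + r once the second moment is bounded. Near the axis the cutoff is
   harmless because w <= c r. Time dependence is treated through increments on short intervals, on
   which superlinear errors vanish under refinement.

   That M2 is only shown not to increase is repaired by the energy: the upper bound suffices for
   localisation, and the lower bound for S found there, inserted in M2 >= 4 r0^(3/2) S - 3 r0^2 M0,
   returns the lower bound for M2 up to O(1 / L), which the velocity estimate requires.

   The bound M of a density and the cutoff parameter n depend on the solution and on time, but do
   not enter the final constants; these are built from p = sqrt r0, mu and c1, ..., c4, and eps0
   makes a fixed multiple of 1 / L at most 1. *)
Require Import Defs.
From HB Require Import structures.
From mathcomp Require Import all_boot all_order all_algebra.
From mathcomp Require Import all_classical all_reals all_analysis.
From mathcomp Require Import measurable_realfun.
From mathcomp Require Import ring lra.
Import Order.TTheory GRing.Theory Num.Theory.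
Import numFieldNormedType.Exports.
Local Open Scope classical_set_scope.
Local Open Scope ring_scope.

Set Implicit Arguments.
Unset Strict Implicit.
Unset Printing Implicit Defensive.

(** * Complements on measurability, integrals and product measures *)

Section MeasurabilityComplements.
Context d (T : measurableType d) (R : realType) (D : set T).
Implicit Types f : T -> R.

(** The identity f^-1 = f * (f^2)^-1 reduces the claim to a power of a nonnegative base; both sides
    are 0 where f vanishes. *)
Lemma measurable_funV f : measurable_fun D f -> measurable_fun D (fun x => (f x)^-1).
Proof.
move=> mf; have -> : (fun x => (f x)^-1) = (fun x => f x * (f x ^+ 2) `^ (-1)).
  apply/funext => x; rewrite powR_inv1 ?sqr_ge0//.
  have [->|f0] := eqVneq (f x) 0; first by rewrite invr0 mul0r.
  by rewrite expr2 invfM mulrA divff// mul1r.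
apply: measurable_funM => //.
apply: (measurableT_comp (measurable_powR _)) => //.
exact: measurable_funX.
Qed.

Lemma measurable_fun_sqrt f :
  measurable_fun D f -> measurable_fun D (fun x => Num.sqrt (f x)).
Proof.
move=> mf; apply: (measurableT_comp _ mf).
apply: continuous_measurable_fun; exact: sqrt_continuous.
Qed.

Lemma measurable_fun_bool_nat (b : T -> bool) :
  measurable_fun setT b -> measurable_fun setT (fun x => (b x)%:R : R).
Proof.
move=> mb; have -> : (fun x => (b x)%:R : R) = \1_(b @^-1` [set true]).
  apply/funext => x; rewrite indicE; case E : (b x); first by rewrite mem_set.
  by rewrite memNset//= E.
apply: measurable_indic; rewrite -[X in measurable X]setTI; exact: mb.
Qed.

End MeasurabilityComplements.

Section IntegralComplements.
Context d (T : measurableType d) (R : realType).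
Variable mu : {measure set T -> \bar R}.
Local Open Scope ereal_scope.

(** The integral of a nonnegative function is the supremum of the integrals of the simple functions
    below it, hence it is monotone even among nonmeasurable functions. *)
Lemma le_integral_nomeas (D : set T) (f g : T -> \bar R) :
  (forall x, D x -> 0 <= f x) -> (forall x, D x -> f x <= g x) ->
  \int[mu]_(x in D) f x <= \int[mu]_(x in D) g x.
Proof.
move=> f0 fg; rewrite !(integral_mkcond D).
have f0' x : 0 <= (f \_ D) x by apply: erestrict_ge0.
have fg' x : (f \_ D) x <= (g \_ D) x.
  by rewrite /patch; case: ifPn => // /set_mem; exact: fg.
rewrite !ge0_integralTE//; last by move=> x; exact: (le_trans (f0' x) (fg' x)).
apply: ereal_sup_le => _ [h /= hf <-]; exists h => // x.
exact: le_trans (hf x) (fg' x).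
Qed.

(** The positive and the negative part of f both have an integral between 0 and B, and two such
    numbers differ by at most B. This covers functions f that may fail to be measurable. *)
Lemma Rintegral_bound (D : set T) (f b : T -> R) (B : R) :
  (forall x, D x -> `|f x| <= b x)%R -> \int[mu]_(x in D) (b x)%:E <= B%:E ->
  (`|\int[mu]_(x in D) f x| <= B)%R.
Proof.
move=> fb bB.
have bnd (g : T -> \bar R) : (forall x, D x -> 0 <= g x /\ g x <= (b x)%:E) ->
    0 <= \int[mu]_(x in D) g x <= B%:E.
  move=> H; apply/andP; split; first by apply: integral_ge0 => x /H[].
  by apply: le_trans bB; apply: le_integral_nomeas => x /H[].
have := bnd ((EFin \o f)^\+); have := bnd ((EFin \o f)^\-).
move=> /(_ _)/andP[|n0 nB].
  move=> x Dx; split; first exact: funeneg_ge0.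
  rewrite funenegE/= -EFin_max lee_fin ge_max; apply/andP; split.
    by apply: le_trans (fb _ Dx); rewrite -normrN ler_norm.
  by apply: le_trans (fb _ Dx).
move=> /(_ _)/andP[|p0 pB].
  move=> x Dx; split; first exact: funepos_ge0.
  rewrite funeposE/= -EFin_max lee_fin ge_max; apply/andP; split.
    by apply: le_trans (fb _ Dx); rewrite ler_norm.
  by apply: le_trans (fb _ Dx).
rewrite /Rintegral integralE.
have nfin : \int[mu]_(x in D) (EFin \o f)^\- x \is a fin_num.
  by rewrite ge0_fin_numE//; exact: le_lt_trans nB (ltry _).
have pfin : \int[mu]_(x in D) (EFin \o f)^\+ x \is a fin_num.
  by rewrite ge0_fin_numE//; exact: le_lt_trans pB (ltry _).
rewrite fineB//.
move: n0 nB p0 pB; rewrite -(fineK nfin) -(fineK pfin) !lee_fin/=.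
move=> *; rewrite ler_norml; apply/andP; split; lra.
Qed.

(** The positive and negative parts of f are squeezed between constants, and max a 0 - max (- a) 0 =
    a recombines the bounds. It serves for the time integral of the flux, whose integrand is only
    compared pointwise with the constant k. *)
Lemma Rintegral_cst_bound (D : set T) (f : T -> R) (k S : R) :
  measurable D -> mu D < +oo ->
  (forall x, D x -> `|f x - k| <= S)%R ->
  (`|\int[mu]_(x in D) f x - k * fine (mu D)| <= S * fine (mu D))%R.
Proof.
move=> mD muD fk.
have [->|/set0P[x0 Dx0]] := eqVneq D set0.
  by rewrite Rintegral_set0 measure0/= !mulr0 subr0 normr0.
have S0 : (0 <= S)%R by apply: le_trans (fk _ Dx0).
have muDf : mu D \is a fin_num by rewrite ge0_fin_numE.
have m0 : (0 <= fine (mu D))%R by rewrite fine_ge0.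
have ic (c : R) : \int[mu]_(x in D) c%:E = (c * fine (mu D))%:E.
  by rewrite integral_cst// EFinM fineK.
rewrite /Rintegral integralE.
have lo x : D x -> (k - S <= f x <= k + S)%R.
  by move=> /fk; rewrite ler_norml => /andP[? ?]; apply/andP; split; lra.
have P1 : \int[mu]_(x in D) (EFin \o f)^\+ x <= (Num.max (k + S) 0 * fine (mu D))%:E.
  rewrite -ic; apply: le_integral_nomeas => x Dx; first exact: funepos_ge0.
  rewrite funeposE/= -EFin_max lee_fin; have /andP[a b] := lo _ Dx.
  by rewrite ge_max !le_max b/= lexx orbT.
have P2 : (Num.max (k - S) 0 * fine (mu D))%:E <= \int[mu]_(x in D) (EFin \o f)^\+ x.
  rewrite -ic; apply: le_integral_nomeas => x Dx; first by rewrite lee_fin le_max lexx orbT.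
  rewrite funeposE/= -EFin_max lee_fin; have /andP[a b] := lo _ Dx.
  by rewrite ge_max !le_max a/= lexx orbT.
have N1 : \int[mu]_(x in D) (EFin \o f)^\- x <= (Num.max (S - k) 0 * fine (mu D))%:E.
  rewrite -ic; apply: le_integral_nomeas => x Dx; first exact: funeneg_ge0.
  rewrite funenegE/= -EFin_max lee_fin; have /andP[a b] := lo _ Dx.
  rewrite ge_max !le_max lexx orbT/=; apply/andP; split => //.
  by rewrite lerNl opprB a.
have N2 : (Num.max (- k - S) 0 * fine (mu D))%:E <= \int[mu]_(x in D) (EFin \o f)^\- x.
  rewrite -ic; apply: le_integral_nomeas => x Dx; first by rewrite lee_fin le_max lexx orbT.
  rewrite funenegE/= -EFin_max lee_fin; have /andP[a b] := lo _ Dx.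
  rewrite ge_max !le_max lexx orbT/=; apply/andP; split => //.
  by rewrite lerNr opprB opprK addrC b.
have pfin : \int[mu]_(x in D) (EFin \o f)^\+ x \is a fin_num.
  rewrite ge0_fin_numE//; first exact: le_lt_trans P1 (ltry _).
  by apply: integral_ge0 => *; exact: funepos_ge0.
have nfin : \int[mu]_(x in D) (EFin \o f)^\- x \is a fin_num.
  rewrite ge0_fin_numE//; first exact: le_lt_trans N1 (ltry _).
  by apply: integral_ge0 => *; exact: funeneg_ge0.
rewrite fineB//; move: P1 P2 N1 N2.
rewrite -(fineK nfin) -(fineK pfin) !lee_fin/=.
set m := fine (mu D); set p := fine (integral _ _ (_^\+)); set n := fine _.
move=> P1 P2 N1 N2.
have mx (a : R) : (Num.max a 0 - Num.max (- a) 0 = a)%R.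
  have [a0|a0] := leP a 0%R; last first.
    by rewrite max_r ?subr0// oppr_le0 ltW.
  by rewrite max_l ?oppr_ge0// opprK add0r.
have E1 : (Num.max (k + S) 0 * m - Num.max (- k - S) 0 * m = (k + S) * m)%R.
  by rewrite -mulrBl -opprD mx.
have E2 : (Num.max (k - S) 0 * m - Num.max (S - k) 0 * m = (k - S) * m)%R.
  by rewrite -mulrBl -(opprB k) mx.
rewrite ler_norml; apply/andP; split; nra.
Qed.

End IntegralComplements.

Ltac meas_step := lazymatch goal with
  | |- measurable_fun _ (fun=> ?c) => exact: measurable_cst
  | |- measurable_fun _ (fun x => @?f x - @?g x) => apply: (@measurable_funB _ _ _ _ f g)
  | |- measurable_fun _ (fun x => @?f x + @?g x) => apply: (@measurable_funD _ _ _ _ f g)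
  | |- measurable_fun _ (fun x => - @?f x) => apply: (@measurable_funN _ _ _ _ f)
  | |- measurable_fun _ (fun x => @?f x ^+ ?n) => apply: (@measurable_funX _ _ _ _ f n)
  | |- measurable_fun _ (fun x => (@?f x)^-1) => apply: (@measurable_funV _ _ _ _ f)
  | |- measurable_fun _ (fun x => @?f x * @?g x) => apply: (@measurable_funM _ _ _ _ f g)
  | |- measurable_fun _ (fun x => Num.sqrt (@?f x)) => apply: (@measurable_fun_sqrt _ _ _ _ f)
  | |- measurable_fun _ (fun x => `|@?f x|) => apply: (measurableT_comp (normr_measurable _) (f := f))
  end.
Ltac meas := repeat meas_step; try assumption.

Section ProductComplements.
Context d1 d2 (T1 : measurableType d1) (T2 : measurableType d2) (R : realType).
Variables (m1 : {sigma_finite_measure set T1 -> \bar R})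
          (m2 : {sigma_finite_measure set T2 -> \bar R}).
Implicit Types k : T1 * T2 -> R.

(** Tonelli is applied to the positive and negative parts separately; where the result is infinite,
    [fine] replaces it by 0, and [fine] is measurable. *)
Lemma measurable_fun_param_Rintegral (D : set T2) k : measurable D ->
  measurable_fun setT k ->
  measurable_fun setT (fun x => \int[m2]_(y in D) k (x, y)).
Proof.
move=> mD mk; rewrite /Rintegral.
apply: (measurableT_comp (@fine_measurable R _ measurableT)) => //.
under eq_fun do rewrite integralE.
have mk' : measurable_fun setT (EFin \o (fun p : T1 * T2 => k p * \1_D p.2)).
  apply/measurable_EFinP/measurable_funM => //.
  apply: measurableT_comp => //; exact: measurable_indic.
have E (f : T1 * T2 -> \bar R) : (forall p, 0 <= f p)%E -> measurable_fun setT f ->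
    measurable_fun setT (fun x => \int[m2]_(y in D) f (x, y))%E.
  move=> f0 mf.
  have -> : (fun x => \int[m2]_(y in D) f (x, y))%E =
            (fun x => \int[m2]_y (f (x, y) * (\1_D y)%:E))%E.
    apply/funext => x; rewrite integral_mkcond; apply: eq_integral => y _.
    by rewrite epatch_indic.
  apply: (@measurable_fun_fubini_tonelli_F _ _ _ _ _ m2
    (fun p => f p * (\1_D p.2)%:E)%E).
    apply: emeasurable_funM => //; apply/measurable_EFinP.
    by apply: measurableT_comp => //; exact: measurable_indic.
  by move=> p; rewrite mule_ge0// lee_fin.
apply: emeasurable_funB.
- have -> : (fun x => \int[m2]_(y in D) (fun x1 => (k (x, x1))%:E)^\+ y)%E =
     (fun x => \int[m2]_(y in D) ((EFin \o k)^\+ (x, y)))%E.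
    by apply/funext => x; apply: eq_integral => y _; rewrite !funeposE.
  apply: E; first by move=> p; exact: funepos_ge0.
  by apply: measurable_funepos; exact/measurable_EFinP.
- have -> : (fun x => \int[m2]_(y in D) (fun x1 => (k (x, x1))%:E)^\- y)%E =
     (fun x => \int[m2]_(y in D) ((EFin \o k)^\- (x, y)))%E.
    by apply/funext => x; apply: eq_integral => y _; rewrite !funenegE.
  apply: E; first by move=> p; exact: funeneg_ge0.
  by apply: measurable_funeneg; exact/measurable_EFinP.
Qed.

Lemma Rintegral_prod k :
  (m1 \x m2)%E.-integrable setT (EFin \o k) ->
  (forall x, m2.-integrable setT (fun y => (k (x, y))%:E)) ->
  \int[(m1 \x m2)%E]_p k p = \int[m1]_x \int[m2]_y k (x, y).
Proof.
move=> ik ikx; rewrite /Rintegral -(integral12_prod_meas1 ik); congr fine.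
apply: eq_integral => x _; rewrite fineK//.
exact: integrable_fin_num.
Qed.

Lemma ge0_integral_prod (k : T1 * T2 -> \bar R) : measurable_fun setT k ->
  (forall p, 0 <= k p)%E ->
  (\int[(m1 \x m2)%E]_p k p = \int[m1]_x \int[m2]_y k (x, y))%E.
Proof. by move=> mk k0; rewrite fubini_tonelli1. Qed.

End ProductComplements.

Section SwapComplements.
Context d (T : measurableType d) (R : realType).
Variable m : {sigma_finite_measure set T -> \bar R}.

Lemma integrable_swap (k : T * T -> R) :
  (m \x m)%E.-integrable setT (EFin \o k) ->
  (m \x m)%E.-integrable setT (EFin \o (fun p => k (p.2, p.1))).
Proof.
move=> /integrableP[/measurable_EFinP mk ik].
have ms : measurable_fun setT (fun p : T * T => (p.2, p.1)).
  exact: measurable_swap.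
apply/integrableP; split.
  by apply/measurable_EFinP; exact: (measurableT_comp mk).
rewrite fubini_tonelli1//=; last first.
  by apply: measurableT_comp => //; apply: measurableT_comp => //; exact: (measurableT_comp mk).
move: ik; rewrite fubini_tonelli2//.
by apply: measurableT_comp => //; exact/measurable_EFinP.
Qed.

Lemma Rintegral_swap (k : T * T -> R) :
  (m \x m)%E.-integrable setT (EFin \o k) ->
  \int[(m \x m)%E]_p k p = \int[(m \x m)%E]_p k (p.2, p.1).
Proof.
move=> ik; rewrite /Rintegral; congr fine.
rewrite -(integral21_prod_meas1 ik).
by rewrite -(integral12_prod_meas1 (integrable_swap ik)).
Qed.

End SwapComplements.

(* The library does not make the Lebesgue measure of the plane available as a
   sigma-finite measure. *)
Definition plane_measure (R : realType) :
  set (measurableTypeR R * measurableTypeR R) -> \bar R :=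
  (@lebesgue_measure R \x @lebesgue_measure R)%E.

HB.instance Definition _ (R : realType) := Measure.on (@plane_measure R).

Lemma plane_measure_sigma_finite (R : realType) :
  sigma_finite setT (@plane_measure R).
Proof.
pose I (n : nat) : set (measurableTypeR R) := `[- n%:R, n%:R]%classic.
exists (fun n => I n `*` I n).
  apply/esym; rewrite -subTset => -[a b] _.
  exists (Num.truncn (Num.max `|a| `|b|)).+1 => //=.
  have := truncnS_gt (Num.max `|a| `|b|); rewrite gt_max => /andP[ha hb].
  by split; rewrite /I/= in_itv/= -ler_norml ltW.
move=> n; have mI : measurable (I n) by exact: measurable_itv.
split; first exact: measurableX.
rewrite /plane_measure product_measure1E//.
by rewrite /I/= lebesgue_measure_itv/=; case: ifPn => _; rewrite ?mule0 ?ltry// -EFinB -EFinM ltry.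
Qed.

HB.instance Definition _ (R : realType) :=
  @Measure_isSigmaFinite.Build _ _ R (@plane_measure R) (@plane_measure_sigma_finite R).

(** * Regularised Biot-Savart kernels *)

Section AngularIntegrals.
Context {R : realType}.
Implicit Types (g h F : R -> R) (a : R).

Definition angint g : R := \int[lebesgue_measure]_(a in `[0, pi]) g a.

Lemma angint_integrable g : continuous g ->
  lebesgue_measure.-integrable `[0%R, pi]%classic (EFin \o g).
Proof.
move=> cg; apply: continuous_compact_integrable; first exact: segment_compact.
exact: continuous_subspaceT.
Qed.

Lemma angint_eq g h : (forall a, 0 <= a <= pi -> g a = h a) -> angint g = angint h.
Proof.
by move=> gh; apply: eq_Rintegral => a; rewrite inE/= in_itv/= => /gh.
Qed.

Lemma angintD g h : continuous g -> continuous h ->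
  angint (fun a => g a + h a) = angint g + angint h.
Proof. by move=> cg ch; rewrite /angint RintegralD//; exact: angint_integrable. Qed.

Lemma angintB g h : continuous g -> continuous h ->
  angint (fun a => g a - h a) = angint g - angint h.
Proof. by move=> cg ch; rewrite /angint RintegralB//; exact: angint_integrable. Qed.

Lemma angintZ (c : R) g : continuous g -> angint (fun a => c * g a) = c * angint g.
Proof. by move=> cg; rewrite /angint RintegralZl//; exact: angint_integrable. Qed.

Lemma angint_le g h : continuous g -> continuous h ->
  (forall a, 0 <= a <= pi -> g a <= h a) -> angint g <= angint h.
Proof.
by move=> cg ch gh; apply: le_Rintegral => //; exact: angint_integrable.
Qed.

Lemma angint_ge0 g : (forall a, 0 <= a <= pi -> 0 <= g a) -> 0 <= angint g.
Proof. by move=> g0; apply: Rintegral_ge0 => a; rewrite /= in_itv/= => /g0. Qed.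

Lemma angint_bound g h : continuous h -> (forall a, 0 <= a <= pi -> `|g a| <= h a) ->
  `|angint g| <= angint h.
Proof.
move=> ch gh; rewrite {1}/angint; apply: (@Rintegral_bound _ _ R lebesgue_measure `[0, pi]%classic g h).
  by move=> a; rewrite /= in_itv/= => /gh.
rewrite /angint /Rintegral fineK//; apply: integrable_fin_num => //.
exact: angint_integrable.
Qed.

Lemma angint_cst (c : R) : angint (fun=> c) = c * pi.
Proof.
rewrite /angint Rintegral_cst//= lebesgue_measure_itv/= lte_fin pi_gt0/=.
by rewrite oppr0 addr0.
Qed.

Lemma angint_cst_bound g (c : R) : (forall a, 0 <= a <= pi -> `|g a| <= c) ->
  `|angint g| <= c * pi.
Proof. by move=> gc; rewrite -angint_cst; apply: angint_bound => // a; exact: cvg_cst. Qed.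

Lemma angint_FTC F g : continuous g -> (forall a, is_derive a 1 F (g a)) ->
  angint g = F pi - F 0.
Proof.
move=> cg dF; rewrite /angint /Rintegral (@continuous_FTC2 _ g F)//.
- exact: pi_gt0.
- exact: continuous_subspaceT.
- have cF : continuous F by move=> a; apply/differentiable_continuous/derivable1_diffP; case: (dF a).
  split => [a _| |]; first by case: (dF a).
  + exact: cvg_at_right_filter (cF _).
  + exact: cvg_at_left_filter (cF _).
- by move=> a _; rewrite derive1E; case: (dF a).
Qed.

Lemma ge0_of_derive F g a : F 0 = 0 -> (forall b : R, is_derive b 1 F (g b)) ->
  (forall b : R, 0 <= b -> 0 <= g b) -> 0 <= a -> 0 <= F a.
Proof.
move=> F0 dF g0 a0; have cF : continuous F.
  by move=> b; apply/differentiable_continuous/derivable1_diffP; case: (dF b).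
have [|c] := @MVT_segment _ F g _ _ a0 (fun b _ => dF b).
  exact: continuous_subspaceT.
rewrite in_itv/= => /andP[c0 _]; rewrite F0 !subr0 => ->.
by rewrite mulr_ge0// g0.
Qed.

(** Up to a = 2 the Taylor bound 1 - cos a >= a^2 / 2 - a^4 / 24 suffices. Beyond, cos decreases, so
    that 1 - cos a >= 1 - cos 2 >= 4 / 3, and a^2 <= 16 because pi < 4; this is where 12 = 16 / (4 /
    3) comes from. *)
Lemma one_minus_cos_ge a : 0 <= a <= pi -> a ^+ 2 / 12 <= 1 - cos a.
Proof.
move=> /andP[a0 api].
have d1 (b : R) : is_derive b 1 (fun b => b - sin b) (1 - cos b).
  by apply: is_derive_eq; rewrite /GRing.scale/=; ring.
have h1 (b : R) : 0 <= b -> 0 <= b - sin b.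
  apply: (ge0_of_derive _ d1); first by rewrite sin0 subr0.
  by move=> c _; rewrite subr_ge0 cos_le1.
have d2 (b : R) : is_derive b 1 (fun b => cos b - 1 + b ^+ 2 / 2) (b - sin b).
  by apply: is_derive_eq; rewrite /GRing.scale/=; field.
have h2 (b : R) : 0 <= b -> 0 <= cos b - 1 + b ^+ 2 / 2.
  by apply: (ge0_of_derive _ d2) => //; rewrite cos0 expr0n/= mul0r; ring.
have d3 (b : R) : is_derive b 1 (fun b => sin b - b + b ^+ 3 / 6) (cos b - 1 + b ^+ 2 / 2).
  by apply: is_derive_eq; rewrite /GRing.scale/=; field.
have h3 (b : R) : 0 <= b -> 0 <= sin b - b + b ^+ 3 / 6.
  by apply: (ge0_of_derive _ d3) => //; rewrite sin0 expr0n/= mul0r; ring.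
have d4 (b : R) : is_derive b 1 (fun b => 1 - cos b - b ^+ 2 / 2 + b ^+ 4 / 24)
    (sin b - b + b ^+ 3 / 6).
  by apply: is_derive_eq; rewrite /GRing.scale/=; field.
have h4 (b : R) : 0 <= b -> 0 <= 1 - cos b - b ^+ 2 / 2 + b ^+ 4 / 24.
  by apply: (ge0_of_derive _ d4) => //; rewrite cos0 !expr0n/= !mul0r; ring.
have [a2|a2] := leP a 2.
  have := h4 _ a0; rewrite (_ : a ^+ 4 = a ^+ 2 * a ^+ 2); last by rewrite -exprD.
  have : a ^+ 2 <= 4 by rewrite (_ : 4 = 2 ^+ 2) ?lerXn2r ?nnegrE//; ring.
  have := sqr_ge0 a; move: (a ^+ 2) (cos a) => s c; nra.
have p4 : pi < 4 :> R by have := @pihalf_lt2 R; lra.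
have h42 := h4 2 (ler0n R 2).
have c2 : cos a <= cos 2.
  by rewrite leNgt ltr_cos ?in_itv/= -?leNgt; [exact: ltW|lra|lra].
have : a ^+ 2 <= 16 by rewrite (_ : 16 = 4 ^+ 2) ?lerXn2r ?nnegrE//; lra.
lra.
Qed.

End AngularIntegrals.

Section Kernels.
Context {R : realType}.
Implicit Types (x y : R * R) (e a : R).

(* The squared distance, increased by e, between the points of R^3 with
   cylindrical coordinates (r, 0, z) and (r', a, z'). *)
Definition sqd e x y a : R :=
  e + (x.1 - y.1) ^+ 2 + (x.2 - y.2) ^+ 2 + 2 * x.1 * y.1 * (1 - cos a).

Definition cyld e x y a : R := Num.sqrt (sqd e x y a).

(** The denominators of all the angular integrals stay away from 0. This holds for e > 0 at every
    pair, and for e = 0 off the diagonal. *)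
Definition sep e x y := forall a, 0 < sqd e x y a.

(** As a sum of squares, the formula shows at once the positivity for e > 0 and that the numerators
    [y.1 - x.1 * cos a] and [x.2 - y.2] are at most the distance. *)
Lemma sqdE e x y a :
  sqd e x y a = e + (x.2 - y.2) ^+ 2 + (y.1 - x.1 * cos a) ^+ 2 + (x.1 * sin a) ^+ 2.
Proof.
rewrite /sqd [X in _ = _ + X]exprMn sin2cos2.
by ring.
Qed.

Lemma sqdC e x y a : sqd e x y a = sqd e y x a.
Proof. by rewrite /sqd; ring. Qed.

Lemma sep_gt0 e x y : 0 < e -> sep e x y.
Proof.
move=> e0 a; rewrite sqdE -!addrA ltr_wpDr// !addr_ge0 ?sqr_ge0//.
Qed.

Lemma sep_neq x y : 0 < x.1 -> 0 < y.1 -> x != y -> sep 0 x y.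
Proof.
move=> x0 y0 xy a; rewrite /sqd add0r ltr_wpDr//.
  by rewrite !mulr_ge0 ?subr_ge0 ?cos_le1// ltW.
rewrite lt_neqAle addr_ge0 ?sqr_ge0// andbT eq_sym paddr_eq0 ?sqr_ge0//.
apply: contraNN xy => /andP[]; rewrite !sqrf_eq0 !subr_eq0 => /eqP h1 /eqP h2.
by apply/eqP; rewrite [x]surjective_pairing h1 h2 -surjective_pairing.
Qed.

Lemma continuous_sqd e x y : continuous (sqd e x y).
Proof.
move=> a; apply: cvgD; first exact: cvg_cst.
apply: cvgM; first exact: cvg_cst.
by apply: cvgB; [exact: cvg_cst|exact: continuous_cos].
Qed.

Lemma continuous_cyld e x y : continuous (cyld e x y).
Proof.
move=> a; apply: (@continuous_comp _ _ _ (sqd e x y) Num.sqrt).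
  exact: continuous_sqd.
exact: sqrt_continuous.
Qed.

Lemma cyld_gt0 e x y a : sep e x y -> 0 < cyld e x y a.
Proof. by move=> h; rewrite sqrtr_gt0. Qed.

Lemma continuous_divcyld e x y n (g : R -> R) : sep e x y -> continuous g ->
  continuous (fun a => g a / cyld e x y a ^+ n).
Proof.
move=> s cg a; apply: cvgM; first exact: cg.
apply: cvgV; first by rewrite expf_neq0// gt_eqF// cyld_gt0.
apply: (@continuous_comp _ _ _ (cyld e x y) (fun t => t ^+ n)).
  exact: continuous_cyld.
exact: exprn_continuous.
Qed.

Lemma is_derive_sqd e x y a : is_derive a 1 (sqd e x y) (2 * x.1 * y.1 * sin a).
Proof.
rewrite /sqd; apply: is_derive_eq.
by rewrite /GRing.scale/=; ring.
Qed.

Lemma is_derive_cyld e x y a : sep e x y ->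
  is_derive a 1 (cyld e x y) (x.1 * y.1 * sin a / cyld e x y a).
Proof.
move=> s; have h := is_derive_sqd e x y a.
have h2 := is_derive1_sqrt (s a).
apply: (is_derive_eq (is_derive1_comp h2 h)).
have := cyld_gt0 a s; rewrite /cyld => q0.
by rewrite /GRing.scale/=; field; rewrite gt_eqF.
Qed.

(** The integrand is the derivative of sin a / cyld, which vanishes at 0 and at pi. *)
Lemma angint_parts e x y : sep e x y ->
  angint (fun a => cos a / cyld e x y a - x.1 * y.1 * sin a ^+ 2 / cyld e x y a ^+ 3) = 0.
Proof.
move=> s.
have cg : continuous (fun a => cos a / cyld e x y a - x.1 * y.1 * sin a ^+ 2 / cyld e x y a ^+ 3).
  move=> a; apply: cvgB.
    by apply: (@continuous_divcyld e x y 1 cos) => //; exact: continuous_cos.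
  apply: (@continuous_divcyld e x y 3 (fun b => x.1 * y.1 * sin b ^+ 2)) => // b.
  apply: cvgM; first exact: cvg_cst.
  apply: (@continuous_comp _ _ _ sin (fun t => t ^+ 2)); first exact: continuous_sin.
  exact: exprn_continuous.
have dF a : is_derive a 1 (fun a => sin a / cyld e x y a)
    (cos a / cyld e x y a - x.1 * y.1 * sin a ^+ 2 / cyld e x y a ^+ 3).
  have hq := is_derive_cyld a s; have q0 := cyld_gt0 a s.
  have qn0 : cyld e x y a != 0 by rewrite gt_eqF.
  have hv : is_derive a 1 (fun a => (cyld e x y a)^-1) _ := is_deriveV qn0 hq.
  apply: is_derive_eq.
  by rewrite /GRing.scale/=; field.
by rewrite (angint_FTC cg dF) sinpi sin0 !mul0r subr0.
Qed.

End Kernels.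

Section BiotSavart.
Context {R : realType}.
Implicit Types (x y : R * R) (e a : R).

Definition gG e x y a : R := x.1 * y.1 * cos a / cyld e x y a.
Definition gN e x y a : R := x.1 * y.1 * cos a / cyld e x y a ^+ 3.
Definition gP e x y a : R := x.1 * y.1 * (y.1 - x.1 * cos a) / cyld e x y a ^+ 3.
(* G is the kernel of the energy and the stream function of the velocity:
   r K = ((z - z') N, P), where - (z - z') N and P are the derivatives of G in z
   and in r.  The kernels of the statement are those for e = 0. *)
Definition Gk e x y : R := (2 * pi)^-1 * angint (gG e x y).
Definition Nk e x y : R := (2 * pi)^-1 * angint (gN e x y).
Definition Pk e x y : R := (2 * pi)^-1 * angint (gP e x y).

Lemma continuous_gG e x y : sep e x y -> continuous (gG e x y).
Proof.
move=> s; apply: (@continuous_divcyld _ e x y 1 (fun a => x.1 * y.1 * cos a)) => // a.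
by apply: cvgM; [exact: cvg_cst|exact: continuous_cos].
Qed.

Lemma continuous_gN e x y : sep e x y -> continuous (gN e x y).
Proof.
move=> s; apply: (@continuous_divcyld _ e x y 3 (fun a => x.1 * y.1 * cos a)) => // a.
by apply: cvgM; [exact: cvg_cst|exact: continuous_cos].
Qed.

Lemma continuous_gP e x y : sep e x y -> continuous (gP e x y).
Proof.
move=> s; apply: (@continuous_divcyld _ e x y 3
  (fun a => x.1 * y.1 * (y.1 - x.1 * cos a))) => // a.
apply: cvgM; first exact: cvg_cst.
apply: cvgB; first exact: cvg_cst.
by apply: cvgM; [exact: cvg_cst|exact: continuous_cos].
Qed.

Lemma continuous_invcyld e x y n : sep e x y ->
  continuous (fun a => (cyld e x y a ^+ n)^-1).
Proof.
move=> s; have c1 : continuous (fun _ : R => 1 : R) by move=> a; exact: cvg_cst.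
have := continuous_divcyld (n := n) s c1.
by under eq_fun do rewrite mul1r.
Qed.

Definition parts e x y a : R :=
  cos a / cyld e x y a - x.1 * y.1 * sin a ^+ 2 / cyld e x y a ^+ 3.

Lemma continuous_parts e x y : sep e x y -> continuous (parts e x y).
Proof.
move=> s a; apply: cvgB.
  by apply: (@continuous_divcyld _ e x y 1 cos) => //; exact: continuous_cos.
apply: (@continuous_divcyld _ e x y 3 (fun b => x.1 * y.1 * sin b ^+ 2)) => // b.
apply: cvgM; first exact: cvg_cst.
apply: (@continuous_comp _ _ _ sin (fun t => t ^+ 2)); first exact: continuous_sin.
exact: exprn_continuous.
Qed.

Lemma cyld_sqr e x y a : sep e x y -> cyld e x y a ^+ 2 = sqd e x y a.
Proof. by move=> s; rewrite sqr_sqrtr// ltW. Qed.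

(* Adding multiples of [parts] does not change the integrals: this encodes the
   relations between the elliptic integrals F, F1 and F2. *)
Lemma angint_add_parts e x y (c : R) (g h : R -> R) : sep e x y -> continuous g ->
  (forall a, g a = h a + c * parts e x y a) -> angint g = angint h.
Proof.
move=> s cg gh.
have -> : angint h = angint (fun a => g a - c * parts e x y a).
  by apply: angint_eq => a _; rewrite gh addrK.
have cp := continuous_parts s.
have cc : continuous (fun a => c * parts e x y a).
  by move=> a; apply: cvgM; [exact: cvg_cst|exact: cp].
by rewrite angintB// angintZ// (angint_parts s) mulr0 subr0.
Qed.

(** After integration by parts the integrand has a sign, which the factor cos a in [gG] hides; the
    positivity of the energy kernel follows. *)
Lemma Gk_sin e x y : sep e x y ->
  Gk e x y = (2 * pi)^-1 *
    angint (fun a => (x.1 * y.1) ^+ 2 * sin a ^+ 2 / cyld e x y a ^+ 3).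
Proof.
move=> s; congr (_ * _); apply: (@angint_add_parts e x y (x.1 * y.1)) => //.
  exact: continuous_gG.
move=> a; rewrite /gG /parts; have := cyld_gt0 a s => q0.
by field; rewrite gt_eqF.
Qed.

Lemma Gk_ge0 e x y : sep e x y -> 0 <= Gk e x y.
Proof.
move=> s; rewrite Gk_sin// mulr_ge0 ?invr_ge0 ?mulr_ge0 ?pi_ge0//.
apply: angint_ge0 => a _; rewrite -exprMn divr_ge0 ?sqr_ge0//.
by rewrite ltW// exprn_gt0// cyld_gt0.
Qed.

Lemma Gk_sym e x y : Gk e x y = Gk e y x.
Proof.
congr (_ * _); apply: angint_eq => a _; rewrite /gG /cyld sqdC.
by rewrite [y.1 * _]mulrC.
Qed.

Lemma Nk_sym e x y : Nk e x y = Nk e y x.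
Proof.
congr (_ * _); apply: angint_eq => a _; rewrite /gN /cyld sqdC.
by rewrite [y.1 * _]mulrC.
Qed.

(* The integrand is the derivative in r of the one defining G. *)
Lemma Pk_raw e x y : sep e x y ->
  Pk e x y = (2 * pi)^-1 * angint (fun a => y.1 * cos a / cyld e x y a
     - x.1 * y.1 * cos a * (x.1 - y.1 * cos a) / cyld e x y a ^+ 3).
Proof.
move=> s; congr (_ * _); apply: (@angint_add_parts e x y (- y.1)) => //.
  exact: continuous_gP.
move=> a; rewrite /gP /parts; have := cyld_gt0 a s => q0.
rewrite sin2cos2; field; by rewrite gt_eqF.
Qed.

(** The axial kernel is split into the energy kernel G, a multiple of N with a factor [x.1 - y.1],
    and N times the squared distance. The last is bounded, the second becomes so after
    symmetrisation, and G alone carries the logarithm. *)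
Lemma Pk_GN e x y : sep e x y ->
  2 * x.1 * Pk e x y = - (2 * x.1 * (x.1 - y.1)) * Nk e x y + Gk e x y
    + Nk e x y * (e + (x.1 - y.1) ^+ 2 + (x.2 - y.2) ^+ 2).
Proof.
move=> s; pose dd := e + (x.1 - y.1) ^+ 2 + (x.2 - y.2) ^+ 2.
have cg := continuous_gG s; have cn := continuous_gN s; have cp := continuous_gP s.
pose c1 := - (2 * x.1 * (x.1 - y.1)) + dd.
have cn1 : continuous (fun a => c1 * gN e x y a).
  by move=> a; apply: cvgM; [exact: cvg_cst|exact: cn].
have cp1 : continuous (fun a => 2 * x.1 * gP e x y a).
  by move=> a; apply: cvgM; [exact: cvg_cst|exact: cp].
have E : angint (fun a => 2 * x.1 * gP e x y a) =
         angint (fun a => c1 * gN e x y a + gG e x y a).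
  apply: (@angint_add_parts e x y (- (2 * x.1 * y.1))) => //.
  move=> a; rewrite /gP /gN /gG /parts; have q0 := cyld_gt0 a s.
  have qE := cyld_sqr a s.
  have -> : c1 = cyld e x y a ^+ 2 - 2 * x.1 * y.1 * (1 - cos a)
                 - (2 * x.1 * (x.1 - y.1)).
    by rewrite qE /sqd /c1 /dd; ring.
  rewrite sin2cos2; field; by rewrite gt_eqF.
move: E; rewrite angintD// !angintZ// => E.
rewrite /Pk mulrCA E /Nk /Gk -/dd /c1; ring.
Qed.

End BiotSavart.

Section KernelBounds.
Context {R : realType}.
Implicit Types (x y : R * R) (e a : R).

Lemma eucl_dist_sqr x y : eucl_dist x y ^+ 2 = (x.1 - y.1) ^+ 2 + (x.2 - y.2) ^+ 2.
Proof. by rewrite sqr_sqrtr// addr_ge0 ?sqr_ge0. Qed.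

Lemma eucl_distC x y : eucl_dist x y = eucl_dist y x.
Proof. by rewrite /eucl_dist; congr Num.sqrt; ring. Qed.

Lemma eucl_dist_gt0 x y : x != y -> 0 < eucl_dist x y.
Proof.
move=> xy; rewrite sqrtr_gt0 lt_neqAle addr_ge0 ?sqr_ge0// andbT eq_sym.
rewrite paddr_eq0 ?sqr_ge0//; apply: contraNN xy => /andP[].
rewrite !sqrf_eq0 !subr_eq0 => /eqP h1 /eqP h2.
by apply/eqP; rewrite [x]surjective_pairing h1 h2 -surjective_pairing.
Qed.

Lemma dist1_le x y : `|x.1 - y.1| <= eucl_dist x y.
Proof. by rewrite -sqrtr_sqr ler_wsqrtr// lerDl sqr_ge0. Qed.

Lemma dist2_le x y : `|x.2 - y.2| <= eucl_dist x y.
Proof. by rewrite -sqrtr_sqr ler_wsqrtr// lerDr sqr_ge0. Qed.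

Lemma cyld_s_le e x y a : 0 <= e -> `|y.1 - x.1 * cos a| <= cyld e x y a.
Proof.
move=> e0; rewrite -sqrtr_sqr ler_wsqrtr// sqdE -!addrA addrA addrCA lerDl.
by rewrite !addr_ge0 ?sqr_ge0.
Qed.

Lemma cyld_z_le e x y a : 0 <= e -> `|x.2 - y.2| <= cyld e x y a.
Proof.
move=> e0; rewrite -sqrtr_sqr ler_wsqrtr// sqdE -!addrA addrCA lerDl.
by rewrite !addr_ge0 ?sqr_ge0.
Qed.

Lemma cyld_mono e x y a : 0 <= e -> cyld 0 x y a <= cyld e x y a.
Proof. by move=> e0; rewrite ler_wsqrtr// /sqd -!addrA lerD2r. Qed.

Lemma cyld_sub_le e x y a : 0 <= e -> sep 0 x y ->
  cyld e x y a <= cyld 0 x y a + Num.sqrt e.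
Proof.
move=> e0 s; have q0 := cyld_gt0 a s; have se := sqrtr_ge0 e.
rewrite -(ler_pXn2r (ltn0Sn 1)) ?nnegrE ?sqrtr_ge0 ?addr_ge0 ?sqrtr_ge0//.
have qE := cyld_sqr a s.
rewrite /cyld sqr_sqrtr; last by rewrite /sqd -!addrA addr_ge0//; have := ltW (s a); rewrite /sqd add0r -!addrA.
rewrite sqrrD qE sqr_sqrtr// /sqd; have := mulr_ge0 (ltW q0) se; rewrite /cyld/sqd; lra.
Qed.

Section pair.
Variables (x y : R * R).
Hypotheses (x0 : 0 < x.1) (y0 : 0 < y.1) (xy : x != y).

Variables d m : R.
Hypotheses (hd : d = eucl_dist x y) (hm : m = Num.sqrt (x.1 * y.1)).

Let s := sep_neq x0 y0 xy.

Let d0 : 0 < d. Proof. rewrite hd; exact: eucl_dist_gt0. Qed.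

Let m0 : 0 < m. Proof. by rewrite hm sqrtr_gt0 mulr_gt0. Qed.

Let mE : m ^+ 2 = x.1 * y.1. Proof. by rewrite hm sqr_sqrtr// ltW// mulr_gt0. Qed.

Let dE : d ^+ 2 = (x.1 - y.1) ^+ 2 + (x.2 - y.2) ^+ 2.
Proof. by rewrite hd eucl_dist_sqr. Qed.

Let p0 : 0 < pi :> R. Proof. exact: pi_gt0. Qed.

Lemma sqd0E a : sqd 0 x y a = d ^+ 2 + 2 * m ^+ 2 * (1 - cos a).
Proof. by rewrite /sqd mE dE add0r mulrA. Qed.

Lemma dist_le_cyld a : d <= cyld 0 x y a.
Proof.
rewrite -(ger0_norm (ltW d0)) -sqrtr_sqr ler_wsqrtr// sqd0E lerDl.
by rewrite mulr_ge0 ?subr_ge0 ?cos_le1// mulr_ge0 ?sqr_ge0.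
Qed.

(** From 2 (1 - cos a) >= a^2 / 6 >= a^2 / 9 one gets cyld^2 >= d^2 (1 + (k a)^2) with k = m / (3
    d), and the inverse of the right side is integrated by the arctangent. *)
Lemma angint_invcyld2 : angint (fun a => (cyld 0 x y a ^+ 2)^-1) <= 3 * pi / (2 * d * m).
Proof.
pose k := m / (3 * d).
have k0 : 0 < k by rewrite divr_gt0 ?mulr_gt0.
pose g a := (1 + (k * a) ^+ 2)^-1.
have g0 a : 0 < 1 + (k * a) ^+ 2 by rewrite ltr_pwDl ?sqr_ge0.
have cg : continuous g.
  move=> a; apply: cvgV; first by rewrite gt_eqF.
  apply: cvgD; first exact: cvg_cst.
  apply: (@continuous_comp _ _ _ (fun a => k * a) (fun t => t ^+ 2)).
    by apply: cvgM; [exact: cvg_cst|exact: cvg_id].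
  exact: exprn_continuous.
have dF a : is_derive a 1 (fun a => k^-1 * atan (k * a)) (g a).
  have h1 : is_derive a 1 (fun a => k * a) k.
    by apply: is_derive_eq; rewrite /GRing.scale/= mulr1.
  have h2 := is_derive1_comp (is_derive1_atan (k * a)) h1.
  have h3 : is_derive a 1 (fun a => atan (k * a)) _ := h2.
  apply: is_derive_eq; rewrite /GRing.scale/= /g; field.
  by rewrite !gt_eqF.
have IG : angint g <= k^-1 * (pi / 2).
  rewrite (angint_FTC cg dF) mulr0 atan0 mulr0 subr0 ler_pM2l ?invr_gt0//.
  exact/ltW/atan_ltpi2.
have le1 : angint (fun a => (cyld 0 x y a ^+ 2)^-1) <= angint (fun a => (d ^- 2) * g a).
  apply: angint_le.
  - exact: continuous_invcyld.
  - by move=> a; apply: cvgM; [exact: cvg_cst|exact: cg].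
  move=> a api; rewrite /g -invfM lef_pV2 ?posrE ?mulr_gt0 ?exprn_gt0 ?cyld_gt0//.
  rewrite cyld_sqr// sqd0E mulrDr mulr1 lerD2l.
  have -> : d ^+ 2 * (k * a) ^+ 2 = m ^+ 2 * (a ^+ 2 / 9).
    rewrite /k; field; by rewrite gt_eqF.
  rewrite [2 * _]mulrC -[X in _ <= X]mulrA; apply: ler_wpM2l; first exact: sqr_ge0.
  have := one_minus_cos_ge api; have := sqr_ge0 a; lra.
apply: (le_trans le1); rewrite angintZ//.
rewrite (_ : 3 * pi / (2 * d * m) = d ^- 2 * (k^-1 * (pi / 2))).
  by rewrite ler_pM2l// invr_gt0 exprn_gt0.
rewrite /k; field; by rewrite ?(gt_eqF d0) ?(gt_eqF m0) ?(gt_eqF p0).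
Qed.

Let bnd (g : R -> R) (c : R) : 0 <= c ->
  (forall a, `|g a| <= c * (cyld 0 x y a ^+ 2)^-1) ->
  `|(2 * pi)^-1 * angint g| <= c * (3 / (4 * d * m)).
Proof.
move=> c0 gc; rewrite normrM ger0_norm; last by rewrite invr_ge0 mulr_ge0// ltW.
have ci := continuous_invcyld (n := 2) s.
have h : `|angint g| <= c * angint (fun a => (cyld 0 x y a ^+ 2)^-1).
  rewrite -angintZ//; apply: angint_bound => // a.
  by apply: cvgM; [exact: cvg_cst|exact: ci].
apply: (@le_trans _ _ ((2 * pi)^-1 * (c * (3 * pi / (2 * d * m))))).
  rewrite ler_pM2l ?invr_gt0 ?mulr_gt0//; apply: (le_trans h).
  by apply: ler_wpM2l => //; exact: angint_invcyld2.
rewrite le_eqVlt; apply/orP; left; apply/eqP; have := p0; move: (pi) => p pp.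
by field; rewrite ?(gt_eqF d0) ?(gt_eqF m0) ?(gt_eqF pp).
Qed.

Lemma Nk_dist2 : `|Nk 0 x y| * d ^+ 2 <= 3 / 4 * m.
Proof.
have -> : `|Nk 0 x y| * d ^+ 2 = `|(2 * pi)^-1 * angint (fun a => d ^+ 2 * gN 0 x y a)|.
  rewrite angintZ; last exact: continuous_gN.
  have -> : (2 * pi)^-1 * (d ^+ 2 * angint (gN 0 x y)) = Nk 0 x y * d ^+ 2.
    by rewrite mulrCA mulrC.
  by rewrite [RHS]normrM [X in _ = _ * X]normrX (gtr0_norm d0).
apply: (@le_trans _ _ (d * m ^+ 2 * (3 / (4 * d * m)))).
  apply: bnd; first by rewrite mulr_ge0 ?sqr_ge0// ltW.
  move=> a; have q0 := cyld_gt0 a s; have dq := dist_le_cyld a.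
  rewrite /gN normrM normrX (gtr0_norm d0) !normrM normfV normrX (gtr0_norm q0) (gtr0_norm x0) (gtr0_norm y0) -mE.
  have -> : d * m ^+ 2 / cyld 0 x y a ^+ 2 = d * cyld 0 x y a * m ^+ 2 / cyld 0 x y a ^+ 3.
    by field; rewrite gt_eqF.
  have -> : d ^+ 2 * (m ^+ 2 * `|cos a| * (cyld 0 x y a ^+ 3)^-1) =
     d ^+ 2 * m ^+ 2 * `|cos a| / cyld 0 x y a ^+ 3 by field; rewrite gt_eqF.
  rewrite ler_pM2r ?invr_gt0 ?exprn_gt0//.
  apply: (@le_trans _ _ (d ^+ 2 * m ^+ 2)).
    have c1 : `|cos a| <= 1 by rewrite ler_norml cos_geN1 cos_le1.
    by apply: ler_piMr => //; rewrite mulr_ge0// sqr_ge0.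
  by rewrite ler_pM2r ?exprn_gt0// expr2 ler_pM2l.
rewrite le_eqVlt; apply/orP; left; apply/eqP; have := p0; move: (pi) => p pp.
by field; rewrite ?(gt_eqF d0) ?(gt_eqF m0) ?(gt_eqF pp).
Qed.

Lemma Pk_dist : `|Pk 0 x y| <= 3 / 4 * (m / d).
Proof.
apply: (@le_trans _ _ (m ^+ 2 * (3 / (4 * d * m)))).
  apply: bnd; first exact: sqr_ge0.
  move=> a; have q0 := cyld_gt0 a s.
  rewrite /gP !normrM normfV normrX (gtr0_norm q0) (gtr0_norm x0) (gtr0_norm y0) -mE -mulrA.
  rewrite ler_pM2l ?exprn_gt0// [_ ^+ 3]exprS invfM mulrA ler_piMl ?invr_ge0 ?exprn_ge0 ?(ltW q0)//.
  by rewrite ler_pdivrMr// mul1r cyld_s_le.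
rewrite le_eqVlt; apply/orP; left; apply/eqP; have := p0; move: (pi) => p pp.
by field; rewrite ?(gt_eqF d0) ?(gt_eqF m0) ?(gt_eqF pp).
Qed.

Lemma Pk_dist2 : `|Pk 0 x y| <= m ^+ 2 / (2 * d ^+ 2).
Proof.
rewrite /Pk normrM ger0_norm; last by rewrite invr_ge0 mulr_ge0// ltW.
apply: (@le_trans _ _ ((2 * pi)^-1 * (m ^+ 2 / d ^+ 2 * pi))).
  rewrite ler_pM2l ?invr_gt0 ?mulr_gt0//; apply: angint_cst_bound => a _.
  have q0 := cyld_gt0 a s; have dq := dist_le_cyld a.
  rewrite /gP !normrM normfV normrX (gtr0_norm q0) (gtr0_norm x0) (gtr0_norm y0) -mE -mulrA.
  rewrite ler_pM2l ?exprn_gt0// [_ ^+ 3]exprS invfM [X in X <= _]mulrA.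
  apply: (@le_trans _ _ (1 * (cyld 0 x y a ^+ 2)^-1)).
    rewrite ler_wpM2r ?invr_ge0 ?exprn_ge0 ?(ltW q0)//.
    by rewrite ler_pdivrMr// mul1r cyld_s_le.
  by rewrite mul1r lef_pV2 ?posrE ?exprn_gt0// lerXn2r ?nnegrE// ltW.
rewrite le_eqVlt; apply/orP; left; apply/eqP; have := p0; move: (pi) => p pp.
by field; rewrite ?(gt_eqF d0) ?(gt_eqF m0) ?(gt_eqF pp).
Qed.

Lemma zNk_dist : `|x.2 - y.2| * `|Nk 0 x y| <= 3 / 4 * (m / d).
Proof.
have := Nk_dist2; have := dist2_le x y; rewrite -hd => h1 h2.
apply: (@le_trans _ _ (d * `|Nk 0 x y|)); first by rewrite ler_wpM2r.
rewrite mulrA ler_pdivlMr// mulrC mulrA -expr2 mulrC//.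
Qed.

Lemma zNk_dist2 : `|x.2 - y.2| * `|Nk 0 x y| <= m ^+ 2 / (2 * d ^+ 2).
Proof.
have -> : `|x.2 - y.2| * `|Nk 0 x y| = (2 * pi)^-1 * `|angint (fun a => (x.2 - y.2) * gN 0 x y a)|.
  rewrite angintZ; last exact: continuous_gN.
  rewrite /Nk !normrM (@ger0_norm _ (2 * pi)^-1) ?invr_ge0 ?mulr_ge0//; last exact: ltW.
  by rewrite mulrCA.
apply: (@le_trans _ _ ((2 * pi)^-1 * (m ^+ 2 / d ^+ 2 * pi))).
  rewrite ler_pM2l ?invr_gt0 ?mulr_gt0//; apply: angint_cst_bound => a _.
  have q0 := cyld_gt0 a s; have dq := dist_le_cyld a.
  rewrite /gN !normrM normfV normrX (gtr0_norm q0) (gtr0_norm x0) (gtr0_norm y0) -mE.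
  have -> : `|x.2 - y.2| * (m ^+ 2 * `|cos a| * (cyld 0 x y a ^+ 3)^-1) =
    m ^+ 2 * ((`|x.2 - y.2| / cyld 0 x y a * `|cos a|) * (cyld 0 x y a ^+ 2)^-1).
    by field; rewrite gt_eqF.
  rewrite ler_pM2l ?exprn_gt0//.
  apply: (@le_trans _ _ (1 * (cyld 0 x y a ^+ 2)^-1)).
    rewrite ler_pM2r ?invr_gt0 ?exprn_gt0// mulr_ile1//.
    - by rewrite divr_ge0// ltW.
    - by rewrite ler_pdivrMr// mul1r cyld_z_le.
    - by rewrite ler_norml cos_geN1 cos_le1.
  by rewrite mul1r lef_pV2 ?posrE ?exprn_gt0// lerXn2r ?nnegrE// ltW.
rewrite le_eqVlt; apply/orP; left; apply/eqP; have := p0; move: (pi) => p pp.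
by field; rewrite ?(gt_eqF d0) ?(gt_eqF m0) ?(gt_eqF pp).
Qed.

(** If y.1 <= 4 x.1, then m <= 2 x.1 and the first bound serves. Otherwise d >= 3 y.1 / 4, and the
    second bound contains the needed factor x.1 through m^2 = x.1 y.1. So the velocity kernels are
    O(1 / d) uniformly up to the axis. *)
Lemma mean_over_r_le (b : R) : b <= 3 / 4 * (m / d) -> b <= m ^+ 2 / (2 * d ^+ 2) ->
  b / x.1 <= 2 / d.
Proof.
move=> b1 b2; rewrite ler_pdivrMr//; have [yx|yx] := leP y.1 (4 * x.1).
  apply: (le_trans b1); rewrite mulrA [2 / d * _]mulrAC ler_wpM2r ?invr_ge0 ?(ltW d0)//.
  have : m <= 2 * x.1.
    rewrite -(@ler_pXn2r _ 2) ?nnegrE ?(ltW m0)//; last by rewrite mulr_ge0// ltW.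
    have : 0 <= x.1 * (4 * x.1 - y.1) by rewrite mulr_ge0 ?subr_ge0// ltW.
    rewrite mE; nra.
  have := x0; lra.
apply: (le_trans b2); rewrite mE.
have yd : 3 / 4 * y.1 <= d.
  rewrite hd; apply: le_trans (dist1_le x y); rewrite distrC; apply: le_trans (ler_norm _); lra.
rewrite ler_pdivrMr ?mulr_gt0 ?exprn_gt0//.
rewrite (_ : 2 / d * x.1 * (2 * d ^+ 2) = x.1 * (4 * d)); last by field; rewrite gt_eqF.
by rewrite ler_pM2l//; have := y0; lra.
Qed.

Section regularised.
Variable e : R.
Hypothesis e0 : 0 <= e.

Let q a := cyld 0 x y a.
Let p a := cyld e x y a.

Let q0 a : 0 < q a. Proof. exact: cyld_gt0. Qed.
Let qp a : q a <= p a. Proof. exact: cyld_mono. Qed.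
Let pq a : p a - q a <= Num.sqrt e. Proof. by rewrite lerBlDl cyld_sub_le. Qed.
Let pp0 a : 0 < p a. Proof. exact: lt_le_trans (q0 a) (qp a). Qed.

Lemma sep_regularised : sep e x y.
Proof. by move=> a; apply: (lt_le_trans (s a)); rewrite /sqd -!addrA lerD2r. Qed.

Let diff3_ge0 a : 0 <= (q a ^+ 3)^-1 - (p a ^+ 3)^-1.
Proof.
by rewrite subr_ge0 lef_pV2 ?posrE ?exprn_gt0// lerXn2r ?nnegrE// ltW.
Qed.

Let diff3_le1 a : q a * ((q a ^+ 3)^-1 - (p a ^+ 3)^-1) <= (q a ^+ 2)^-1.
Proof.
rewrite mulrBr; have -> : q a / q a ^+ 3 = (q a ^+ 2)^-1.
  by field; rewrite gt_eqF ?exprn_gt0.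
by rewrite gerBl mulr_ge0 ?invr_ge0 ?exprn_ge0// ltW.
Qed.

(** Factorise p^3 - q^3 by p - q <= sqrt e; the remaining power of p is traded for 1 / d by p >=
    d. *)
Let diff3_le2 a :
  q a * ((q a ^+ 3)^-1 - (p a ^+ 3)^-1) <= 3 * Num.sqrt e / d * (q a ^+ 2)^-1.
Proof.
have se := sqrtr_ge0 e; have Q := q0 a; have P := pp0 a; have QP := qp a; have PQ := pq a.
have dq : d <= q a by exact: dist_le_cyld.
have -> : q a * ((q a ^+ 3)^-1 - (p a ^+ 3)^-1) =
   ((p a - q a) * (p a ^+ 2 + p a * q a + q a ^+ 2) / p a ^+ 3) / q a ^+ 2.
  by field; rewrite !gt_eqF.
rewrite ler_wpM2r ?invr_ge0 ?exprn_ge0 ?(ltW Q)// ler_pdivrMr ?exprn_gt0//.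
apply: (@le_trans _ _ (Num.sqrt e * (3 * p a ^+ 2))).
  apply: ler_pM => //; first by rewrite subr_ge0.
    by rewrite !addr_ge0 ?mulr_ge0 ?sqr_ge0// ltW.
  have : 0 <= (p a - q a) * (2 * p a + q a).
    by rewrite mulr_ge0 ?subr_ge0// addr_ge0 ?mulr_ge0// ltW.
  lra.
rewrite (_ : _ * p a ^+ 3 = Num.sqrt e * (3 * p a ^+ 2) * (p a / d)); last first.
  by field; rewrite gt_eqF.
apply: ler_peMr; first by rewrite mulr_ge0// mulr_ge0 ?sqr_ge0.
by rewrite ler_pdivlMr// mul1r; exact: le_trans dq QP.
Qed.

Let diff_bound (g h : R -> R) : (forall a, `|g a - h a| <= m ^+ 2 * (q a * ((q a ^+ 3)^-1 - (p a ^+ 3)^-1))) ->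
  continuous g -> continuous h ->
  `|(2 * pi)^-1 * angint g - (2 * pi)^-1 * angint h| <= 3 / 4 * (m / d) /\
  `|(2 * pi)^-1 * angint g - (2 * pi)^-1 * angint h| <= 9 / 4 * Num.sqrt e * (m / d ^+ 2).
Proof.
move=> gh cg ch; rewrite -mulrBr -angintB//; split.
  apply: (@le_trans _ _ (m ^+ 2 * (3 / (4 * d * m)))).
    apply: bnd => [|a]; first exact: sqr_ge0.
    by apply: (le_trans (gh a)); rewrite ler_wpM2l ?sqr_ge0//; exact: diff3_le1.
  by rewrite le_eqVlt; apply/orP; left; apply/eqP; field; rewrite ?(gt_eqF d0) ?(gt_eqF m0).
apply: (@le_trans _ _ (m ^+ 2 * (3 * Num.sqrt e / d) * (3 / (4 * d * m)))).
  apply: bnd => [|a].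
    by rewrite mulr_ge0 ?sqr_ge0// divr_ge0 ?mulr_ge0 ?sqrtr_ge0// ltW.
  by apply: (le_trans (gh a)); rewrite -mulrA ler_wpM2l ?sqr_ge0//; exact: diff3_le2.
by rewrite le_eqVlt; apply/orP; left; apply/eqP; field; rewrite ?(gt_eqF d0) ?(gt_eqF m0).
Qed.

(** The first bound is integrable at the diagonal and is used near it; the second one is small with
    e and is used away from the diagonal. *)
Lemma Pk_regularised :
  `|Pk e x y - Pk 0 x y| <= 3 / 4 * (m / d) /\
  `|Pk e x y - Pk 0 x y| <= 9 / 4 * Num.sqrt e * (m / d ^+ 2).
Proof.
rewrite (distrC (Pk e x y)).
apply: diff_bound; try (apply: continuous_gP => //; exact: sep_regularised).
move=> a; rewrite /gP -mulrBr -/(q a) -/(p a) !normrM (ger0_norm (diff3_ge0 a)).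
rewrite (gtr0_norm x0) (gtr0_norm y0) -mE -mulrA ler_wpM2l ?sqr_ge0// ler_wpM2r//.
exact: cyld_s_le.
Qed.

Lemma zNk_regularised :
  `|(x.2 - y.2) * Nk e x y - (x.2 - y.2) * Nk 0 x y| <= 3 / 4 * (m / d) /\
  `|(x.2 - y.2) * Nk e x y - (x.2 - y.2) * Nk 0 x y| <= 9 / 4 * Num.sqrt e * (m / d ^+ 2).
Proof.
have E b : sep b x y -> (x.2 - y.2) * Nk b x y = (2 * pi)^-1 * angint (fun a => (x.2 - y.2) * gN b x y a).
  move=> sb; rewrite angintZ; last exact: continuous_gN.
  by rewrite mulrCA.
have cN b : sep b x y -> continuous (fun a => (x.2 - y.2) * gN b x y a).
  by move=> sb a; apply: cvgM; [exact: cvg_cst|exact: continuous_gN].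
rewrite (distrC (_ * Nk e x y)) !E//; last exact: sep_regularised.
apply: diff_bound; try (apply: cN => //; exact: sep_regularised).
move=> a; rewrite /gN -!mulrBr -/(q a) -/(p a) !normrM (ger0_norm (diff3_ge0 a)).
rewrite (gtr0_norm x0) (gtr0_norm y0) -mE.
have -> (A B C D : R) : A * (B * C * D) = B * (A * C * D) by ring.
rewrite ler_wpM2l ?sqr_ge0// ler_wpM2r//.
apply: (@le_trans _ _ (`|x.2 - y.2| * 1)).
  by rewrite ler_wpM2l// ler_norml cos_geN1 cos_le1.
by rewrite mulr1; exact: cyld_z_le.
Qed.

Lemma Gk_regularised : `|Gk e x y - Gk 0 x y| <= 3 / 4 * Num.sqrt e * (m / d).
Proof.
have se := sep_regularised; have sq := sqrtr_ge0 e.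
rewrite distrC /Gk -mulrBr -angintB; [|exact: continuous_gG..].
apply: (@le_trans _ _ (m ^+ 2 * Num.sqrt e * (3 / (4 * d * m)))).
  apply: bnd => [|a]; first by rewrite mulr_ge0 ?sqr_ge0.
  have Q := q0 a; have P := pp0 a.
  rewrite /gG -mulrBr -/(q a) -/(p a) normrM normrM normrM (gtr0_norm x0) (gtr0_norm y0) -mE.
  have -> : (q a)^-1 - (p a)^-1 = (p a - q a) / p a / q a by field; rewrite !gt_eqF.
  have t0 : 0 <= (p a - q a) / p a / q a.
    by rewrite divr_ge0 ?(ltW Q)// divr_ge0 ?(ltW P)// subr_ge0; exact: qp.
  rewrite (ger0_norm t0) -!(mulrA (m ^+ 2)); apply: ler_wpM2l; first exact: sqr_ge0.
  apply: (@le_trans _ _ (1 * ((p a - q a) / p a / q a))).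
    by apply: ler_wpM2r => //; rewrite ler_norml cos_geN1 cos_le1.
  rewrite mul1r -mulrA; apply: ler_pM; first by rewrite subr_ge0; exact: qp.
  - by rewrite mulr_ge0 ?invr_ge0 ?(ltW Q) ?(ltW P).
  - exact: pq.
  rewrite expr2 invfM; apply: ler_wpM2r; first by rewrite invr_ge0 ltW.
  by rewrite lef_pV2 ?posrE//; exact: qp.
by rewrite le_eqVlt; apply/orP; left; apply/eqP; field; rewrite ?(gt_eqF d0) ?(gt_eqF m0).
Qed.

End regularised.

(** On [0, pi] one has cos a <= cos (a / 2). With V = 2 m sin (a / 2) the squared distance is d^2 +
    V^2, so the enlarged integrand m^2 cos (a / 2) / cyld has the explicit primitive m ln (V +
    cyld). *)
Lemma Gk_log : Gk 0 x y <= m / (2 * pi) * ln (1 + 4 * m / d).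
Proof.
pose V a := 2 * m * sin (a / 2).
pose q a := cyld 0 x y a.
have q0 a : 0 < q a by exact: cyld_gt0.
have qV a : q a ^+ 2 = d ^+ 2 + V a ^+ 2.
  rewrite cyld_sqr// sqd0E /V; congr (_ + _).
  rewrite {1}(_ : a = a / 2 + a / 2); last by field.
  rewrite cosD -!expr2 cos2sin2; ring.
have Vq0 a : 0 < V a + q a.
  have : `|V a| < q a.
    rewrite -(@ltr_pXn2r _ 2) ?nnegrE ?(ltW (q0 a))// -normrX ger0_norm ?sqr_ge0//.
    by rewrite qV ltrDr exprn_gt0.
  by rewrite ltr_norml => /andP[h _]; lra.
have dV a : is_derive a 1 V (m * cos (a / 2)).
  have h1 : is_derive a 1 (fun a : R => a / 2) (1 / 2).
    by apply: is_derive_eq; rewrite /GRing.scale/=; ring.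
  have h2 : is_derive a 1 (fun a => sin (a / 2)) _ :=
    @is_derive1_comp R sin (fun a : R => a / 2) a _ _ (is_derive_sin (a / 2)) h1.
  by apply: is_derive_eq; rewrite /GRing.scale/=; field.
pose f a := m ^+ 2 * cos (a / 2) / q a ^+ 1.
have dF a : is_derive a 1 (fun a => m * ln (V a + q a)) (f a).
  have hq : is_derive a 1 q _ := is_derive_cyld a s.
  have h1 : is_derive a 1 (fun a => V a + q a) _ := is_deriveD (dV a) hq.
  have h2 : is_derive a 1 (fun a => ln (V a + q a)) _ :=
    @is_derive1_comp R (@ln R) (fun a => V a + q a) a _ _ (is_derive1_ln (Vq0 a)) h1.
  apply: is_derive_eq; rewrite /GRing.scale/= /f -/(q a).
  have -> : x.1 * y.1 * sin a = V a * (m * cos (a / 2)).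
    rewrite -mE /V {1}(_ : a = a / 2 + a / 2); last by field.
    by rewrite sinD; ring.
  by field; rewrite (gt_eqF (q0 a)) (gt_eqF (Vq0 a)).
have ch : continuous (fun a : R => cos (a / 2)).
  move=> a; apply: (@continuous_comp _ _ _ (fun a : R => a / 2) cos).
    by apply: cvgM; [exact: cvg_id|exact: cvg_cst].
  exact: continuous_cos.
have cf : continuous f.
  apply: (@continuous_divcyld _ 0 x y 1 (fun a => m ^+ 2 * cos (a / 2))) => // a.
  by apply: cvgM; [exact: cvg_cst|exact: ch].
have le1 : angint (gG 0 x y) <= angint f.
  apply: angint_le => //; first exact: continuous_gG.
  move=> a /andP[a0 api]; rewrite /gG /f -mE -/(q a) expr1.
  rewrite ler_wpM2r ?invr_ge0 ?(ltW (q0 a))// ler_wpM2l ?sqr_ge0//.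
  rewrite leNgt ltr_cos ?in_itv/=; [rewrite -leNgt; lra|apply/andP; split; lra|apply/andP; split; lra].
have qpi : q pi ^+ 2 = d ^+ 2 + 4 * m ^+ 2.
  by rewrite qV /V sin_pihalf mulr1 exprMn; congr (_ + _ * _); rewrite expr2; ring.
have le2 : angint f <= m * ln (1 + 4 * m / d).
  rewrite (angint_FTC cf dF) -mulrBr ler_wpM2l ?(ltW m0)//.
  have V0 : V 0 = 0 by rewrite /V mul0r sin0 mulr0.
  have Q0 : q 0 = d.
    apply/eqP; rewrite -(@eqrXn2 _ 2) ?(ltW (q0 _)) ?(ltW d0)//.
    by rewrite qV V0 expr0n addr0.
  have Vpi : V pi = 2 * m by rewrite /V sin_pihalf mulr1.
  have md0 : 0 <= 4 * m / d by rewrite divr_ge0 ?mulr_ge0 ?(ltW m0) ?(ltW d0).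
  have Vqpi : 0 < V pi + q pi by rewrite Vpi addr_gt0// mulr_gt0.
  rewrite V0 Q0 add0r -lnV ?posrE// -lnM ?posrE ?invr_gt0//.
  rewrite ler_ln ?posrE ?divr_gt0//; last by rewrite ltr_wpDr.
  rewrite ler_pdivrMr// mulrDl mul1r divfK ?gt_eqF//.
  rewrite Vpi; have : q pi <= d + 2 * m.
    rewrite -(@ler_pXn2r _ 2) ?nnegrE ?addr_ge0 ?mulr_ge0 ?(ltW (q0 _)) ?(ltW m0) ?(ltW d0)//.
    have : 0 <= d * m by rewrite mulr_ge0 ?(ltW m0) ?(ltW d0).
    rewrite qpi; nra.
  lra.
have k0 : 0 <= (2 * pi)^-1 :> R by rewrite invr_ge0 mulr_ge0// (ltW p0).
rewrite [X in _ <= X](_ : _ = (2 * pi)^-1 * (m * ln (1 + 4 * m / d))); last by rewrite [RHS]mulrCA mulrA.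
by rewrite /Gk; apply: ler_wpM2l => //; exact: le_trans le1 le2.
Qed.

End pair.

End KernelBounds.

Section KernelsOfTheStatement.
Context {R : realType}.
Implicit Types (x y : R * R) (e a : R).

Lemma powR_half_n (t : R) n : 0 <= t -> t `^ (n%:R / 2) = Num.sqrt t ^+ n.
Proof.
move=> t0; rewrite -powR12_sqrt// -powR_mulrn ?powR_ge0// -powRrM.
by congr (_ `^ _); rewrite mulrC.
Qed.

Section pair.
Variables (x y : R * R).
Hypotheses (x0 : 0 < x.1) (y0 : 0 < y.1) (xy : x != y).
Variable m : R.
Hypothesis hm : m = Num.sqrt (x.1 * y.1).
Let s := sep_neq x0 y0 xy.
Let m0 : 0 < m. Proof. by rewrite hm sqrtr_gt0 mulr_gt0. Qed.
Let mE : m ^+ 2 = x.1 * y.1. Proof. by rewrite hm sqr_sqrtr// ltW// mulr_gt0. Qed.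

Lemma sqrt_sdist a :
  Num.sqrt (sdist x y ^+ 2 + 2 - 2 * cos a) = cyld 0 x y a / m.
Proof.
have -> : sdist x y ^+ 2 + 2 - 2 * cos a = sqd 0 x y a / m ^+ 2.
  rewrite /sdist expr_div_n eucl_dist_sqr -hm /sqd -[2 * x.1 * _]mulrA -mE; field.
  by rewrite gt_eqF.
rewrite sqrtrM; last by rewrite sqdE add0r !addr_ge0 ?sqr_ge0.
by rewrite sqrtrV ?sqr_ge0// sqrtr_sqr gtr0_norm.
Qed.

Lemma sdist_cos_ge0 a : 0 <= sdist x y ^+ 2 + 2 - 2 * cos a.
Proof. by rewrite -addrA addr_ge0 ?sqr_ge0//; have := cos_le1 a; lra. Qed.

Lemma Fell_Gk :
  Num.sqrt (x.1 * y.1) / (2 * pi) * Fell (eucl_dist x y ^+ 2 / (x.1 * y.1)) = Gk 0 x y.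
Proof.
rewrite -hm /Gk [m / _]mulrC -mulrA; congr (_ * _).
have cg : continuous (fun a => m * cos a / cyld 0 x y a ^+ 1).
  apply: (@continuous_divcyld _ 0 x y 1 (fun a => m * cos a)) => // a.
  by apply: cvgM; [exact: cvg_cst|exact: continuous_cos].
have -> : Fell (eucl_dist x y ^+ 2 / (x.1 * y.1)) = angint (fun a => m * cos a / cyld 0 x y a ^+ 1).
  apply: angint_eq => a _.
  have -> : eucl_dist x y ^+ 2 / (x.1 * y.1) + 2 - 2 * cos a = sdist x y ^+ 2 + 2 - 2 * cos a.
    by rewrite -mE -expr_div_n /sdist -hm.
  rewrite (powR_half_n 1) ?sdist_cos_ge0// sqrt_sdist expr1.
  by field; rewrite (gt_eqF m0) gt_eqF// cyld_gt0.
rewrite -angintZ//; apply: angint_eq => a _; rewrite /gG -mE expr1.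
by field; rewrite gt_eqF// cyld_gt0.
Qed.

Lemma F1_Nk : F1 (sdist x y) = 2 * pi * m * Nk 0 x y.
Proof.
have p0 := @pi_gt0 R.
rewrite /Nk [2 * pi * m * _]mulrA [_ * m]mulrC -[m * _ / _]mulrA divff; last by rewrite mulf_neq0// gt_eqF.
rewrite mulr1 -angintZ; last exact: continuous_gN.
apply: angint_eq => a _; rewrite powR_half_n ?sdist_cos_ge0// sqrt_sdist /gN -mE.
by field; rewrite (gt_eqF m0) gt_eqF// cyld_gt0.
Qed.

Lemma Kr_Nk : Kr x y = (x.2 - y.2) * Nk 0 x y / x.1.
Proof.
have := @pi_gt0 R; rewrite /Kr F1_Nk -hm; move: (pi) => p p0.
by field; rewrite (gt_eqF m0) (gt_eqF p0) (gt_eqF x0).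
Qed.

(** The decomposition y.1 - x.1 cos a = (y.1 - x.1) cos a + y.1 (1 - cos a) separates the parts
    given by [F1] and by [F2]. *)
Lemma Kz_Pk : Kz x y = Pk 0 x y / x.1.
Proof.
have pp := @pi_gt0 R.
have cN := continuous_gN s.
have c2 : continuous (fun a => m ^+ 3 * (1 - cos a) / cyld 0 x y a ^+ 3).
  apply: (@continuous_divcyld _ 0 x y 3 (fun a => m ^+ 3 * (1 - cos a))) => // a.
  apply: cvgM; first exact: cvg_cst.
  by apply: cvgB; [exact: cvg_cst|exact: continuous_cos].
have E2 : F2 (sdist x y) = angint (fun a => m ^+ 3 * (1 - cos a) / cyld 0 x y a ^+ 3).
  apply: angint_eq => a _; rewrite powR_half_n ?sdist_cos_ge0// sqrt_sdist.
  by field; rewrite (gt_eqF m0) gt_eqF// cyld_gt0.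
have EP : angint (gP 0 x y) = (y.1 - x.1) * angint (gN 0 x y) + y.1 / m * F2 (sdist x y).
  rewrite E2 -!angintZ// -angintD//.
  - apply: angint_eq => a _; rewrite /gP /gN -mE.
    by field; rewrite (gt_eqF m0) gt_eqF// cyld_gt0.
  - by move=> a; apply: cvgM; [exact: cvg_cst|exact: cN].
  - by move=> a; apply: cvgM; [exact: cvg_cst|exact: c2].
have Esq : Num.sqrt (y.1 / x.1) = m / x.1.
  rewrite -[RHS]ger0_norm ?divr_ge0 ?ltW// -sqrtr_sqr expr_div_n mE; congr Num.sqrt.
  by field; rewrite gt_eqF.
have mx : m ^+ 2 / x.1 = y.1 by rewrite mE; field; rewrite gt_eqF.
have yx : y.1 = m ^+ 2 / x.1 by [].
rewrite /Kz Esq F1_Nk -hm /Pk EP /Nk; set A := angint _; set B := F2 _.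
rewrite yx; move: pp; move: (pi) => p pp.
by field; rewrite (gt_eqF m0) (gt_eqF pp) (gt_eqF x0).
Qed.

End pair.

Lemma Kr_bound x y : 0 < x.1 -> 0 < y.1 -> x != y -> `|Kr x y| <= 2 / eucl_dist x y.
Proof.
move=> x0 y0 xy; rewrite (Kr_Nk x0 y0 xy erefl) 2!normrM normfV (gtr0_norm x0).
apply: (mean_over_r_le x0 y0 xy erefl erefl).
- exact: zNk_dist.
- exact: zNk_dist2.
Qed.

Lemma Kz_bound x y : 0 < x.1 -> 0 < y.1 -> x != y -> `|Kz x y| <= 2 / eucl_dist x y.
Proof.
move=> x0 y0 xy; rewrite (Kz_Pk x0 y0 xy erefl) normrM normfV (gtr0_norm x0).
apply: (mean_over_r_le x0 y0 xy erefl erefl).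
- exact: Pk_dist.
- exact: Pk_dist2.
Qed.

End KernelsOfTheStatement.

Section KernelMeasurability.
Context {R : realType}.
Local Notation pT := (measurableTypeR R * measurableTypeR R)%type.

Lemma measurable_cos : measurable_fun setT (@cos R).
Proof. by apply: continuous_measurable_fun; exact: continuous_cos. Qed.

Lemma measurable_angint d (T : measurableType d) (k : T * measurableTypeR R -> R) :
  measurable_fun setT k -> measurable_fun setT (fun p => angint (fun a => k (p, a))).
Proof.
move=> mk; exact: (measurable_fun_param_Rintegral (@lebesgue_measure R)).
Qed.

Local Notation T3 := ((pT * pT) * measurableTypeR R)%type.

Let m11 : measurable_fun setT (fun p : T3 => p.1.1.1).
Proof. by do 2 apply: measurableT_comp => //; apply: measurableT_comp. Qed.
Let m12 : measurable_fun setT (fun p : T3 => p.1.1.2).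
Proof. by do 2 apply: measurableT_comp => //; apply: measurableT_comp. Qed.
Let m21 : measurable_fun setT (fun p : T3 => p.1.2.1).
Proof. by do 2 apply: measurableT_comp => //; apply: measurableT_comp. Qed.
Let m22 : measurable_fun setT (fun p : T3 => p.1.2.2).
Proof. by do 2 apply: measurableT_comp => //; apply: measurableT_comp. Qed.
Let mc : measurable_fun setT (fun p : T3 => cos p.2).
Proof. by apply: measurableT_comp => //; exact: measurable_cos. Qed.

Let mcyld (e : R) : measurable_fun setT (fun p : T3 => cyld e p.1.1 p.1.2 p.2).
Proof. rewrite /cyld /sqd; meas. Qed.

Lemma measurable_Gk (e : R) : measurable_fun setT (fun p : pT * pT => Gk e p.1 p.2).
Proof.
apply: measurable_funM => //; apply: (@measurable_angint _ _ (fun p => gG e p.1.1 p.1.2 p.2)).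
have := mcyld e; rewrite /gG => ?; meas.
Qed.

Lemma measurable_Nk (e : R) : measurable_fun setT (fun p : pT * pT => Nk e p.1 p.2).
Proof.
apply: measurable_funM => //; apply: (@measurable_angint _ _ (fun p => gN e p.1.1 p.1.2 p.2)).
have := mcyld e; rewrite /gN => ?; meas.
Qed.

Lemma measurable_Pk (e : R) : measurable_fun setT (fun p : pT * pT => Pk e p.1 p.2).
Proof.
apply: measurable_funM => //; apply: (@measurable_angint _ _ (fun p => gP e p.1.1 p.1.2 p.2)).
have := mcyld e; rewrite /gP => ?; meas.
Qed.

Lemma measurable_eucl_dist : measurable_fun setT (fun p : pT * pT => eucl_dist p.1 p.2).
Proof. by rewrite /eucl_dist; meas; apply: measurableT_comp => //; exact: measurableT_comp. Qed.

End KernelMeasurability.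

(** * Singular integrals and densities *)

Section SingularIntegral.
Context {R : realType}.
Local Notation mu2 := (@plane_measure R).

Definition square (x : R * R) (h : R) : set (R * R) :=
  `]x.1 - h, x.1 + h[%classic `*` `]x.2 - h, x.2 + h[%classic.

Lemma measurable_square x h :
  measurable (square x h : set (measurableTypeR R * measurableTypeR R)%type).
Proof. by apply: measurableX; exact: measurable_itv. Qed.

Local Open Scope ereal_scope.

Lemma plane_measure_square x (h : R) : (0 < h)%R -> mu2 (square x h) = (4 * h ^+ 2)%:E.
Proof.
move=> h0; rewrite /plane_measure /square product_measure1E//=; try exact: measurable_itv.
rewrite !lebesgue_measure_itv/= !lte_fin.
have lt t : (t - h < t + h)%R by lra.
by rewrite !lt -!EFinB -EFinM; congr EFin; ring.
Qed.

Lemma dyadic_bracket (t h : R) : (0 < t)%R -> (t < h)%R ->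
  exists k : nat, (h / 2 ^+ k.+1 <= t)%R /\ (t < h / 2 ^+ k)%R.
Proof.
move=> t0 th; have h0 : (0 < h)%R by exact: lt_trans t0 th.
have ex : exists k, (h / 2 ^+ k <= t)%R.
  have [k hk] : exists k : nat, (h / t < 2 ^+ k)%R.
    exists (Num.truncn (h / t)).+1; apply: lt_le_trans (truncnS_gt _) _.
    elim: (_.+1) => [|n IH]; first by rewrite expr0.
    rewrite exprS -natr1; have : (1 <= 2 ^+ n :> R)%R by rewrite exprn_ege1// ler1n.
    lra.
  exists k; rewrite ler_pdivrMr ?exprn_gt0// mulrC -ler_pdivrMr//; exact: ltW.
case: (ex_minnP ex) => -[|k].
  by rewrite expr0 divr1 => /(lt_le_trans th); rewrite ltxx.
move=> hk kmin; exists k; split => //.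
by rewrite ltNge; apply/negP => /kmin; rewrite ltnn.
Qed.

Lemma sum_halves_le (n : nat) : (\sum_(0 <= k < n) (2 ^+ k)^-1 <= 2 :> R)%R.
Proof.
suff : (\sum_(0 <= k < n) (2 ^+ k)^-1 = 2 - 2 / 2 ^+ n :> R)%R.
  by move=> ->; rewrite gerBl divr_ge0// exprn_ge0.
elim: n => [|n IH]; first by rewrite big_geq// expr0 divr1 subrr.
rewrite big_nat_recr//= IH exprS; field.
by rewrite expf_neq0.
Qed.

(** Dyadic decomposition: where d is between h / 2^(k+1) and h / 2^k, the integrand is at most
    2^(k+1) / h, and the enclosing square has area 4 h^2 / 4^k. The contributions 8 h / 2^k sum up
    to 16 h. *)
Lemma singular_integral (x : R * R) (h : R) : (0 < h)%R ->
  \int[mu2]_y ((eucl_dist x y)^-1 * (eucl_dist x y < h)%R%:R)%:E <= (16 * h)%:E.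
Proof.
move=> h0; pose hk k := (h / 2 ^+ k)%R.
have hk0 k : (0 < hk k)%R by rewrite divr_gt0// exprn_gt0.
pose g k (y : (measurableTypeR R * measurableTypeR R)%type) : \bar R :=
  (2 / hk k * \1_(square x (hk k)) y)%:E.
have g0 k y : 0 <= g k y by rewrite lee_fin mulr_ge0// divr_ge0// ltW.
have mg k : measurable_fun setT (g k).
  apply/measurable_EFinP/measurable_funM => //; apply: measurable_indic.
  exact: measurable_square.
apply: (@le_trans _ _ (\int[mu2]_y \sum_(0 <= k <oo) g k y)).
  apply: le_integral_nomeas => y _.
    by rewrite lee_fin mulr_ge0 ?invr_ge0 ?sqrtr_ge0.
  have s0 : 0 <= \sum_(0 <= k <oo) g k y by apply: nneseries_ge0.
  have [dh|dh] := ltP (eucl_dist x y) h; last by rewrite mulr0.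
  have [->|dn0] := eqVneq (eucl_dist x y) 0%R; first by rewrite invr0 mul0r.
  have d0 : (0 < eucl_dist x y)%R by rewrite lt_neqAle eq_sym dn0 sqrtr_ge0.
  have [k [k1 k2]] := dyadic_bracket d0 dh.
  apply: (@le_trans _ _ (g k y)).
    rewrite /g mulr1 lee_fin.
    have -> : (\1_(square x (hk k)) y = 1 :> R)%R.
      rewrite indicE mem_set//; have := dist1_le x y; have := dist2_le x y.
      rewrite !ler_norml => /andP[a1 a2] /andP[b1 b2].
      by split; rewrite /= in_itv/=; apply/andP; split; rewrite /hk; lra.
    rewrite mulr1 (_ : 2 / hk k = (h / 2 ^+ k.+1)^-1)%R.
      by rewrite lef_pV2 ?posrE// divr_gt0// exprn_gt0.
    by rewrite /hk exprS; field; rewrite (gt_eqF h0) ?expf_neq0.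
  rewrite (@nneseriesD1 _ _ k)//.
  by rewrite leeDl// nneseries_ge0// => *; case: ifP.
rewrite integral_nneseries//.
apply: lime_le.
  by apply: is_cvg_nneseries => n _ _; apply: integral_ge0.
apply: nearW => n.
have E k : \int[mu2]_y g k y = (8 * h * (2 ^+ k)^-1)%:E.
  rewrite /g; under eq_integral do rewrite EFinM.
  rewrite ge0_integralZl_EFin//=; last 2 first.
  - by apply/measurable_EFinP; apply: measurable_indic; exact: measurable_square.
  - by rewrite divr_ge0// ltW.
  rewrite integral_indic//=; last exact: measurable_square.
  rewrite setIT plane_measure_square// -EFinM; congr EFin.
  by rewrite /hk; field; rewrite (gt_eqF h0) ?expf_neq0.
under eq_bigr do rewrite E.
rewrite sumEFin lee_fin -mulr_sumr; have := sum_halves_le n; nra.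
Qed.

End SingularIntegral.

Section OffDiagonal.
Context {R : realType}.
Implicit Types x y : R * R.
Local Notation pT := (measurableTypeR R * measurableTypeR R)%type.

(* Removes the diagonal: d / d is 0 at d = 0. *)
Definition offd x y : R := eucl_dist x y / eucl_dist x y.
Definition G0 x y : R := offd x y * Gk 0 x y.
Definition N0 x y : R := offd x y * Nk 0 x y.
Definition KR x y : R := (x.2 - y.2) * N0 x y / x.1.
Definition KZ x y : R := offd x y * Pk 0 x y / x.1.

Lemma offd_neq x y : x != y -> offd x y = 1.
Proof. by move=> xy; rewrite /offd divff// gt_eqF// eucl_dist_gt0. Qed.

Lemma eucl_dist_xx x : eucl_dist x x = 0.
Proof. by rewrite /eucl_dist !subrr expr0n addr0 sqrtr0. Qed.

Lemma offd_eq x : offd x x = 0.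
Proof. by rewrite /offd eucl_dist_xx mul0r. Qed.

Lemma measurable_offd : measurable_fun setT (fun p : pT * pT => offd p.1 p.2).
Proof. rewrite /offd; meas; exact: measurable_eucl_dist. Qed.

Lemma measurable_G0 : measurable_fun setT (fun p : pT * pT => G0 p.1 p.2).
Proof. rewrite /G0; meas; [exact: measurable_offd|exact: measurable_Gk]. Qed.

Lemma measurable_N0 : measurable_fun setT (fun p : pT * pT => N0 p.1 p.2).
Proof. rewrite /N0; meas; [exact: measurable_offd|exact: measurable_Nk]. Qed.

Let m11 : measurable_fun setT (fun p : pT * pT => p.1.1).
Proof. by apply: measurableT_comp. Qed.
Let m12 : measurable_fun setT (fun p : pT * pT => p.1.2).
Proof. by apply: measurableT_comp. Qed.
Let m22 : measurable_fun setT (fun p : pT * pT => p.2.2).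
Proof. by apply: measurableT_comp. Qed.

Lemma measurable_KR : measurable_fun setT (fun p : pT * pT => KR p.1 p.2).
Proof. have := measurable_N0; rewrite /KR => ?; meas. Qed.

Lemma measurable_KZ : measurable_fun setT (fun p : pT * pT => KZ p.1 p.2).
Proof. have := measurable_Pk (R := R) 0; have := measurable_offd; rewrite /KZ => ? ?; meas. Qed.

Section pair.
Variables (x y : R * R).
Hypotheses (x0 : 0 < x.1) (y0 : 0 < y.1).
Let d := eucl_dist x y.
Let m := Num.sqrt (x.1 * y.1).

Lemma KR_bound : `|KR x y| <= 2 / d.
Proof.
have [->|xy] := eqVneq x y; first by rewrite /KR subrr !mul0r normr0 divr_ge0 ?sqrtr_ge0.
by have := Kr_bound x0 y0 xy; rewrite (Kr_Nk x0 y0 xy erefl) /KR /N0 offd_neq// mul1r.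
Qed.

Lemma KZ_bound : `|KZ x y| <= 2 / d.
Proof.
have [->|xy] := eqVneq x y; first by rewrite /KZ offd_eq !mul0r normr0 divr_ge0 ?sqrtr_ge0.
by have := Kz_bound x0 y0 xy; rewrite (Kz_Pk x0 y0 xy erefl) /KZ offd_neq// mul1r.
Qed.

Lemma KR_Kr : x != y -> KR x y = Kr x y.
Proof. by move=> xy; rewrite (Kr_Nk x0 y0 xy erefl) /KR /N0 offd_neq// mul1r. Qed.

Lemma KZ_Kz : x != y -> KZ x y = Kz x y.
Proof. by move=> xy; rewrite (Kz_Pk x0 y0 xy erefl) /KZ offd_neq// mul1r. Qed.

Lemma N0_dist2 : `|N0 x y| * d ^+ 2 <= 3 / 4 * m.
Proof.
have [->|xy] := eqVneq x y.
  by rewrite /N0 offd_eq mul0r normr0 mul0r mulr_ge0 ?sqrtr_ge0.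
by rewrite /N0 offd_neq// mul1r; exact: (Nk_dist2 x0 y0 xy erefl erefl).
Qed.

Lemma G0_ge0 : 0 <= G0 x y.
Proof.
have [->|xy] := eqVneq x y; first by rewrite /G0 offd_eq mul0r.
by rewrite /G0 offd_neq// mul1r; apply: Gk_ge0; exact: sep_neq.
Qed.

Lemma G0_log : G0 x y <= m / (2 * pi) * ln (1 + 4 * m / d).
Proof.
have [E|xy] := eqVneq x y.
  rewrite /d -E eucl_dist_xx invr0 mulr0 addr0 ln1 mulr0.
  by rewrite /G0 offd_eq mul0r.
by rewrite /G0 offd_neq// mul1r; exact: (Gk_log x0 y0 xy erefl erefl).
Qed.

Lemma KZ_GN : 2 * x.1 ^+ 2 * KZ x y =
  - (2 * x.1 * (x.1 - y.1)) * N0 x y + G0 x y + N0 x y * d ^+ 2.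
Proof.
have E : 2 * x.1 ^+ 2 * KZ x y = 2 * x.1 * (offd x y * Pk 0 x y).
  by rewrite /KZ; field; rewrite gt_eqF.
rewrite E; have [->|xy] := eqVneq x y; first by rewrite /N0 /G0 offd_eq !mul0r !mulr0 !addr0.
rewrite /N0 /G0 offd_neq// !mul1r (Pk_GN (sep_neq x0 y0 xy)) add0r.
by rewrite /d eucl_dist_sqr.
Qed.

End pair.

Lemma N0_sym x y : N0 x y = N0 y x.
Proof. by rewrite /N0 /offd Nk_sym eucl_distC. Qed.

End OffDiagonal.

Section Densities.
Context {R : realType}.
Local Notation mu2 := (@plane_measure R).
Local Notation mu4 := (mu2 \x mu2)%E.
Local Notation pT := (measurableTypeR R * measurableTypeR R)%type.
Implicit Types (f g : R * R -> R) (k b : R * R -> R * R -> R).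

(* The bounds hold everywhere: for a solution they do so after modification on a
   null set, and then c is c1 eps^-2. *)
Record good (c M : R) f : Prop := Good {
  good_meas : measurable_fun setT (f : pT -> R) ;
  good_ge0 : forall x, 0 <= f x ;
  good_out : forall x, ~ (0 < x.1) -> f x = 0 ;
  good_c : forall x, 0 < x.1 -> f x <= c * x.1 ;
  good_M : forall x, f x <= M ;
  good_mass : (\int[mu2]_x (f x)%:E <= M%:E)%E ;
  good_rmass : (\int[mu2]_x (x.1 * f x)%:E <= M%:E)%E }.

Definition J f k : R := \int[mu4]_p (k p.1 p.2 * (f p.1 * f p.2)).
Definition Jb f b : \bar R := (\int[mu4]_p (b p.1 p.2 * (f p.1 * f p.2))%:E)%E.
Definition meas2 k := measurable_fun setT (fun p : pT * pT => k p.1 p.2).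

Lemma measurable_r : measurable_fun setT (fun x : pT => x.1). Proof. exact: measurable_fst. Qed.
Lemma measurable_p1 d (T : measurableType d) (g : pT -> T) : measurable_fun setT g ->
  measurable_fun setT (fun p : pT * pT => g p.1).
Proof. by move=> mg; apply: (measurableT_comp mg). Qed.

Lemma measurable_p2 d (T : measurableType d) (g : pT -> T) : measurable_fun setT g ->
  measurable_fun setT (fun p : pT * pT => g p.2).
Proof. by move=> mg; apply: (measurableT_comp mg). Qed.

Lemma meas2_section k x : meas2 k -> measurable_fun setT (k x : pT -> R).
Proof.
move=> mk; have := measurableT_comp mk (pair1_measurable x).
by [].
Qed.

Section one.
Variables (c M : R) (f : R * R -> R).
Hypothesis gf : good c M f.

Let f0 := good_ge0 gf.
Let mf : measurable_fun setT (f : pT -> R) := good_meas gf.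

Lemma good_halfplane x : f x != 0 -> 0 < x.1.
Proof. by apply: contraNT => /negP h; apply/eqP; exact: good_out gf _ h. Qed.

Lemma good_M_ge0 : 0 <= M.
Proof. by rewrite -lee_fin; apply: le_trans (good_mass gf); apply: integral_ge0 => x _; rewrite lee_fin. Qed.

Lemma good_le (g h : R * R -> R) x : (0 < x.1 -> g x <= h x) -> g x * f x <= h x * f x.
Proof.
move=> gh; have [->|/good_halfplane/gh hx] := eqVneq (f x) 0; first by rewrite !mulr0.
by rewrite ler_wpM2r.
Qed.

Lemma good_weight_ge0 (g : R * R -> R) x : (0 < x.1 -> 0 <= g x) -> 0 <= g x * f x.
Proof. by move=> g0; have := @good_le (fun=> 0) g x g0; rewrite mul0r. Qed.

Lemma good_weight_norm (g h : R * R -> R) x :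
  (0 < x.1 -> `|g x| <= h x) -> `|g x * f x| <= h x * f x.
Proof. by move=> gh; rewrite normrM (ger0_norm (f0 x)); exact: (@good_le (fun x => `|g x|)). Qed.

Lemma good_integrable (g h : R * R -> R) (B : R) : measurable_fun setT (g : pT -> R) ->
  (forall x, 0 < x.1 -> `|g x| <= h x) -> (\int[mu2]_x (h x * f x)%:E <= B%:E)%E ->
  mu2.-integrable setT (fun x => (g x * f x)%:E).
Proof.
move=> mg gh hB; apply/integrableP; split.
  by apply/measurable_EFinP; exact: measurable_funM.
apply: (@le_lt_trans _ _ B%:E); last exact: ltry.
apply: le_trans hB; apply: le_integral_nomeas => x _ //=.
by rewrite lee_fin; exact: (good_weight_norm (gh x)).
Qed.

Lemma good_integral_le (g : R * R -> R) (a b : R) :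
  (forall x, 0 < x.1 -> 0 <= g x <= a + b * x.1) -> 0 <= a -> 0 <= b ->
  (\int[mu2]_x (g x * f x)%:E <= ((a + b) * M)%:E)%E.
Proof.
move=> gab a0 b0; apply: (@le_trans _ _ (\int[mu2]_x ((a * f x)%:E + (b * (x.1 * f x))%:E))%E).
  apply: le_integral_nomeas => x _.
    by rewrite lee_fin; apply: good_weight_ge0 => /gab /andP[].
  rewrite -EFinD lee_fin mulrA -mulrDl.
  by apply: (@good_le g (fun x => a + b * x.1)) => /gab /andP[].
have rf0 x : 0 <= x.1 * f x by apply: (@good_weight_ge0 fst) => /ltW.
have mrf : measurable_fun setT (fun x : pT => x.1 * f x) by apply: measurable_funM.
rewrite ge0_integralD//=; last 4 first.
- by move=> x _; rewrite lee_fin mulr_ge0.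
- by apply/measurable_EFinP; apply: measurable_funM.
- by move=> x _; rewrite lee_fin mulr_ge0.
- by apply/measurable_EFinP; apply: measurable_funM.
have Z (t : R) (g' : pT -> R) : 0 <= t -> measurable_fun setT g' -> (forall x, 0 <= g' x) ->
  (\int[mu2]_x (t * g' x)%:E = t%:E * \int[mu2]_x (g' x)%:E)%E.
  move=> t0 mg' g0; under eq_integral do rewrite EFinM.
  rewrite ge0_integralZl_EFin//=; first by move=> x _; rewrite lee_fin.
  exact/measurable_EFinP.
rewrite !Z// mulrDl EFinD !EFinM; apply: leeD; apply: lee_wpmul2l; rewrite ?lee_fin//.
  exact: good_mass gf.
exact: good_rmass gf.
Qed.

(** 17 = 16 + 1: at distance below 1 the density is at most M and [singular_integral] gives 16;
    further away the kernel is at most 1 and the mass at most M. *)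
Lemma potential_le x : (\int[mu2]_y ((eucl_dist x y)^-1 * f y)%:E <= (17 * M)%:E)%E.
Proof.
have M0 := good_M_ge0.
pose s y : R := (eucl_dist x y)^-1 * (eucl_dist x y < 1)%R%:R.
have ms : measurable_fun setT (s : pT -> R).
  apply: measurable_funM; first by apply: measurable_funV; exact: (meas2_section x (@measurable_eucl_dist R)).
  apply: measurable_fun_bool_nat.
  apply: measurable_fun_ltr => //; exact: (meas2_section x (@measurable_eucl_dist R)).
have s0 y : 0 <= s y by rewrite mulr_ge0 ?invr_ge0 ?sqrtr_ge0.
apply: (@le_trans _ _ (\int[mu2]_y (M%:E * (s y)%:E + (f y)%:E))%E).
  apply: le_integral_nomeas => y _; first by rewrite lee_fin mulr_ge0 ?invr_ge0 ?sqrtr_ge0.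
  rewrite -EFinM -EFinD lee_fin /s; have [d1|d1] := ltP (eucl_dist x y) 1.
    rewrite mulr1 mulrC -[X in X <= _]addr0 lerD// ler_wpM2r ?invr_ge0 ?sqrtr_ge0//.
    exact: good_M gf y.
  rewrite !mulr0 add0r ler_piMl// invf_le1//; exact: lt_le_trans d1.
rewrite ge0_integralD//=; last 3 first.
- by apply/measurable_EFinP; apply: measurable_funM.
- by move=> y _; rewrite lee_fin.
- exact/measurable_EFinP.
rewrite ge0_integralZl_EFin//=; last 2 first.
- by move=> y _; rewrite lee_fin.
- exact/measurable_EFinP.
  rewrite (_ : 17 * M = M * 16 + M); last by ring.
  rewrite EFinD EFinM; apply: leeD; last exact: good_mass gf.
  apply: lee_wpmul2l; first by rewrite lee_fin.
  by have := singular_integral x (@ltr01 R); rewrite mulr1.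
by move=> y _; rewrite -EFinM lee_fin mulr_ge0.
Qed.

Lemma Jb_le b (beta : R * R -> R) : meas2 b ->
  (forall x y, 0 < x.1 -> 0 < y.1 -> 0 <= b x y) ->
  (forall x, 0 < x.1 -> (\int[mu2]_y (b x y * f y)%:E <= (beta x)%:E)%E) ->
  (Jb f b <= \int[mu2]_x (beta x * f x)%:E)%E.
Proof.
move=> mb b0 bb; rewrite /Jb ge0_integral_prod//=; last 2 first.
- apply/measurable_EFinP; apply: measurable_funM => //.
  by apply: measurable_funM; [exact: measurable_p1|exact: measurable_p2].
- move=> p; rewrite lee_fin.
  have [->|/good_halfplane h1] := eqVneq (f p.1) 0; first by rewrite mul0r mulr0.
  have [->|/good_halfplane h2] := eqVneq (f p.2) 0; first by rewrite !mulr0.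
  by rewrite mulr_ge0 ?b0 ?mulr_ge0.
apply: le_integral_nomeas => x _.
  apply: integral_ge0 => y _; rewrite lee_fin.
  have [->|/good_halfplane h1] := eqVneq (f x) 0; first by rewrite mul0r mulr0.
  have [->|/good_halfplane h2] := eqVneq (f y) 0; first by rewrite !mulr0.
  by rewrite mulr_ge0 ?b0 ?mulr_ge0.
have [->|/good_halfplane h1] := eqVneq (f x) 0.
  by rewrite mulr0; under eq_integral do rewrite mul0r mulr0; rewrite integral0.
have -> : (\int[mu2]_y (b x y * (f x * f y))%:E = (f x)%:E * \int[mu2]_y (b x y * f y)%:E)%E.
  rewrite -ge0_integralZl_EFin//=.
  - by apply: eq_integral => y _; rewrite -EFinM mulrCA.
  - by move=> y _; rewrite lee_fin; apply: (@good_weight_ge0 (b x)) => h2; exact: b0.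
  - by apply/measurable_EFinP; apply: measurable_funM => //; exact: meas2_section.
rewrite [beta x * _]mulrC EFinM; apply: lee_wpmul2l; first by rewrite lee_fin.
exact: bb.
Qed.

Lemma J_pair_norm k b x y : (0 < x.1 -> 0 < y.1 -> `|k x y| <= b x y) ->
  `|k x y * (f x * f y)| <= b x y * (f x * f y).
Proof.
move=> kb.
have [->|/good_halfplane h1] := eqVneq (f x) 0; first by rewrite mul0r !mulr0 normr0.
have [->|/good_halfplane h2] := eqVneq (f y) 0; first by rewrite !mulr0 normr0.
by rewrite normrM (ger0_norm (mulr_ge0 (f0 _) (f0 _))) ler_wpM2r ?mulr_ge0// kb.
Qed.

Lemma J_integrable k b (B : R) : meas2 k ->
  (forall x y, 0 < x.1 -> 0 < y.1 -> `|k x y| <= b x y) -> (Jb f b <= B%:E)%E ->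
  mu4.-integrable setT (fun p => (k p.1 p.2 * (f p.1 * f p.2))%:E).
Proof.
move=> mk kb bB; apply/integrableP; split.
  apply/measurable_EFinP; apply: measurable_funM => //.
  by apply: measurable_funM; [exact: measurable_p1|exact: measurable_p2].
apply: (@le_lt_trans _ _ B%:E); last exact: ltry.
apply: le_trans bB; apply: le_integral_nomeas => p _ //=.
by rewrite lee_fin; apply: J_pair_norm; exact: kb.
Qed.

Lemma J_bound k b (B : R) :
  (forall x y, 0 < x.1 -> 0 < y.1 -> `|k x y| <= b x y) -> (Jb f b <= B%:E)%E ->
  `|J f k| <= B.
Proof.
move=> kb bB; apply: (@Rintegral_bound _ _ _ mu4 setT _ (fun p => b p.1 p.2 * (f p.1 * f p.2))) => //.
by move=> p _; apply: J_pair_norm; exact: kb.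
Qed.

Definition Jint k := mu4.-integrable setT (fun p => (k p.1 p.2 * (f p.1 * f p.2))%:E).

Lemma J_D k1 k2 : Jint k1 -> Jint k2 -> J f (fun x y => k1 x y + k2 x y) = J f k1 + J f k2.
Proof.
move=> i1 i2; rewrite /J -RintegralD//; apply: eq_Rintegral => p _.
by rewrite mulrDl.
Qed.

Lemma J_Z (t : R) k : Jint k -> J f (fun x y => t * k x y) = t * J f k.
Proof.
move=> i1; rewrite /J -RintegralZl//; apply: eq_Rintegral => p _.
by rewrite -mulrA.
Qed.

Lemma Jint_D k1 k2 : Jint k1 -> Jint k2 -> Jint (fun x y => k1 x y + k2 x y).
Proof.
move=> i1 i2; have := integrableD measurableT i1 i2.
rewrite /Jint; congr (_.-integrable _ _); apply/funext => p /=.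
by rewrite mulrDl EFinD.
Qed.

Lemma Jint_Z (t : R) k : Jint k -> Jint (fun x y => t * k x y).
Proof.
move=> i1; have := integrableZl measurableT t i1.
rewrite /Jint; congr (_.-integrable _ _); apply/funext => p /=.
by rewrite -EFinM -mulrA.
Qed.

Lemma Jint_sym k : Jint k -> Jint (fun x y => k y x).
Proof.
move=> i1; have := @integrable_swap _ _ R mu2 (fun p => k p.1 p.2 * (f p.1 * f p.2)) i1.
rewrite /Jint; congr (_.-integrable _ _); apply/funext => p /=.
by rewrite [f p.2 * _]mulrC.
Qed.

Lemma J_sym k : Jint k -> J f k = J f (fun x y => k y x).
Proof.
move=> i1; rewrite /J (@Rintegral_swap _ _ R mu2)//; apply: eq_Rintegral => p _ /=.
by rewrite [f p.2 * _]mulrC.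
Qed.

(** The two orders of the variables give the same integral, so cancellations between [k x y] and
    [k y x] may be exploited; k alone only has to be integrable, with any constant. *)
Lemma J_sym_bound k b (B : R) : Jint k ->
  (forall x y, 0 < x.1 -> 0 < y.1 -> `|k x y + k y x| <= b x y) -> (Jb f b <= B%:E)%E ->
  `|J f k| <= B / 2.
Proof.
move=> ik kb bB.
have -> : J f k = 2^-1 * J f (fun x y => k x y + k y x).
  rewrite J_D//; last exact: Jint_sym.
  by rewrite [X in _ + X](_ : _ = J f k); [field|rewrite [RHS]J_sym].
rewrite normrM ger0_norm ?invr_ge0// mulrC ler_pM2r ?invr_gt0//.
exact: J_bound kb bB.
Qed.

Lemma eq_J k1 k2 : (forall x y, 0 < x.1 -> 0 < y.1 -> k1 x y = k2 x y) -> J f k1 = J f k2.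
Proof.
move=> k12; apply: eq_Rintegral => p _.
have [->|/good_halfplane h1] := eqVneq (f p.1) 0; first by rewrite mul0r !mulr0.
have [->|/good_halfplane h2] := eqVneq (f p.2) 0; first by rewrite !mulr0.
by rewrite k12.
Qed.

Lemma J_le k1 k2 : Jint k1 -> Jint k2 -> (forall x y, 0 < x.1 -> 0 < y.1 -> k1 x y <= k2 x y) ->
  J f k1 <= J f k2.
Proof.
move=> i1 i2 k12; apply: le_Rintegral => // p _.
have [->|/good_halfplane h1] := eqVneq (f p.1) 0; first by rewrite mul0r !mulr0.
have [->|/good_halfplane h2] := eqVneq (f p.2) 0; first by rewrite !mulr0.
by rewrite ler_wpM2r ?mulr_ge0 ?k12.
Qed.

Lemma J_iterated k : Jint k ->
  (forall x, 0 < x.1 -> mu2.-integrable setT (fun y => (k x y * f y)%:E)) ->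
  J f k = \int[mu2]_x (\int[mu2]_y (k x y * f y) * f x).
Proof.
move=> ik iy; rewrite /J (@Rintegral_prod _ _ _ _ R mu2 mu2)//=.
  apply: eq_Rintegral => x _.
  have [->|/good_halfplane h1] := eqVneq (f x) 0.
    under eq_Rintegral do rewrite mul0r mulr0.
    by rewrite mulr0 /Rintegral integral0.
  rewrite mulrC -RintegralZl//; last exact: iy.
  by apply: eq_Rintegral => y _; rewrite mulrCA.
move=> x; have [->|/good_halfplane h1] := eqVneq (f x) 0.
  under eq_fun do rewrite mul0r mulr0; exact: integrable0.
have := integrableZl measurableT (f x) (iy _ h1).
congr (_.-integrable _ _); apply/funext => y /=.
by rewrite -EFinM mulrCA.
Qed.

End one.
End Densities.

Section Moments.
Context {R : realType}.
Local Notation mu2 := (@plane_measure R).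
Local Notation mu4 := (mu2 \x mu2)%E.
Local Notation pT := (measurableTypeR R * measurableTypeR R)%type.
Implicit Types (g h : R * R -> R) (k b : R * R -> R * R -> R).

Definition mom (f : R * R -> R) g : R := \int[mu2]_x (g x * f x).

Record good2 (c M : R) (f : R * R -> R) : Prop := Good2 {
  good2_good : good c M f ;
  good2_r2 : (\int[mu2]_x (x.1 ^+ 2 * f x)%:E <= M%:E)%E }.

Coercion good2_good : good2 >-> good.

Lemma measurable_near (x : R * R) (t : R) :
  measurable_fun setT ((fun y => (eucl_dist x y < t)%R%:R) : pT -> R).
Proof.
apply: measurable_fun_bool_nat; apply: measurable_fun_ltr => //.
exact: (meas2_section x (@measurable_eucl_dist R)).
Qed.

Lemma measurable_far (x : R * R) (t : R) :
  measurable_fun setT ((fun y => (t <= eucl_dist x y)%R%:R) : pT -> R).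
Proof.
apply: measurable_fun_bool_nat; apply: measurable_fun_ler => //.
exact: (meas2_section x (@measurable_eucl_dist R)).
Qed.

Lemma meas2_near (t : R) : meas2 (fun x y : R * R => (eucl_dist x y < t)%R%:R : R).
Proof.
apply: measurable_fun_bool_nat; apply: measurable_fun_ltr => //.
exact: measurable_eucl_dist.
Qed.

Lemma meas2_far (t : R) : meas2 (fun x y : R * R => (t <= eucl_dist x y)%R%:R : R).
Proof.
apply: measurable_fun_bool_nat; apply: measurable_fun_ler => //.
exact: measurable_eucl_dist.
Qed.

Definition momint (f : R * R -> R) g := mu2.-integrable setT (fun x => (g x * f x)%:E).

Section good_moments.
Variables (c M : R) (f : R * R -> R).
Hypothesis gf : good c M f.

Lemma mom_le g h : momint f g -> momint f h -> (forall x, 0 < x.1 -> g x <= h x) -> mom f g <= mom f h.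
Proof.
move=> ig ih gh; apply: le_Rintegral => // x _.
exact: (good_le gf (gh x)).
Qed.

Lemma mom_ge0 g : (forall x, 0 < x.1 -> 0 <= g x) -> 0 <= mom f g.
Proof.
by move=> g0; apply: Rintegral_ge0 => x _; apply: (good_weight_ge0 gf); exact: g0.
Qed.

Lemma eq_mom g h : (forall x, 0 < x.1 -> g x = h x) -> mom f g = mom f h.
Proof.
move=> gh; apply: eq_Rintegral => x _.
by have [->|/(good_halfplane gf)/gh ->] := eqVneq (f x) 0; rewrite ?mulr0.
Qed.

Lemma mom_bound g h (B : R) : (forall x, 0 < x.1 -> `|g x| <= h x) ->
  (\int[mu2]_x (h x * f x)%:E <= B%:E)%E -> `|mom f g| <= B.
Proof.
move=> gh hB; apply: (@Rintegral_bound _ _ _ mu2 setT _ (fun x => h x * f x)) => // x _.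
exact: (good_weight_norm gf (gh x)).
Qed.

End good_moments.

Section fixed.
Variables (c M : R) (f : R * R -> R).
Hypothesis gf2 : good2 c M f.
Let gf := good2_good gf2.
Let f0 := good_ge0 gf.
Let mf : measurable_fun setT (f : pT -> R) := good_meas gf.
Let M0 : 0 <= M. Proof. exact: good_M_ge0 gf. Qed.
Let mr : measurable_fun setT ((fun x => x.1) : pT -> R) := @measurable_r R.

Lemma weight_le g (a : R) : (forall x, 0 < x.1 -> 0 <= g x <= a * (1 + x.1 ^+ 2)) -> 0 <= a ->
  (\int[mu2]_x (g x * f x)%:E <= (2 * a * M)%:E)%E.
Proof.
move=> ga a0; apply: (@le_trans _ _ (\int[mu2]_x (a%:E * ((f x)%:E + (x.1 ^+ 2 * f x)%:E)))%E).
  apply: le_integral_nomeas => x _.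
    by rewrite lee_fin; apply: (good_weight_ge0 gf) => /ga /andP[].
  rewrite -EFinD -EFinM lee_fin.
  have -> : a * (f x + x.1 ^+ 2 * f x) = a * (1 + x.1 ^+ 2) * f x by ring.
  by apply: (good_le gf (h := fun x => a * (1 + x.1 ^+ 2))) => /ga /andP[].
have m2 : measurable_fun setT ((fun x => x.1 ^+ 2 * f x) : pT -> R).
  by apply: measurable_funM => //; exact: measurable_funX.
rewrite ge0_integralZl_EFin//=.
- have -> : (2 * a * M)%:E = (a%:E * (M%:E + M%:E))%E by rewrite -EFinD -EFinM; congr EFin; ring.
  apply: lee_wpmul2l; first by rewrite lee_fin.
  rewrite ge0_integralD//=; try exact/measurable_EFinP.
  + by apply: leeD; [exact: good_mass gf|exact: good2_r2 gf2].
  + by move=> x _; rewrite lee_fin.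
  + by move=> x _; rewrite lee_fin mulr_ge0// sqr_ge0.
- by move=> x _; rewrite -EFinD lee_fin addr_ge0// mulr_ge0// sqr_ge0.
- by apply: emeasurable_funD; exact/measurable_EFinP.
Qed.

Lemma mom_integrable g (a : R) : measurable_fun setT (g : pT -> R) ->
  (forall x, 0 < x.1 -> `|g x| <= a * (1 + x.1 ^+ 2)) -> 0 <= a -> momint f g.
Proof.
move=> mg ga a0; apply: (good_integrable gf (h := fun x => a * (1 + x.1 ^+ 2)) (B := 2 * a * M)) => //.
apply: weight_le => // x x0; by rewrite lexx andbT mulr_ge0// addr_ge0 ?sqr_ge0.
Qed.

Lemma momD g h : momint f g -> momint f h -> mom f (fun x => g x + h x) = mom f g + mom f h.
Proof.
move=> ig ih; rewrite /mom -RintegralD//; apply: eq_Rintegral => x _.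
by rewrite mulrDl.
Qed.

Lemma momZ (t : R) g : momint f g -> mom f (fun x => t * g x) = t * mom f g.
Proof.
move=> ig; rewrite /mom -RintegralZl//; apply: eq_Rintegral => x _.
by rewrite -mulrA.
Qed.

Lemma momint_D g h : momint f g -> momint f h -> momint f (fun x => g x + h x).
Proof.
move=> i1 i2; have := integrableD measurableT i1 i2.
rewrite /momint; congr (_.-integrable _ _); apply/funext => p /=.
by rewrite mulrDl EFinD.
Qed.

Lemma momint_Z (t : R) g : momint f g -> momint f (fun x => t * g x).
Proof.
move=> i1; have := integrableZl measurableT t i1.
rewrite /momint; congr (_.-integrable _ _); apply/funext => p /=.
by rewrite -EFinM -mulrA.
Qed.

Lemma mom_EFin g : momint f g -> (\int[mu2]_x (g x * f x)%:E = (mom f g)%:E)%E.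
Proof. by move=> ig; rewrite /mom /Rintegral fineK//; exact: integrable_fin_num. Qed.

Lemma J_prod g h : momint f g -> momint f h -> J f (fun x y => g x * h y) = mom f g * mom f h.
Proof.
move=> ig ih.
have mg : measurable_fun setT ((fun x => g x * f x) : pT -> R).
  by have /integrableP[/measurable_EFinP] := ig.
have mh : measurable_fun setT ((fun x => h x * f x) : pT -> R).
  by have /integrableP[/measurable_EFinP] := ih.
have E x y : g x * h y * (f x * f y) = (g x * f x) * (h y * f y) by ring.
have ii : mu4.-integrable setT (EFin \o (fun p => g p.1 * f p.1 * (h p.2 * f p.2))).
  apply/integrableP; split.
    by apply/measurable_EFinP; apply: measurable_funM; [exact: (measurable_p1 mg)|exact: (measurable_p2 mh)].
  rewrite fubini_tonelli1//=; last first.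
    apply/measurable_EFinP.
    apply: measurableT_comp => //.
    by apply: measurable_funM; [exact: (measurable_p1 mg)|exact: (measurable_p2 mh)].
  rewrite /fubini_F/=; under eq_integral => x _.
    under eq_integral do rewrite normrM EFinM.
    rewrite ge0_integralZl_EFin//=; last by apply/measurable_EFinP; apply: measurableT_comp.
    over.
  rewrite /=; have /integrableP[_ fing] := ig; have /integrableP[_ finh] := ih.
  have finh' : (\int[mu2]_y `|h y * f y|%:E)%E \is a fin_num.
    by rewrite ge0_fin_numE//; apply: integral_ge0 => *; rewrite lee_fin.
  rewrite ge0_integralZr//=.
  - have g0 : (0 <= \int[mu2]_x `|g x * f x|%:E)%E by apply: integral_ge0 => x _; rewrite lee_fin.
    by apply: lte_mul_pinfty => //; rewrite ge0_fin_numE.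
  - by apply/measurable_EFinP; apply: measurableT_comp.
  - by apply: integral_ge0 => x _; rewrite lee_fin.
have iy x : mu2.-integrable setT (fun y => (g x * f x * (h y * f y))%:E).
  have := integrableZl measurableT (g x * f x) ih.
  by congr (_.-integrable _ _); apply/funext => y /=; rewrite -EFinM.
rewrite /J (_ : Rintegral _ _ _ = \int[mu4]_p (g p.1 * f p.1 * (h p.2 * f p.2))); last first.
  by apply: eq_Rintegral => p _.
rewrite (@Rintegral_prod _ _ _ _ R mu2 mu2 (fun p => g p.1 * f p.1 * (h p.2 * f p.2)))//=.
rewrite mulrC -RintegralZl//; apply: eq_Rintegral => x _.
by rewrite RintegralZl// mulrC.
Qed.

Lemma Jb_ge b g : meas2 b ->
  (forall x y, 0 < x.1 -> 0 < y.1 -> 0 <= b x y) -> (forall x, 0 < x.1 -> 0 <= g x) ->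
  (forall x, 0 < x.1 -> ((g x)%:E <= \int[mu2]_y (b x y * f y)%:E)%E) ->
  (\int[mu2]_x (g x * f x)%:E <= Jb f b)%E.
Proof.
move=> mb b0 g0 gb; rewrite /Jb.
rewrite (@ge0_integral_prod _ _ _ _ R mu2 mu2 (fun p => (b p.1 p.2 * (f p.1 * f p.2))%:E))//=; last 2 first.
- apply/measurable_EFinP; apply: measurable_funM => //.
  by apply: measurable_funM; [exact: measurable_p1|exact: measurable_p2].
- move=> p; rewrite lee_fin.
  have [->|/(good_halfplane gf) h1] := eqVneq (f p.1) 0; first by rewrite mul0r mulr0.
  have [->|/(good_halfplane gf) h2] := eqVneq (f p.2) 0; first by rewrite !mulr0.
  by rewrite mulr_ge0 ?b0 ?mulr_ge0.
apply: le_integral_nomeas => x _.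
  by rewrite lee_fin; apply: (good_weight_ge0 gf); exact: g0.
have [->|/(good_halfplane gf) h1] := eqVneq (f x) 0.
  by rewrite mulr0; under eq_integral do rewrite mul0r mulr0; rewrite integral0.
have -> : (\int[mu2]_y (b x y * (f x * f y))%:E = (f x)%:E * \int[mu2]_y (b x y * f y)%:E)%E.
  rewrite -ge0_integralZl_EFin//=.
  - by apply: eq_integral => y _; rewrite -EFinM mulrCA.
  - by move=> y _; rewrite lee_fin; apply: (@good_weight_ge0 _ _ _ _ gf (b x)) => h2; exact: b0.
  - by apply/measurable_EFinP; apply: measurable_funM => //; exact: meas2_section.
rewrite [g x * _]mulrC EFinM; apply: lee_wpmul2l; first by rewrite lee_fin.
exact: gb.
Qed.

End fixed.
End Moments.

(** * Concentration *)

Section EnergyUpperBound.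
Context {R : realType}.
Local Notation mu2 := (@plane_measure R).
Local Notation mu4 := (mu2 \x mu2)%E.
Local Notation pT := (measurableTypeR R * measurableTypeR R)%type.
Implicit Types (x y : R * R).

Definition gm x y : R := Num.sqrt (x.1 * y.1).
Definition far (t : R) x y : R := (t <= eucl_dist x y)%R%:R.
Definition near (t : R) x y : R := (eucl_dist x y < t)%R%:R.

Lemma near_ge0 t x y : 0 <= near t x y. Proof. by rewrite ler0n. Qed.
Lemma far_ge0 t x y : 0 <= far t x y. Proof. by rewrite ler0n. Qed.
Lemma far_le1 t x y : far t x y <= 1. Proof. by rewrite lern1; case: (_ <= _). Qed.

Lemma gm_ge0 x y : 0 <= gm x y. Proof. exact: sqrtr_ge0. Qed.

Lemma gm_sqr x y : 0 < x.1 -> 0 < y.1 -> gm x y ^+ 2 = x.1 * y.1.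
Proof. by move=> x0 y0; rewrite sqr_sqrtr// mulr_ge0// ltW. Qed.

Lemma gm_le_mean x y : 0 < x.1 -> 0 < y.1 -> gm x y <= (x.1 + y.1) / 2.
Proof.
move=> x0 y0; rewrite -(@ler_pXn2r _ 2) ?nnegrE ?gm_ge0//; last by rewrite divr_ge0// addr_ge0// ltW.
rewrite gm_sqr//; have := sqr_ge0 (x.1 - y.1); nra.
Qed.

Lemma gm_sqrt x y : 0 < x.1 -> gm x y = Num.sqrt x.1 * Num.sqrt y.1.
Proof. by move=> x0; rewrite /gm sqrtrM// ltW. Qed.

Lemma meas2_gm : meas2 gm.
Proof. by rewrite /meas2 /gm; meas; apply: measurableT_comp. Qed.

Lemma ln1D_le (t : R) : 0 <= t -> ln (1 + t) <= t.
Proof. by move=> t0; apply: le_ln1Dx; lra. Qed.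

(** Three ranges of d. For d >= sqrt eps the logarithm of 1 / d is at most half of - ln eps, the
    gain that drives the localisation. For eps <= d < sqrt eps it is at most - ln eps. For d < eps
    the excess ln (eps / d) is at most eps / d. *)
Lemma log_split (eps d t : R) : 0 < eps -> eps <= 1 -> 0 <= d -> 0 <= t ->
  ln (1 + t / d) <= - ln eps * (1 - (Num.sqrt eps <= d)%R%:R / 2) + t
    + eps / d * (d < eps)%R%:R.
Proof.
move=> e0 e1 d0 t0; have L0 : 0 <= - ln eps by rewrite oppr_ge0 ln_le0.
have [->|dn0] := eqVneq d 0.
  rewrite invr0 !mulr0 mul0r addr0 ln1 addr0 addr_ge0// mulr_ge0//.
  by case: (_ <= 0)%R; rewrite ?mulr0n ?mulr1n; lra.
have dp : 0 < d by rewrite lt_neqAle eq_sym dn0.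
have ln1t : ln (1 + t) <= t by exact: ln1D_le.
have t1 : 0 < 1 + t by rewrite ltr_pwDl.
have td : 0 < 1 + t / d by rewrite ltr_pwDl// divr_ge0.
have se : 0 < Num.sqrt eps by rewrite sqrtr_gt0.
have key (u : R) : 0 < u -> u <= 1 -> u <= d -> ln (1 + t / d) <= t - ln u.
  move=> u0 u1 ud; apply: (@le_trans _ _ (ln ((1 + t) / u))); last first.
    by rewrite lnM ?posrE ?invr_gt0// lnV ?posrE// lerD2r.
  rewrite ler_ln ?posrE ?divr_gt0// mulrDl lerD//.
    by rewrite mul1r invf_ge1.
  by rewrite ler_wpM2l// lef_pV2.
have se2 : ln (Num.sqrt eps) = ln eps / 2.
  by rewrite -{2}(sqr_sqrtr (ltW e0)) lnXn// mulr2n; field.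
have se1 : Num.sqrt eps <= 1 by rewrite -sqrtr1 ler_wsqrtr.
have ese : eps <= Num.sqrt eps.
  by rewrite -{1}(sqr_sqrtr (ltW e0)) expr2 ler_piMl// ltW.
have nn : 0 <= eps / d * (d < eps)%R%:R by rewrite mulr_ge0// divr_ge0// ltW.
have [fd|fd] := leP (Num.sqrt eps) d.
  have := key _ se se1 fd; rewrite se2 mulr1n; lra.
rewrite mul0r subr0 mulr1.
have [nd|nd] := ltP d eps; last first.
  by have := key _ e0 e1 nd; rewrite mulr0; lra.
have := key _ dp (le_trans (ltW nd) e1) (lexx d).
rewrite mulr1 => h; apply: (le_trans h).
have : ln (1 + eps / d) <= eps / d by apply: ln1D_le; rewrite divr_ge0// ltW.
have : ln (eps / d) <= ln (1 + eps / d).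
  by rewrite ler_ln ?posrE ?divr_gt0 ?ltr_pwDl ?divr_ge0 ?lerDr ?ltW.
rewrite lnM ?posrE ?invr_gt0// lnV ?posrE//; lra.
Qed.

Section generic.
Variables (c M : R) (f : R * R -> R).
Hypothesis gf2 : good2 c M f.
Let gf := good2_good gf2.
Let f0 := good_ge0 gf.
Let mf : measurable_fun setT (f : pT -> R) := good_meas gf.
Let M0 : 0 <= M. Proof. exact: good_M_ge0 gf. Qed.

Lemma Jint_prod_bound k : meas2 k ->
  (forall x y, 0 < x.1 -> 0 < y.1 -> `|k x y| <= (1 + x.1) * (1 + y.1)) -> Jint f k.
Proof.
move=> mk kb; apply: (J_integrable gf mk kb (B := 2 * (2 * M) * M)).
have mb : meas2 (fun x y : R * R => (1 + x.1) * (1 + y.1)).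
  rewrite /meas2; meas; exact: measurableT_comp.
apply: (@le_trans _ _ (\int[mu2]_x ((1 + x.1) * (2 * M) * f x)%:E)%E).
  apply: (Jb_le gf mb) => [x y x0 y0|x x0].
    by rewrite mulr_ge0// addr_ge0// ltW.
  under eq_integral do rewrite -mulrA EFinM.
  have x1 : 0 <= 1 + x.1 by rewrite addr_ge0// ltW.
  rewrite ge0_integralZl_EFin//=; last 2 first.
  - by move=> y _; rewrite lee_fin; apply: (good_weight_ge0 gf (g := fun y => 1 + y.1)) => y0; rewrite addr_ge0// ltW.
  - apply/measurable_EFinP; apply: measurable_funM => //; exact: measurable_funD.
  rewrite EFinM; apply: lee_wpmul2l; first by rewrite lee_fin.
  have := @good_integral_le _ _ _ _ gf (fun y => 1 + y.1) 1 1.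
  rewrite (_ : 1 + 1 = 2 :> R)//; apply => // y y0.
  by rewrite mul1r lexx andbT addr_ge0// ltW.
have := @good_integral_le _ _ _ _ gf (fun y => (1 + y.1) * (2 * M)) (2 * M) (2 * M).
rewrite (_ : (2 * M + 2 * M) = 2 * (2 * M)); last by ring.
apply; rewrite ?mulr_ge0// => y y0.
rewrite mulr_ge0 ?mulr_ge0// ?addr_ge0 ?(ltW y0)//=.
by rewrite mulrDl mul1r [y.1 * _]mulrC.
Qed.

Lemma Jint_over_dist k : meas2 k ->
  (forall x y, 0 < x.1 -> 0 < y.1 -> `|k x y| <= (1 + x.1 ^+ 2) / eucl_dist x y) -> Jint f k.
Proof.
move=> mk kb; apply: (J_integrable gf mk kb (B := 2 * (17 * M) * M)).
have mb : meas2 (fun x y : R * R => (1 + x.1 ^+ 2) / eucl_dist x y).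
  rewrite /meas2; meas; [exact: measurableT_comp|exact: measurable_eucl_dist].
apply: (@le_trans _ _ (\int[mu2]_x ((17 * M) * (1 + x.1 ^+ 2) * f x)%:E)%E).
  apply: (Jb_le gf mb) => [x y x0 y0|x x0].
    by rewrite divr_ge0 ?sqrtr_ge0// addr_ge0// sqr_ge0.
  under eq_integral do rewrite -mulrA EFinM.
  have x1 : 0 <= 1 + x.1 ^+ 2 by rewrite addr_ge0// sqr_ge0.
  rewrite ge0_integralZl_EFin//=; last 2 first.
  - by move=> y _; rewrite lee_fin mulr_ge0 ?invr_ge0 ?sqrtr_ge0.
  - apply/measurable_EFinP; apply: measurable_funM => //; apply: measurable_funV.
    exact: (meas2_section x (@measurable_eucl_dist R)).
  rewrite [17 * M * _]mulrC EFinM; apply: lee_wpmul2l; first by rewrite lee_fin.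
  exact: potential_le gf x.
apply: (weight_le gf2); last by rewrite mulr_ge0.
move=> x x0; rewrite lexx andbT mulr_ge0 ?addr_ge0 ?sqr_ge0//.
by rewrite mulr_ge0.
Qed.

End generic.

Section fixed.
Variables (c1 eps M : R) (f : R * R -> R).
Hypotheses (hc1 : 0 < c1) (e0 : 0 < eps) (e1 : eps <= 1).
Hypothesis gf2 : good2 (c1 * eps ^- 2) M f.
Let gf := good2_good gf2.
Let f0 := good_ge0 gf.
Let mf : measurable_fun setT (f : pT -> R) := good_meas gf.
Let M0 : 0 <= M. Proof. exact: good_M_ge0 gf. Qed.
Let L := - ln eps.
Let L0 : 0 <= L. Proof. by rewrite /L oppr_ge0 ln_le0. Qed.

(** The outcome of [G0_log] and of [log_split] with t = 4 gm, using gm^2 = x.1 y.1. The last term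
    lives at distance below eps. *)
Definition Gmaj x y : R :=
  (2 * pi)^-1 * (L * (gm x y - gm x y * far (Num.sqrt eps) x y / 2)
    + 4 * (x.1 * y.1) + gm x y * (eps / eucl_dist x y * near eps x y)).

Lemma G0_le_Gmaj x y : 0 < x.1 -> 0 < y.1 -> G0 x y <= Gmaj x y.
Proof.
move=> x0 y0; have p0 := @pi_gt0 R.
apply: (le_trans (G0_log x0 y0)); rewrite -/(gm x y) /Gmaj (mulrC (gm x y)) -mulrA.
have k0 : 0 <= (2 * pi)^-1 :> R by rewrite invr_ge0 mulr_ge0// ltW.
rewrite -[X in X <= _]mulrA; apply: ler_wpM2l => //.
have g0 := gm_ge0 x y; have d0 := sqrtr_ge0 ((x.1 - y.1) ^+ 2 + (x.2 - y.2) ^+ 2).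
have g4 : 0 <= 4 * gm x y by rewrite mulr_ge0.
have := log_split e0 e1 d0 g4; rewrite -/(eucl_dist x y) -mulrA => h.
apply: (le_trans (ler_wpM2l g0 h)); rewrite -(gm_sqr x0 y0) /far /near /L.
rewrite le_eqVlt; apply/orP; left; apply/eqP; ring.
Qed.

(** At distance below eps both gm and the second radius are at most x.1 + eps, so the density is at
    most c1 eps^-2 (x.1 + eps), while eps / d has integral at most 16 eps^2. The powers of eps
    cancel. *)
Lemma near_potential x : 0 < x.1 ->
  (\int[mu2]_y (gm x y * (eps / eucl_dist x y * near eps x y) * f y)%:E
    <= (32 * c1 * (1 + x.1 ^+ 2))%:E)%E.
Proof.
move=> x0; have ec : 0 <= c1 * eps ^- 2 by rewrite mulr_ge0 ?invr_ge0 ?exprn_ge0 ?(ltW e0) ?(ltW hc1).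
pose K := (x.1 + eps) * eps * (c1 * eps ^- 2 * (x.1 + eps)).
have K0 : 0 <= K by rewrite /K !mulr_ge0 ?addr_ge0 ?invr_ge0 ?exprn_ge0 ?(ltW x0) ?(ltW e0) ?(ltW hc1).
apply: (@le_trans _ _ (\int[mu2]_y (K%:E * ((eucl_dist x y)^-1 * near eps x y)%:E))%E).
  apply: le_integral_nomeas => y _.
    rewrite lee_fin mulr_ge0// mulr_ge0 ?gm_ge0// mulr_ge0 ?near_ge0//.
    by rewrite divr_ge0 ?sqrtr_ge0// ltW.
  rewrite -EFinM lee_fin; have [->|/(good_halfplane gf) y0] := eqVneq (f y) 0.
    by rewrite mulr0 mulr_ge0// mulr_ge0 ?near_ge0 ?invr_ge0 ?sqrtr_ge0.
  rewrite /near; have [nd|_] := ltP (eucl_dist x y) eps; last by rewrite !mulr0 mul0r.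
  rewrite !mulr1.
  have yx : y.1 <= x.1 + eps.
    have := dist1_le x y; rewrite ler_norml => /andP[h _]; lra.
  have gx : gm x y <= x.1 + eps by have := gm_le_mean x0 y0; have := e0; lra.
  have fy : f y <= c1 * eps ^- 2 * (x.1 + eps).
    by apply: le_trans (good_c gf y0) _; rewrite ler_wpM2l.
  have -> : gm x y * (eps / eucl_dist x y) * f y = gm x y * eps * f y / eucl_dist x y by ring.
  apply: ler_wpM2r; first by rewrite invr_ge0 sqrtr_ge0.
  apply: ler_pM => //; first by rewrite mulr_ge0 ?gm_ge0// ltW.
  by rewrite ler_wpM2r// ltW.
rewrite ge0_integralZl_EFin//=; last 2 first.
- by move=> y _; rewrite lee_fin mulr_ge0 ?near_ge0 ?invr_ge0 ?sqrtr_ge0.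
- apply/measurable_EFinP; apply: measurable_funM; last exact: measurable_near.
  by apply: measurable_funV; exact: (meas2_section x (@measurable_eucl_dist R)).
apply: (@le_trans _ _ (K%:E * (16 * eps)%:E)%E).
  by apply: lee_wpmul2l; rewrite ?lee_fin//; exact: singular_integral.
rewrite -EFinM lee_fin.
have -> : K * (16 * eps) = 16 * c1 * (x.1 + eps) ^+ 2 by rewrite /K; field; rewrite gt_eqF.
have : 16 * c1 * (x.1 + eps) ^+ 2 <= 16 * c1 * (x.1 + 1) ^+ 2.
  rewrite ler_wpM2l ?mulr_ge0 ?(ltW hc1)// lerXn2r ?nnegrE ?addr_ge0 ?(ltW x0) ?(ltW e0)//.
  by rewrite lerD2l.
have : 0 <= c1 * (x.1 - 1) ^+ 2 by rewrite mulr_ge0 ?sqr_ge0 ?(ltW hc1).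
nra.
Qed.

Lemma Jint_near : Jint f (fun x y => gm x y * (eps / eucl_dist x y * near eps x y)).
Proof.
have m1 := @meas2_near R eps; have m2 := @measurable_eucl_dist R; have m3 := meas2_gm.
have mk : meas2 (fun x y => gm x y * (eps / eucl_dist x y * near eps x y)).
  rewrite /meas2; meas; exact: m1.
apply: (J_integrable gf mk (b := fun x y => gm x y * (eps / eucl_dist x y * near eps x y)) (B := 2 * (32 * c1) * M)).
  move=> x y x0 y0; rewrite ger0_norm// mulr_ge0 ?gm_ge0// mulr_ge0 ?near_ge0//.
  by rewrite divr_ge0 ?sqrtr_ge0// ltW.
apply: (@le_trans _ _ (\int[mu2]_x ((32 * c1) * (1 + x.1 ^+ 2) * f x)%:E)%E).
  apply: (Jb_le gf mk) => [x y x0 y0|x x0]; last exact: near_potential.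
  rewrite mulr_ge0 ?gm_ge0// mulr_ge0 ?near_ge0//.
  by rewrite divr_ge0 ?sqrtr_ge0// ltW.
apply: (weight_le gf2) => [x x0|]; last by rewrite mulr_ge0// ltW.
rewrite lexx andbT mulr_ge0 ?addr_ge0 ?sqr_ge0//.
by rewrite mulr_ge0// ltW.
Qed.

Lemma mom_near_le :
  J f (fun x y => gm x y * (eps / eucl_dist x y * near eps x y)) <=
  32 * c1 * (mom f (fun=> 1) + mom f (fun x => x.1 ^+ 2)).
Proof.
have m1 := @meas2_near R eps; have m2 := @measurable_eucl_dist R; have m3 := meas2_gm.
have mk : meas2 (fun x y => gm x y * (eps / eucl_dist x y * near eps x y)).
  rewrite /meas2; meas; exact: m1.
have i1 : momint f (fun=> 1).
  apply: (mom_integrable gf2 (a := 1)) => // x _.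
  by rewrite normr1 mul1r lerDl sqr_ge0.
have i2 : momint f (fun x => x.1 ^+ 2).
  apply: (mom_integrable gf2 (a := 1)) => //; first by apply: measurable_funX.
  by move=> x _; rewrite ger0_norm ?sqr_ge0// mul1r lerDr.
have i3 := momint_Z (32 * c1) (momint_D i1 i2).
rewrite -momD// -momZ//; last exact: momint_D.
apply: le_trans (ler_norm _) _.
apply: (J_bound gf (b := fun x y => gm x y * (eps / eucl_dist x y * near eps x y))).
  move=> x y x0 y0; rewrite ger0_norm// mulr_ge0 ?gm_ge0// mulr_ge0 ?near_ge0//.
  by rewrite divr_ge0 ?sqrtr_ge0// ltW.
rewrite -(mom_EFin i3); apply: (Jb_le gf mk) => [x y x0 y0|x x0]; last exact: near_potential.
rewrite mulr_ge0 ?gm_ge0// mulr_ge0 ?near_ge0//.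
by rewrite divr_ge0 ?sqrtr_ge0// ltW.
Qed.

End fixed.
End EnergyUpperBound.

Section ConcentrationNumerics.
Context {R : realType}.
Variables (p mu c2 c3 k l : R).
Hypotheses (p0 : 0 < p) (mu0 : 0 < mu) (hc2 : 0 < c2) (hc3 : 0 < c3) (k0 : 0 < k)
  (l0 : 0 < l) (l1 : l <= 1).

(** With l = 1 / L, these constants appear in S <= p mu + cS l, Far <= cFar l and V <= cV l, where V
    is the integral of (r - r0)^2 w. *)
Definition cS : R := (c3 + 3 * p ^+ 4 * c2) / (4 * p ^+ 3).
Definition cFar : R := 2 * (2 * (p * mu) * cS + cS ^+ 2 + k).
Definition cV : R := 4 * p ^+ 3 * (k / (p * mu)) + c3 + 3 * p ^+ 4 * c2.

Lemma cS_gt0 : 0 < cS.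
Proof. by rewrite divr_gt0 ?mulr_gt0 ?addr_gt0 ?exprn_gt0 ?mulr_gt0. Qed.

Lemma cFar_gt0 : 0 < cFar.
Proof.
have s0 := cS_gt0; have pm : 0 < p * mu by rewrite mulr_gt0.
have s2 : 0 < cS ^+ 2 by rewrite exprn_gt0.
have := mulr_gt0 pm s0; have := k0; rewrite /cFar; lra.
Qed.

(** Since V >= 0, the moments bound S from above by p mu + O(l). The energy inequality then leaves
    only O(l) for Far and bounds S from below; inserted in the inequality for V, this lower bound
    shows V = O(l). *)
Lemma concentration_numeric (m0 m2 S Far V : R) :
  m0 <= mu + c2 * l -> m2 <= p ^+ 4 * mu + c3 * l -> 0 <= S -> 0 <= Far -> 0 <= V ->
  V <= m2 - 4 * p ^+ 3 * S + 3 * p ^+ 4 * m0 ->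
  p ^+ 2 * mu ^+ 2 - k * l <= S ^+ 2 - Far / 2 ->
  [/\ Far <= cFar * l, p * mu - k / (p * mu) * l <= S & V <= cV * l].
Proof.
move=> hm0 hm2 S0 F0 V0 hV hS.
have P3 : 0 < p ^+ 3 by rewrite exprn_gt0.
have P4 : 0 < p ^+ 4 by rewrite exprn_gt0.
have pm : 0 < p * mu by rewrite mulr_gt0.
have h0 : 3 * p ^+ 4 * m0 <= 3 * p ^+ 4 * (mu + c2 * l).
  by rewrite ler_pM2l// mulr_gt0.
have s0 := cS_gt0.
have hS1 : S <= p * mu + cS * l.
  have E : 4 * p ^+ 3 * (p * mu + cS * l) = 4 * p ^+ 4 * mu + (c3 + 3 * p ^+ 4 * c2) * l.
    by rewrite /cS; field; rewrite gt_eqF.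
  have : 4 * p ^+ 3 * S <= 4 * p ^+ 3 * (p * mu + cS * l) by rewrite E; lra.
  by rewrite ler_pM2l// mulr_gt0.
have hS2 : S ^+ 2 <= (p * mu) ^+ 2 + (2 * (p * mu) * cS + cS ^+ 2) * l.
  apply: (@le_trans _ _ ((p * mu + cS * l) ^+ 2)).
    have sl := mulr_gt0 s0 l0.
    by rewrite lerXn2r ?nnegrE//; lra.
  have : cS ^+ 2 * (l * l) <= cS ^+ 2 * l.
    by rewrite ler_wpM2l ?sqr_ge0// ler_piMl// ltW.
  lra.
have E2 : (p * mu) ^+ 2 = p ^+ 2 * mu ^+ 2 by rewrite exprMn.
have hS3 : p * mu - k / (p * mu) * l <= S.
  have kp : 0 <= k / (p * mu) * l.
    apply: mulr_ge0; last exact: ltW.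
    by rewrite divr_ge0 ?(ltW pm) ?(ltW k0).
  have [Sp|Sp] := leP (p * mu) S; first by lra.
  have h1 : (p * mu - S) * (p * mu + S) <= k * l.
    have -> : (p * mu - S) * (p * mu + S) = (p * mu) ^+ 2 - S ^+ 2 by ring.
    lra.
  have h2 : (p * mu - S) * (p * mu) <= k * l.
    apply: le_trans h1; rewrite ler_wpM2l ?subr_ge0 ?(ltW Sp)//; lra.
  rewrite -[k / (p * mu) * l]mulrAC.
  have : p * mu - S <= k * l / (p * mu) by rewrite ler_pdivlMr.
  lra.
split => //; first by rewrite /cFar; lra.
apply: (le_trans hV).
have : 4 * p ^+ 3 * (p * mu - k / (p * mu) * l) <= 4 * p ^+ 3 * S.
  by rewrite ler_pM2l// mulr_gt0.
have E4 : 4 * p ^+ 3 * (p * mu) = 4 * p ^+ 4 * mu by ring.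
rewrite /cV; lra.
Qed.

Variables (cB cO : R).
Hypotheses (cB0 : 0 < cB) (cO0 : 0 < cO).

Definition cR1 : R := 2 * p * ((k / (p * mu) + cB + p * c2) / mu) + 2.
Definition cR2 : R := (c3 + p ^+ 4 * (c2 + cO)) / (p ^+ 2 * mu) + 3.

Lemma cR1_gt0 : 0 < cR1.
Proof.
rewrite addr_gt0// !mulr_gt0 ?invr_gt0// addr_gt0 ?mulr_gt0// addr_gt0//.
by rewrite divr_gt0// mulr_gt0.
Qed.

(** Here r is the radius of the centre and t that of the ball around it. If r were too small, sqrt
    (r + t) times the mass, plus the far part, could not reach the lower bound of S. *)
Lemma radius_lower (r t m0 S : R) : 0 < r -> 0 <= t -> t <= 2 * l ->
  m0 <= mu + c2 * l -> p * mu - k / (p * mu) * l <= S ->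
  S <= Num.sqrt (r + t) * m0 + cB * l -> p ^+ 2 - cR1 * l <= r.
Proof.
move=> r0 t0 tl hm hS hS2.
set P := Num.sqrt (r + t); have P0 : 0 <= P by exact: sqrtr_ge0.
have PE : P ^+ 2 = r + t by rewrite sqr_sqrtr// addr_ge0// ltW.
set k2 := (k / (p * mu) + cB + p * c2) / mu.
have k20 : 0 < k2.
  apply: divr_gt0 => //; apply: addr_gt0; last exact: mulr_gt0.
  by apply: addr_gt0 => //; apply: divr_gt0 => //; exact: mulr_gt0.
have hP : p - k2 * l <= P.
  have h1 : p * mu - (k / (p * mu) + cB) * l <= P * (mu + c2 * l).
    have : P * m0 <= P * (mu + c2 * l) by rewrite ler_wpM2l.
    move: hS2; rewrite -/P; lra.
  have mc : 0 < mu + c2 * l by rewrite addr_gt0// mulr_gt0.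
  rewrite -(ler_pM2r mc); apply: le_trans h1.
  have E : k2 * mu = k / (p * mu) + cB + p * c2 by rewrite /k2 divfK// gt_eqF.
  have := mulr_gt0 (mulr_gt0 k20 hc2) (mulr_gt0 l0 l0).
  have : (p - k2 * l) * (mu + c2 * l) = p * mu + p * c2 * l - (k2 * mu) * l - k2 * c2 * (l * l) by ring.
  rewrite E; lra.
have -> : cR1 = 2 * p * k2 + 2 by [].
(* If k2 l > p, the lower bound claimed for r is negative. *)
have [pk|pk] := leP (k2 * l) p.
  have : (p - k2 * l) ^+ 2 <= P ^+ 2 by rewrite lerXn2r ?nnegrE// subr_ge0.
  rewrite PE; have := sqr_ge0 (k2 * l); have : (p - k2 * l) ^+ 2 = p ^+ 2 - 2 * p * k2 * l + (k2 * l) ^+ 2 by ring.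
  lra.
have : p * p < p * (k2 * l) by rewrite ltr_pM2l.
have := mulr_gt0 p0 (mulr_gt0 k20 l0).
have := l0; have := r0; rewrite expr2; lra.
Qed.

(** If r were too large, the mass in the ball would have a second moment above m2. In [cR2] the
    summand 3 is 2 + 1: 2 l absorbs the radius t of the ball, and the remaining l makes the
    contradiction strict. *)
Lemma radius_upper (r t m0 m2 : R) : 0 < r -> 0 <= t -> t <= 2 * l ->
  mu - c2 * l <= m0 -> m2 <= p ^+ 4 * mu + c3 * l -> (c2 + cO) * l <= mu / 2 ->
  (t <= r -> (r - t) ^+ 2 * (m0 - cO * l) <= m2) -> r <= p ^+ 2 + cR2 * l.
Proof.
move=> r0 t0 tl hm0 hm2 lsmall hr; rewrite leNgt; apply/negP => rbig.
have P4 : 0 < p ^+ 4 by rewrite exprn_gt0.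
have P2 : 0 < p ^+ 2 by rewrite exprn_gt0.
set s := cR2 - 2.
have s0 : 0 < s.
  have X : 0 < (c3 + p ^+ 4 * (c2 + cO)) / (p ^+ 2 * mu).
    apply: divr_gt0; last exact: mulr_gt0.
    by apply: addr_gt0 => //; apply: mulr_gt0 => //; exact: addr_gt0.
  by rewrite /s /cR2; lra.
have sl : 0 < s * l by rewrite mulr_gt0.
have rt : p ^+ 2 + s * l <= r - t.
  have : s * l = cR2 * l - 2 * l by rewrite /s; ring.
  lra.
have tr : t <= r by lra.
have := hr tr; set m := m0 - cO * l.
have hm : mu / 2 <= m by rewrite /m; lra.
have mc : mu - (c2 + cO) * l <= m by rewrite /m; lra.
have m0' : 0 < m by apply: lt_le_trans hm; rewrite divr_gt0.
have h1 : (p ^+ 2 + s * l) ^+ 2 * m <= (r - t) ^+ 2 * m.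
  rewrite ler_pM2r// lerXn2r ?nnegrE; lra.
have h2 : (p ^+ 4 + 2 * p ^+ 2 * (s * l)) * m <= (p ^+ 2 + s * l) ^+ 2 * m.
  rewrite ler_pM2r//; have := sqr_ge0 (s * l).
  have : (p ^+ 2 + s * l) ^+ 2 = p ^+ 4 + 2 * p ^+ 2 * (s * l) + (s * l) ^+ 2 by ring.
  lra.
have h3 : p ^+ 4 * (mu - (c2 + cO) * l) <= p ^+ 4 * m by rewrite ler_pM2l.
have h4 : 2 * p ^+ 2 * (s * l) * (mu / 2) <= 2 * p ^+ 2 * (s * l) * m.
  by rewrite ler_pM2l// !mulr_gt0.
move=> h5; have : p ^+ 2 * mu * s * l <= (c3 + p ^+ 4 * (c2 + cO)) * l.
  have : (p ^+ 4 + 2 * p ^+ 2 * (s * l)) * m = p ^+ 4 * m + 2 * p ^+ 2 * (s * l) * m by ring.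
  have : 2 * p ^+ 2 * (s * l) * (mu / 2) = p ^+ 2 * mu * s * l by field.
  lra.
rewrite ler_pM2r// leNgt => /negP; apply.
have -> : p ^+ 2 * mu * s = c3 + p ^+ 4 * (c2 + cO) + p ^+ 2 * mu.
  by rewrite /s /cR2; field; rewrite !gt_eqF.
by rewrite ltrDl mulr_gt0.
Qed.

End ConcentrationNumerics.

Section EnergyMoments.
Context {R : realType}.
Local Notation mu2 := (@plane_measure R).
Local Notation pT := (measurableTypeR R * measurableTypeR R)%type.
Section generic.
Variables (c M : R) (f : R * R -> R).
Hypothesis gf2 : good2 c M f.
Let gf := good2_good gf2.
Let f0 := good_ge0 gf.

Definition sqr (x : R * R) : R := Num.sqrt x.1.
Definition one (x : R * R) : R := 1.
Definition r1 (x : R * R) : R := x.1.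
Definition r2 (x : R * R) : R := x.1 ^+ 2.

Lemma measurable_sqr : measurable_fun setT (sqr : pT -> R).
Proof. by rewrite /sqr; meas; exact: measurable_fst. Qed.

Lemma measurable_r2 : measurable_fun setT (r2 : pT -> R).
Proof. by rewrite /r2; meas; exact: measurable_fst. Qed.

Lemma sqr_le x : 0 < x.1 -> sqr x <= 1 + x.1 ^+ 2.
Proof.
move=> x0; rewrite /sqr; set q := Num.sqrt _.
have q0 : 0 <= q by exact: sqrtr_ge0.
have <- : q ^+ 2 = x.1 by rewrite sqr_sqrtr// ltW.
have [q1|q1] := leP q 1; first by have := sqr_ge0 (q ^+ 2); lra.
have : q <= q ^+ 2 by rewrite expr2 ler_peMl// ltW.
have := sqr_ge0 (q ^+ 2 - 1); have := sqr_ge0 (q ^+ 2); nra.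
Qed.

Lemma momint_sqr : momint f sqr.
Proof.
apply: (mom_integrable gf2 (a := 1)) => //; first exact: measurable_sqr.
by move=> x x0; rewrite mul1r ger0_norm ?sqrtr_ge0//; exact: sqr_le.
Qed.

Lemma momint_one : momint f one.
Proof.
apply: (mom_integrable gf2 (a := 1)) => //; first exact: measurable_cst.
by move=> x x0; rewrite mul1r normr1 lerDl sqr_ge0.
Qed.

Lemma momint_r1 : momint f r1.
Proof.
apply: (mom_integrable gf2 (a := 1)) => //; first exact: measurable_fst.
move=> x x0; rewrite mul1r ger0_norm ?(ltW x0)// /r1.
have := sqr_ge0 (x.1 - 1); nra.
Qed.

Lemma momint_r2 : momint f r2.
Proof.
apply: (mom_integrable gf2 (a := 1)) => //; first exact: measurable_r2.
by move=> x x0; rewrite mul1r ger0_norm ?sqr_ge0// lerDr.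
Qed.

Let gm_le1 (x y : R * R) : 0 < x.1 -> 0 < y.1 -> gm x y <= (1 + x.1) * (1 + y.1).
Proof.
move=> x0 y0; have := gm_le_mean x0 y0; have : 0 < x.1 * y.1 by rewrite mulr_gt0.
nra.
Qed.

Lemma Jint_gm : Jint f gm.
Proof.
apply: (Jint_prod_bound gf2); first exact: meas2_gm.
by move=> x y x0 y0; rewrite ger0_norm ?gm_ge0//; exact: gm_le1.
Qed.

Lemma Jint_gmfar t : Jint f (fun x y => gm x y * far t x y).
Proof.
apply: (Jint_prod_bound gf2); first by apply: measurable_funM; [exact: meas2_gm|exact: meas2_far].
move=> x y x0 y0; rewrite ger0_norm ?mulr_ge0 ?gm_ge0 ?far_ge0//.
by apply: le_trans (gm_le1 x0 y0); rewrite ler_piMr ?gm_ge0 ?far_le1.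
Qed.

Lemma Jint_rr : Jint f (fun x y : R * R => x.1 * y.1).
Proof.
apply: (Jint_prod_bound gf2); first by rewrite /meas2; meas; exact: measurableT_comp.
move=> x y x0 y0; rewrite ger0_norm ?mulr_ge0 ?(ltW x0) ?(ltW y0)//.
nra.
Qed.

Lemma J_gm : J f gm = mom f sqr ^+ 2.
Proof.
rewrite expr2 -(J_prod momint_sqr momint_sqr); apply: (eq_J gf) => x y x0 y0.
by rewrite gm_sqrt.
Qed.

Lemma mom_r1_le : mom f r1 <= (mom f one + mom f r2) / 2.
Proof.
rewrite mulrC -(momD momint_one momint_r2) -(momZ _ (momint_D momint_one momint_r2)).
apply: (mom_le gf2) => //; first exact: momint_r1.
  exact: momint_Z (momint_D momint_one momint_r2).
move=> x x0; rewrite /r1 /one /r2; have := sqr_ge0 (x.1 - 1); nra.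
Qed.

(** By ln (1 + u) <= u and gm^2 = x.1 y.1 one has G0 <= x.1 y.1 / d, and y.1 <= x.1 + d bounds this
    by x.1^2 / d + x.1, both summands being integrable against the density. *)
Lemma Jint_G0 : Jint f G0.
Proof.
have i1 : Jint f (fun x y : R * R => (1 + x.1 ^+ 2) / eucl_dist x y).
  apply: (Jint_over_dist gf2) => //.
    rewrite /meas2; meas; [exact: measurableT_comp|exact: measurable_eucl_dist].
  by move=> x y x0 y0; rewrite ger0_norm// divr_ge0 ?sqrtr_ge0// addr_ge0// sqr_ge0.
have p2 := @pi_ge2 R.
have m1 := @measurable_G0 R.
have i2 : Jint f (fun x y : R * R => x.1 ^+ 2 / eucl_dist x y + x.1).
  apply: Jint_D.
    apply: (Jint_over_dist gf2).
      rewrite /meas2; meas; [exact: measurableT_comp|exact: measurable_eucl_dist].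
    move=> x y x0 y0; rewrite ger0_norm; last by rewrite divr_ge0 ?sqrtr_ge0// sqr_ge0.
    by rewrite ler_wpM2r ?invr_ge0 ?sqrtr_ge0// lerDr.
  apply: (Jint_prod_bound gf2); first by rewrite /meas2; exact: measurableT_comp.
  move=> x y x0 y0; rewrite ger0_norm ?(ltW x0)//; nra.
have /integrableP[_ fin2] := i2.
set b := (\int[_]_x _)%E in fin2.
have bfin : b \is a fin_num.
  by rewrite ge0_fin_numE//; apply: integral_ge0 => *; exact: abse_ge0.
apply: (J_integrable gf m1 (b := fun x y => `|x.1 ^+ 2 / eucl_dist x y + x.1|) (B := fine b)); last first.
  rewrite fineK// /b /Jb le_eqVlt; apply/orP; left; apply/eqP; apply: eq_integral => q _.
  by congr EFin; rewrite normrM [X in _ = _ * X]ger0_norm// mulr_ge0.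
move=> x y x0 y0; rewrite ger0_norm ?G0_ge0//.
apply: (@le_trans _ _ (x.1 ^+ 2 / eucl_dist x y + x.1)); last exact: ler_norm.
apply: (le_trans (G0_log x0 y0)).
have d0 : 0 <= eucl_dist x y by exact: sqrtr_ge0.
have g0 := gm_ge0 x y; rewrite -/(gm x y).
have h1 : ln (1 + 4 * gm x y / eucl_dist x y) <= 4 * gm x y / eucl_dist x y.
  by apply: ln1D_le; rewrite divr_ge0// mulr_ge0.
have k0 : 0 <= gm x y / (2 * pi) by rewrite divr_ge0// mulr_ge0// pi_ge0.
apply: (le_trans (ler_wpM2l k0 h1)).
have [d00|dn0] := eqVneq (eucl_dist x y) 0.
  by rewrite d00 invr0 !mulr0 add0r ltW.
have dp : 0 < eucl_dist x y by rewrite lt_neqAle eq_sym dn0.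
have -> : gm x y / (2 * pi) * (4 * gm x y / eucl_dist x y) = (2 / pi) * (gm x y ^+ 2 / eucl_dist x y).
  have := pi_gt0 R; move: (pi) => q q0; field; by rewrite dn0 gt_eqF.
rewrite gm_sqr//; have pp : 2 / pi <= 1 :> R by rewrite ler_pdivrMr ?pi_gt0// mul1r.
have q0 : 0 <= x.1 * y.1 / eucl_dist x y by rewrite divr_ge0// mulr_ge0// ltW.
apply: (@le_trans _ _ (x.1 * y.1 / eucl_dist x y)); first by rewrite ler_piMl.
rewrite ler_pdivrMr// mulrDl divfK//.
have := dist1_le x y; rewrite ler_norml => /andP[h _].
have : x.1 * y.1 <= x.1 * (x.1 + eucl_dist x y) by rewrite ler_pM2l//; lra.
nra.
Qed.

(* The difference of the two integrands is 2 p^2 (sqrt r - p)^2. *)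
Lemma variance_le (p : R) : 0 < p ->
  mom f (fun x => (x.1 - p ^+ 2) ^+ 2) <=
  mom f r2 - 4 * p ^+ 3 * mom f sqr + 3 * p ^+ 4 * mom f one.
Proof.
move=> p0; have i1 := momint_Z (- (4 * p ^+ 3)) momint_sqr.
have i2 := momint_Z (3 * p ^+ 4) momint_one.
have -> : mom f r2 - 4 * p ^+ 3 * mom f sqr + 3 * p ^+ 4 * mom f one =
   mom f (fun x => r2 x + - (4 * p ^+ 3) * sqr x + 3 * p ^+ 4 * one x).
  rewrite (momD (momint_D momint_r2 i1) i2) (momD momint_r2 i1).
  by rewrite (momZ _ momint_sqr) (momZ _ momint_one) mulNr.
apply: (mom_le gf2).
- apply: (mom_integrable gf2 (a := 2 + 2 * p ^+ 4)) => //.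
  + apply: measurable_funX; apply: measurable_funB => //; exact: measurable_fst.
  + move=> x x0; rewrite ger0_norm ?sqr_ge0//.
    have P4 : 0 <= p ^+ 4 by rewrite exprn_ge0// ltW.
    have : p ^+ 4 = (p ^+ 2) ^+ 2 by rewrite -exprM.
    have := sqr_ge0 (x.1 + p ^+ 2); have := mulr_ge0 P4 (sqr_ge0 x.1); have := sqr_ge0 x.1; nra.
  + by rewrite addr_ge0// mulr_ge0// exprn_ge0// ltW.
- exact: momint_D (momint_D momint_r2 i1) i2.
move=> x x0; rewrite /r2 /sqr /one; set q := Num.sqrt _.
have <- : q ^+ 2 = x.1 by rewrite sqr_sqrtr// ltW.
rewrite -subr_ge0.
have -> : (q ^+ 2) ^+ 2 + - (4 * p ^+ 3) * q + 3 * p ^+ 4 * 1 - (q ^+ 2 - p ^+ 2) ^+ 2 =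
   2 * (p * (q - p)) ^+ 2 by ring.
by rewrite mulr_ge0// sqr_ge0.
Qed.

End generic.

Variables (c1 eps M : R) (f : R * R -> R).
Hypotheses (hc1 : 0 < c1) (e0 : 0 < eps) (e1 : eps <= 1).
Hypothesis gf2 : good2 (c1 * eps ^- 2) M f.
Let gf := good2_good gf2.
Let f0 := good_ge0 gf.
Let L := - ln eps.

(** This is [G0_le_Gmaj] integrated: gm factorises, so its double integral is the square of
    [mom f sqr]; the term 4 x.1 y.1 gives four times the square of the first moment, which is at
    most half of [mom f one + mom f r2]. *)
Lemma energy_upper (Far : R) : Far = J f (fun x y => gm x y * far (Num.sqrt eps) x y) ->
  2 * pi * J f G0 <= L * (mom f sqr ^+ 2 - Far / 2)
    + (mom f one + mom f r2) ^+ 2 + 32 * c1 * (mom f one + mom f r2).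
Proof.
move=> hF; have pp : 0 < 2 * pi :> R by rewrite mulr_gt0 ?pi_gt0.
have inear := Jint_near hc1 e0 e1 gf2.
have i1 := Jint_Z L (Jint_D (Jint_gm gf2) (Jint_Z (- 2^-1) (Jint_gmfar gf2 (Num.sqrt eps)))).
have i2 := Jint_Z 4 (Jint_rr gf2).
have i3 := Jint_D (Jint_D i1 i2) inear.
have E : J f G0 <= (2 * pi)^-1 * (L * (mom f sqr ^+ 2 - Far / 2) + 4 * mom f r1 ^+ 2
    + J f (fun x y => gm x y * (eps / eucl_dist x y * near eps x y))).
  apply: (@le_trans _ _ (J f (fun x y => (2 * pi)^-1 * (L * (gm x y + - 2^-1 * (gm x y * far (Num.sqrt eps) x y))
      + 4 * (x.1 * y.1) + gm x y * (eps / eucl_dist x y * near eps x y))))).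
    apply: (J_le gf (Jint_G0 gf2)); first exact: (Jint_Z _ i3).
    move=> x y x0 y0; apply: (le_trans (G0_le_Gmaj e0 e1 x0 y0)).
    rewrite /Gmaj le_eqVlt; apply/orP; left; apply/eqP; congr (_ * _).
    by rewrite -/L; congr (_ * _ + _ + _); field.
  rewrite (J_Z _ i3) (J_D (Jint_D i1 i2) inear) (J_D i1 i2).
  rewrite (J_Z L (Jint_D (Jint_gm gf2) (Jint_Z (- 2^-1) (Jint_gmfar gf2 _)))) (J_Z 4 (Jint_rr gf2)).
  rewrite (J_D (Jint_gm gf2) (Jint_Z (- 2^-1) (Jint_gmfar gf2 _))) (J_Z (- 2^-1) (Jint_gmfar gf2 _)).
  rewrite (J_gm gf2) -hF (_ : J f (fun x y : R * R => x.1 * y.1) = mom f r1 ^+ 2); last first.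
    by rewrite expr2 -(J_prod (momint_r1 gf2) (momint_r1 gf2)).
  by rewrite le_eqVlt; apply/orP; left; apply/eqP; congr (_ * (_ * _ + _ + _)); field.
have := ler_wpM2l (ltW pp) E; rewrite mulrA divff ?gt_eqF// mul1r => h.
apply: (le_trans h); apply: lerD; last exact: (mom_near_le hc1 e0 e1 gf2).
rewrite lerD2l; have := (mom_r1_le gf2); have r10 : 0 <= mom f r1.
  by apply: (mom_ge0 gf2) => x x0; rewrite /r1 ltW.
move=> h1; have : mom f r1 ^+ 2 <= ((mom f one + mom f r2) / 2) ^+ 2.
  by rewrite lerXn2r ?nnegrE//; exact: le_trans h1.
by rewrite expr_div_n; lra.
Qed.

End EnergyMoments.

Section Concentration.
Context {R : realType}.
Local Notation mu2 := (@plane_measure R).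
Local Notation pT := (measurableTypeR R * measurableTypeR R)%type.
(* p is the square root of r0. *)
Variables (p mu c1 c2 c3 c4 : R).
Hypotheses (p0 : 0 < p) (mu0 : 0 < mu) (hc1 : 0 < c1) (hc2 : 0 < c2) (hc3 : 0 < c3) (hc4 : 0 < c4).

(** [cA] bounds the mass plus the second moment and [cK] the error of the energy inequality
    multiplied by 2 pi. [cB] and [cO] bound, up to the factor 1 / L, the part of sqrt r w and of (1
    + r^2) w outside the ball; [cLam / L <= 1] is the smallness required, and [cRad] controls the
    radius of the centre. *)
Definition cA : R := mu + c2 + p ^+ 4 * mu + c3.
Definition cK : R := 2 * pi * c4 + cA ^+ 2 + 32 * c1 * cA.
Definition cB : R := 4 * cFar p mu c2 c3 cK / (p * mu).
Definition cKappa : R := (1 + 2 * p ^+ 4) * (2 / p) + (1 + 2 * p ^+ 4) * (4 / p ^+ 4) + 2.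
Definition cO : R := cKappa * (cB + cV p mu c2 c3 cK).
Definition cLam : R := 1 + 2 * (c2 + cO) / mu + 2 * (cK / (p * mu)) / (p * mu).
Definition cRad : R := cR1 p mu c2 cK cB + cR2 p mu c2 c3 cO + cO.

Lemma cA_gt0 : 0 < cA.
Proof.
by rewrite /cA; have := mulr_gt0 (exprn_gt0 4 p0) mu0; have := mu0; have := hc2; have := hc3; lra.
Qed.

Lemma cK_gt0 : 0 < cK.
Proof.
have a0 := cA_gt0; have := mulr_gt0 hc1 a0; have := exprn_gt0 2 a0.
by have := mulr_gt0 (@pi_gt0 R) hc4; rewrite /cK; lra.
Qed.

Let pm : 0 < p * mu. Proof. exact: mulr_gt0. Qed.
Let k0 := cK_gt0.

Lemma cB_gt0 : 0 < cB.
Proof. by apply: divr_gt0 => //; apply: mulr_gt0 => //; exact: cFar_gt0. Qed.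

Lemma cKappa_gt0 : 0 < cKappa.
Proof.
have P4 := exprn_gt0 4 p0; have Q : 0 < 1 + 2 * p ^+ 4 by lra.
have h1 : 0 < (1 + 2 * p ^+ 4) * (2 / p) by apply: mulr_gt0 => //; exact: divr_gt0.
have h2 : 0 < (1 + 2 * p ^+ 4) * (4 / p ^+ 4) by apply: mulr_gt0 => //; exact: divr_gt0.
by rewrite /cKappa; lra.
Qed.

Lemma cV_gt0 : 0 < cV p mu c2 c3 cK.
Proof.
have P4 := exprn_gt0 4 p0; have P3 := exprn_gt0 3 p0.
have := mulr_gt0 P3 (divr_gt0 k0 pm); have := mulr_gt0 P4 hc2; have := hc3.
by rewrite /cV; lra.
Qed.

Lemma cO_gt0 : 0 < cO.
Proof.
by apply: mulr_gt0; [exact: cKappa_gt0|apply: addr_gt0; [exact: cB_gt0|exact: cV_gt0]].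
Qed.

Lemma cLam_ge1 : 1 <= cLam.
Proof.
have := divr_gt0 (addr_gt0 hc2 cO_gt0) mu0; have := divr_gt0 (divr_gt0 k0 pm) pm.
by rewrite /cLam; lra.
Qed.

Lemma cR2_gt0 : 0 < cR2 p mu c2 c3 cO.
Proof.
have h : 0 < c3 + p ^+ 4 * (c2 + cO).
  apply: addr_gt0 => //; apply: mulr_gt0; first exact: exprn_gt0.
  by apply: addr_gt0 => //; exact: cO_gt0.
by have := divr_gt0 h (mulr_gt0 (exprn_gt0 2 p0) mu0); rewrite /cR2; lra.
Qed.

Lemma cRad_gt0 : 0 < cRad.
Proof.
have := cR1_gt0 p0 mu0 hc2 k0 cB_gt0; have := cR2_gt0; have := cO_gt0.
by rewrite /cRad; lra.
Qed.

(** Up to a constant, r^2 is controlled by (r - p^2)^2. The constant is absorbed by sqrt r when sqrt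
    r >= p / 2; otherwise r <= p^2 / 4, and (r - p^2)^2 >= p^4 / 4 absorbs it. *)
Lemma one_sqr_le_kappa (r : R) : 0 < r ->
  1 + r ^+ 2 <= cKappa * (Num.sqrt r + (r - p ^+ 2) ^+ 2).
Proof.
move=> r0; set q := Num.sqrt r; have q0 : 0 <= q by exact: sqrtr_ge0.
have P2 := exprn_gt0 2 p0; have P4 := exprn_gt0 4 p0; have Q : 0 < 1 + 2 * p ^+ 4 by lra.
set v := (r - p ^+ 2) ^+ 2; have v0 : 0 <= v by exact: sqr_ge0.
have h0 : 1 + r ^+ 2 <= 1 + 2 * p ^+ 4 + 2 * v.
  have : p ^+ 4 = (p ^+ 2) ^+ 2 by rewrite -exprM.
  by rewrite /v; have := sqr_ge0 (r - 2 * p ^+ 2); lra.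
have a0 : 0 < (1 + 2 * p ^+ 4) * (2 / p) by apply: mulr_gt0 => //; exact: divr_gt0.
have b0 : 0 < (1 + 2 * p ^+ 4) * (4 / p ^+ 4) by apply: mulr_gt0 => //; exact: divr_gt0.
have qq : q ^+ 2 = r by rewrite sqr_sqrtr// ltW.
apply: (le_trans h0); rewrite /cKappa; have := mulr_ge0 (ltW a0) v0; have := mulr_ge0 (ltW b0) q0.
have := mulr_ge0 (ltW a0) q0; have := mulr_ge0 (ltW b0) v0.
have [qp|qp] := leP (p / 2) q.
  have : 1 + 2 * p ^+ 4 <= (1 + 2 * p ^+ 4) * (2 / p) * q.
    rewrite -mulrA ler_peMr ?(ltW Q)// mulrAC ler_pdivlMr//; lra.
  by lra.
have rp : r <= p ^+ 2 / 4.
  rewrite -qq (_ : p ^+ 2 / 4 = (p / 2) ^+ 2); last by field.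
  by rewrite lerXn2r ?nnegrE ?(ltW qp)// divr_ge0// ltW.
have vp : p ^+ 4 / 4 <= v.
  have -> : p ^+ 4 / 4 = (p ^+ 2 / 2) ^+ 2 by field.
  have -> : v = (p ^+ 2 - r) ^+ 2 by rewrite /v; ring.
  rewrite lerXn2r ?nnegrE; lra.
have : 1 + 2 * p ^+ 4 <= (1 + 2 * p ^+ 4) * (4 / p ^+ 4) * v.
  rewrite -mulrA ler_peMr ?(ltW Q)// mulrAC ler_pdivlMr//; lra.
by lra.
Qed.

(** Apply ln u <= u - 1 to u = eps^(-1/2). The radius sqrt eps of the ball is thus itself O(1 / L)
    and may be counted among the errors. *)
Lemma sqrt_le_log (eps : R) : 0 < eps -> eps < 1 -> Num.sqrt eps <= 2 * (- ln eps)^-1.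
Proof.
move=> e0 e1; have s0 : 0 < Num.sqrt eps by rewrite sqrtr_gt0.
have L0 : 0 < - ln eps by rewrite oppr_gt0 ln_lt0// e0.
rewrite ler_pdivlMr//.
have : ln eps = 2 * ln (Num.sqrt eps).
  by rewrite -{1}(sqr_sqrtr (ltW e0)) lnXn// mulr2n; ring.
have : ln (1 + ((Num.sqrt eps)^-1 - 1)) <= (Num.sqrt eps)^-1 - 1.
  by apply: le_ln1Dx; have := s0; rewrite -invr_gt0; lra.
rewrite subrKC lnV ?posrE// => h1 h2.
have : Num.sqrt eps * (- ln (Num.sqrt eps)) <= Num.sqrt eps * ((Num.sqrt eps)^-1 - 1).
  by rewrite ler_pM2l.
rewrite mulrBr mulfV ?gt_eqF// h2; lra.
Qed.

Variables (eps M : R) (f : R * R -> R).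
Hypotheses (e0 : 0 < eps) (e1 : eps < 1).
Let L := - ln eps.
Let l := L^-1.
Hypothesis small : cLam * l <= 1.
Hypothesis gf2 : good2 (c1 * eps ^- 2) M f.
Hypothesis hm0 : `|mom f one - mu| <= c2 * l.
Hypothesis hm2 : mom f r2 <= p ^+ 4 * mu + c3 * l.
Hypothesis hE : p ^+ 2 * mu ^+ 2 / (2 * pi) * L - c4 <= J f G0.

Let gf := good2_good gf2.
Let L0 : 0 < L. Proof. by rewrite oppr_gt0 ln_lt0// e0. Qed.
Let l0 : 0 < l. Proof. by rewrite invr_gt0. Qed.
Let t := Num.sqrt eps.

Lemma small_l1 : l <= 1.
Proof. by apply: le_trans small; rewrite ler_peMl ?cLam_ge1// ltW. Qed.

Lemma small_mu : (c2 + cO) * l <= mu / 2.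
Proof.
have h : 2 * (c2 + cO) / mu * l <= 1.
  apply: le_trans small; apply: ler_wpM2r; first exact: ltW.
  by rewrite /cLam; have := divr_gt0 (divr_gt0 k0 pm) pm; lra.
have : 2 * (c2 + cO) / mu * l * mu <= 1 * mu by rewrite ler_wpM2r// ltW.
have -> : 2 * (c2 + cO) / mu * l * mu = 2 * (c2 + cO) * l by field; rewrite gt_eqF.
by lra.
Qed.

Lemma small_pm : cK / (p * mu) * l <= p * mu / 2.
Proof.
have h : 2 * (cK / (p * mu)) / (p * mu) * l <= 1.
  apply: le_trans small; apply: ler_wpM2r; first exact: ltW.
  by rewrite /cLam; have := divr_gt0 (addr_gt0 hc2 cO_gt0) mu0; lra.
have : 2 * (cK / (p * mu)) / (p * mu) * l * (p * mu) <= 1 * (p * mu) by rewrite ler_wpM2r// ltW.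
rewrite (mulrAC (2 * _ / _)) divfK ?gt_eqF//.
by lra.
Qed.

Let hm0u : mom f one <= mu + c2 * l.
Proof. by have := hm0; rewrite ler_norml => /andP[_]; lra. Qed.
Let hm0l : mu - c2 * l <= mom f one.
Proof. by have := hm0; rewrite ler_norml => /andP[]; lra. Qed.
Let m00 : 0 <= mom f one. Proof. by apply: (mom_ge0 gf2) => x _; exact: ler01. Qed.
Let m20 : 0 <= mom f r2. Proof. by apply: (mom_ge0 gf2) => x _; exact: sqr_ge0. Qed.
Let Far := J f (fun x y => gm x y * far t x y).
Let V := mom f (fun x => (x.1 - p ^+ 2) ^+ 2).

Lemma momint_var : momint f (fun x => (x.1 - p ^+ 2) ^+ 2).
Proof.
apply: (mom_integrable gf2 (a := 2 + 2 * p ^+ 4)).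
- apply: measurable_funX; apply: measurable_funB => //; exact: measurable_fst.
- move=> x x0; rewrite ger0_norm ?sqr_ge0//.
  have P4 : 0 <= p ^+ 4 by rewrite exprn_ge0// ltW.
  have : p ^+ 4 = (p ^+ 2) ^+ 2 by rewrite -exprM.
  have := sqr_ge0 (x.1 + p ^+ 2); have := mulr_ge0 P4 (sqr_ge0 x.1); have := sqr_ge0 x.1; nra.
- by rewrite addr_ge0// mulr_ge0// exprn_ge0// ltW.
Qed.

Lemma Far_ge0 : 0 <= Far.
Proof.
apply: Rintegral_ge0 => q _; have [->|/(good_halfplane gf) h1] := eqVneq (f q.1) 0.
  by rewrite mul0r mulr0.
by rewrite mulr_ge0 ?mulr_ge0 ?gm_ge0 ?far_ge0 ?(good_ge0 gf).
Qed.

Lemma moment_concentration :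
  [/\ Far <= cFar p mu c2 c3 cK * l, p * mu - cK / (p * mu) * l <= mom f sqr
    & V <= cV p mu c2 c3 cK * l].
Proof.
apply: (concentration_numeric p0 mu0 hc2 hc3 k0 l0 small_l1 hm0u hm2 _ Far_ge0 _ (variance_le gf2 p0)).
- by apply: (mom_ge0 gf2) => x _; exact: sqrtr_ge0.
- by apply: (mom_ge0 gf2) => x _; exact: sqr_ge0.
have h := energy_upper hc1 e0 (ltW e1) gf2 (erefl Far).
rewrite -/L in h; set A := mom f one + mom f r2 in h; set S := mom f sqr in h *.
have A0 : 0 <= A by exact: addr_ge0.
have AA : A <= cA.
  have l1 := small_l1; have := ler_piMr (ltW hc2) l1; have := ler_piMr (ltW hc3) l1.
  by rewrite /A /cA; have := hm0u; have := hm2; lra.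
have A2 : A ^+ 2 <= cA ^+ 2 by rewrite lerXn2r ?nnegrE// ltW// cA_gt0.
have A3 : 32 * c1 * A <= 32 * c1 * cA by rewrite ler_wpM2l// mulr_ge0// ltW.
have pp : 0 < 2 * pi :> R by rewrite mulr_gt0 ?pi_gt0.
have E : p ^+ 2 * mu ^+ 2 * L - 2 * pi * c4 <= 2 * pi * J f G0.
  apply: le_trans (ler_wpM2l (ltW pp) hE).
  by move: pp; move: (pi) => q q0; rewrite le_eqVlt; apply/orP; left; apply/eqP; field; rewrite gt_eqF//; lra.
have X : p ^+ 2 * mu ^+ 2 * L - cK <= (S ^+ 2 - Far / 2) * L.
  by rewrite /cK; lra.
rewrite -(ler_pM2r L0); apply: le_trans X.
by rewrite mulrBl -(mulrA cK) /l mulVf ?gt_eqF// mulr1.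
Qed.

Let far01 x y : far t x y = 0 \/ far t x y = 1.
Proof. by rewrite /far; case: (_ <= _)%R; [right|left]. Qed.

Lemma momint_weighted_far x (g : R * R -> R) (a : R) : 0 <= a -> measurable_fun setT (g : pT -> R) ->
  (forall x, 0 < x.1 -> `|g x| <= a * (1 + x.1 ^+ 2)) -> momint f (fun y => g y * far t x y).
Proof.
move=> a0 mg ga; apply: (mom_integrable gf2 (a := a)) => //.
  by apply: measurable_funM => //; exact: measurable_far.
move=> y y0; rewrite normrM (ger0_norm (far_ge0 _ _ _)); apply: le_trans (ga y y0).
by rewrite ler_piMr ?far_le1.
Qed.

Lemma momint_sqr_far x : momint f (fun y => sqr y * far t x y).
Proof.
apply: (@momint_weighted_far _ _ 1) => //; first exact: measurable_sqr.
by move=> y y0; rewrite mul1r ger0_norm ?sqrtr_ge0//; exact: sqr_le.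
Qed.

Lemma momint_one_far x : momint f (fun y => 1 * far t x y).
Proof.
apply: (@momint_weighted_far _ (fun=> 1) 1) => //.
by move=> y y0; rewrite mul1r normr1 lerDl sqr_ge0.
Qed.

Lemma momint_r2_far x : momint f (fun y => (1 + y.1 ^+ 2) * far t x y).
Proof.
apply: (@momint_weighted_far _ _ 1) => //.
  by apply: measurable_funD => //; exact: measurable_r2.
by move=> y y0; rewrite mul1r ger0_norm ?addr_ge0 ?sqr_ge0.
Qed.

(* Otherwise integration against sqr x f x makes Far exceed its bound. *)
Lemma concentration_point : exists x : R * R,
  0 < x.1 /\ mom f (fun y => sqr y * far t x y) <= cB * l.
Proof.
have [hF hS _] := moment_concentration.
have S2 : p * mu / 2 <= mom f sqr by have := small_pm; lra.
apply: contrapT => /forallNP nx.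
have nx' x : 0 < x.1 -> cB * l < mom f (fun y => sqr y * far t x y).
  by move=> x0; rewrite ltNge; apply/negP => h; apply: (nx x).
have ifar : Jint f (fun x y => gm x y * far t x y) by exact: (Jint_gmfar gf2).
have B0 : 0 <= cB * l by rewrite mulr_ge0 ?(ltW l0) ?(ltW cB_gt0).
have : cB * l * mom f sqr <= Far.
  rewrite -(momZ _ (momint_sqr gf2)) -lee_fin -(mom_EFin (momint_Z _ (momint_sqr gf2))).
  have -> : Far%:E = Jb f (fun x y => gm x y * far t x y).
    by rewrite /Far /J /Rintegral fineK//; exact: integrable_fin_num ifar.
  apply: (Jb_ge gf2).
  - by apply: measurable_funM; [exact: meas2_gm|exact: meas2_far].
  - by move=> x y _ _; rewrite mulr_ge0 ?gm_ge0 ?far_ge0.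
  - by move=> x _; rewrite mulr_ge0// sqrtr_ge0.
  move=> x x0; have i := momint_sqr_far x.
  have -> : (\int[mu2]_y (gm x y * far t x y * f y)%:E = (sqr x * mom f (fun y => sqr y * far t x y))%:E)%E.
    rewrite -(momZ _ i) -(mom_EFin (momint_Z _ i)); apply: eq_integral => y _.
    have [->|/(good_halfplane gf) y0] := eqVneq (f y) 0; first by rewrite !mulr0.
    by rewrite gm_sqrt// -(mulrA (Num.sqrt x.1)).
  by rewrite lee_fin mulrC ler_wpM2l ?sqrtr_ge0// ltW// nx'.
have : cB * l * (p * mu / 2) <= cB * l * mom f sqr by rewrite ler_wpM2l.
have -> : cB * l * (p * mu / 2) = 2 * (cFar p mu c2 c3 cK * l).
  by rewrite /cB; field; rewrite !gt_eqF.
have := mulr_gt0 (cFar_gt0 p0 mu0 hc2 hc3 k0) l0; lra.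
Qed.

Lemma concentration : exists x : R * R, [/\ 0 < x.1,
  `|x.1 - p ^+ 2| <= cRad * l & mom f (fun y => (1 + y.1 ^+ 2) * far t x y) <= cO * l].
Proof.
have [x [x0 hx]] := concentration_point; exists x.
have [hF hS hV] := moment_concentration.
have hO : mom f (fun y => (1 + y.1 ^+ 2) * far t x y) <= cO * l.
  (* Outside the ball this is [one_sqr_le_kappa]; inside it the left side is 0 and the variance term
     is nonnegative. *)
  apply: (@le_trans _ _ (mom f (fun y => cKappa * (sqr y * far t x y + (y.1 - p ^+ 2) ^+ 2)))).
    have i := momint_Z cKappa (momint_D (momint_sqr_far x) momint_var).
    apply: (mom_le gf2 (momint_r2_far x) i) => y y0.
    case: (far01 x y) => ->.
      by rewrite !mulr0 add0r mulr_ge0 ?sqr_ge0// ltW// cKappa_gt0.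
    by rewrite !mulr1; exact: one_sqr_le_kappa.
  rewrite (momZ _ (momint_D (momint_sqr_far x) momint_var)) (momD (momint_sqr_far x) momint_var).
  rewrite /cO -mulrA ler_pM2l ?cKappa_gt0// mulrDl; exact: lerD.
have t0 : 0 <= t by exact: sqrtr_ge0.
have t2 : t <= 2 * l by exact: sqrt_le_log.
have near1 y : far t x y = 0 -> eucl_dist x y < t.
  by rewrite /far ltNge; case: (_ <= _)%R => //= /eqP; rewrite oner_eq0.
have hone : mom f (fun y => 1 * far t x y) <= cO * l.
  apply: le_trans hO; apply: (mom_le gf2 (momint_one_far x) (momint_r2_far x)) => y y0.
  by rewrite ler_wpM2r ?far_ge0// lerDl sqr_ge0.
have rl : p ^+ 2 - cR1 p mu c2 cK cB * l <= x.1.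
  apply: (radius_lower p0 mu0 hc2 k0 l0 cB_gt0 x0 t0 t2 hm0u hS).
  apply: (@le_trans _ _ (mom f (fun y => Num.sqrt (x.1 + t) * one y + sqr y * far t x y))).
    have i := momint_D (momint_Z (Num.sqrt (x.1 + t)) (momint_one gf2)) (momint_sqr_far x).
    apply: (mom_le gf2 (momint_sqr gf2) i) => y y0; rewrite /one mulr1.
    case: (far01 x y) => [h|->]; last by rewrite mulr1 lerDr sqrtr_ge0.
    rewrite h mulr0 addr0 /sqr ler_wsqrtr//.
    by have := near1 _ h; have := dist1_le x y; rewrite ler_norml => /andP[]; lra.
  rewrite (momD (momint_Z (Num.sqrt (x.1 + t)) (momint_one gf2)) (momint_sqr_far x)).
  by rewrite (momZ _ (momint_one gf2)) lerD2l.
have ru : x.1 <= p ^+ 2 + cR2 p mu c2 c3 cO * l.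
  apply: (radius_upper p0 mu0 hc2 hc3 l0 cO_gt0 x0 t0 t2 hm0l hm2 small_mu) => tx.
  have c0 : 0 <= (x.1 - t) ^+ 2 by exact: sqr_ge0.
  (* In the ball the radius is at least x.1 - t, so (x.1 - t)^2 is dominated by r^2; outside, the
     second summand takes its place. *)
  suff : (x.1 - t) ^+ 2 * mom f one <= mom f r2 + (x.1 - t) ^+ 2 * mom f (fun y => 1 * far t x y).
    by have := ler_wpM2l c0 hone; lra.
  rewrite -(momZ _ (momint_one gf2)) -(momZ _ (momint_one_far x)).
  have i := momint_Z ((x.1 - t) ^+ 2) (momint_one_far x).
  rewrite -(momD (momint_r2 gf2) i).
  apply: (mom_le gf2 (momint_Z _ (momint_one gf2)) (momint_D (momint_r2 gf2) i)) => y y0.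
  rewrite /one /r2 !mulr1 mul1r; case: (far01 x y) => [h|->]; last by rewrite mulr1 lerDr sqr_ge0.
  rewrite h mulr0 addr0 lerXn2r ?nnegrE ?subr_ge0 ?(ltW y0)//.
  by have := near1 _ h; have := dist1_le x y; rewrite ler_norml => /andP[]; lra.
split => //.
have R1 := cR1_gt0 p0 mu0 hc2 k0 cB_gt0; have R2 := cR2_gt0; have O0 := cO_gt0.
have h1 := mulr_gt0 R1 l0; have h2 := mulr_gt0 R2 l0; have h3 := mulr_gt0 O0 l0.
by rewrite /cRad ler_norml; apply/andP; split; lra.
Qed.

End Concentration.

(** * Velocity of a concentrated vortex *)

Section CutoffWeight.
Context {R : realType}.
Variable n : R.
Hypothesis n1 : 1 <= n.

(** The moment r^2 is replaced by r^2 rho(r), which is at most n^2, increases to r^2 with n, and has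
    the simple derivative 2 r rho^2. The constants derived from it are uniform in n. *)
Definition rho (r : R) : R := (1 + r ^+ 2 / n ^+ 2)^-1.

Let n0 : 0 < n. Proof. exact: lt_le_trans n1. Qed.
Let den (r : R) : 1 <= 1 + r ^+ 2 / n ^+ 2.
Proof. by rewrite lerDl divr_ge0 ?sqr_ge0. Qed.

Lemma rho_gt0 r : 0 < rho r.
Proof. by rewrite invr_gt0; exact: lt_le_trans (den r). Qed.

Lemma rho_le1 r : rho r <= 1.
Proof. by rewrite invf_le1 ?den// (lt_le_trans _ (den r)). Qed.

Lemma rho_r_le r : 0 <= r -> r * rho r <= n / 2.
Proof.
move=> r0; rewrite ler_pdivrMr ?(lt_le_trans _ (den r))//.
have -> : n / 2 * (1 + r ^+ 2 / n ^+ 2) = (n ^+ 2 + r ^+ 2) / (2 * n) by field; rewrite gt_eqF.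
rewrite ler_pdivlMr ?mulr_gt0//; have := sqr_ge0 (n - r); nra.
Qed.

Lemma rhoB r s : rho r - rho s = (s - r) * ((r + s) / n ^+ 2 * (rho r * rho s)).
Proof.
have h1 := lt_le_trans ltr01 (den r); have h2 := lt_le_trans ltr01 (den s).
have nn := exprn_gt0 2 n0; have g1 : 0 < n ^+ 2 + r ^+ 2 by rewrite ltr_pwDl// sqr_ge0.
have g2 : 0 < n ^+ 2 + s ^+ 2 by rewrite ltr_pwDl// sqr_ge0.
have E u : rho u = n ^+ 2 / (n ^+ 2 + u ^+ 2).
  have gu : 0 < n ^+ 2 + u ^+ 2 by rewrite ltr_pwDl// sqr_ge0.
  rewrite /rho -[RHS]invrK invf_div; congr (_^-1); field; rewrite gt_eqF//.
by rewrite !E; field; rewrite !gt_eqF.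
Qed.

(** The Lipschitz constant 1 / n of rho compensates the axial weight h, which is only bounded by n,
    in the symmetrised flux. *)
Lemma rho_lip r s : 0 <= r -> 0 <= s -> n * `|rho r - rho s| <= `|r - s|.
Proof.
move=> r0 s0; have pr := rho_gt0 r; have ps := rho_gt0 s.
have c0 : 0 <= (r + s) / n ^+ 2 * (rho r * rho s).
  apply: mulr_ge0; last exact: mulr_ge0 (ltW pr) (ltW ps).
  by rewrite divr_ge0 ?sqr_ge0// addr_ge0.
rewrite rhoB normrM (ger0_norm c0) distrC mulrCA ler_piMr//.
have -> : n * ((r + s) / n ^+ 2 * (rho r * rho s)) =
   (r * rho r * rho s + s * rho s * rho r) / n by field; rewrite gt_eqF.
rewrite ler_pdivrMr// mul1r.
have h1 : r * rho r * rho s <= n / 2.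
  by apply: le_trans (rho_r_le r0); rewrite ler_piMr ?rho_le1// mulr_ge0// ltW.
have h2 : s * rho s * rho r <= n / 2.
  by apply: le_trans (rho_r_le s0); rewrite ler_piMr ?rho_le1// mulr_ge0// ltW.
lra.
Qed.

Lemma rho_lip1 r s : 0 <= r -> 0 <= s -> `|rho r - rho s| <= `|r - s|.
Proof. by move=> r0 s0; apply: le_trans (rho_lip r0 s0); rewrite ler_peMl. Qed.

(** With a = r / n and b = s / n, the difference is (r - s) (1 - a b) rho(r) rho(s), and |1 - a b|
    <= (1 + a^2) (1 + b^2). *)
Lemma r_rho_lip r s : 0 <= r -> 0 <= s -> `|r * rho r - s * rho s| <= `|r - s|.
Proof.
move=> r0 s0; have pr := rho_gt0 r; have ps := rho_gt0 s.
have g1 : 0 < 1 + r ^+ 2 / n ^+ 2 by exact: lt_le_trans (den r).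
have g2 : 0 < 1 + s ^+ 2 / n ^+ 2 by exact: lt_le_trans (den s).
have -> : r * rho r - s * rho s = (r - s) * ((1 - r / n * (s / n)) * (rho r * rho s)).
  have -> : (1 - r / n * (s / n)) * (rho r * rho s) = rho r * rho s - (r * s / n ^+ 2) * rho r * rho s.
    by field; rewrite gt_eqF.
  have e1 : rho r * (1 + r ^+ 2 / n ^+ 2) = 1 by rewrite mulVf// gt_eqF.
  have e2 : rho s * (1 + s ^+ 2 / n ^+ 2) = 1 by rewrite mulVf// gt_eqF.
  have -> : r * rho r = r * rho r * (rho s * (1 + s ^+ 2 / n ^+ 2)) by rewrite e2 mulr1.
  have -> : s * rho s = s * rho s * (rho r * (1 + r ^+ 2 / n ^+ 2)) by rewrite e1 mulr1.
  by ring.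
rewrite normrM ler_piMr// normrM (ger0_norm (mulr_ge0 (ltW pr) (ltW ps))).
rewrite -invfM ler_pdivrMr ?mulr_gt0// mul1r.
set a := r / n; set b := s / n.
have a0 : 0 <= a by rewrite divr_ge0// ltW.
have b0 : 0 <= b by rewrite divr_ge0// ltW.
rewrite -!expr_div_n -/a -/b ler_norml; have := sqr_ge0 (a * b); have := sqr_ge0 (a - b).
have := mulr_ge0 a0 b0; have := sqr_ge0 a; have := sqr_ge0 b; move=> *; apply/andP; split; nra.
Qed.

Lemma measurable_rho : measurable_fun setT rho.
Proof. by rewrite /rho; meas. Qed.

End CutoffWeight.

Section Dominated.
Context {R : realType}.
Local Notation mu2 := (@plane_measure R).
Local Notation pT := (measurableTypeR R * measurableTypeR R)%type.
Variables (c M : R) (f : R * R -> R).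
Hypothesis gf2 : good2 c M f.
Let gf := good2_good gf2.
Implicit Types (x y : R * R) (k b : R * R -> R * R -> R).

Lemma Jb_EFin k : Jint f k -> Jb f k = (J f k)%:E.
Proof. by move=> ik; rewrite /J /Rintegral fineK//; exact: integrable_fin_num ik. Qed.

Lemma Jint_dom k b : meas2 k -> (forall x y, 0 < x.1 -> 0 < y.1 -> `|k x y| <= b x y) ->
  Jint f b -> Jint f k.
Proof.
by move=> mk kb ib; apply: (J_integrable gf mk kb (B := J f b)); rewrite Jb_EFin.
Qed.

Lemma J_bound_dom k b : (forall x y, 0 < x.1 -> 0 < y.1 -> `|k x y| <= b x y) ->
  Jint f b -> `|J f k| <= J f b.
Proof. by move=> kb ib; apply: (J_bound gf kb); rewrite Jb_EFin. Qed.

Definition wt (x : R * R) : R := 1 + x.1 ^+ 2.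

Lemma wt_ge1 x : 1 <= wt x. Proof. by rewrite lerDl sqr_ge0. Qed.
Lemma wt_ge0 x : 0 <= wt x. Proof. exact: le_trans (wt_ge1 x). Qed.

Lemma momint_wt : momint f wt.
Proof. exact: momint_D (momint_one gf2) (momint_r2 gf2). Qed.

Lemma mom_wt : mom f wt = mom f one + mom f r2.
Proof. exact: momD (momint_one gf2) (momint_r2 gf2). Qed.

Lemma Jint_wt : Jint f (fun x y => wt x * wt y).
Proof.
have m : meas2 (fun x y => wt x * wt y).
  by rewrite /meas2 /wt; meas; apply: measurableT_comp.
apply: (J_integrable gf m (b := fun x y => wt x * wt y) (B := 2 * (mom f wt) * M)).
  by move=> x y _ _; rewrite ger0_norm// mulr_ge0 ?wt_ge0.
apply: (@le_trans _ _ (\int[mu2]_x (mom f wt * wt x * f x)%:E)%E).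
  apply: (Jb_le gf m) => [x y _ _|x x0]; first by rewrite mulr_ge0 ?wt_ge0.
  rewrite mulrC -(momZ _ momint_wt) -(mom_EFin (momint_Z _ momint_wt)).
  by apply: le_integral_nomeas => y _//; rewrite lee_fin mulr_ge0 ?mulr_ge0 ?wt_ge0 ?(good_ge0 gf).
have w0 : 0 <= mom f wt by apply: (mom_ge0 gf2) => x _; exact: wt_ge0.
by apply: (weight_le gf2) => // x _; rewrite lexx andbT mulr_ge0 ?wt_ge0.
Qed.

Lemma J_wt : J f (fun x y => wt x * wt y) = mom f wt ^+ 2.
Proof. by rewrite (J_prod momint_wt momint_wt) expr2. Qed.

Lemma gm_le_wt x y : 0 < x.1 -> 0 < y.1 -> gm x y <= wt x * wt y.
Proof.
move=> x0 y0; have := gm_le_mean x0 y0; rewrite /wt.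
have := sqr_ge0 (x.1 - 1); have := sqr_ge0 (y.1 - 1); have := sqr_ge0 (x.1 * y.1).
by have := sqr_ge0 x.1; have := sqr_ge0 y.1; lra.
Qed.

Lemma Jint_gm_over_dist : Jint f (fun x y => gm x y / eucl_dist x y).
Proof.
have m1 := @meas2_gm R; have m2 := @measurable_eucl_dist R.
have i1 : Jint f (fun x y : R * R => (1 + x.1 ^+ 2) / eucl_dist x y).
  apply: (Jint_over_dist gf2); first by rewrite /meas2; meas; exact: measurableT_comp.
  by move=> x y x0 y0; rewrite ger0_norm// divr_ge0 ?sqrtr_ge0// addr_ge0// sqr_ge0.
apply: (Jint_dom _ _ (Jint_D i1 Jint_wt)).
  by rewrite /meas2; meas.
move=> x y x0 y0; have d0 := sqrtr_ge0 ((x.1 - y.1) ^+ 2 + (x.2 - y.2) ^+ 2).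
rewrite -/(eucl_dist x y) in d0; rewrite ger0_norm ?divr_ge0 ?gm_ge0//.
have w1 : 1 <= wt x * wt y by have := wt_ge1 x; have := wt_ge1 y; nra.
have [->|dn] := eqVneq (eucl_dist x y) 0; first by rewrite invr0 !mulr0 add0r (le_trans ler01).
have dp : 0 < eucl_dist x y by rewrite lt_neqAle eq_sym dn.
rewrite ler_pdivrMr// mulrDl divfK//.
have := gm_le_mean x0 y0; have := dist1_le x y; rewrite ler_norml => /andP[h _] hg.
have := ler_wpM2r d0 w1; have := sqr_ge0 (x.1 - 1); nra.
Qed.

End Dominated.

Section StaticVelocity.
Context {R : realType}.
Local Notation mu2 := (@plane_measure R).
Local Notation pT := (measurableTypeR R * measurableTypeR R)%type.
Implicit Types (x y : R * R).
Variables (n : R) (h dh : R -> R).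
Hypotheses (n1 : 1 <= n) (hn : forall z, `|h z| <= n)
  (hlip : forall z z', `|h z - h z'| <= `|z - z'|) (dh1 : forall z, `|dh z| <= 1)
  (dhlip : forall z z', `|dh z - dh z'| <= 3 * `|z - z'|)
  (mh : measurable_fun setT h) (mdh : measurable_fun setT dh).

Let n0 : 0 < n. Proof. exact: lt_le_trans n1. Qed.

Definition chi x : R := rho n x.1 * dh x.2.

(** This is the flux of the test function r^2 rho(r) h(z), of gradient (2 r rho^2 h, r^2 rho h');
    the factor r of the radial derivative cancels the one in the denominator of [KR]. *)
Definition flux_kernel x y : R :=
  2 * rho n x.1 ^+ 2 * h x.2 * ((x.2 - y.2) * N0 x y) + chi x * (x.1 ^+ 2 * KZ x y).

Definition flux_error x y : R :=
  2 * rho n x.1 ^+ 2 * h x.2 * ((x.2 - y.2) * N0 x y)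
  - x.1 * chi x * ((x.1 - y.1) * N0 x y) + chi x / 2 * (N0 x y * eucl_dist x y ^+ 2).

Lemma flux_kernelE x y : 0 < x.1 -> 0 < y.1 ->
  flux_kernel x y = flux_error x y + 2^-1 * (chi x * G0 x y).
Proof.
move=> x0 y0; have := KZ_GN x0 y0; rewrite /flux_kernel /flux_error => E.
have -> : x.1 ^+ 2 * KZ x y = (2 * x.1 ^+ 2 * KZ x y) / 2 by field.
by rewrite E; field.
Qed.

Lemma chi_le1 x : `|chi x| <= 1.
Proof.
rewrite normrM (ger0_norm (ltW (rho_gt0 n _)))//; apply: mulr_ile1 => //.
  exact: ltW (rho_gt0 n _).
exact: rho_le1.
Qed.

Lemma chi_lip x y : 0 < x.1 -> 0 < y.1 -> `|chi x - chi y| <= 4 * eucl_dist x y.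
Proof.
move=> x0 y0; have -> : chi x - chi y = (rho n x.1 - rho n y.1) * dh x.2 + rho n y.1 * (dh x.2 - dh y.2).
  by rewrite /chi; ring.
have := rho_lip1 n1 (ltW x0) (ltW y0); have := dist1_le x y; have := dist2_le x y => d2 d1 hr.
have h1 : `|(rho n x.1 - rho n y.1) * dh x.2| <= eucl_dist x y.
  by rewrite normrM; apply: le_trans (le_trans hr d1); rewrite ler_piMr.
have h2 : `|rho n y.1 * (dh x.2 - dh y.2)| <= 3 * eucl_dist x y.
  rewrite normrM (ger0_norm (ltW (rho_gt0 n _))).
  apply: (@le_trans _ _ `|dh x.2 - dh y.2|); first by rewrite ler_piMl ?rho_le1.
  by apply: le_trans (dhlip _ _) _; rewrite ler_pM2l.
by apply: le_trans (ler_normD _ _) _; lra.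
Qed.

(* The differences contribute a factor d^2, and N0 d^2 is bounded. *)
Lemma flux_error_sym x y : 0 < x.1 -> 0 < y.1 ->
  `|flux_error x y + flux_error y x| <= 6 * (wt x * wt y).
Proof.
move=> x0 y0; set d := eucl_dist x y; have d0 : 0 <= d by exact: sqrtr_ge0.
have d1 : `|x.1 - y.1| <= d by exact: dist1_le.
have d2 : `|x.2 - y.2| <= d by exact: dist2_le.
pose a (u : R * R) := 2 * rho n u.1 ^+ 2 * h u.2; pose g (u : R * R) := x.1 * chi u.
have rx := rho_gt0 n x.1; have ry := rho_gt0 n y.1.
have rx1 := rho_le1 n x.1; have ry1 := rho_le1 n y.1.
have -> : flux_error x y + flux_error y x = N0 x y *
   ((a x - a y) * (x.2 - y.2) - (x.1 * chi x - y.1 * chi y) * (x.1 - y.1) + (chi x + chi y) / 2 * d ^+ 2).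
  by rewrite /flux_error (N0_sym y x) (eucl_distC y x) -/d /a; field.
have ha : `|a x - a y| <= 6 * d.
  have -> : a x - a y = 2 * rho n x.1 ^+ 2 * (h x.2 - h y.2)
     + 2 * (rho n x.1 + rho n y.1) * ((rho n x.1 - rho n y.1) * h y.2) by rewrite /a; ring.
  have b1 : `|2 * rho n x.1 ^+ 2 * (h x.2 - h y.2)| <= 2 * d.
    rewrite normrM ger0_norm; last by rewrite mulr_ge0 ?sqr_ge0.
    apply: ler_pM => //; first by rewrite mulr_ge0 ?sqr_ge0.
      by rewrite ler_piMr// expr_le1// ltW.
    exact: le_trans (hlip _ _) d2.
  have b2 : `|(rho n x.1 - rho n y.1) * h y.2| <= d.
    rewrite normrM; apply: (@le_trans _ _ (`|rho n x.1 - rho n y.1| * n)); first by rewrite ler_wpM2l.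
    by rewrite mulrC; apply: le_trans (rho_lip n1 (ltW x0) (ltW y0)) d1.
  have b3 : `|2 * (rho n x.1 + rho n y.1) * ((rho n x.1 - rho n y.1) * h y.2)| <= 4 * d.
    rewrite normrM ger0_norm; last by rewrite mulr_ge0// addr_ge0// ltW.
    apply: ler_pM => //; first by rewrite mulr_ge0// addr_ge0// ltW.
    lra.
  by apply: le_trans (ler_normD _ _) _; lra.
have hg : `|x.1 * chi x - y.1 * chi y| <= (1 + 3 * y.1) * d.
  have -> : x.1 * chi x - y.1 * chi y = (x.1 * rho n x.1 - y.1 * rho n y.1) * dh x.2
     + y.1 * rho n y.1 * (dh x.2 - dh y.2) by rewrite /chi; ring.
  have b1 : `|(x.1 * rho n x.1 - y.1 * rho n y.1) * dh x.2| <= d.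
    rewrite normrM; apply: le_trans (le_trans (r_rho_lip n1 (ltW x0) (ltW y0)) d1).
    by rewrite ler_piMr.
  have b2 : `|y.1 * rho n y.1 * (dh x.2 - dh y.2)| <= y.1 * (3 * d).
    rewrite normrM ger0_norm; last by rewrite mulr_ge0// ltW.
    apply: ler_pM => //; first by rewrite mulr_ge0// ltW.
      by rewrite ler_piMr// ltW.
    by apply: le_trans (dhlip _ _) _; rewrite ler_pM2l.
  by apply: le_trans (ler_normD _ _) _; lra.
have hc : `|(chi x + chi y) / 2| <= 1.
  have := chi_le1 x; have := chi_le1 y; rewrite !ler_norml => /andP[? ?] /andP[? ?].
  by apply/andP; split; lra.
have dd (u v B : R) : `|u| <= B * d -> `|v| <= d -> `|u * v| <= B * d ^+ 2.
  by move=> h1 h2; rewrite normrM expr2 mulrA; exact: ler_pM.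
have B1 := dd _ _ _ ha d2; have B2 := dd _ _ _ hg d1.
have B3 : `|(chi x + chi y) / 2 * d ^+ 2| <= d ^+ 2.
  by rewrite normrM (ger0_norm (sqr_ge0 d)) ler_piMl ?sqr_ge0.
have tri (u v w : R) : `|u - v + w| <= `|u| + `|v| + `|w|.
  by apply: le_trans (ler_normD _ _) _; rewrite lerD2r ler_normB.
rewrite normrM.
have BB : `|(a x - a y) * (x.2 - y.2) - (x.1 * chi x - y.1 * chi y) * (x.1 - y.1) + (chi x + chi y) / 2 * d ^+ 2|
   <= (8 + 3 * y.1) * d ^+ 2 by apply: le_trans (tri _ _ _) _; lra.
apply: (le_trans (ler_wpM2l (normr_ge0 _) BB)).
have y8 : 0 <= 8 + 3 * y.1 by have := y0; lra.
have := ler_wpM2l y8 (N0_dist2 x0 y0); rewrite -/(gm x y) -/d => hN.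
have -> : `|N0 x y| * ((8 + 3 * y.1) * d ^+ 2) = (8 + 3 * y.1) * (`|N0 x y| * d ^+ 2) by ring.
apply: (le_trans hN); have hm := ler_wpM2l y8 (gm_le_mean x0 y0); rewrite /wt.
have := sqr_ge0 (x.1 - 1); have := sqr_ge0 (y.1 - 1); have := sqr_ge0 (x.1 * y.1).
have := sqr_ge0 (x.1 - y.1); have := mulr_gt0 x0 y0.
by have := sqr_ge0 x.1; have := sqr_ge0 y.1; lra.
Qed.

End StaticVelocity.

Section StaticVelocityEstimate.
Context {R : realType}.
Local Notation mu2 := (@plane_measure R).
Local Notation pT := (measurableTypeR R * measurableTypeR R)%type.
Implicit Types (x y : R * R).
Variables (n : R) (h dh : R -> R).
Hypotheses (n1 : 1 <= n) (hn : forall z, `|h z| <= n)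
  (hlip : forall z z', `|h z - h z'| <= `|z - z'|) (dh1 : forall z, `|dh z| <= 1)
  (dhlip : forall z z', `|dh z - dh z'| <= 3 * `|z - z'|)
  (mh : measurable_fun setT h) (mdh : measurable_fun setT dh).
Variables (p mu c1 c4 c5 A O : R).
Hypotheses (p0 : 0 < p) (mu0 : 0 < mu) (hc1 : 0 < c1) (hc4 : 0 < c4) (hc5 : 0 < c5)
  (A0 : 0 < A) (O0 : 0 < O).
Variables (eps M : R) (f : R * R -> R).
Hypotheses (e0 : 0 < eps) (e1 : eps < 1).
Let L := - ln eps.
Let l := L^-1.
Hypothesis l1 : l <= 1.
Hypothesis gf2 : good2 (c1 * eps ^- 2) M f.
Hypothesis hA : mom f wt <= A.
Hypothesis hm2 : `|mom f r2 - p ^+ 4 * mu| <= c5 * l.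
Hypothesis hE : `|J f G0 - p ^+ 2 * mu ^+ 2 / (2 * pi) * L| <= c4.
Let t := Num.sqrt eps.
Variable xs : R * R.
Hypothesis xs0 : 0 < xs.1.
Hypothesis hO : mom f (fun y => (1 + y.1 ^+ 2) * far t xs y) <= O * l.

Let gf := good2_good gf2.
Let f0 := good_ge0 gf.
Let L0 : 0 < L. Proof. by rewrite oppr_gt0 ln_lt0// e0. Qed.
Let l0 : 0 < l. Proof. by rewrite invr_gt0. Qed.
Let Ll : L * l = 1. Proof. by rewrite mulfV ?gt_eqF. Qed.
Let t0 : 0 <= t. Proof. exact: sqrtr_ge0. Qed.
Let tl : t <= 2 * l. Proof. exact: sqrt_le_log. Qed.
Let ch := chi n dh.

Let mN : meas2 (@N0 R) := @measurable_N0 R.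
Let mG : meas2 (@G0 R) := @measurable_G0 R.
Let mD : meas2 (@eucl_dist R) := @measurable_eucl_dist R.
Let mrho := measurable_rho n.

Lemma measurable_chi : measurable_fun setT (chi n dh : pT -> R).
Proof.
apply: measurable_funM.
  by apply: (measurableT_comp mrho); exact: measurable_fst.
by apply: (measurableT_comp mdh); exact: measurable_snd.
Qed.

Let m11 : measurable_fun setT (fun q : pT * pT => q.1.1).
Proof. by apply: measurableT_comp. Qed.
Let m12 : measurable_fun setT (fun q : pT * pT => q.1.2).
Proof. by apply: measurableT_comp. Qed.
Let m21 : measurable_fun setT (fun q : pT * pT => q.2.1).
Proof. by apply: measurableT_comp. Qed.
Let m22 : measurable_fun setT (fun q : pT * pT => q.2.2).
Proof. by apply: measurableT_comp. Qed.

Lemma measurable_flux_error : meas2 (flux_error n h dh).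
Proof.
have m1 := measurable_p1 measurable_chi.
have m2 : measurable_fun setT (fun q : pT * pT => rho n q.1.1) by exact: (measurableT_comp mrho).
have m3 : measurable_fun setT (fun q : pT * pT => h q.1.2) by exact: (measurableT_comp mh).
by rewrite /meas2 /flux_error; meas.
Qed.

(** Only integrability matters here, so the constant may grow with n. The bound uniform in n comes
    from the symmetrised kernel. *)
Lemma Jint_flux_error : Jint f (flux_error n h dh).
Proof.
have n0 : 0 <= n by exact: le_trans n1.
pose K := 3 * n + 1.
have K0 : 0 <= K by rewrite /K; lra.
have i := Jint_D (Jint_Z K (Jint_gm_over_dist gf2)) (Jint_gm gf2).
apply: (Jint_dom gf2 measurable_flux_error _ i) => x y x0 y0.
set d := eucl_dist x y; have d0 : 0 <= d by exact: sqrtr_ge0.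
have g0 := gm_ge0 x y.
have hN := N0_dist2 x0 y0; rewrite -/d -/(gm x y) in hN.
have Nd (u : R) : `|u| <= d -> `|u * N0 x y| <= gm x y / d.
  move=> ud; have [dz|dn] := eqVneq d 0.
    by move: ud; rewrite dz invr0 mulr0 normr_le0 => /eqP ->; rewrite mul0r normr0.
  have dp : 0 < d by rewrite lt_neqAle eq_sym dn.
  rewrite normrM ler_pdivlMr//; apply: (@le_trans _ _ (`|N0 x y| * d ^+ 2)).
    have -> : `|u| * `|N0 x y| * d = `|N0 x y| * d * `|u| by ring.
    by rewrite expr2 mulrA ler_wpM2l// mulr_ge0.
  by lra.
have rx := rho_gt0 n x.1; have rx1 := rho_le1 n x.1.
have q0 : 0 <= gm x y / d by rewrite divr_ge0.
have B1 : `|2 * rho n x.1 ^+ 2 * h x.2 * ((x.2 - y.2) * N0 x y)| <= 2 * n * (gm x y / d).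
  rewrite normrM; apply: ler_pM => //; last by apply: Nd; exact: dist2_le.
  rewrite normrM (ger0_norm (mulr_ge0 (ler0n _ _) (sqr_ge0 _))); apply: ler_pM => //.
    by rewrite mulr_ge0 ?sqr_ge0.
  by rewrite ler_piMr// expr_le1// ltW.
have B2 : `|x.1 * ch x * ((x.1 - y.1) * N0 x y)| <= n * (gm x y / d).
  rewrite normrM; apply: ler_pM => //; last by apply: Nd; exact: dist1_le.
  rewrite /ch /chi mulrA normrM ger0_norm; last by rewrite mulr_ge0 ?(ltW x0) ?(ltW rx).
  apply: (@le_trans _ _ (x.1 * rho n x.1)); first by rewrite ler_piMr// mulr_ge0 ?(ltW x0) ?(ltW rx).
  by apply: le_trans (rho_r_le n1 (ltW x0)) _; lra.
have B3 : `|ch x / 2 * (N0 x y * d ^+ 2)| <= gm x y.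
  rewrite normrM [X in _ * X]normrM (ger0_norm (sqr_ge0 d)).
  apply: (@le_trans _ _ (1 * (3 / 4 * gm x y))); last by lra.
  apply: ler_pM => //; first by rewrite mulr_ge0 ?sqr_ge0.
  have := chi_le1 n dh1 x; rewrite -/ch !ler_norml => /andP[? ?]; apply/andP; split; lra.
rewrite /flux_error; apply: le_trans (ler_normD _ _) _; rewrite -/d -/ch.
apply: (@le_trans _ _ (2 * n * (gm x y / d) + n * (gm x y / d) + gm x y)); last first.
  by rewrite /K; lra.
apply: lerD => //; apply: le_trans (ler_normB _ _) _; exact: lerD.
Qed.

Lemma J_flux_error : `|J f (flux_error n h dh)| <= 3 * A ^+ 2.
Proof.
have := J_sym_bound gf Jint_flux_error (@flux_error_sym _ n h dh n1 hn hlip dh1 dhlip).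
move=> /(_ (6 * mom f wt ^+ 2)) H; apply: (le_trans (H _)).
  by rewrite (Jb_EFin (Jint_Z _ (Jint_wt gf2))) (J_Z _ (Jint_wt gf2)) (J_wt gf2).
have w0 : 0 <= mom f wt by apply: (mom_ge0 gf2) => x _; exact: wt_ge0.
have : mom f wt ^+ 2 <= A ^+ 2 by rewrite lerXn2r ?nnegrE// ltW.
lra.
Qed.

(** The potential of f at x is at most K (1 + x.1^2) with K of order L, while the part of (1 + r^2)
    f outside the ball is O(1 / L); the product is bounded. *)
Lemma far_energy_le : J f (fun x y => far t xs x * G0 x y) <= (5 * A + 32 * c1) * O.
Proof.
have Lge1 : 1 <= L by rewrite -(invrK L) invf_ge1// invr_gt0.
have m1 : meas2 (fun x y => far t xs x * G0 x y).
  by apply: measurable_funM => //; exact: (measurable_p1 (measurable_far xs t)).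
have i : Jint f (fun x y => far t xs x * G0 x y).
  apply: (Jint_dom gf2 m1 _ (Jint_G0 gf2)) => x y x0 y0.
  have g0 := G0_ge0 x0 y0; rewrite ger0_norm; last exact: mulr_ge0 (far_ge0 _ _ _) g0.
  by rewrite ler_piMl// far_le1.
pose K := (L + 4) * A + 32 * c1.
have K0 : 0 <= K by have := mulr_gt0 L0 A0; rewrite /K; have := hc1; have := A0; lra.
have ifar := momint_r2_far gf2 xs.
have pot x : 0 < x.1 -> (\int[mu2]_y (far t xs x * G0 x y * f y)%:E <= (K * ((1 + x.1 ^+ 2) * far t xs x))%:E)%E.
  move=> x0; under eq_integral do rewrite -mulrA EFinM.
  have mGx : measurable_fun setT ((fun y => G0 x y) : pT -> R) by exact: (meas2_section x mG).
  have mf := good_meas gf.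
  rewrite ge0_integralZl_EFin//=; last 2 first.
  - by move=> y _; rewrite lee_fin; apply: (good_weight_ge0 gf) => y0; exact: G0_ge0.
  - by apply/measurable_EFinP; exact: measurable_funM.
  rewrite mulrCA mulrA mulrC EFinM; apply: lee_wpmul2l; first by rewrite lee_fin far_ge0.
  pose g2 y := gm x y * (eps / eucl_dist x y * near eps x y).
  have g20 y : 0 <= g2 y.
    by rewrite /g2 mulr_ge0 ?gm_ge0// mulr_ge0 ?near_ge0// divr_ge0 ?sqrtr_ge0// ltW.
  have mg2 : measurable_fun setT (g2 : pT -> R).
    have mgx : measurable_fun setT ((fun y => gm x y) : pT -> R) by exact: (meas2_section x (@meas2_gm R)).
    have mdx : measurable_fun setT ((fun y => eucl_dist x y) : pT -> R) by exact: (meas2_section x mD).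
    have mnx : measurable_fun setT ((fun y => near eps x y) : pT -> R) by exact: measurable_near.
    by rewrite /g2; meas.
  have iw := momint_Z ((L + 4) * (1 + x.1 ^+ 2)) (momint_wt gf2).
  have w1 : 0 <= 1 + x.1 ^+ 2 by rewrite addr_ge0 ?sqr_ge0.
  have hh y : 0 <= (L + 4) * (1 + x.1 ^+ 2) * wt y.
    by rewrite mulr_ge0 ?wt_ge0// mulr_ge0//; have := L0; lra.
  apply: (@le_trans _ _ (\int[mu2]_y (((L + 4) * (1 + x.1 ^+ 2) * wt y * f y)%:E + (g2 y * f y)%:E))%E).
    apply: le_integral_nomeas => y _.
      by rewrite lee_fin; apply: (good_weight_ge0 gf) => y0; exact: G0_ge0.
    rewrite -EFinD -mulrDl lee_fin.
    apply: (good_le gf (g := G0 x) (h := fun y => (L + 4) * (1 + x.1 ^+ 2) * wt y + g2 y)) => y0.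
    apply: (le_trans (G0_le_Gmaj e0 (ltW e1) x0 y0)); rewrite /Gmaj -/L -/t.
    have fg := mulr_ge0 (gm_ge0 x y) (far_ge0 t x y).
    have gw := gm_le_wt x0 y0; rewrite -/(g2 y).
    have rr : x.1 * y.1 <= wt x * wt y.
      rewrite /wt; have := sqr_ge0 (x.1 * y.1 - 1); have := sqr_ge0 x.1; have := sqr_ge0 y.1.
      have := sqr_ge0 (x.1 - y.1); nra.
    have k1 : (2 * pi)^-1 <= 1 :> R.
      by rewrite invf_le1 ?mulr_gt0 ?pi_gt0//; have := @pi_ge2 R; lra.
    have B : L * (gm x y - gm x y * far t x y / 2) + 4 * (x.1 * y.1) + g2 y
        <= (L + 4) * (1 + x.1 ^+ 2) * wt y + g2 y.
      rewrite lerD2r -/(wt x); have := ler_wpM2l (ltW L0) gw; have := mulr_ge0 (ltW L0) fg; lra.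
    have B0 : 0 <= L * (gm x y - gm x y * far t x y / 2) + 4 * (x.1 * y.1) + g2 y.
      have h1 : 0 <= gm x y - gm x y * far t x y / 2.
        by have := ler_piMr (gm_ge0 x y) (far_le1 t x y); lra.
      rewrite addr_ge0 ?g20// addr_ge0//; first by rewrite mulr_ge0// ltW.
      by rewrite mulr_ge0// mulr_ge0// ltW.
    by apply: le_trans B; rewrite ler_piMl.
  rewrite ge0_integralD//=; last 4 first.
  - by move=> y _; rewrite lee_fin mulr_ge0.
  - by have /integrableP[] := iw.
  - by move=> y _; rewrite lee_fin mulr_ge0.
  - by apply/measurable_EFinP; exact: measurable_funM.
  rewrite (mom_EFin iw) (momZ _ (momint_wt gf2)).
  apply: (@le_trans _ _ (((L + 4) * (1 + x.1 ^+ 2) * mom f wt)%:E + (32 * c1 * (1 + x.1 ^+ 2))%:E)%E).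
    by apply: leeD; [exact: lexx|exact: (near_potential hc1 e0 (ltW e1) gf2)].
  rewrite -EFinD lee_fin /K; have := ler_wpM2l (mulr_ge0 (ltW (_ : 0 < L + 4)) w1) hA.
  by move=> /(_ (ltr_wpDr (ler0n _ _) L0)); lra.
have : J f (fun x y => far t xs x * G0 x y) <= K * mom f (fun y => (1 + y.1 ^+ 2) * far t xs y).
  rewrite -lee_fin -(Jb_EFin i) -(momZ _ ifar) -(mom_EFin (momint_Z _ ifar)).
  apply: (Jb_le gf m1) => // x y x0 y0.
  by rewrite mulr_ge0 ?far_ge0 ?G0_ge0.
move=> h1; apply: (le_trans h1); apply: (le_trans (ler_wpM2l K0 hO)).
have -> : K * (O * l) = ((1 + 4 * l) * A + 32 * c1 * l) * O.
  have -> : K * (O * l) = (L * l * A + 4 * l * A + 32 * c1 * l) * O by rewrite /K; ring.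
  by rewrite Ll; ring.
rewrite ler_pM2r//; have := ler_piMr (ltW A0) l1; have := ler_piMr (ltW hc1) l1; lra.
Qed.

(** In order: the symmetrised error, the variation of chi in the ball weighted by the energy, the
    energy outside the ball, the error in the energy itself, and the error in the second moment
    multiplied by zeta. *)
Definition cFlux : R := 3 * A ^+ 2 + 2 * (2 * (p ^+ 2 * mu ^+ 2 + c4)) + (5 * A + 32 * c1) * O
  + c4 / 2 + mu / (4 * pi * p ^+ 2) * (8 * A + 2 * O + c5).

Let far01 x : far t xs x = 0 \/ far t xs x = 1.
Proof. by rewrite /far; case: (_ <= _)%R; [right|left]. Qed.

Let chi_near x : 0 < x.1 -> `|ch x - ch xs| <= 4 * t + 2 * far t xs x.
Proof.
move=> x0; case: (far01 x) => [h0|->].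
  have : eucl_dist xs x < t by move: h0; rewrite /far ltNge; case: (_ <= _)%R => //= /eqP; rewrite oner_eq0.
  have := chi_lip n1 dh1 dhlip x0 xs0; rewrite -/ch eucl_distC h0; lra.
have := chi_le1 n dh1 x; have := chi_le1 n dh1 xs; rewrite -/ch !ler_norml => /andP[? ?] /andP[? ?].
by apply/andP; split; have := t0; lra.
Qed.

Lemma energy_term :
  `|J f (fun x y => 2^-1 * (ch x * G0 x y)) - ch xs * (p ^+ 2 * mu ^+ 2 / (4 * pi) * L)|
  <= 2 * (2 * (p ^+ 2 * mu ^+ 2 + c4)) + (5 * A + 32 * c1) * O + c4 / 2.
Proof.
have m1 := measurable_p1 measurable_chi.
have iG := Jint_G0 gf2.
have icG : Jint f (fun x y => ch x * G0 x y).
  apply: (Jint_dom gf2 _ _ iG); first exact: measurable_funM.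
  move=> x y x0 y0; have g0 := G0_ge0 x0 y0.
  by rewrite normrM (ger0_norm g0) ler_piMl// chi_le1.
have ifG : Jint f (fun x y => far t xs x * G0 x y).
  apply: (Jint_dom gf2 _ _ iG).
    by apply: measurable_funM => //; exact: (measurable_p1 (measurable_far xs t)).
  move=> x y x0 y0; have g0 := G0_ge0 x0 y0.
  by rewrite ger0_norm ?ler_piMl ?far_le1// mulr_ge0// far_ge0.
have J0 : 0 <= J f G0.
  have := J_le gf (Jint_Z 0 iG) iG; rewrite (J_Z _ iG) mul0r; apply => x y x0 y0.
  by rewrite mul0r; exact: G0_ge0.
have Lge1 : 1 <= L by rewrite -(invrK L) invf_ge1// invr_gt0.
have pp : 1 <= 2 * pi :> R by have := @pi_ge2 R; lra.
have pm : 0 < p ^+ 2 * mu ^+ 2 by rewrite mulr_gt0 ?exprn_gt0.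
have JL : J f G0 <= (p ^+ 2 * mu ^+ 2 + c4) * L.
  have h1 : p ^+ 2 * mu ^+ 2 / (2 * pi) * L <= p ^+ 2 * mu ^+ 2 * L.
    by rewrite ler_wpM2r ?(ltW L0)// ler_pdivrMr ?(lt_le_trans _ pp)// ler_peMr// ltW.
  have h2 : c4 <= c4 * L by rewrite ler_peMr// ltW.
  by have := hE; rewrite ler_norml => /andP[_]; lra.
(* In the ball chi varies by O(t), and t <= 2 / L compensates an energy of order L. *)
have tJ : t * J f G0 <= 2 * (p ^+ 2 * mu ^+ 2 + c4).
  have q0 : 0 <= (p ^+ 2 * mu ^+ 2 + c4) * L by exact: le_trans JL.
  apply: (@le_trans _ _ (2 * l * ((p ^+ 2 * mu ^+ 2 + c4) * L))); first exact: ler_pM.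
  have -> : 2 * l * ((p ^+ 2 * mu ^+ 2 + c4) * L) = 2 * (p ^+ 2 * mu ^+ 2 + c4) * (L * l) by ring.
  by rewrite Ll mulr1.
have D : `|J f (fun x y => 2^-1 * (ch x * G0 x y) + - (ch xs / 2) * G0 x y)|
    <= 2 * (2 * (p ^+ 2 * mu ^+ 2 + c4)) + (5 * A + 32 * c1) * O.
  have ib := Jint_D (Jint_Z (2 * t) iG) ifG.
  apply: (le_trans (J_bound_dom gf2 (b := fun x y => 2 * t * G0 x y + far t xs x * G0 x y) _ ib)).
    move=> x y x0 y0; have g0 := G0_ge0 x0 y0.
    have -> : 2^-1 * (ch x * G0 x y) + - (ch xs / 2) * G0 x y = (ch x - ch xs) / 2 * G0 x y by field.
    rewrite normrM (ger0_norm g0) -mulrDl ler_wpM2r//.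
    by rewrite normrM [X in _ * X]ger0_norm//; have := chi_near x0; lra.
  rewrite (J_D (Jint_Z (2 * t) iG) ifG) (J_Z _ iG); have := far_energy_le; lra.
rewrite (J_D (Jint_Z _ icG) (Jint_Z _ iG)) (J_Z _ iG) in D.
set a := J f _ in D *.
have -> : a - ch xs * (p ^+ 2 * mu ^+ 2 / (4 * pi) * L) =
   (a + - (ch xs / 2) * J f G0) + ch xs / 2 * (J f G0 - p ^+ 2 * mu ^+ 2 / (2 * pi) * L).
  by have := pi_gt0 R; move: (pi) => q q0; field; rewrite gt_eqF.
apply: le_trans (ler_normD _ _) _; apply: lerD => //.
have c1' := chi_le1 n dh1 xs; rewrite -/ch in c1'.
rewrite -[ch xs / 2 * _]mulrAC normrM normrM (ger0_norm (_ : 0 <= 2^-1))//.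
rewrite ler_pM2r//; apply: le_trans hE; exact: ler_piMl.
Qed.

Lemma momint_chi_r2 : momint f (fun x => chi n dh x * x.1 ^+ 2).
Proof.
apply: (mom_integrable gf2 (a := 1)) => //.
  by apply: measurable_funM; [exact: measurable_chi|exact: measurable_r2].
move=> x x0; rewrite mul1r normrM (ger0_norm (sqr_ge0 _)).
by apply: (@le_trans _ _ (x.1 ^+ 2)); [rewrite ler_piMl ?sqr_ge0 ?chi_le1|rewrite lerDr].
Qed.

Lemma moment_term : `|mom f (fun x => chi n dh x * x.1 ^+ 2) - ch xs * (p ^+ 4 * mu)|
   <= (8 * A + 2 * O + c5) * l.
Proof.
have i1 := momint_chi_r2; have i2 := momint_r2 gf2; have i3 := momint_r2_far gf2 xs.
have D : `|mom f (fun x => chi n dh x * x.1 ^+ 2 + - ch xs * r2 x)| <= 8 * A * l + 2 * (O * l).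
  have i4 := momint_D (momint_Z (4 * t) i2) (momint_Z 2 i3).
  apply: (@le_trans _ _ (mom f (fun x => 4 * t * r2 x + 2 * ((1 + x.1 ^+ 2) * far t xs x)))).
    apply: (mom_bound gf2 (h := fun x => 4 * t * r2 x + 2 * ((1 + x.1 ^+ 2) * far t xs x))); last first.
      by rewrite (mom_EFin i4).
    move=> x x0; rewrite /r2 -/ch.
    have -> : ch x * x.1 ^+ 2 + - ch xs * x.1 ^+ 2 = (ch x - ch xs) * x.1 ^+ 2 by ring.
    rewrite normrM (ger0_norm (sqr_ge0 _)).
    have := ler_wpM2r (sqr_ge0 x.1) (chi_near x0); have := far_ge0 t xs x; lra.
  rewrite (momD (momint_Z (4 * t) i2) (momint_Z 2 i3)) (momZ _ i2) (momZ _ i3).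
  have A2 : mom f r2 <= A.
    have m1 : 0 <= mom f one by apply: (mom_ge0 gf2) => x _; exact: ler01.
    by have := hA; rewrite (mom_wt gf2); lra.
  have m2 : 0 <= mom f r2 by apply: (mom_ge0 gf2) => x _; exact: sqr_ge0.
  have : 4 * t * mom f r2 <= 4 * (2 * l) * A.
    by apply: ler_pM => //; rewrite ?mulr_ge0// ler_pM2l.
  by have := hO; lra.
rewrite (momD i1 (momint_Z _ i2)) (momZ _ i2) in D.
set a := mom f (fun x => _ x * _) in D *.
have -> : a - ch xs * (p ^+ 4 * mu) = (a + - ch xs * mom f r2) + ch xs * (mom f r2 - p ^+ 4 * mu) by ring.
apply: le_trans (ler_normD _ _) _.
have : `|ch xs * (mom f r2 - p ^+ 4 * mu)| <= c5 * l.
  by apply: le_trans hm2; rewrite normrM ler_piMl// chi_le1.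
lra.
Qed.

(** Both terms are evaluated with chi frozen at the centre. The flux then becomes chi p^2 mu^2 L /
    (4 pi) and the moment chi p^4 mu; their quotient mu L / (4 pi p^2) is zeta. *)
Theorem static_velocity :
  `|J f (flux_kernel n h dh)
    - mu / (4 * pi * p ^+ 2) * L * mom f (fun x => chi n dh x * x.1 ^+ 2)| <= cFlux.
Proof.
have m1 := measurable_p1 measurable_chi.
have icG : Jint f (fun x y => 2^-1 * (ch x * G0 x y)).
  apply: Jint_Z; apply: (Jint_dom gf2 _ _ (Jint_G0 gf2)); first exact: measurable_funM.
  move=> x y x0 y0; have g0 := G0_ge0 x0 y0.
  by rewrite normrM (ger0_norm g0) ler_piMl// chi_le1.
rewrite (eq_J gf (flux_kernelE n h dh)) (J_D Jint_flux_error icG).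
have h1 := J_flux_error; have h2 := energy_term; have h3 := moment_term.
set a := J f (flux_error _ _ _) in h1 *; set b := J f (fun x y => _) in h2 *.
set m := mom f _ in h3 *.
set q := mu / (4 * pi * p ^+ 2).
have q0 : 0 < q by rewrite /q divr_gt0 ?mulr_gt0 ?pi_gt0 ?exprn_gt0.
have -> : a + b - q * L * m = a + (b - ch xs * (p ^+ 2 * mu ^+ 2 / (4 * pi) * L))
   - q * L * (m - ch xs * (p ^+ 4 * mu)).
  rewrite /q; have := pi_gt0 R; move: (pi) => w w0; field; rewrite ?gt_eqF//.
have tri (u v w : R) : `|u + v - w| <= `|u| + `|v| + `|w|.
  by apply: le_trans (ler_normB _ _) _; rewrite lerD2r ler_normD.
apply: (le_trans (tri _ _ _)); rewrite normrM (ger0_norm (_ : 0 <= q * L)); last by rewrite mulr_ge0 ?ltW.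
have : q * L * `|m - ch xs * (p ^+ 4 * mu)| <= q * (8 * A + 2 * O + c5).
  have := ler_wpM2l (ltW (mulr_gt0 q0 L0)) h3.
  have -> : q * L * ((8 * A + 2 * O + c5) * l) = q * (8 * A + 2 * O + c5) * (L * l) by ring.
  by rewrite Ll mulr1.
rewrite /cFlux -/q; lra.
Qed.

End StaticVelocityEstimate.

(** * The weak equation *)

Section Differentiability.
Context {R : realType}.
Implicit Types (g dg : R -> R) (phi phir phiz psi psir psiz : R * R -> R).
Local Notation pT := (measurableTypeR R * measurableTypeR R)%type.

(** For kernels given by integrals a quadratic remainder is easier to establish than a limit under
    the integral sign, since it can be integrated. *)
Lemma is_derive_quad g (x d C : R) :
  (forall h, `|h| <= 1 -> `|g (x + h) - g x - h * d| <= C * h ^+ 2) -> is_derive x 1 g d.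
Proof.
move=> gq.
have cv : h^-1 *: ((g \o shift x) (h *: (1 : R)) - g x) @[h --> 0^'] --> d.
  apply/cvgrPdist_le => e e0; near=> h.
  have h0 : h != 0 by near: h; exact: nbhs_dnbhs_neq.
  have hp : 0 < `|h| by rewrite normr_gt0.
  have h1 : `|h| <= 1 by near: h; apply: dnbhs0_le.
  have C0 : 0 < `|C| + 1 by rewrite ltr_wpDl.
  have he : `|h| <= e / (`|C| + 1) by near: h; apply: dnbhs0_le; exact: divr_gt0.
  have := gq h h1; rewrite /= /shift/= /GRing.scale/= mulr1 (addrC h x) => q.
  have -> : d - h^-1 * (g (x + h) - g x) = - (h^-1 * (g (x + h) - g x - h * d)) by field.
  rewrite normrN normrM normfV ler_pdivrMl//; apply: (le_trans q).
  rewrite -(@ger0_norm _ (h ^+ 2)) ?sqr_ge0// normrX.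
  have := he; rewrite ler_pdivlMr// => he'.
  have : `|h| * `|h| * C <= `|h| * `|h| * (`|C| + 1).
    by rewrite ler_wpM2l ?mulr_ge0//; have := ler_norm C; lra.
  have := ler_wpM2l (ltW hp) he'; lra.
split; first by apply/cvg_ex; exists d.
exact: cvg_lim cv.
Unshelve. all: by end_near. Qed.

Record C1 (phi phir phiz : R * R -> R) : Prop := MkC1 {
  C1_r : forall x : R * R, is_derive x.1 (1 : R) (fun r => phi (r, x.2)) (phir x) ;
  C1_z : forall x : R * R, is_derive x.2 (1 : R) (fun z => phi (x.1, z)) (phiz x) ;
  C1_cont : continuous phi ; C1_contr : continuous phir ; C1_contz : continuous phiz ;
  C1_meas : measurable_fun setT (phi : pT -> R) ;
  C1_measr : measurable_fun setT (phir : pT -> R) ;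
  C1_measz : measurable_fun setT (phiz : pT -> R) }.

Lemma C1_mul phi phir phiz psi psir psiz : C1 phi phir phiz -> C1 psi psir psiz ->
  C1 (fun x => phi x * psi x) (fun x => phir x * psi x + phi x * psir x)
     (fun x => phiz x * psi x + phi x * psiz x).
Proof.
move=> [a1 a2 a3 a4 a5 a6 a7 a8] [b1 b2 b3 b4 b5 b6 b7 b8]; split.
- move=> x; have h := @is_deriveM _ _ (fun r => phi (r, x.2)) (fun r => psi (r, x.2)) x.1 1 _ _ (a1 x) (b1 x).
  apply: is_derive_eq; rewrite /GRing.scale/= -surjective_pairing; ring.
- move=> x; have h := @is_deriveM _ _ (fun z => phi (x.1, z)) (fun z => psi (x.1, z)) x.2 1 _ _ (a2 x) (b2 x).
  apply: is_derive_eq; rewrite /GRing.scale/= -surjective_pairing; ring.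
- by move=> x; apply: continuousM; [exact: a3|exact: b3].
- by move=> x; apply: cvgD; apply: cvgM;
    [exact: a4|exact: b3|exact: a3|exact: b4].
- by move=> x; apply: cvgD; apply: cvgM;
    [exact: a5|exact: b3|exact: a3|exact: b5].
- exact: measurable_funM.
- by apply: measurable_funD; exact: measurable_funM.
- by apply: measurable_funD; exact: measurable_funM.
Qed.

Lemma C1_radial g dg : (forall r, is_derive r (1 : R) g (dg r)) -> continuous dg ->
  C1 (fun x => g x.1) (fun x => dg x.1) (fun=> 0).
Proof.
move=> gd cdg; have cg : continuous g.
  by move=> r; apply: differentiable_continuous; apply/derivable1_diffP; have [] := gd r.
split.
- by move=> x /=; exact: gd.
- by move=> x /=; exact: is_derive_cst.
- by move=> x; apply: continuous_comp; [exact: cvg_fst|exact: cg].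
- by move=> x; apply: continuous_comp; [exact: cvg_fst|exact: cdg].
- by move=> x; exact: cst_continuous.
- by apply: (measurableT_comp (continuous_measurable_fun cg)).
- by apply: (measurableT_comp (continuous_measurable_fun cdg)).
- exact: measurable_cst.
Qed.

Lemma C1_axial g dg : (forall r, is_derive r (1 : R) g (dg r)) -> continuous dg ->
  C1 (fun x => g x.2) (fun=> 0) (fun x => dg x.2).
Proof.
move=> gd cdg; have cg : continuous g.
  by move=> r; apply: differentiable_continuous; apply/derivable1_diffP; have [] := gd r.
split.
- by move=> x /=; exact: is_derive_cst.
- by move=> x /=; exact: gd.
- by move=> x; apply: continuous_comp; [exact: cvg_snd|exact: cg].
- by move=> x; exact: cst_continuous.
- by move=> x; apply: continuous_comp; [exact: cvg_snd|exact: cdg].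
- by apply: (measurableT_comp (continuous_measurable_fun cg)).
- exact: measurable_cst.
- by apply: (measurableT_comp (continuous_measurable_fun cdg)).
Qed.

End Differentiability.

Section Flux.
Context {R : realType}.
Local Notation mu2 := (@plane_measure R).
Local Notation pT := (measurableTypeR R * measurableTypeR R)%type.
Implicit Types (x y : R * R) (phi phir phiz b : R * R -> R).

(** The velocity is written with the off-diagonal kernels and integrated over the whole plane; it is
    used for densities that vanish outside the half-plane. *)
Definition vr (f : R * R -> R) x : R := mom f (KR x).
Definition vz (f : R * R -> R) x : R := mom f (KZ x).
Definition flux (f : R * R -> R) phir phiz : R :=
  mom f (fun x => phir x * vr f x + phiz x * vz f x).

Variables (c M : R) (f : R * R -> R).
Hypothesis gf : good c M f.
Let M0 : 0 <= M. Proof. exact: good_M_ge0 gf. Qed.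
Let f0 := good_ge0 gf.
Let mf : measurable_fun setT (f : pT -> R) := good_meas gf.

Lemma potential2_le x : (\int[mu2]_y (2 / eucl_dist x y * f y)%:E <= (34 * M)%:E)%E.
Proof.
under eq_integral do rewrite -mulrA EFinM.
rewrite ge0_integralZl_EFin//=; last 2 first.
- by move=> y _; rewrite lee_fin mulr_ge0// invr_ge0 sqrtr_ge0.
- apply/measurable_EFinP; apply: measurable_funM => //; apply: measurable_funV.
  exact: (meas2_section x (@measurable_eucl_dist R)).
rewrite (_ : 34 * M = 2 * (17 * M)); last by ring.
by rewrite EFinM; apply: lee_wpmul2l; [rewrite lee_fin|exact: potential_le gf x].
Qed.

Lemma vr_bound x : 0 < x.1 -> `|vr f x| <= 34 * M.
Proof.
move=> x0; apply: (@Rintegral_bound _ _ _ mu2 setT _ (fun y => 2 / eucl_dist x y * f y)).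
  by move=> y _; apply: (good_weight_norm gf (h := fun y => 2 / eucl_dist x y)) => y0; exact: KR_bound.
exact: potential2_le.
Qed.

Lemma vz_bound x : 0 < x.1 -> `|vz f x| <= 34 * M.
Proof.
move=> x0; apply: (@Rintegral_bound _ _ _ mu2 setT _ (fun y => 2 / eucl_dist x y * f y)).
  by move=> y _; apply: (good_weight_norm gf (h := fun y => 2 / eucl_dist x y)) => y0; exact: KZ_bound.
exact: potential2_le.
Qed.

Lemma measurable_mom_section k : meas2 k -> measurable_fun setT ((fun x => mom f (k x)) : pT -> R).
Proof.
move=> mk; apply: (@measurable_fun_param_Rintegral _ _ pT pT R mu2 setT (fun p => k p.1 p.2 * f p.2)) => //.
by apply: measurable_funM => //; exact: measurable_p2.
Qed.

Lemma measurable_vr : measurable_fun setT (vr f : pT -> R).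
Proof. exact: measurable_mom_section (@measurable_KR R). Qed.

Lemma measurable_vz : measurable_fun setT (vz f : pT -> R).
Proof. exact: measurable_mom_section (@measurable_KZ R). Qed.

Lemma flux_density_bound phir phiz b x : 0 < x.1 ->
  `|phir x| <= b x -> `|phiz x| <= b x ->
  `|phir x * vr f x + phiz x * vz f x| <= 68 * M * b x.
Proof.
move=> x0 hr hz; have h1 := vr_bound x0; have h2 := vz_bound x0.
apply: le_trans (ler_normD _ _) _; rewrite !normrM.
have : `|phir x| * `|vr f x| <= b x * (34 * M) by exact: ler_pM.
have : `|phiz x| * `|vz f x| <= b x * (34 * M) by exact: ler_pM.
lra.
Qed.

Lemma flux_bound phir phiz b (B : R) :
  (forall x, 0 < x.1 -> `|phir x| <= b x /\ `|phiz x| <= b x) ->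
  (\int[mu2]_x (68 * M * b x * f x)%:E <= B%:E)%E ->
  `|flux f phir phiz| <= B.
Proof.
move=> hb hB; apply: (@Rintegral_bound _ _ _ mu2 setT _ (fun x => 68 * M * b x * f x)) => // x _.
apply: (good_weight_norm gf (g := fun x => phir x * vr f x + phiz x * vz f x)
  (h := fun x => 68 * M * b x)) => x0.
by have [h1 h2] := hb x x0; exact: (flux_density_bound (b := b)).
Qed.

Lemma momint_flux phir phiz b (B : R) :
  measurable_fun setT (phir : pT -> R) -> measurable_fun setT (phiz : pT -> R) ->
  (forall x, 0 < x.1 -> `|phir x| <= b x /\ `|phiz x| <= b x) ->
  (\int[mu2]_x (68 * M * b x * f x)%:E <= B%:E)%E ->
  momint f (fun x => phir x * vr f x + phiz x * vz f x).
Proof.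
move=> mr mz hb hB; apply: (good_integrable gf (h := fun x => 68 * M * b x) (B := B)) => //.
  by apply: measurable_funD; apply: measurable_funM => //; [exact: measurable_vr|exact: measurable_vz].
by move=> x x0; have [h1 h2] := hb x x0; exact: (flux_density_bound (b := b)).
Qed.

(** A bounded gradient makes the double kernel integrable, so that Fubini turns the flux into a
    double integral, which can be symmetrised. *)
Lemma flux_kernel_integral (C : R) phir phiz : 0 <= C ->
  measurable_fun setT (phir : pT -> R) -> measurable_fun setT (phiz : pT -> R) ->
  (forall x, 0 < x.1 -> `|phir x| <= C /\ `|phiz x| <= C) ->
  Jint f (fun x y => phir x * KR x y + phiz x * KZ x y) /\
  flux f phir phiz = J f (fun x y => phir x * KR x y + phiz x * KZ x y).
Proof.
move=> C0 mr mz hb.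
have mKR := @measurable_KR R; have mKZ := @measurable_KZ R; have mD := @measurable_eucl_dist R.
pose k x y := phir x * KR x y + phiz x * KZ x y.
have mk : meas2 k.
  by apply: measurable_funD; apply: measurable_funM => //; [exact: (measurable_p1 mr)|exact: (measurable_p1 mz)].
have kb x y : 0 < x.1 -> 0 < y.1 -> `|k x y| <= 2 * C * (2 / eucl_dist x y).
  move=> x0 y0; have [h1 h2] := hb x x0; apply: le_trans (ler_normD _ _) _.
  have : `|phir x * KR x y| <= C * (2 / eucl_dist x y) by rewrite normrM; apply: ler_pM => //; exact: KR_bound.
  have : `|phiz x * KZ x y| <= C * (2 / eucl_dist x y) by rewrite normrM; apply: ler_pM => //; exact: KZ_bound.
  lra.
have K0 : 0 <= 2 * C by rewrite mulr_ge0.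
have d0 x y : 0 <= 2 / eucl_dist x y by rewrite divr_ge0// sqrtr_ge0.
have row x : (\int[mu2]_y (2 * C * (2 / eucl_dist x y) * f y)%:E <= (2 * C * (34 * M))%:E)%E.
  under eq_integral do rewrite -mulrA EFinM.
  rewrite ge0_integralZl_EFin//=; last 2 first.
  - by move=> y _; rewrite lee_fin mulr_ge0 ?(good_ge0 gf).
  - apply/measurable_EFinP; apply: measurable_funM => //; apply: measurable_funM => //.
    by apply: measurable_funV; exact: (meas2_section x mD).
  rewrite (EFinM (2 * C) (34 * M)); apply: lee_wpmul2l; first by rewrite lee_fin.
  exact: potential2_le x.
have Jk : Jint f k.
  apply: (J_integrable gf mk kb (B := 2 * C * (34 * M) * M)).
  apply: (@le_trans _ _ (\int[mu2]_x (2 * C * (34 * M) * f x)%:E)%E).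
    apply: (Jb_le gf (beta := fun=> 2 * C * (34 * M))) => [|x y _ _|x x0].
    - by rewrite /meas2; meas.
    - exact: mulr_ge0.
    - exact: row.
  have B0 : 0 <= 2 * C * (34 * M) by exact: mulr_ge0 K0 (mulr_ge0 (ler0n _ _) M0).
  have := @good_integral_le _ _ _ _ gf (fun=> 2 * C * (34 * M)) (2 * C * (34 * M)) 0.
  by rewrite addr0; apply => // x x0; rewrite mul0r addr0 lexx B0.
split; first exact: Jk.
rewrite -/k (J_iterated gf Jk); last first.
  move=> x x0; apply: (good_integrable gf (h := fun y => 2 * C * (2 / eucl_dist x y)) (B := 2 * C * (34 * M))) => //.
  - exact: meas2_section.
  - by move=> y y0; exact: kb.
have iK (kk : R * R -> R * R -> R) x : meas2 kk -> (forall y, 0 < y.1 -> `|kk x y| <= 2 / eucl_dist x y) -> momint f (kk x).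
  move=> mkk hk; apply: (good_integrable gf (h := fun y => 2 / eucl_dist x y) (B := 34 * M)) => //.
  - exact: meas2_section.
  - exact: potential2_le x.
apply: (eq_mom gf) => x x0.
have i1 : momint f (KR x) by apply: iK => // y y0; exact: KR_bound.
have i2 : momint f (KZ x) by apply: iK => // y y0; exact: KZ_bound.
by rewrite /vr /vz -(momZ _ i1) -(momZ _ i2) -(momD (momint_Z _ i1) (momint_Z _ i2)).
Qed.

End Flux.

Section Cutoffs.
Context {R : realType}.
Implicit Types (y r z : R).

(** The squared positive part is the elementary C1 function from which all the cutoffs are
    composed. *)
Definition possq y : R := Num.max y 0 ^+ 2.
Definition dpossq y : R := 2 * Num.max y 0.

Lemma is_derive_possq y : is_derive y (1 : R) possq (dpossq y).
Proof.
apply: (@is_derive_quad _ _ _ _ 1) => h _; rewrite mul1r /possq /dpossq.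
have := sqr_ge0 h; have := sqr_ge0 (y + h); have := sqr_ge0 y.
have [y0|y0] := leP y 0; have [yh0|yh0] := leP (y + h) 0; rewrite ?expr0n/= ler_norml => *; apply/andP; split; nra.
Qed.

Lemma continuous_dpossq : continuous dpossq.
Proof.
move=> y; apply: cvgM; first exact: cvg_cst.
by apply: continuous_max => //; exact: cst_continuous.
Qed.

Lemma possq_ge0 y : 0 <= possq y. Proof. exact: sqr_ge0. Qed.
Lemma dpossq_ge0 y : 0 <= dpossq y. Proof. by rewrite mulr_ge0// le_max lexx orbT. Qed.
Lemma possq_neg y : y <= 0 -> possq y = 0.
Proof. by move=> y0; rewrite /possq; case: (leP y 0) y0 => // *; rewrite expr0n. Qed.
Lemma dpossq_neg y : y <= 0 -> dpossq y = 0.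
Proof. by move=> y0; rewrite /dpossq; case: (leP y 0) y0 => // *; rewrite mulr0. Qed.
Lemma possq_pos y : 0 <= y -> possq y = y ^+ 2.
Proof. by move=> y0; rewrite /possq; case: (leP y 0) => // y1; rewrite (le_anti (introT andP (conj y0 y1))). Qed.
Lemma dpossq_pos y : 0 <= y -> dpossq y = 2 * y.
Proof. by move=> y0; rewrite /dpossq; case: (leP y 0) => // y1; rewrite (le_anti (introT andP (conj y0 y1))). Qed.

Lemma possq_le1 y : y <= 1 -> possq y <= 1.
Proof.
move=> y1; have [y0|/ltW y0] := leP y 0; first by rewrite possq_neg.
by rewrite possq_pos// expr_le1.
Qed.

(** A transition from 0 to 1 on [0, 1]; [possq] is applied at either end so that the derivative
    vanishes at both. *)
Definition ramp y : R := 1 - possq (1 - possq y).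
Definition dramp y : R := dpossq (1 - possq y) * dpossq y.

Lemma is_derive_ramp y : is_derive y (1 : R) ramp (dramp y).
Proof.
have h1 := is_derive_possq y.
have h0 : is_derive y (1 : R) (fun=> 1 : R) 0 by exact: is_derive_cst.
have h2 : is_derive y (1 : R) (fun y => 1 - possq y) (0 - dpossq y) by exact: is_deriveB h0 h1.
have h3 : is_derive y (1 : R) (fun y => possq (1 - possq y)) _ :=
  @is_derive1_comp _ possq (fun y => 1 - possq y) y _ _ (is_derive_possq _) h2.
have h4 : is_derive y (1 : R) ramp _ := is_deriveB h0 h3.
by apply: is_derive_eq; rewrite /dramp; ring.
Qed.

Lemma continuous_possq : continuous possq.
Proof.
by move=> y; apply: differentiable_continuous; apply/derivable1_diffP; have [] := is_derive_possq y.
Qed.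

Lemma continuous_dramp : continuous dramp.
Proof.
move=> y; apply: cvgM; last exact: continuous_dpossq.
apply: (@continuous_comp _ _ _ (fun y => 1 - possq y) dpossq); last exact: continuous_dpossq.
by apply: continuousB; [exact: cst_continuous|exact: continuous_possq].
Qed.

Lemma ramp01 y : 0 <= ramp y <= 1.
Proof.
have : possq (1 - possq y) <= 1 by apply: possq_le1; have := possq_ge0 y; lra.
by have := possq_ge0 (1 - possq y); rewrite /ramp; move=> *; apply/andP; split; lra.
Qed.

Lemma ramp_neg y : y <= 0 -> ramp y = 0.
Proof. by move=> y0; rewrite /ramp (possq_neg y0) subr0 possq_pos// expr1n subrr. Qed.

Lemma ramp_ge1 y : 1 <= y -> ramp y = 1.
Proof.
move=> y1; rewrite /ramp possq_neg ?subr0// subr_le0 possq_pos ?(le_trans ler01)//.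
by rewrite expr_ge1 ?(le_trans ler01).
Qed.

Lemma dramp_neg y : y <= 0 -> dramp y = 0.
Proof. by move=> y0; rewrite /dramp (dpossq_neg y0) mulr0. Qed.

Lemma dramp_ge1 y : 1 <= y -> dramp y = 0.
Proof.
move=> y1; rewrite /dramp dpossq_neg ?mul0r// subr_le0 possq_pos ?(le_trans ler01)//.
by rewrite expr_ge1 ?(le_trans ler01).
Qed.

Lemma dramp_bound y : `|dramp y| <= 4.
Proof.
have [y0|/ltW y0] := leP y 0; first by rewrite dramp_neg// normr0.
have [y1|/ltW y1] := leP 1 y; first by rewrite dramp_ge1// normr0.
rewrite ger0_norm; last by rewrite mulr_ge0 ?dpossq_ge0.
have a : dpossq y <= 2 by rewrite dpossq_pos//; lra.
have b : dpossq (1 - possq y) <= 2.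
  have := possq_ge0 y; have := possq_le1 y1 => *; rewrite dpossq_pos; lra.
by apply: le_trans (ler_pM (dpossq_ge0 _) (dpossq_ge0 _) b a) _; lra.
Qed.

End Cutoffs.

Section CutoffFamily.
Context {R : realType}.
Local Notation mu2 := (@plane_measure R).
Local Notation pT := (measurableTypeR R * measurableTypeR R)%type.
Implicit Types (x y : R * R) (g dg k dk : R -> R).

Lemma C1_eq (phi phir phiz phir' phiz' : R * R -> R) : phir =1 phir' -> phiz =1 phiz' ->
  C1 phi phir phiz -> C1 phi phir' phiz'.
Proof. by move=> /funext -> /funext ->. Qed.

Lemma C1_separated g dg k dk :
  (forall r, is_derive r (1 : R) g (dg r)) -> continuous dg ->
  (forall z, is_derive z (1 : R) k (dk z)) -> continuous dk ->
  C1 (fun x => g x.1 * k x.2) (fun x => dg x.1 * k x.2) (fun x => g x.1 * dk x.2).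
Proof.
move=> gd cdg kd cdk; apply: (C1_eq _ _ (C1_mul (C1_radial gd cdg) (C1_axial kd cdk))) => x.
  by rewrite mulr0 addr0.
by rewrite mul0r add0r.
Qed.

Lemma plane_measure_rect (A B : set (measurableTypeR R)) : measurable A -> measurable B ->
  mu2 (A `*` B) = (lebesgue_measure A * lebesgue_measure B)%E.
Proof. by move=> mA mB; rewrite /plane_measure product_measure1E. Qed.

Section fixed.
Variable n : R.
Hypothesis n1 : 1 <= n.
Let n0 : 0 < n. Proof. exact: lt_le_trans n1. Qed.
Let nn : 0 < n ^+ 2. Proof. exact: exprn_gt0. Qed.

Definition cutz (z : R) : R := possq (1 - z ^+ 2 / n ^+ 2).
Definition dcutz (z : R) : R := dpossq (1 - z ^+ 2 / n ^+ 2) * (- (2 * z / n ^+ 2)).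
(** The inner scale is n^-2 and the outer one n. With an inner scale delta, the gradient 1 / delta,
    an area of order delta n and a density of order c delta produce c n delta, which has to tend to
    0. *)
Definition cutr (r : R) : R := ramp (n ^+ 2 * r - 1) * cutz r.
Definition dcutr (r : R) : R :=
  n ^+ 2 * dramp (n ^+ 2 * r - 1) * cutz r + ramp (n ^+ 2 * r - 1) * dcutz r.

Lemma is_derive_cutz z : is_derive z (1 : R) cutz (dcutz z).
Proof.
have h0 : is_derive z (1 : R) (fun z => 1 - z ^+ 2 / n ^+ 2) (- (2 * z / n ^+ 2)).
  apply: (@is_derive_quad _ _ _ _ ((n ^+ 2)^-1)) => h _.
  rewrite (_ : _ - _ - _ = - (h ^+ 2 / n ^+ 2)); last by field; rewrite gt_eqF.
  by rewrite normrN ger0_norm ?divr_ge0 ?sqr_ge0// mulrC.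
exact: (@is_derive1_comp _ possq (fun z => 1 - z ^+ 2 / n ^+ 2) z _ _ (is_derive_possq _) h0).
Qed.

Lemma is_derive_cutr r : is_derive r (1 : R) cutr (dcutr r).
Proof.
have h0 : is_derive r (1 : R) (fun r => n ^+ 2 * r - 1) (n ^+ 2).
  apply: (@is_derive_quad _ _ _ _ 0) => h _; rewrite mul0r.
  by rewrite (_ : _ - _ - _ = 0) ?normr0//; ring.
have h1 := @is_derive1_comp _ ramp (fun r => n ^+ 2 * r - 1) r _ _ (is_derive_ramp _) h0.
have h2 : is_derive r (1 : R) cutr _ := is_deriveM h1 (is_derive_cutz r).
by apply: is_derive_eq; rewrite /dcutr /GRing.scale/=; ring.
Qed.

Let csq : continuous (fun z : R => 1 - z ^+ 2 / n ^+ 2).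
Proof.
move=> z; apply: cvgB; first exact: cvg_cst.
by apply: cvgM; [exact: exprn_continuous|exact: cvg_cst].
Qed.

Lemma continuous_cutz : continuous cutz.
Proof. by move=> z; exact: (@continuous_comp _ _ _ (fun z : R => 1 - z ^+ 2 / n ^+ 2) (@possq R) z (@csq z) (@continuous_possq _ _)). Qed.

Lemma continuous_dcutz : continuous dcutz.
Proof.
move=> z; apply: cvgM; first by exact: (@continuous_comp _ _ _ (fun z : R => 1 - z ^+ 2 / n ^+ 2) (@dpossq R) z (@csq z) (@continuous_dpossq _ _)).
apply: cvgN; apply: cvgM; last exact: cvg_cst.
by apply: cvgM; [exact: cvg_cst|exact: cvg_id].
Qed.

Lemma continuous_dcutr : continuous dcutr.
Proof.
have ca : continuous (fun r : R => n ^+ 2 * r - 1).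
  move=> r; apply: cvgB; last exact: cvg_cst.
  by apply: cvgM; [exact: cvg_cst|exact: cvg_id].
have cramp : continuous (@ramp R).
  by move=> y; apply: differentiable_continuous; apply/derivable1_diffP; have [] := is_derive_ramp y.
move=> r; apply: cvgD.
  apply: cvgM; last exact: continuous_cutz.
  by apply: cvgM; [exact: cvg_cst|apply: (@continuous_comp _ _ _ (fun r : R => n ^+ 2 * r - 1) dramp r (ca r)); exact: continuous_dramp].
by apply: cvgM; [apply: (@continuous_comp _ _ _ (fun r : R => n ^+ 2 * r - 1) ramp r (ca r)); exact: cramp|exact: continuous_dcutz].
Qed.

Definition cut x : R := cutr x.1 * cutz x.2.
Definition cut_r x : R := dcutr x.1 * cutz x.2.
Definition cut_z x : R := cutr x.1 * dcutz x.2.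

Lemma C1_cut : C1 cut cut_r cut_z.
Proof.
exact: (C1_separated is_derive_cutr continuous_dcutr is_derive_cutz continuous_dcutz).
Qed.

Lemma cutz01 z : 0 <= cutz z <= 1.
Proof.
rewrite possq_ge0/= possq_le1// gerBl divr_ge0 ?sqr_ge0//.
Qed.

Lemma cutr01 r : 0 <= cutr r <= 1.
Proof.
have /andP[a0 a1] := ramp01 (n ^+ 2 * r - 1); have /andP[b0 b1] := cutz01 r.
by rewrite mulr_ge0//= mulr_ile1.
Qed.

Lemma cut01 x : 0 <= cut x <= 1.
Proof.
have /andP[a0 a1] := cutr01 x.1; have /andP[b0 b1] := cutz01 x.2.
by rewrite mulr_ge0//= mulr_ile1.
Qed.

Lemma cutz_out z : n <= `|z| -> cutz z = 0 /\ dcutz z = 0.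
Proof.
move=> nz; have h : 1 - z ^+ 2 / n ^+ 2 <= 0.
  rewrite subr_le0 ler_pdivlMr// mul1r -(real_normK (num_real z)).
  by rewrite lerXn2r ?nnegrE// ltW.
by rewrite /cutz /dcutz possq_neg// dpossq_neg// mul0r.
Qed.

Lemma dcutz_bound z : `|dcutz z| <= 4 / n.
Proof.
have [nz|zn] := leP n `|z|.
  by have [_ ->] := cutz_out nz; rewrite normr0 divr_ge0// ltW.
have d2 : dpossq (1 - z ^+ 2 / n ^+ 2) <= 2.
  have q0 : 0 <= z ^+ 2 / n ^+ 2 by rewrite divr_ge0 ?sqr_ge0.
  have [h|/ltW h] := leP (1 - z ^+ 2 / n ^+ 2) 0; first by rewrite dpossq_neg.
  by rewrite dpossq_pos//; lra.
rewrite normrM normrN (ger0_norm (dpossq_ge0 _)).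
have -> : 4 / n = 2 * (2 / n) by field; rewrite gt_eqF.
apply: ler_pM => //; first exact: dpossq_ge0.
rewrite normrM normfV (gtr0_norm nn) normrM (ger0_norm (ler0n _ _)) ler_pdivrMr//.
have -> : 2 / n * n ^+ 2 = 2 * n by field; rewrite gt_eqF.
by rewrite ler_pM2l// ltW.
Qed.

Definition strip x : R := ((x.1 < 2 / n ^+ 2) && (`|x.2| < n))%R%:R.

Lemma strip_ge0 x : 0 <= strip x. Proof. by rewrite ler0n. Qed.

Lemma cut_z_bound x : `|cut_z x| <= 4 / n.
Proof.
have /andP[a0 a1] := cutr01 x.1; rewrite normrM (ger0_norm a0).
by apply: le_trans (dcutz_bound x.2); rewrite ler_piMl.
Qed.

Lemma cut_r_bound x : `|cut_r x| <= 4 / n + 4 * n ^+ 2 * strip x.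
Proof.
have /andP[b0 b1] := cutz01 x.2; have /andP[c0 c1] := cutz01 x.1.
have /andP[a0 a1] := ramp01 (n ^+ 2 * x.1 - 1).
have q : 0 <= 4 / n by rewrite divr_ge0// ltW.
have s0 : 0 <= 4 * n ^+ 2 * strip x by rewrite !mulr_ge0 ?strip_ge0// ltW.
have [nz|zn] := leP n `|x.2|.
  by have [h _] := cutz_out nz; rewrite /cut_r h mulr0 normr0 addr_ge0.
rewrite normrM (ger0_norm b0); apply: (@le_trans _ _ `|dcutr x.1|); first by rewrite ler_piMr.
apply: le_trans (ler_normD _ _) _; rewrite addrC; apply: lerD.
  by rewrite normrM (ger0_norm a0); apply: le_trans (dcutz_bound x.1); rewrite ler_piMl.
have [h|h] := leP (2 / n ^+ 2) x.1.
  rewrite dramp_ge1 ?mulr0 ?mul0r ?normr0//.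
  by move: h; rewrite ler_pdivrMr//; lra.
rewrite /strip h zn mulr1 normrM (ger0_norm c0).
apply: (@le_trans _ _ `|n ^+ 2 * dramp (n ^+ 2 * x.1 - 1)|); first by rewrite ler_piMr.
by rewrite normrM (ger0_norm (ltW nn)) mulrC ler_pM2r// dramp_bound.
Qed.

Lemma cut_support : exists A : set (R * R), [/\ compact A, A `<=` (@halfplane R) &
  forall x, ~ A x -> cut x = 0].
Proof.
exists (`[(n ^+ 2)^-1, n]%classic `*` `[- n, n]%classic); split.
- by apply: compact_setX; exact: segment_compact.
- move=> x [/= + _]; rewrite in_itv/= => /andP[h _]; apply: lt_le_trans h.
  by rewrite invr_gt0.
- move=> x; have [nz|zn] := leP n `|x.2|.
    by have [h _] := cutz_out nz; rewrite /cut h mulr0.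
  have [nz|rn] := leP n `|x.1|.
    by have [h _] := cutz_out nz; rewrite /cut /cutr h mulr0 mul0r.
  have [h|h] := leP x.1 ((n ^+ 2)^-1).
    rewrite /cut /cutr ramp_neg ?mul0r// subr_le0.
    by have := ler_wpM2l (ltW nn) h; rewrite mulfV ?gt_eqF.
  case; split => /=; rewrite in_itv/=.
    by rewrite (ltW h)/=; move: rn; rewrite ltr_norml => /andP[_ /ltW].
  by move: zn; rewrite ltr_norml => /andP[/ltW -> /ltW ->].
Qed.

Lemma measurable_strip : measurable_fun setT (strip : pT -> R).
Proof.
apply: measurable_fun_bool_nat; apply: measurable_and.
  by apply: measurable_fun_ltr; [exact: measurable_fst|exact: measurable_cst].
apply: measurable_fun_ltr; last exact: measurable_cst.
by apply: measurableT_comp => //; exact: measurable_snd.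
Qed.

Variables (c M : R) (f : R * R -> R).
Hypothesis gf : good c M f.

Lemma strip_mass : 0 <= c ->
  (\int[mu2]_x (4 * n ^+ 2 * strip x * f x)%:E <= (32 * c / n)%:E)%E.
Proof.
move=> c0.
pose D : set pT := `]0, 2 / n ^+ 2[%classic `*` `]- n, n[%classic.
have mD : measurable D by apply: measurableX; exact: measurable_itv.
have e0 : 0 < 2 / n ^+ 2 by rewrite divr_gt0.
apply: (@le_trans _ _ (\int[mu2]_x ((8 * c)%:E * (\1_D x)%:E))%E).
  apply: le_integral_nomeas => x _.
    by rewrite lee_fin !mulr_ge0 ?strip_ge0 ?(good_ge0 gf)// ltW.
  rewrite -EFinM lee_fin.
  have [->|/(good_halfplane gf) h1] := eqVneq (f x) 0; first by rewrite mulr0 mulr_ge0 ?mulr_ge0.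
  have q0 : 0 <= 8 * c * \1_D x by rewrite !mulr_ge0.
  rewrite /strip; have [h2|h2] := ltP x.1 (2 / n ^+ 2); last by rewrite mulr0 mul0r.
  have [h3|h3] := ltP `|x.2| n; last by rewrite mulr0 mul0r.
  rewrite indicE mem_set; last first.
    by split => /=; rewrite in_itv/= ?h1 ?h2//; move: h3; rewrite ltr_norml.
  rewrite !mulr1.
  have : f x <= c * (2 / n ^+ 2).
    by apply: le_trans (good_c gf h1) _; rewrite ler_wpM2l// ltW.
  have n4 : 0 <= 4 * n ^+ 2 by rewrite mulr_ge0// ltW.
  move=> /(ler_wpM2l n4) h; apply: (le_trans h); rewrite le_eqVlt; apply/orP; left; apply/eqP; field; rewrite gt_eqF//.
rewrite ge0_integralZl_EFin//=; last 2 first.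
- by apply/measurable_EFinP; exact: measurable_indic.
- by rewrite mulr_ge0.
rewrite integral_indic// setIT /D.
have E := plane_measure_rect (measurable_itv `]0, 2 / n ^+ 2[) (measurable_itv `]- n, n[).
rewrite -[X in (_ * X <= _)%E]/(mu2 (`]0, 2 / n ^+ 2[%classic `*` `]- n, n[%classic)) E.
rewrite !lebesgue_measure_itv/= !lte_fin e0 (_ : - n < n); last by have := n0; lra.
rewrite -!EFinB -!EFinM lee_fin le_eqVlt; apply/orP; left; apply/eqP; field; rewrite gt_eqF//.
Qed.

End fixed.
End CutoffFamily.

Section Tails.
Context {R : realType}.
Local Notation mu2 := (@plane_measure R).
Local Notation pT := (measurableTypeR R * measurableTypeR R)%type.
Implicit Types (x y : R * R).

Definition tail (n : R) x : R := 1 - cut n x.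
Definition lin x : R := 1 + x.1.

Lemma tail01 n x : 0 <= tail n x <= 1.
Proof. by have /andP[h0 h1] := cut01 n x; rewrite /tail; apply/andP; split; lra. Qed.

Lemma measurable_tail n : 1 <= n -> measurable_fun setT (tail n : pT -> R).
Proof. by move=> n1; apply: measurable_funB => //; exact: C1_meas (C1_cut n1). Qed.

Lemma cut_cvg x : 0 < x.1 -> (cut k.+1%:R x) @[k --> \oo] --> (1 : R).
Proof.
move=> x0.
have inv : (@harmonic R) @ \oo --> (0 : R) by exact: cvg_harmonic.
have cz z : cutz k.+1%:R z @[k --> \oo] --> (1 : R).
  rewrite [X in _ --> X](_ : 1 = possq (1 - (z * 0) ^+ 2)); last by rewrite mulr0 expr0n subr0 possq_pos// expr1n.
  have -> : (fun k => cutz k.+1%:R z) = (fun k => possq (1 - (z * harmonic k) ^+ 2)).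
    by apply/funext => k; rewrite /cutz /harmonic/= exprMn exprVn.
  have h0 : z * harmonic k @[k --> \oo] --> z * (0 : R) by apply: cvgM => //; exact: cvg_cst.
  have h1 : (1 - (z * harmonic k) ^+ 2) @[k --> \oo] --> (1 - (z * 0) ^+ 2 : R).
    by apply: cvgB; [exact: cvg_cst|rewrite !expr2; apply: cvgM].
  exact: (cvg_comp _ _ h1 (@continuous_possq R _)).
have cr : ramp (k.+1%:R ^+ 2 * x.1 - 1) @[k --> \oo] --> (1 : R).
  apply: cvg_near_cst; near=> k; rewrite ramp_ge1// lerBrDr.
  have kx : (2 / x.1) <= k.+1%:R.
    by apply: ltW; apply: (lt_le_trans (archi_boundP _)); [rewrite divr_ge0// ltW|
      rewrite ler_nat leqW//; near: k; exact: nbhs_infty_ge].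
  move: kx; rewrite ler_pdivrMr// => kx; rewrite (_ : 1 + 1 = 2 :> R)//; apply: (le_trans kx).
  by rewrite ler_pM2r// ler_peMl// ler1n.
have := cvgM (cvgM cr (cz x.1)) (cz x.2); rewrite !mulr1; exact.
Unshelve. all: by end_near. Qed.

Section fixed.
Variables (c M : R) (f : R * R -> R).
Hypothesis gf : good c M f.

Lemma momint_lin (g : R * R -> R) (a : R) : measurable_fun setT (g : pT -> R) -> 0 <= a ->
  (forall x, 0 < x.1 -> `|g x| <= a * lin x) -> momint f g.
Proof.
move=> mg a0 ga; apply: (good_integrable gf (h := fun x => a + a * x.1) (B := (a + a) * M)) => //.
  by move=> x x0; apply: le_trans (ga x x0) _; rewrite /lin mulrDr mulr1.
apply: (good_integral_le gf) => // x x0.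
by rewrite lexx andbT addr_ge0// mulr_ge0// ltW.
Qed.

Lemma lin_ge1 x : 0 < x.1 -> 1 <= lin x. Proof. by move=> x0; rewrite lerDl ltW. Qed.

Lemma momint_1 : momint f one.
Proof.
apply: (@momint_lin _ 1) => // [|x x0]; first exact: measurable_cst.
rewrite (_ : one x = 1)// normr1 mul1r; exact: lin_ge1.
Qed.

Lemma momint_id : momint f r1.
Proof.
apply: (@momint_lin _ 1) => //; first exact: measurable_fst.
by move=> x x0; rewrite mul1r ger0_norm ?(ltW x0)// lerDr.
Qed.

Lemma mom_id_le : mom f r1 <= M.
Proof.
rewrite -lee_fin -(mom_EFin momint_id); apply: le_trans (good_rmass gf).
by apply: le_integral_nomeas => x _//; rewrite lee_fin; apply: (good_weight_ge0 gf) => /ltW.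
Qed.

Lemma momint_tail (g : R * R -> R) n : 1 <= n -> measurable_fun setT (g : pT -> R) ->
  (forall x, 0 < x.1 -> `|g x| <= lin x) -> momint f (fun x => g x * tail n x).
Proof.
move=> n1 mg ga; apply: (@momint_lin _ 1) => //.
  by apply: measurable_funM => //; exact: measurable_tail.
move=> x x0; have /andP[t0 t1] := tail01 n x; rewrite mul1r normrM (ger0_norm t0).
by apply: le_trans (ga x x0); rewrite ler_piMr.
Qed.

Lemma tail_small (eta : R) : 0 < eta -> exists N, forall k, (N <= k)%N ->
  mom f (tail k.+1%:R) <= eta.
Proof.
move=> eta0.
have mf := good_meas gf; have f0 := good_ge0 gf.
have n1 k : 1 <= k.+1%:R :> R by rewrite ler1n.
have cv := @dominated_cvg _ pT R mu2 setT measurableT (fun k x => (tail k.+1%:R x * f x)%:E)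
  (fun=> 0%E) (fun x => (one x * f x)%:E) _ _ _ momint_1 _.
have {}cv : (\int[mu2]_x (tail k.+1%:R x * f x)%:E)%E @[k --> \oo] --> (0%:E : \bar R).
  rewrite -[X in _ --> X](@integral0 _ _ _ mu2 setT); apply: cv => //.
  - by move=> k; apply/measurable_EFinP; apply: measurable_funM => //; exact: measurable_tail.
  - move=> x _; apply: cvg_EFin; first exact: nearW.
    have [fx|/(good_halfplane gf) x0] := eqVneq (f x) 0.
      by rewrite fx; under eq_fun do rewrite mulr0; exact: cvg_cst.
    rewrite -[X in _ --> X](mul0r (f x)); apply: cvgM; last exact: cvg_cst.
    by rewrite -[X in _ --> X](subrr 1); apply: cvgB; [exact: cvg_cst|exact: cut_cvg].
  - move=> k x _; rewrite lee_fin /one mul1r normrM (ger0_norm (f0 x)).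
    by have /andP[t0 t1] := tail01 k.+1%:R x; rewrite ger0_norm// ler_piMl.
have [_ /fine_cvgP [_]] := (I, cv) ; move/cvgrPdist_le => /(_ _ eta0)[N _ hN].
exists N => k Nk; have := hN k Nk; rewrite /= sub0r normrN => h.
by apply: le_trans h; exact: ler_norm.
Qed.

End fixed.
End Tails.

Section Evolution.
Context {R : realType}.
Local Notation mu2 := (@plane_measure R).
Local Notation pT := (measurableTypeR R * measurableTypeR R)%type.
Implicit Types (x y : R * R) (phi phir phiz : R * R -> R).

(* Comparing the flux with a constant replaces its time integral, so that nothing
   is required of its dependence on time. *)
Definition weak_evolution (T : R) (v : R -> R * R -> R)
    (test : (R * R -> R) -> (R * R -> R) -> (R * R -> R) -> Prop) : Prop :=
  forall phi phir phiz, test phi phir phiz ->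
  forall t1 t2 kappa S : R, - T <= t1 -> t1 <= t2 -> t2 <= T ->
  (forall tau, t1 <= tau <= t2 -> `|flux (v tau) phir phiz - kappa| <= S) ->
  `|mom (v t2) phi - mom (v t1) phi - kappa * (t2 - t1)| <= S * (t2 - t1).

Definition C1c phi phir phiz : Prop :=
  C1 phi phir phiz /\ exists A : set (R * R), [/\ compact A, A `<=` (@halfplane R) &
    forall x, ~ A x -> phi x = 0].

(** The weak equation is extended to these tests first with the weight [one], which gives the bound
    of the second moment, and then with [lin], which the potentials of the energy require. *)
Definition C1w (wgt : R * R -> R) phi phir phiz : Prop :=
  C1 phi phir phiz /\ exists B : R, 0 <= B /\
    forall x, 0 < x.1 -> [/\ `|phi x| <= B * wgt x, `|phir x| <= B * wgt x & `|phiz x| <= B * wgt x].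

Section fixed.
Variables (T c M : R) (v : R -> R * R -> R).
Hypotheses (T0 : 0 <= T) (c0 : 0 <= c).
Hypothesis gv : forall t, - T <= t <= T -> good c M (v t).
Hypothesis wv : weak_evolution T v C1c.

Let M0 : 0 <= M.
Proof. by apply: (good_M_ge0 (gv (_ : - T <= 0 <= T))); rewrite oppr_le0 T0. Qed.

Definition cMass : R := 68 * M * (8 * M + 96 * c).

Let cMass0 : 0 <= cMass.
Proof. by rewrite /cMass mulr_ge0 ?addr_ge0 ?mulr_ge0. Qed.

(* The mass carried by the inner strip [r < 2 / n^2, |z| < n], where the gradient
   of the cutoff is of size n^2, is O(n^-3) because [v <= c r]. *)
Lemma cut_gradient_mass (f wgt : R * R -> R) (n : R) : 1 <= n -> good c M f ->
  (forall x, 0 < x.1 -> 0 <= wgt x <= lin x) ->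
  (\int[mu2]_x (wgt x * (4 / n + 4 * n ^+ 2 * strip n x) * f x)%:E <= ((8 * M + 96 * c) / n)%:E)%E.
Proof.
move=> n1 gf wl; have n0 : 0 < n by exact: lt_le_trans n1.
have nn : 0 < n ^+ 2 by rewrite exprn_gt0.
have mf := good_meas gf; have f0 := good_ge0 gf.
have q : 0 <= 4 / n by rewrite divr_ge0// ltW.
have s0 x : 0 <= 4 * n ^+ 2 * strip n x by rewrite !mulr_ge0 ?strip_ge0// ltW.
apply: (@le_trans _ _ (\int[mu2]_x ((4 / n + 4 / n * x.1) * f x)%:E
   + 3%:E * \int[mu2]_x (4 * n ^+ 2 * strip n x * f x)%:E)%E); last first.
  apply: (@le_trans _ _ (((4 / n + 4 / n) * M)%:E + 3%:E * (32 * c / n)%:E)%E).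
    apply: leeD; last by apply: lee_wpmul2l => //; exact: strip_mass gf c0.
    apply: (good_integral_le gf) => // x x0.
    by rewrite lexx andbT addr_ge0// mulr_ge0// ltW.
  by rewrite -EFinM -EFinD lee_fin le_eqVlt; apply/orP; left; apply/eqP; field; rewrite gt_eqF.
have l0 x : 0 <= (4 / n + 4 / n * x.1) * f x.
  by apply: (good_weight_ge0 gf (g := fun x => 4 / n + 4 / n * x.1)) => x0; rewrite addr_ge0// mulr_ge0// ltW.
have m1 : measurable_fun setT ((fun x => (4 / n + 4 / n * x.1) * f x) : pT -> R).
  by apply: measurable_funM => //; apply: measurable_funD => //; apply: measurable_funM => //; exact: measurable_fst.
have m2 : measurable_fun setT ((fun x => 4 * n ^+ 2 * strip n x * f x) : pT -> R).
  by apply: measurable_funM => //; apply: measurable_funM => //; exact: measurable_strip.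
rewrite -ge0_integralZl_EFin//=; last 2 first.
- by move=> x _; rewrite lee_fin mulr_ge0.
- exact/measurable_EFinP.
rewrite -ge0_integralD//=; last 4 first.
- by move=> x _; rewrite lee_fin.
- exact/measurable_EFinP.
- by move=> x _; rewrite -EFinM lee_fin mulr_ge0// mulr_ge0.
- by under eq_fun do rewrite -EFinM; apply/measurable_EFinP; exact: measurable_funM.
apply: le_integral_nomeas => x _.
  rewrite lee_fin; apply: (good_weight_ge0 gf (g := fun x => wgt x * (4 / n + 4 * n ^+ 2 * strip n x))) => x0.
  by have /andP[w0 _] := wl x x0; rewrite mulr_ge0// addr_ge0.
rewrite -EFinM -EFinD lee_fin [3 * _]mulrA -mulrDl.
apply: (good_le gf (g := fun x => wgt x * (4 / n + 4 * n ^+ 2 * strip n x))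
   (h := fun x => 4 / n + 4 / n * x.1 + 3 * (4 * n ^+ 2 * strip n x))) => x0.
have /andP[w0 w1] := wl x x0; rewrite mulrDr; apply: lerD.
  have := ler_wpM2r q w1; rewrite /lin; lra.
rewrite /strip; case E: (_ && _); last by rewrite !mulr0.
apply: ler_wpM2r; first by rewrite !mulr_ge0// ltW.
apply: (le_trans w1); rewrite /lin.
have /andP[h _] := E; have : 2 / n ^+ 2 <= 2.
  by rewrite ler_pdivrMr// ler_peMr// exprn_ege1.
lra.
Qed.

Lemma scaled_integral_le (f g : R * R -> R) (K B : R) : 0 <= K ->
  good c M f -> measurable_fun setT (g : pT -> R) -> (forall x, 0 < x.1 -> 0 <= g x) ->
  (\int[mu2]_x (g x * f x)%:E <= B%:E)%E -> (\int[mu2]_x (K * g x * f x)%:E <= (K * B)%:E)%E.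
Proof.
move=> K0 gf mg g0 gB; under eq_integral do rewrite -mulrA EFinM.
rewrite ge0_integralZl_EFin//=; last 2 first.
- by move=> x _; rewrite lee_fin; apply: (good_weight_ge0 gf) => /g0.
- by apply/measurable_EFinP; apply: measurable_funM => //; exact: good_meas gf.
by rewrite EFinM; apply: lee_wpmul2l.
Qed.

Lemma cut_increment n (a b : R) : 1 <= n -> - T <= a -> a <= b -> b <= T ->
  `|mom (v b) (cut n) - mom (v a) (cut n)| <= cMass / n * (b - a).
Proof.
move=> n1 Ta ab bT.
have := @wv (cut n) (cut_r n) (cut_z n) _ a b 0 (cMass / n) Ta ab bT; rewrite mul0r subr0; apply.
  by split; [exact: C1_cut|exact: cut_support].
move=> t /andP[at_ tb]; rewrite subr0.
have gt : good c M (v t) by apply: gv; rewrite (le_trans Ta at_) (le_trans tb bT).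
have n0 : 0 < n by exact: lt_le_trans n1.
have s0 x : 0 <= 4 * n ^+ 2 * strip n x by rewrite !mulr_ge0 ?strip_ge0 ?exprn_ge0// ltW.
have q : 0 <= 4 / n by rewrite divr_ge0// ltW.
apply: (flux_bound gt (b := fun x => 1 * (4 / n + 4 * n ^+ 2 * strip n x))).
  move=> x x0; rewrite mul1r; split; first exact: cut_r_bound.
  by apply: le_trans (cut_z_bound n1 x) _; rewrite lerDl.
have -> : cMass / n = 68 * M * ((8 * M + 96 * c) / n) by rewrite /cMass mulrA.
apply: scaled_integral_le => //.
- by rewrite mulr_ge0.
- apply: measurable_funM => //; apply: measurable_funD => //; apply: measurable_funM => //.
  exact: measurable_strip.
- by move=> x _; rewrite mul1r addr_ge0.
apply: (cut_gradient_mass (wgt := fun=> 1)) => // x x0.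
by rewrite ler01/= lin_ge1.
Qed.

Lemma mom_cut n t : 1 <= n -> - T <= t <= T -> mom (v t) (cut n) = mom (v t) one - mom (v t) (tail n).
Proof.
move=> n1 tT; have gt := gv tT.
have i1 := momint_1 gt.
have i3 : momint (v t) (tail n).
  apply: (momint_lin gt (a := 1)) => //; first exact: measurable_tail.
  move=> x x0; have /andP[t0 t1] := tail01 n x.
  by rewrite ger0_norm// mul1r (le_trans t1)// lin_ge1.
rewrite -(mulN1r (mom _ (tail n))) -(momZ _ i3) -(momD i1 (momint_Z _ i3)).
by apply: (eq_mom gt) => x _; rewrite /one /tail; ring.
Qed.

Lemma tail_ge0 n t : - T <= t <= T -> 0 <= mom (v t) (tail n).
Proof. by move=> tT; apply: (mom_ge0 (gv tT)) => x _; have /andP[] := tail01 n x. Qed.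

Lemma inv_small (K eta : R) : 0 <= K -> 0 < eta -> exists N, forall k, (N <= k)%N -> K / k.+1%:R <= eta.
Proof.
move=> K0 e0; exists (Num.bound (K / eta)) => k Nk.
rewrite ler_pdivrMr// mulrC -ler_pdivrMr//; apply: ltW.
apply: (lt_le_trans (archi_boundP _)); first by rewrite divr_ge0// ltW.
by rewrite ler_nat leqW.
Qed.

Lemma cut_increment0 n t : 1 <= n -> - T <= t <= T ->
  `|mom (v t) (cut n) - mom (v 0) (cut n)| <= cMass * T / n.
Proof.
move=> n1 /andP[t1 t2]; have n0 : 0 < n by exact: lt_le_trans n1.
have q : 0 <= cMass / n by rewrite divr_ge0// ltW.
rewrite mulrAC; have [h|/ltW h] := leP 0 t.
  apply: (le_trans (@cut_increment n 0 t n1 _ h t2)); first by rewrite oppr_le0.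
  by rewrite subr0 ler_wpM2l.
rewrite distrC; apply: (le_trans (@cut_increment n t 0 n1 t1 h T0)).
by rewrite sub0r ler_wpM2l// lerNl.
Qed.

Lemma mass_conserved t : - T <= t <= T -> mom (v t) one = mom (v 0) one.
Proof.
move=> tT; have oT : - T <= 0 <= T by rewrite oppr_le0 T0.
apply/eqP; rewrite -subr_eq0 -normr_le0; apply/ler_addgt0Pr => e e0; rewrite add0r.
have e3 : 0 < e / 3 by rewrite divr_gt0.
have [N1 h1] := tail_small (gv tT) e3; have [N2 h2] := tail_small (gv oT) e3.
have [N3 h3] := inv_small (mulr_ge0 cMass0 T0) e3.
pose k := maxn N1 (maxn N2 N3).
have k1 : (N1 <= k)%N by rewrite leq_maxl.
have k2 : (N2 <= k)%N by rewrite /k (leq_trans (leq_maxl N2 N3))// leq_maxr.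
have k3 : (N3 <= k)%N by rewrite /k (leq_trans (leq_maxr N2 N3))// leq_maxr.
have n1 : 1 <= k.+1%:R :> R by rewrite ler1n.
have := cut_increment0 n1 tT; rewrite !mom_cut// => hc.
have := h1 _ k1; have := h2 _ k2; have := h3 _ k3.
have := tail_ge0 k.+1%:R tT; have := tail_ge0 k.+1%:R oT.
move: hc; move: (mom (v t) (tail _)) (mom (v 0) (tail _)) (cMass * T / _) => a b q'.
by rewrite !ler_norml => /andP[? ?] ? ? ? ? ?; apply/andP; split; lra.
Qed.

Definition tight (wgt : R * R -> R) : Prop := forall eta : R, 0 < eta ->
  exists N, forall k, (N <= k)%N -> forall t, - T <= t <= T ->
  mom (v t) (fun x => wgt x * tail k.+1%:R x) <= eta.

(** Dominated convergence alone would give a rank depending on t. Here the total mass is constant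
    and the cut mass moves by O(1 / n), so the tail at time t is that at time 0 up to O(1 / n). *)
Lemma tight_one : tight one.
Proof.
move=> eta e0; have oT : - T <= 0 <= T by rewrite oppr_le0 T0.
have e2 : 0 < eta / 2 by rewrite divr_gt0.
have [N2 h2] := tail_small (gv oT) e2; have [N3 h3] := inv_small (mulr_ge0 cMass0 T0) e2.
exists (maxn N2 N3) => k; rewrite geq_max => /andP[k2 k3] t tT.
have n1 : 1 <= k.+1%:R :> R by rewrite ler1n.
have := cut_increment0 n1 tT; rewrite !mom_cut// mass_conserved// => hc.
have -> : mom (v t) (fun x => one x * tail k.+1%:R x) = mom (v t) (tail k.+1%:R).
  by apply: (eq_mom (gv tT)) => x _; rewrite /one mul1r.
have := h2 _ k2; have := h3 _ k3.
move: hc; move: (mom (v t) (tail _)) (mom (v 0) (tail _)) (cMass * T / _) => a b q'.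
by rewrite !ler_norml => /andP[? ?] ? ?; lra.
Qed.

Lemma flux_add (f : R * R -> R) (p1 p2 q1 q2 : R * R -> R) :
  momint f (fun x => p1 x * vr f x + p2 x * vz f x) ->
  momint f (fun x => q1 x * vr f x + q2 x * vz f x) ->
  flux f (fun x => p1 x + q1 x) (fun x => p2 x + q2 x) = flux f p1 p2 + flux f q1 q2.
Proof.
move=> i1 i2; rewrite /flux -(momD i1 i2); congr mom; apply/funext => x; ring.
Qed.

Lemma cutoff_removed (a1 a2 u1 u2 k S B Q D eta e : R) :
  `|a2 - u2 - (a1 - u1) - k * D| <= (S + Q * eta) * D -> `|u1| <= B * eta -> `|u2| <= B * eta ->
  (2 * B + Q * D) * eta <= e -> `|a2 - a1 - k * D| <= S * D + e.
Proof.
rewrite !ler_norml => /andP[? ?] /andP[? ?] /andP[? ?] ?.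
by apply/andP; split; lra.
Qed.

(** The product of phi with the cutoff is an admissible test. Its gradient differs from that of phi
    by at most B wgt times the tail plus the gradient of the cutoff, whose integral is small
    uniformly in time by tightness. *)
Theorem weak_weighted (wgt : R * R -> R) : measurable_fun setT (wgt : pT -> R) ->
  (forall x, 0 < x.1 -> 0 <= wgt x <= lin x) -> tight wgt -> weak_evolution T v (C1w wgt).
Proof.
move=> mw wl tw phi phir phiz [C1phi [B [B0 hB]]] t1 t2 kappa S Tt1 t12 t2T hS.
set D := t2 - t1; have D0 : 0 <= D by rewrite subr_ge0.
have tT1 : - T <= t1 <= T by rewrite Tt1 (le_trans t12).
have tT2 : - T <= t2 <= T by rewrite t2T (le_trans Tt1).
pose Q := 68 * M * B * (1 + (8 * M + 96 * c)).
have Q0 : 0 <= Q by rewrite /Q !mulr_ge0// addr_ge0// addr_ge0// mulr_ge0.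
(* K eta is the total error: B eta for the test function at either end, and Q eta for the flux over
   a time D. *)
pose K := 2 * B + Q * D.
have K0 : 0 <= K by rewrite addr_ge0// mulr_ge0.
have K1 : 0 < K + 1 by rewrite ltr_wpDl.
apply/ler_addgt0Pr => e e0; pose eta := e / (K + 1).
have eta0 : 0 < eta by rewrite divr_gt0.
have Keta : K * eta <= e by rewrite /eta mulrA ler_pdivrMr// mulrC ler_pM2l// lerDl.
have [N1 h1] := tw _ eta0; have [N2 h2] := inv_small (@ler01 R) eta0.
pose k := maxn N1 N2; have {}h1 := h1 k (leq_maxl _ _); have {}h2 := h2 k (leq_maxr _ _).
pose n : R := k.+1%:R; rewrite -/n in h1 h2.
have n1 : 1 <= n by rewrite ler1n.
have n0 : 0 < n by exact: lt_le_trans n1.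
have Cc := C1_cut n1; have Cp := C1_mul C1phi Cc.
have q : 0 <= 4 / n by rewrite divr_ge0// ltW.
have s0 x : 0 <= 4 * n ^+ 2 * strip n x by rewrite !mulr_ge0 ?strip_ge0 ?exprn_ge0// ltW.
have w0 x : 0 < x.1 -> 0 <= wgt x by move=> /wl /andP[].
pose b x := wgt x * tail n x + wgt x * (4 / n + 4 * n ^+ 2 * strip n x).
have mt := measurable_tail n1; have ms := @measurable_strip R n.
have mb : measurable_fun setT (b : pT -> R).
  by apply: measurable_funD; apply: measurable_funM => //; apply: measurable_funD => //; exact: measurable_funM.
have b0 x : 0 < x.1 -> 0 <= b x.
  move=> x0; have /andP[ta _] := tail01 n x.
  by rewrite addr_ge0// mulr_ge0 ?w0// addr_ge0.
have tailint t : - T <= t <= T -> momint (v t) (fun x => wgt x * tail n x).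
  move=> tT; apply: (momint_tail (gv tT)) => // x x0.
  by have /andP[? ?] := wl x x0; rewrite ger0_norm.
have bint t : - T <= t <= T -> (\int[mu2]_x (b x * v t x)%:E <= ((1 + (8 * M + 96 * c)) * eta)%:E)%E.
  move=> tT; have gt := gv tT; have m1 := good_meas gt.
  under eq_integral do rewrite mulrDl EFinD.
  rewrite ge0_integralD//=; last 4 first.
  - move=> x _; rewrite lee_fin; apply: (good_weight_ge0 gt (g := fun x => wgt x * tail n x)) => x0.
    by have /andP[ta _] := tail01 n x; rewrite mulr_ge0 ?w0.
  - by apply/measurable_EFinP; apply: measurable_funM => //; exact: measurable_funM.
  - move=> x _; rewrite lee_fin.
    apply: (good_weight_ge0 gt (g := fun x => wgt x * (4 / n + 4 * n ^+ 2 * strip n x))) => x0.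
    by rewrite mulr_ge0 ?w0// addr_ge0.
  - apply/measurable_EFinP; apply: measurable_funM => //; apply: measurable_funM => //.
    by apply: measurable_funD => //; exact: measurable_funM.
  rewrite (_ : ((1 + _) * eta)%:E = (eta%:E + ((8 * M + 96 * c) * eta)%:E)%E); last first.
    by rewrite -EFinD mulrDl mul1r.
  apply: leeD.
    by rewrite (mom_EFin (tailint _ tT)) lee_fin; exact: h1.
  apply: le_trans (cut_gradient_mass n1 gt wl) _; rewrite lee_fin ler_wpM2l ?addr_ge0 ?mulr_ge0//.
  by move: h2; rewrite div1r.
have hb x : 0 < x.1 ->
    `|phir x * cut n x + phi x * cut_r n x + - phir x| <= B * b x /\
    `|phiz x * cut n x + phi x * cut_z n x + - phiz x| <= B * b x.
  move=> x0; have [p0 p1 p2] := hB x x0; have /andP[ta tb] := tail01 n x.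
  have aux (u w : R) : `|u| <= B * wgt x -> `|w| <= 4 / n + 4 * n ^+ 2 * strip n x ->
      `|u * cut n x + phi x * w + - u| <= B * b x.
    move=> hu hw; have -> : u * cut n x + phi x * w + - u = phi x * w - u * tail n x by rewrite /tail; ring.
    apply: le_trans (ler_normB _ _) _; rewrite !normrM (ger0_norm ta).
    have -> : B * b x = B * wgt x * (4 / n + 4 * n ^+ 2 * strip n x) + B * wgt x * tail n x by rewrite /b; ring.
    by apply: lerD; [exact: ler_pM|exact: ler_wpM2r].
  split; apply: aux => //; first exact: cut_r_bound.
  by apply: le_trans (cut_z_bound n1 x) _; rewrite lerDl.
have fluxd t : t1 <= t <= t2 ->
   `|flux (v t) (fun x => phir x * cut n x + phi x * cut_r n x) (fun x => phiz x * cut n x + phi x * cut_z n x) - kappa|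
     <= S + Q * eta.
  move=> t12'; have tT : - T <= t <= T.
    by move: t12' => /andP[u1 u2]; rewrite (le_trans Tt1 u1) (le_trans u2 t2T).
  have gt := gv tT; have := hS t t12'.
  have bB : (\int[mu2]_x (68 * M * (B * b x) * v t x)%:E <= (Q * eta)%:E)%E.
    under eq_integral do rewrite (mulrA (68 * M) B).
    rewrite (_ : Q * eta = 68 * M * B * ((1 + (8 * M + 96 * c)) * eta)); last by rewrite /Q; ring.
    apply: scaled_integral_le => //; last exact: bint.
    by rewrite !mulr_ge0.
  have i1 : momint (v t) (fun x => phir x * vr (v t) x + phiz x * vz (v t) x).
    apply: (momint_flux gt (b := fun x => B + B * x.1) (B := (68 * M * B + 68 * M * B) * M)).
    - exact: C1_measr C1phi.
    - exact: C1_measz C1phi.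
    - move=> x x0; have [_ p1 p2] := hB x x0; have /andP[_ w1] := wl x x0.
      have : B * wgt x <= B + B * x.1 by have := ler_wpM2l B0 w1; rewrite /lin; lra.
      by split; [apply: le_trans p1 _|apply: le_trans p2 _].
    apply: (good_integral_le gt) => //; try by rewrite !mulr_ge0.
    move=> x x0; have x1 := mulr_ge0 B0 (ltW x0); rewrite mulr_ge0 ?mulr_ge0 ?addr_ge0//=.
    by rewrite le_eqVlt; apply/orP; left; apply/eqP; ring.
  have mr := measurable_funD (C1_measr Cp) (measurable_funN (C1_measr C1phi)).
  have mz := measurable_funD (C1_measz Cp) (measurable_funN (C1_measz C1phi)).
  have i2 := momint_flux gt mr mz hb bB.
  have hf := flux_bound gt hb bB.
  have -> : flux (v t) (fun x => phir x * cut n x + phi x * cut_r n x) (fun x => phiz x * cut n x + phi x * cut_z n x)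
     = flux (v t) phir phiz + flux (v t) (fun x => phir x * cut n x + phi x * cut_r n x + - phir x)
         (fun x => phiz x * cut n x + phi x * cut_z n x + - phiz x).
    by rewrite -(flux_add i1 i2); congr flux; apply/funext => x /=; rewrite [RHS]addrC subrK.
  move: hf; set F2 := flux _ _ _; set F1 := flux _ _ _ => hf hF.
  have -> : F1 + F2 - kappa = (F1 - kappa) + F2 by ring.
  by apply: le_trans (ler_normD _ _) _; exact: lerD.
have csupp : exists A : set (R * R), [/\ compact A, A `<=` (@halfplane R) &
    forall x, ~ A x -> phi x * cut n x = 0].
  have [A [cA AH A0]] := cut_support n1; exists A; split=> // x /A0 ->; exact: mulr0.
have main := wv (conj Cp csupp) Tt1 t12 t2T fluxd; rewrite -/D in main.
have momt t : - T <= t <= T -> mom (v t) (fun x => phi x * cut n x) =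
    mom (v t) phi - mom (v t) (fun x => phi x * tail n x) /\ `|mom (v t) (fun x => phi x * tail n x)| <= B * eta.
  move=> tT; have gt := gv tT.
  have p1 x : 0 < x.1 -> `|phi x| <= B * lin x.
    by move=> x0; have [p _ _] := hB x x0; apply: (le_trans p); rewrite ler_wpM2l//; have /andP[] := wl x x0.
  have i1 : momint (v t) phi by apply: (momint_lin gt (C1_meas C1phi) B0 p1).
  have i2 : momint (v t) (fun x => phi x * tail n x).
    apply: (momint_lin gt _ B0); first by apply: measurable_funM => //; exact: C1_meas C1phi.
    move=> x x0; have /andP[ta tb] := tail01 n x; apply: le_trans (p1 x x0).
    by rewrite normrM (ger0_norm ta) ler_piMr.
  split.
    rewrite -(mulN1r (mom _ (fun x => phi x * _))) -(momZ _ i2) -(momD i1 (momint_Z _ i2)).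
    by congr mom; apply/funext => x; rewrite /tail; ring.
  apply: (mom_bound gt (h := fun x => B * (wgt x * tail n x))).
    move=> x x0; have [p _ _] := hB x x0; have /andP[ta tb] := tail01 n x.
    by rewrite normrM (ger0_norm ta) mulrA ler_wpM2r.
  have ti := momint_Z B (tailint _ tT); rewrite (mom_EFin ti) lee_fin (momZ _ (tailint _ tT)).
  by rewrite ler_wpM2l// h1.
have [E1 b1] := momt _ tT1; have [E2 b2] := momt _ tT2.
rewrite E1 E2 in main.
exact: cutoff_removed main b1 b2 Keta.
Qed.

End fixed.
End Evolution.

Section MomentBound.
Context {R : realType}.
Local Notation mu2 := (@plane_measure R).
Local Notation pT := (measurableTypeR R * measurableTypeR R)%type.
Implicit Types (x y : R * R) (phi phir phiz : R * R -> R).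

Section radial.
Variable n : R.
Hypothesis n1 : 1 <= n.
Let n0 : 0 < n. Proof. exact: lt_le_trans n1. Qed.
Let nn : 0 < n ^+ 2. Proof. exact: exprn_gt0. Qed.
Let den (r : R) : 0 < 1 + r ^+ 2 / n ^+ 2.
Proof. by rewrite ltr_pwDl// divr_ge0 ?sqr_ge0// ltW. Qed.

Definition rsq (r : R) : R := r ^+ 2 * rho n r.
Definition drsq (r : R) : R := 2 * r * rho n r ^+ 2.

Lemma is_derive_rsq r : is_derive r (1 : R) rsq (drsq r).
Proof.
have h1 : is_derive r (1 : R) (fun r => 1 + r ^+ 2 / n ^+ 2) (2 * r / n ^+ 2).
  apply: (@is_derive_quad _ _ _ _ ((n ^+ 2)^-1)) => h _.
  rewrite (_ : _ - _ - _ = h ^+ 2 / n ^+ 2); last by field; rewrite gt_eqF.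
  by rewrite ger0_norm ?divr_ge0 ?sqr_ge0 ?(ltW nn)// mulrC.
have h2 : is_derive r (1 : R) (fun r => (1 + r ^+ 2 / n ^+ 2)^-1) _ :=
  @is_deriveV _ (fun r => 1 + r ^+ 2 / n ^+ 2) r _ 1 (lt0r_neq0 (den r)) h1.
have h3 : is_derive r (1 : R) (fun r : R => r ^+ 2) (2 * r).
  apply: (@is_derive_quad _ _ _ _ 1) => h _.
  by rewrite (_ : _ - _ - _ = h ^+ 2); [rewrite ger0_norm ?sqr_ge0// mul1r|ring].
have h4 : is_derive r (1 : R) rsq _ := is_deriveM h3 h2.
apply: is_derive_eq; rewrite /drsq /rho /GRing.scale/=.
have D0 := den r; set D := 1 + _ in D0 *.
have rn : r ^+ 2 / n ^+ 2 = D - 1 by rewrite /D addrC addKr.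
have -> : r ^+ 2 * (- D ^- 2 * (2 * r / n ^+ 2)) = - (2 * r * (r ^+ 2 / n ^+ 2)) * D ^- 2 by ring.
by rewrite rn; move: D D0 {rn} => D D0; field; rewrite gt_eqF.
Qed.

Lemma continuous_rho : continuous (rho n).
Proof.
move=> r; apply: cvgV; first by rewrite gt_eqF.
apply: cvgD; first exact: cvg_cst.
by apply: cvgM; [exact: exprn_continuous|exact: cvg_cst].
Qed.

Lemma continuous_drsq : continuous drsq.
Proof.
move=> r; apply: cvgM.
  by apply: cvgM; [exact: cvg_cst|exact: cvg_id].
by under eq_fun do rewrite expr2; rewrite expr2; apply: cvgM; exact: continuous_rho.
Qed.

Lemma rsq_le r : 0 <= rsq r <= n ^+ 2.
Proof.
have q := rho_gt0 n r; rewrite mulr_ge0 ?sqr_ge0 ?(ltW q)//=.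
rewrite /rsq /rho ler_pdivrMr// mulrDr mulr1 (mulrC _ (_ / _)) divfK ?gt_eqF// lerDr ltW//.
Qed.

Lemma drsq_le r : 0 <= r -> 0 <= drsq r <= n.
Proof.
move=> r0; have q := rho_gt0 n r; have q1 := rho_le1 n r.
rewrite {1}/drsq (mulr_ge0 (mulr_ge0 (ler0n _ _) r0) (sqr_ge0 _))/=.
have := rho_r_le n1 r0; have := ler_wpM2l (mulr_ge0 r0 (ltW q)) q1; rewrite /drsq expr2; lra.
Qed.

Lemma C1_rsq : C1 (fun x => rsq x.1) (fun x => drsq x.1) (fun=> 0).
Proof. exact: C1_radial is_derive_rsq continuous_drsq. Qed.

Variables (c M : R) (f : R * R -> R).
Hypothesis gf : good c M f.
Let M0 : 0 <= M. Proof. exact: good_M_ge0 gf. Qed.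

(** For the weight r^2 the symmetrised flux would vanish. With the cutoff there remains 2 (rho(x)^2
    - rho(y)^2) (z - z') N, in which the differences supply a factor d^2 / n that makes N bounded
    and the whole O(1 / n). *)
Lemma flux_rsq : `|flux f (fun x => drsq x.1) (fun=> 0)| <= 2 * M ^+ 2 / n.
Proof.
have n2 : 0 <= n by exact: ltW.
have hb x : 0 < x.1 -> `|drsq x.1| <= n /\ `|(0 : R)| <= n.
  by move=> x0; have /andP[h1 h2] := drsq_le (ltW x0); rewrite ger0_norm// normr0.
have [ik ->] := flux_kernel_integral gf n2 (C1_measr C1_rsq) (C1_measz C1_rsq) hb.
pose k x y := drsq x.1 * KR x y.
have kE : (fun x y => drsq x.1 * KR x y + 0 * KZ x y) = k.
  by apply/funext => x; apply/funext => y; rewrite mul0r addr0.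
rewrite kE in ik *; have Jk : Jint f k := ik.
have kk : forall x y, 0 < x.1 -> 0 < y.1 -> `|k x y + k y x| <= 2 / n * (x.1 + y.1).
  move=> x y x0 y0.
  have -> : k x y + k y x = 2 * (rho n x.1 ^+ 2 - rho n y.1 ^+ 2) * ((x.2 - y.2) * N0 x y).
    by rewrite /k /KR /drsq (N0_sym y x); field; rewrite !gt_eqF.
  have -> : 2 * (rho n x.1 ^+ 2 - rho n y.1 ^+ 2) * ((x.2 - y.2) * N0 x y) =
    N0 x y * ((rho n x.1 - rho n y.1) * (2 * (rho n x.1 + rho n y.1)) * (x.2 - y.2)) by ring.
  set d := eucl_dist x y; have d0 : 0 <= d by exact: sqrtr_ge0.
  have rx := rho_gt0 n x.1; have ry := rho_gt0 n y.1.
  have rx1 := rho_le1 n x.1; have ry1 := rho_le1 n y.1.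
  have b1 : `|rho n x.1 - rho n y.1| <= d / n.
    rewrite ler_pdivlMr// mulrC; apply: le_trans (rho_lip n1 (ltW x0) (ltW y0)) _; exact: dist1_le.
  have b2 : `|2 * (rho n x.1 + rho n y.1)| <= 4 by rewrite ger0_norm; lra.
  have b3 : `|x.2 - y.2| <= d by exact: dist2_le.
  rewrite normrM; apply: (@le_trans _ _ (`|N0 x y| * (d / n * 4 * d))).
    apply: ler_wpM2l => //; rewrite normrM; apply: ler_pM => //.
    by rewrite normrM; exact: ler_pM.
  have -> : `|N0 x y| * (d / n * 4 * d) = 4 / n * (`|N0 x y| * d ^+ 2) by ring.
  have q : 0 <= 4 / n by rewrite divr_ge0// ltW.
  apply: (le_trans (ler_wpM2l q (N0_dist2 x0 y0))); rewrite -/(gm x y).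
  apply: (le_trans (ler_wpM2l q (ler_wpM2l _ (gm_le_mean x0 y0)))) => //.
  have -> : 4 / n * (3 / 4 * ((x.1 + y.1) / 2)) = 3 / 2 / n * (x.1 + y.1) by field; rewrite gt_eqF.
  rewrite ler_pM2r ?addr_gt0// ler_pM2r ?invr_gt0//; lra.
have h : `|J f k| <= 4 * M ^+ 2 / n / 2.
  apply: (J_sym_bound gf Jk kk).
  have q : 0 <= 2 / n by rewrite divr_ge0// ltW.
  apply: (@le_trans _ _ (\int[mu2]_x ((2 / n * (M * x.1 + M)) * f x)%:E)%E).
    apply: (Jb_le gf (beta := fun x => 2 / n * (M * x.1 + M))) => [|x y x0 y0|x x0].
    - by rewrite /meas2; meas; apply: measurableT_comp.
    - by rewrite mulr_ge0// addr_ge0// ltW.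
    have := @good_integral_le _ _ _ _ gf (fun y => 2 / n * (x.1 + y.1)) (2 / n * x.1) (2 / n).
    rewrite (_ : (2 / n * x.1 + 2 / n) * M = 2 / n * (M * x.1 + M)); last by ring.
    apply => //; last by rewrite mulr_ge0// ltW.
    by move=> y y0; rewrite mulrDr lexx andbT addr_ge0// mulr_ge0// ltW.
  have := @good_integral_le _ _ _ _ gf (fun x => 2 / n * (M * x.1 + M)) (2 / n * M) (2 / n * M).
  rewrite (_ : (2 / n * M + 2 / n * M) * M = 4 * M ^+ 2 / n); last by field; rewrite gt_eqF.
  have Mq : 0 <= 2 / n * M by exact: mulr_ge0.
  apply => // x x0.
  have -> : 2 / n * (M * x.1 + M) = 2 / n * M + 2 / n * M * x.1 by ring.
  by rewrite lexx andbT addr_ge0// mulr_ge0// ltW.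
by apply: (le_trans h); rewrite le_eqVlt; apply/orP; left; apply/eqP; field; rewrite gt_eqF.
Qed.

End radial.

Lemma rsq_cvg (r : R) : (rsq k.+1%:R r) @[k --> \oo] --> r ^+ 2.
Proof.
have inv : (@harmonic R) @ \oo --> (0 : R) by exact: cvg_harmonic.
have h0 : r * harmonic k @[k --> \oo] --> r * (0 : R) by apply: cvgM => //; exact: cvg_cst.
have h1 : 1 + (r * harmonic k) ^+ 2 @[k --> \oo] --> (1 : R).
  rewrite [X in _ --> X](_ : 1 = 1 + r * 0 * (r * 0)); last by rewrite !mulr0 addr0.
  by apply: cvgD; [exact: cvg_cst|under eq_fun do rewrite expr2; exact: cvgM].
have h2 : r ^+ 2 * (1 + (r * harmonic k) ^+ 2)^-1 @[k --> \oo] --> r ^+ 2 * 1^-1.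
  by apply: cvgM; [exact: cvg_cst|apply: cvgV => //; exact: oner_neq0].
have E : (fun k => rsq k.+1%:R r) = (fun k => r ^+ 2 * (1 + (r * harmonic k) ^+ 2)^-1).
  by apply/funext => k; rewrite /rsq /rho /harmonic/= exprMn exprVn.
by rewrite E; rewrite invr1 mulr1 in h2.
Qed.

Section fixed.
Variables (T c M : R) (v : R -> R * R -> R).
Hypotheses (T0 : 0 <= T) (c0 : 0 <= c).
Hypothesis gv : forall t, - T <= t <= T -> good c M (v t).
Hypothesis wv : weak_evolution T v C1c.

Let M0 : 0 <= M.
Proof. by apply: (good_M_ge0 (gv (_ : - T <= 0 <= T))); rewrite oppr_le0 T0. Qed.

Lemma weak_one : weak_evolution T v (C1w one).
Proof.
apply: (weak_weighted T0 c0 gv wv); first exact: measurable_cst.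
  by move=> x x0; rewrite /one ler01 /= lin_ge1.
exact: tight_one gv wv.
Qed.

Lemma rsq_increment n t : 1 <= n -> - T <= t <= T ->
  `|mom (v t) (fun x => rsq n x.1) - mom (v 0) (fun x => rsq n x.1)| <= 2 * M ^+ 2 / n * T.
Proof.
move=> n1 /andP[t1 t2]; have n0 : 0 < n by exact: lt_le_trans n1.
have q : 0 <= 2 * M ^+ 2 / n by rewrite divr_ge0 ?mulr_ge0 ?sqr_ge0// ltW.
have C : C1w one (fun x => rsq n x.1) (fun x => drsq n x.1) (fun=> 0).
  split; first exact: C1_rsq n1.
  exists (n ^+ 2 + n); split=> [|x x0]; first by rewrite addr_ge0 ?sqr_ge0// ltW.
  rewrite /one mulr1 normr0; have /andP[a0 a1] := rsq_le n1 x.1.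
  have /andP[b0 b1] := drsq_le n1 (ltW x0); rewrite !ger0_norm//.
  by split; have := sqr_ge0 n; lra.
have F a b : - T <= a -> a <= b -> b <= T ->
   `|mom (v b) (fun x => rsq n x.1) - mom (v a) (fun x => rsq n x.1)| <= 2 * M ^+ 2 / n * (b - a).
  move=> Ta ab bT; have := @weak_one _ _ _ C a b 0 (2 * M ^+ 2 / n) Ta ab bT.
  rewrite mul0r subr0; apply=> s /andP[s1 s2]; rewrite subr0.
  by apply: flux_rsq => //; apply: gv; rewrite (le_trans Ta s1) (le_trans s2 bT).
have [h|/ltW h] := leP 0 t.
  apply: (le_trans (F 0 t _ h t2)); first by rewrite oppr_le0.
  by rewrite subr0 ler_wpM2l.
rewrite distrC; apply: (le_trans (F t 0 t1 h T0)).
by rewrite sub0r ler_wpM2l// lerNl.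
Qed.

(** Monotone convergence in n: the truncated moment grows by at most O(1 / n). Finiteness at time t
    is part of the conclusion, and a matching lower bound is recovered from the energy in the last
    estimates. *)
Lemma second_moment_le (m2 : R) t : - T <= t <= T ->
  (\int[mu2]_x (x.1 ^+ 2 * v 0 x)%:E <= m2%:E)%E ->
  (\int[mu2]_x (x.1 ^+ 2 * v t x)%:E <= m2%:E)%E.
Proof.
move=> tT hm2; have gt := gv tT; have oT : - T <= 0 <= T by rewrite oppr_le0 T0.
have g0 := gv oT; have mt := good_meas gt; have n1 k : 1 <= k.+1%:R :> R by rewrite ler1n.
have mf (k : nat) : measurable_fun setT ((fun x => (rsq k.+1%:R x.1 * v t x)%:E) : pT -> \bar R).
  by apply/measurable_EFinP; apply: measurable_funM => //; exact: C1_meas (C1_rsq (n1 k)).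
have f0 (k : nat) x : True -> (0 <= (rsq k.+1%:R x.1 * v t x)%:E)%E.
  by move=> _; rewrite lee_fin mulr_ge0 ?(good_ge0 gt)//; have /andP[] := rsq_le (n1 k) x.1.
have fh x : True -> {homo (fun k => (rsq k.+1%:R x.1 * v t x)%:E) : k m / (k <= m)%N >-> (k <= m)%E}.
  move=> _ k m km; rewrite lee_fin ler_wpM2r ?(good_ge0 gt)// ler_wpM2l ?sqr_ge0//.
  have hk : 0 < k.+1%:R :> R by rewrite ltr0n.
  have hm : k.+1%:R <= m.+1%:R :> R by rewrite ler_nat.
  have hd (a : R) : 0 < 1 + x.1 ^+ 2 / a ^+ 2 by rewrite ltr_pwDl// divr_ge0 ?sqr_ge0.
  rewrite lef_pV2 ?posrE// lerD2l ler_wpM2l ?sqr_ge0// lef_pV2 ?posrE ?exprn_gt0 ?(lt_le_trans hk hm)//.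
  by rewrite lerXn2r ?nnegrE ?ler0n.
have := @cvg_monotone_convergence _ pT R mu2 setT measurableT _ mf f0 fh.
have -> : (\int[mu2]_x limn (fun k => (rsq k.+1%:R x.1 * v t x)%:E) = \int[mu2]_x (x.1 ^+ 2 * v t x)%:E)%E.
  apply: eq_integral => x _; apply: cvg_lim => //; apply: cvg_EFin; first exact: nearW.
  by apply: cvgM; [exact: rsq_cvg|exact: cvg_cst].
move=> cv; apply/lee_addgt0Pr => e e0.
have [N hN] := inv_small (mulr_ge0 (mulr_ge0 (ler0n R 2) (sqr_ge0 M)) T0) e0.
rewrite -(cvg_lim _ cv)//; apply: lime_le; first by apply/cvg_ex; eexists; exact: cv.
exists N => // k Nk /=.
have ik s : - T <= s <= T -> momint (v s) (fun x => rsq k.+1%:R x.1).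
  move=> sT; apply: (momint_lin (gv sT) (a := k.+1%:R ^+ 2)).
  - exact: C1_meas (C1_rsq (n1 k)).
  - exact: sqr_ge0.
  move=> x x0; have /andP[h1 h2] := rsq_le (n1 k) x.1; rewrite ger0_norm//.
  by apply: (le_trans h2); rewrite ler_peMr ?sqr_ge0// lin_ge1.
rewrite (mom_EFin (ik t tT)) -EFinD lee_fin.
have h0 : mom (v 0) (fun x => rsq k.+1%:R x.1) <= m2.
  rewrite -lee_fin -(mom_EFin (ik 0 oT)); apply: le_trans hm2.
  apply: le_integral_nomeas => x _; rewrite lee_fin.
    by rewrite mulr_ge0 ?(good_ge0 g0)//; have /andP[] := rsq_le (n1 k) x.1.
  rewrite ler_wpM2r ?(good_ge0 g0)// /rsq ler_piMr ?sqr_ge0//; exact: rho_le1.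
have h1 : 2 * M ^+ 2 / k.+1%:R * T <= e by rewrite mulrAC; exact: hN.
move: (rsq_increment (n1 k) tT) h1 h0; rewrite ler_norml => /andP[_].
by move: (mom _ _) (mom _ _) (_ / _ * _) => a b q; lra.
Qed.

(** For r > K the weight 1 + r is at most 2 r^2 / K, which the second moment controls; for r <= K it
    is at most 1 + K, and the tightness of the mass applies. K is chosen so that 2 m2 / K <= eta /
    2. *)
Lemma tight_lin (m2 : R) : 0 <= m2 ->
  (forall t, - T <= t <= T -> (\int[mu2]_x (x.1 ^+ 2 * v t x)%:E <= m2%:E)%E) -> tight T v lin.
Proof.
move=> m20 hm2 eta e0.
pose K := 1 + 4 * m2 / eta.
have K1 : 1 <= K by rewrite /K lerDl divr_ge0 ?mulr_ge0// ltW.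
have K0 : 0 < 1 + K by lra.
have eK : 0 < eta / 2 / (1 + K) by rewrite !divr_gt0.
have [N hN] := tight_one T0 c0 gv wv eK; exists N => k Nk t tT.
have gt := gv tT; have n1 : 1 <= k.+1%:R :> R by rewrite ler1n.
have g2 : good2 c (Num.max M m2) (v t).
  have gM : good c (Num.max M m2) (v t).
    have MM : M <= Num.max M m2 by rewrite le_max lexx.
    case: gt => *; split => //.
    - by move=> x; apply: le_trans MM.
    - by apply: (@le_trans _ _ M%:E) => //; rewrite lee_fin.
    - by apply: (@le_trans _ _ M%:E) => //; rewrite lee_fin.
  by split => //; apply: le_trans (hm2 t tT) _; rewrite lee_fin le_max lexx orbT.
have i1 : momint (v t) (fun x => one x * tail k.+1%:R x).
  apply: (momint_tail gt) => //; first exact: measurable_cst.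
  by move=> x x0; rewrite /one normr1 lin_ge1.
have i2 := momint_r2 g2.
have i3 : momint (v t) (fun x => lin x * tail k.+1%:R x).
  apply: (momint_tail gt) => //; first by apply: measurable_funD => //; exact: measurable_fst.
  by move=> x x0; rewrite ger0_norm// (le_trans ler01)// lin_ge1.
have K00 : 0 < K by lra.
apply: (@le_trans _ _ (mom (v t) (fun x => (1 + K) * (one x * tail k.+1%:R x) + 2 / K * r2 x))).
  apply: (mom_le gt i3 (momint_D (momint_Z _ i1) (momint_Z _ i2))) => x x0.
  have /andP[t0 t1] := tail01 k.+1%:R x; rewrite /one /lin /r2 mul1r.
  have q0 : 0 <= 2 / K * x.1 ^+ 2 by rewrite mulr_ge0 ?sqr_ge0// divr_ge0// ltW.
  have [xK|Kx] := leP x.1 K.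
    by apply: (@le_trans _ _ ((1 + K) * tail k.+1%:R x)); [rewrite ler_wpM2r// lerD2l|rewrite lerDl].
  have h1 : (1 + x.1) * tail k.+1%:R x <= 1 + x.1 by rewrite ler_piMr// addr_ge0// ltW.
  have h2 : 1 + x.1 <= 2 / K * x.1 ^+ 2.
    rewrite mulrAC ler_pdivlMr//; have : x.1 * K <= x.1 * x.1 by rewrite ler_pM2l// ltW.
    have : K <= x.1 * K by rewrite ler_peMl// ltW//; lra.
    by rewrite expr2; nra.
  have := mulr_ge0 (ltW K0) t0; lra.
rewrite (momD (momint_Z _ i1) (momint_Z _ i2)) (momZ _ i1) (momZ _ i2).
have h1 := hN k Nk t tT.
have h2 : mom (v t) r2 <= m2 by rewrite -lee_fin -(mom_EFin i2); exact: hm2.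
have h3 : (1 + K) * mom (v t) (fun x => one x * tail k.+1%:R x) <= eta / 2.
  by rewrite mulrC -ler_pdivlMr.
have h4 : 2 / K * mom (v t) r2 <= eta / 2.
  have q : 0 <= 2 / K by rewrite divr_ge0// ltW.
  apply: (le_trans (ler_wpM2l q h2)); rewrite mulrAC ler_pdivrMr//.
  have : eta / 2 * K = eta / 2 + 2 * m2 by rewrite /K; field; rewrite gt_eqF.
  lra.
lra.
Qed.

Lemma weak_lin (m2 : R) : 0 <= m2 -> (\int[mu2]_x (x.1 ^+ 2 * v 0 x)%:E <= m2%:E)%E ->
  weak_evolution T v (C1w lin).
Proof.
move=> m20 hm2; apply: (weak_weighted T0 c0 gv wv).
- by apply: measurable_funD => //; exact: measurable_fst.
- by move=> x x0; rewrite lexx andbT (le_trans ler01)// lin_ge1.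
apply: (tight_lin m20) => t tT; exact: second_moment_le.
Qed.

End fixed.

End MomentBound.

(** * Conservation of energy *)

Section Increments.
Context {R : realType}.

(** An inequality valid on short intervals up to a small relative error holds exactly on all
    intervals: sum it over a uniform partition and let the error tend to 0. *)
Lemma increment_partition (f : R -> R) (lo hi C : R) :
  (forall eta : R, 0 < eta -> exists2 h : R, 0 < h & forall a b : R, lo <= a -> a <= b -> b <= hi ->
     b - a <= h -> `|f b - f a| <= (C + eta) * (b - a)) ->
  forall a b : R, lo <= a -> a <= b -> b <= hi -> `|f b - f a| <= C * (b - a).
Proof.
move=> H a b la ab bh; apply/ler_addgt0Pr => e e0.
have D0 : 0 <= b - a by rewrite subr_ge0.
pose eta := e / (b - a + 1); have eta0 : 0 < eta by rewrite divr_gt0// ltr_wpDl.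
have [h h0 Hh] := H eta eta0.
pose N := (Num.bound ((b - a) / h)).+1.
have N0 : 0 < N%:R :> R by rewrite ltr0n.
pose p k : R := a + (b - a) * (k%:R / N%:R).
have pS k : p k.+1 - p k = (b - a) / N%:R by rewrite /p -natr1; field; rewrite gt_eqF.
have step : (b - a) / N%:R <= h.
  rewrite ler_pdivrMr// mulrC -ler_pdivrMr//; apply: ltW.
  by apply: (lt_le_trans (archi_boundP _)); [rewrite divr_ge0// ltW|rewrite ler_nat].
have dN : 0 <= (b - a) / N%:R by rewrite divr_ge0// ltW.
have pa k : a <= p k by rewrite lerDl mulr_ge0// divr_ge0// ltW.
have pb k : (k <= N)%N -> p k <= b.
  move=> kN; rewrite /p addrC -lerBrDr ler_piMr// ler_pdivrMr// mul1r ler_nat.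
  exact: kN.
have P k : (k <= N)%N -> `|f (p k) - f a| <= (C + eta) * (p k - a).
  elim: k => [|k IH] kN; first by rewrite /p mul0r mulr0 addr0 !subrr normr0 mulr0.
  have -> : f (p k.+1) - f a = (f (p k.+1) - f (p k)) + (f (p k) - f a) by ring.
  apply: le_trans (ler_normD _ _) _.
  have -> : (C + eta) * (p k.+1 - a) = (C + eta) * (p k.+1 - p k) + (C + eta) * (p k - a) by ring.
  apply: lerD; last exact: IH (ltnW kN).
  apply: Hh; rewrite ?pS//; first exact: le_trans (pa k).
    by rewrite -subr_ge0 pS.
  exact: le_trans (pb _ kN) bh.
have pN : p N = b by rewrite /p divff ?gt_eqF// mulr1 addrC subrK.
have := P N (leqnn _); rewrite pN mulrDl => h1; apply: (le_trans h1); rewrite lerD2l.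
rewrite /eta mulrAC ler_pdivrMr ?ltr_wpDl//; have := ltW e0; nra.
Qed.

(** q and q1 are the distances before and after a displacement h, and s is the component of the
    difference along it. The first bound is the second order remainder of the inverse distance, the
    second its Lipschitz bound; both are uniform because the distances are at least dl. *)
Lemma inv_sqrt_remainder (q q1 h s dl : R) : 0 < dl -> dl <= q -> dl <= q1 ->
  q1 ^+ 2 = q ^+ 2 + 2 * h * s + h ^+ 2 -> `|s| <= q ->
  `|q1^-1 - q^-1 + h * s / q ^+ 3| <= 3 / dl ^+ 3 * h ^+ 2 /\ `|q1^-1 - q^-1| <= `|h| / dl ^+ 2.
Proof.
move=> dl0 dq dq1 E sq.
have q0 : 0 < q by exact: lt_le_trans dq.
have q10 : 0 < q1 by exact: lt_le_trans dq1.
have hh : `|h| ^+ 2 = h ^+ 2 by rewrite real_normK// num_real.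
have hs : `|h * s| <= `|h| * q by rewrite normrM ler_wpM2l.
(* The triangle inequality for distances, recovered from |s| <= q. *)
have qh : `|q1 - q| <= `|h|.
  move: hs; rewrite ler_norml => /andP[s1 s2]; have h0 := normr_ge0 h.
  rewrite ler_norml; apply/andP; split.
    have [qh|qh] := leP q `|h|; first lra.
    suff : q - `|h| <= q1 by lra.
    by rewrite -(@ler_pXn2r _ 2) ?nnegrE ?(ltW q10)//; nra.
  suff : q1 <= q + `|h| by lra.
  by rewrite -(@ler_pXn2r _ 2) ?nnegrE ?(ltW q10)//; nra.
have E2 : (q1 - q) * (q1 + q) = 2 * (h * s) + h ^+ 2.
  by rewrite (_ : (q1 - q) * (q1 + q) = q1 ^+ 2 - q ^+ 2); [rewrite E|]; ring.
have qq : 0 < q + q1 by exact: addr_gt0.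
have inv1 : q^-1 <= dl^-1 by rewrite lef_pV2.
have inv2 : q1^-1 <= dl^-1 by rewrite lef_pV2.
have i0 : 0 <= q^-1 by rewrite invr_ge0 ltW.
have i1 : 0 <= q1^-1 by rewrite invr_ge0 ltW.
have B2 : q^-1 * q1^-1 <= dl ^- 2 by rewrite -exprVn expr2; exact: ler_pM.
have B3 : q^-1 * q^-1 * q1^-1 <= dl ^- 3.
  by rewrite -exprVn !exprS expr0 mulr1 mulrA; apply: ler_pM => //; [exact: mulr_ge0|exact: ler_pM].
split; last first.
  have -> : q1^-1 - q^-1 = (q - q1) * (q^-1 * q1^-1) by field; rewrite !gt_eqF.
  rewrite normrM distrC; apply: ler_pM => //; rewrite ger0_norm// mulr_ge0//.
have -> : q1^-1 - q^-1 + h * s / q ^+ 3 =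
   (h * s * q^-1) * (q1 - q) * ((q1 + 2 * q) / (q + q1)) * (q^-1 * q^-1 * q1^-1)
   - h ^+ 2 * (q^-1 * (q / (q + q1)) * q^-1 * q1^-1).
  have -> : q1^-1 - q^-1 = - ((q1 - q) * (q1 + q)) / (q * q1 * (q + q1)) by field; rewrite !gt_eqF.
  rewrite E2 (_ : h * s / q ^+ 3 = h * s * (q1 * (q + q1)) / (q ^+ 3 * q1 * (q + q1))); last first.
    by field; rewrite !gt_eqF.
  by field; rewrite !gt_eqF.
have f1 : (q1 + 2 * q) / (q + q1) <= 2 by rewrite ler_pdivrMr//; lra.
have f10 : 0 <= (q1 + 2 * q) / (q + q1) by rewrite divr_ge0//; lra.
have f2 : q / (q + q1) <= 1 by rewrite ler_pdivrMr//; lra.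
have f20 : 0 <= q / (q + q1) by rewrite divr_ge0//; lra.
have t1 : `|h * s * q^-1| <= `|h|.
  by rewrite normrM (ger0_norm i0) -/(_ / q) ler_pdivrMr.
have b3 : 0 <= q^-1 * q^-1 * q1^-1 by rewrite !mulr_ge0.
have T1 : `|(h * s * q^-1) * (q1 - q) * ((q1 + 2 * q) / (q + q1)) * (q^-1 * q^-1 * q1^-1)|
   <= h ^+ 2 * 2 * dl ^- 3.
  have nm (a b c d : R) : 0 <= c -> 0 <= d -> `|a * b * c * d| = `|a| * `|b| * c * d.
    by move=> u0 w0; rewrite !normrM (ger0_norm u0) (ger0_norm w0).
  rewrite (nm _ _ _ _ f10 b3); apply: ler_pM => //.
    by apply: mulr_ge0 => //; exact: mulr_ge0.
  by apply: ler_pM => //; rewrite -hh expr2; exact: ler_pM.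
have T2 : `|h ^+ 2 * (q^-1 * (q / (q + q1)) * q^-1 * q1^-1)| <= h ^+ 2 * dl ^- 3.
  rewrite normrM (ger0_norm (sqr_ge0 h)) ler_wpM2l ?sqr_ge0//.
  rewrite ger0_norm; last exact: mulr_ge0 (mulr_ge0 (mulr_ge0 i0 f20) i0) i1.
  apply: le_trans B3; apply: ler_wpM2r => //; apply: ler_wpM2r => //.
  by rewrite ler_piMr.
apply: le_trans (ler_normB _ _) _; have := lerD T1 T2.
by rewrite (_ : 3 / dl ^+ 3 * h ^+ 2 = h ^+ 2 * 2 * dl ^- 3 + h ^+ 2 * dl ^- 3)//; ring.
Qed.

End Increments.

Lemma four_point_close {R : realFieldType} (a b a' b' s p q E F : R) : `|a - b| <= E -> `|a' - b'| <= E ->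
  `|a' - a - s * p| <= F -> `|b' - b - s * q| <= F -> `|s * (p - q)| <= 2 * E + 2 * F.
Proof.
rewrite !ler_norml => /andP[? ?] /andP[? ?] /andP[? ?] /andP[? ?].
by apply/andP; split; lra.
Qed.

Section QuadraticRemainder.
Context {R : realType}.
Local Notation mu2 := (@plane_measure R).
Local Notation pT := (measurableTypeR R * measurableTypeR R)%type.
Implicit Types (x y : R * R) (phi phir phiz : R * R -> R).

(** At most linear growth in r and quadratic remainders are inherited by integrals of the kernel
    against a density. Continuity of the derivatives follows from them in [quad_C1]. *)
Record quad_fun phi phir phiz (C : R) : Prop := QuadFun {
  quad_C : 0 <= C ;
  quad_b : forall x, `|phi x| <= C * (1 + `|x.1|) ;
  quad_br : forall x, `|phir x| <= C * (1 + `|x.1|) ;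
  quad_bz : forall x, `|phiz x| <= C * (1 + `|x.1|) ;
  quad_r : forall x (h : R), `|phi (x.1 + h, x.2) - phi x - h * phir x| <= C * (1 + `|x.1|) * h ^+ 2 ;
  quad_z : forall x (h : R), `|phi (x.1, x.2 + h) - phi x - h * phiz x| <= C * (1 + `|x.1|) * h ^+ 2 ;
  quad_m : measurable_fun setT (phi : pT -> R) ;
  quad_mr : measurable_fun setT (phir : pT -> R) ;
  quad_mz : measurable_fun setT (phiz : pT -> R) }.

Lemma near_square x (r : R) : 0 < r -> \forall u \near x, `|u.1 - x.1| <= r /\ `|u.2 - x.2| <= r.
Proof.
move=> r0; exists ([set a : R | `|a - x.1| <= r], [set b : R | `|b - x.2| <= r]); last by move=> u.
by split; apply/nbhs_ballP; exists r => //= a; rewrite /ball/= distrC => /ltW.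
Qed.

Section fixed.
Variables (phi phir phiz : R * R -> R) (C : R).
Hypothesis Q : quad_fun phi phir phiz C.
Let C0 := quad_C Q.

Lemma quad_lip x u : `|u.1 - x.1| <= 1 -> `|u.2 - x.2| <= 1 ->
  `|phi u - phi x| <= 2 * C * (2 + `|x.1|) * (`|u.1 - x.1| + `|u.2 - x.2|).
Proof.
move=> h1 h2; set h := u.1 - x.1 in h1 *; set k := u.2 - x.2 in h2 *.
pose y : R * R := (x.1 + h, x.2).
have ux : u.1 = x.1 + h by rewrite /h; ring.
have uE : u = (y.1, y.2 + k).
  by rewrite [LHS]surjective_pairing /y /= /k -ux; congr pair; ring.
have y1 : `|y.1| <= 1 + `|x.1| by apply: le_trans (ler_normD _ _) _; rewrite addrC lerD2r.
have sm (A B t p : R) : `|A - t * p| <= B * t ^+ 2 -> `|p| <= B -> `|t| <= 1 -> `|A| <= 2 * B * `|t|.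
  move=> a1 a2 a3; have B0 : 0 <= B by exact: le_trans a2.
  have -> : A = (A - t * p) + t * p by ring.
  apply: le_trans (ler_normD _ _) _; rewrite normrM.
  have -> : 2 * B * `|t| = B * `|t| + `|t| * B by ring.
  apply: lerD; last exact: ler_wpM2l.
  by apply: (le_trans a1); rewrite ler_wpM2l// -real_normK ?num_real// expr2 ler_piMr.
have s1 := sm _ _ _ _ (quad_r Q x h) (quad_br Q x) h1.
have s2 := sm _ _ _ _ (quad_z Q y k) (quad_bz Q y) h2.
rewrite -uE in s2; rewrite -/y in s1.
have -> : phi u - phi x = (phi u - phi y) + (phi y - phi x) by ring.
apply: le_trans (ler_normD _ _) _; rewrite addrC mulrDr; apply: lerD.
  apply: (le_trans s1); rewrite ler_wpM2r// mulrA ler_wpM2l ?mulr_ge0//; lra.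
apply: (le_trans s2); rewrite ler_wpM2r// mulrA ler_wpM2l ?mulr_ge0//; lra.
Qed.

Lemma quad_continuous : continuous phi.
Proof.
move=> x; apply/cvgrPdist_le => e e0.
pose K := 2 * C * (2 + `|x.1|) * 2 + 1.
have K0 : 0 < K by rewrite ltr_wpDl// !mulr_ge0// addr_ge0.
have d0 : 0 < Num.min 1 (e / K) by rewrite lt_min ltr01 divr_gt0.
apply: filterS (near_square x d0) => u []; rewrite !le_min => /andP[a1 a2] /andP[b1 b2].
rewrite distrC; apply: (le_trans (quad_lip a1 b1)).
have : `|u.1 - x.1| + `|u.2 - x.2| <= 2 * (e / K) by lra.
have q0 : 0 <= 2 * C * (2 + `|x.1|) by rewrite !mulr_ge0// addr_ge0.
move=> /(ler_wpM2l q0) h; apply: (le_trans h).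
have : 2 * C * (2 + `|x.1|) * (2 * (e / K)) = (K - 1) * (e / K) by rewrite /K; ring.
have : K * (e / K) = e by rewrite mulrC divfK// gt_eqF.
have : 0 < e / K by rewrite divr_gt0.
lra.
Qed.

(** A derivative is a difference quotient of step s up to O(s), and the quotients at u and at x
    differ by O(|u - x| / s). Continuity of the derivative results from a step of the order of the
    square root of |u - x|. *)
Lemma quad_deriv_close (x u x' u' : R * R) (a b s : R) : 0 < s -> s <= 1 ->
  `|u.1 - x.1| <= 1 -> `|u.2 - x.2| <= 1 -> u'.1 - x'.1 = u.1 - x.1 -> u'.2 - x'.2 = u.2 - x.2 ->
  `|x'.1| <= 1 + `|x.1| ->
  `|phi u' - phi u - s * a| <= C * (1 + `|u.1|) * s ^+ 2 ->
  `|phi x' - phi x - s * b| <= C * (1 + `|x.1|) * s ^+ 2 ->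
  `|a - b| <= 4 * C * (3 + `|x.1|) * ((`|u.1 - x.1| + `|u.2 - x.2|) / s + s).
Proof.
move=> s0 s1 h1 h2 E1 E2 x1 qa qb.
have l1 := quad_lip h1 h2.
have l2 : `|phi u' - phi x'| <= 2 * C * (2 + `|x'.1|) * (`|u'.1 - x'.1| + `|u'.2 - x'.2|).
  by apply: quad_lip; rewrite ?E1 ?E2.
rewrite E1 E2 in l2; set D := `|u.1 - x.1| + `|u.2 - x.2| in l1 l2 *.
have D0 : 0 <= D by rewrite addr_ge0.
have u1 : `|u.1| <= 1 + `|x.1|.
  have -> : u.1 = (u.1 - x.1) + x.1 by ring.
  by apply: le_trans (ler_normD _ _) _; rewrite lerD2r.
have l2' : `|phi u' - phi x'| <= 2 * C * (3 + `|x.1|) * D.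
  by apply: (le_trans l2); rewrite ler_wpM2r// ler_wpM2l ?mulr_ge0//; lra.
have l1' : `|phi u - phi x| <= 2 * C * (3 + `|x.1|) * D.
  by apply: (le_trans l1); rewrite ler_wpM2r// ler_wpM2l ?mulr_ge0//; lra.
have ss : 0 <= s ^+ 2 by exact: sqr_ge0.
have qa' : `|phi u' - phi u - s * a| <= C * (3 + `|x.1|) * s ^+ 2.
  by apply: (le_trans qa); rewrite ler_wpM2r// ler_wpM2l//; lra.
have qb' : `|phi x' - phi x - s * b| <= C * (3 + `|x.1|) * s ^+ 2.
  by apply: (le_trans qb); rewrite ler_wpM2r// ler_wpM2l//; lra.
have K0 : 0 <= C * (3 + `|x.1|) by rewrite mulr_ge0// addr_ge0.
have : `|s * (a - b)| <= 4 * C * (3 + `|x.1|) * D + 2 * (C * (3 + `|x.1|)) * s ^+ 2.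
  rewrite (_ : 4 * C * (3 + `|x.1|) * D + 2 * (C * (3 + `|x.1|)) * s ^+ 2 =
    2 * (2 * C * (3 + `|x.1|) * D) + 2 * (C * (3 + `|x.1|) * s ^+ 2)); last by ring.
  exact: four_point_close l1' l2' qa' qb'.
rewrite normrM (gtr0_norm s0) => h.
rewrite -(ler_pM2l s0); apply: (le_trans h).
have -> : s * (4 * C * (3 + `|x.1|) * (D / s + s)) = 4 * C * (3 + `|x.1|) * D + 4 * (C * (3 + `|x.1|)) * s ^+ 2.
  by field; rewrite gt_eqF.
rewrite lerD2l ler_wpM2r//; lra.
Qed.

Let cvg_small (x : R * R) (psi : R * R -> R) (K : R) : 0 <= K ->
  (forall u s, 0 < s -> s <= 1 -> `|u.1 - x.1| <= 1 -> `|u.2 - x.2| <= 1 ->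
    `|psi u - psi x| <= K * ((`|u.1 - x.1| + `|u.2 - x.2|) / s + s)) ->
  {for x, continuous psi}.
Proof.
move=> K0 H; apply/cvgrPdist_le => e e0.
have K1 : 0 < 3 * K + 1 by rewrite ltr_wpDl// mulr_ge0.
(* On the square of half-side s^2 the quotient is at most 2 s, so the whole bound is at most 3 K
   s. *)
pose s := Num.min 1 (e / (3 * K + 1)).
have s0 : 0 < s by rewrite lt_min ltr01 divr_gt0.
have s1 : s <= 1 by rewrite ge_min lexx.
have se : s * (3 * K + 1) <= e by rewrite -ler_pdivlMr// ge_min lexx orbT.
apply: filterS (near_square x (exprn_gt0 2 s0)) => u [a b].
have ss : s ^+ 2 <= 1 by rewrite expr_le1// ltW.
rewrite distrC; apply: (le_trans (H u s s0 s1 (le_trans a ss) (le_trans b ss))).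
have : (`|u.1 - x.1| + `|u.2 - x.2|) / s <= 2 * s by rewrite ler_pdivrMr//; lra.
move=> h; apply: (@le_trans _ _ (K * (3 * s))); first by rewrite ler_wpM2l//; lra.
lra.
Qed.

Lemma quad_C1 : C1 phi phir phiz.
Proof.
split.
- move=> x; apply: (@is_derive_quad _ _ _ _ (C * (1 + `|x.1|))) => h _.
  by have := quad_r Q x h; rewrite -surjective_pairing.
- move=> x; apply: (@is_derive_quad _ _ _ _ (C * (1 + `|x.1|))) => h _.
  by have := quad_z Q x h; rewrite -surjective_pairing.
- exact: quad_continuous.
- move=> x; apply: (@cvg_small _ _ (4 * C * (3 + `|x.1|))).
    by rewrite !mulr_ge0// addr_ge0.
  move=> u s s0 s1 h1 h2.
  apply: (quad_deriv_close s0 s1 h1 h2 _ _ _ (quad_r Q u s) (quad_r Q x s)) => /=.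
  + by ring.
  + by [].
  + apply: le_trans (ler_normD _ _) _; rewrite (gtr0_norm s0); lra.
- move=> x; apply: (@cvg_small _ _ (4 * C * (3 + `|x.1|))).
    by rewrite !mulr_ge0// addr_ge0.
  move=> u s s0 s1 h1 h2.
  apply: (quad_deriv_close s0 s1 h1 h2 _ _ _ (quad_z Q u s) (quad_z Q x s)) => /=.
  + by [].
  + by ring.
  + by rewrite lerDr.
- exact: quad_m Q.
- exact: quad_mr Q.
- exact: quad_mz Q.
Qed.

Lemma quad_C1w : C1w lin phi phir phiz.
Proof.
split; first exact: quad_C1.
exists C; split => // x x0; have <- : 1 + `|x.1| = lin x by rewrite ger0_norm// ltW.
by split; [exact: quad_b Q x|exact: quad_br Q x|exact: quad_bz Q x].
Qed.

End fixed.
End QuadraticRemainder.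

Section RegularisedKernels.
Context {R : realType}.
Local Notation mu2 := (@plane_measure R).
Local Notation pT := (measurableTypeR R * measurableTypeR R)%type.
Implicit Types (x y : R * R).
Variable e : R.
Hypothesis e0 : 0 < e.

Definition Zk x y : R := - ((x.2 - y.2) * Nk e x y).

Let E := Num.sqrt e.
Let E0 : 0 < E. Proof. by rewrite sqrtr_gt0. Qed.
Let s x y : sep e x y := sep_gt0 x y e0.

Definition cQ : R := 3 / E ^+ 3 + 1 / E ^+ 2 + 1 / E.

Let cQ0 : 0 <= cQ.
Proof. by rewrite /cQ !addr_ge0// divr_ge0// ?exprn_ge0// ltW. Qed.

Let iE : 0 <= 1 / E. Proof. by rewrite divr_ge0// ltW. Qed.
Let iE2 : 0 <= 1 / E ^+ 2. Proof. by rewrite divr_ge0// exprn_ge0// ltW. Qed.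
Let iE3 : 0 <= 3 / E ^+ 3. Proof. by rewrite divr_ge0// exprn_ge0// ltW. Qed.

Let qE x y a : E <= cyld e x y a.
Proof.
rewrite /E /cyld ler_wsqrtr// sqdE -!addrA lerDl !addr_ge0 ?sqr_ge0//.
Qed.

Let q0 x y a : 0 < cyld e x y a. Proof. exact: lt_le_trans (qE x y a). Qed.

Let sz x y a : `|x.2 - y.2| <= cyld e x y a.
Proof.
rewrite -(@ler_pXn2r _ 2) ?nnegrE ?normr_ge0 ?(ltW (q0 x y a))//.
rewrite real_normK ?num_real// cyld_sqr// sqdE.
have := sqr_ge0 (y.1 - x.1 * cos a); have := sqr_ge0 (x.1 * sin a); have := e0; lra.
Qed.

Let sr x y a : `|x.1 - y.1 * cos a| <= cyld e x y a.
Proof.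
rewrite -(@ler_pXn2r _ 2) ?nnegrE ?normr_ge0 ?(ltW (q0 x y a))//.
rewrite real_normK ?num_real// cyld_sqr// sqdC sqdE.
have := sqr_ge0 (y.2 - x.2); have := sqr_ge0 (y.1 * sin a); have := e0; lra.
Qed.

Let k0 : 0 <= (2 * pi)^-1 :> R.
Proof. by rewrite invr_ge0 mulr_ge0// pi_ge0. Qed.

Let kpi (c : R) : 0 <= c -> (2 * pi)^-1 * (c * pi) <= c.
Proof.
move=> c0; have := @pi_gt0 R; move: (pi) => p p0.
rewrite (_ : (2 * p)^-1 * (c * p) = c / 2); last by field; rewrite gt_eqF.
by lra.
Qed.

Let normcos a : `|cos a| <= 1 :> R. Proof. by rewrite ler_norml cos_geN1 cos_le1. Qed.

Let angk (g : R -> R) (c : R) : (forall a, `|g a| <= c) -> `|(2 * pi)^-1 * angint g| <= c.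
Proof.
move=> gc; have c0 : 0 <= c by exact: le_trans (normr_ge0 _) (gc 0).
rewrite normrM (ger0_norm k0); apply: le_trans (kpi c0).
by rewrite ler_wpM2l//; apply: angint_cst_bound => a _.
Qed.

Let inv1 x y a : (cyld e x y a)^-1 <= 1 / E.
Proof. by rewrite div1r lef_pV2 ?posrE. Qed.

Let inv2 x y a (u w : R) : `|u| <= w * cyld e x y a -> 0 <= w -> `|u / cyld e x y a ^+ 3| <= w * (1 / E ^+ 2).
Proof.
move=> uw w0; rewrite normrM normfV (ger0_norm (exprn_ge0 3 (ltW (q0 x y a)))).
rewrite ler_pdivrMr ?exprn_gt0//.
apply: (le_trans uw).
have : E ^+ 2 <= cyld e x y a ^+ 2 by rewrite lerXn2r ?nnegrE ?(ltW E0) ?(ltW (q0 x y a)).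
have := q0 x y a; set q := cyld e x y a => qp h.
have -> : w * (1 / E ^+ 2) * q ^+ 3 = w * q * (q ^+ 2 / E ^+ 2) by field; rewrite gt_eqF.
rewrite ler_peMr ?mulr_ge0 ?(ltW qp)// ler_pdivlMr ?exprn_gt0// mul1r //.
Qed.

Lemma Gk_bound x y : `|Gk e x y| <= cQ * `|x.1| * `|y.1|.
Proof.
apply: (@le_trans _ _ (`|x.1| * `|y.1| * (1 / E))).
  apply: angk => a; rewrite /gG normrM normfV (gtr0_norm (q0 x y a)).
  apply: ler_pM; [exact: normr_ge0|by rewrite invr_ge0 ltW| |exact: inv1].
  by rewrite !normrM ler_piMr// mulr_ge0.
have -> : cQ * `|x.1| * `|y.1| = `|x.1| * `|y.1| * cQ by ring.
rewrite ler_wpM2l ?mulr_ge0// /cQ.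
have : 0 <= 3 / E ^+ 3 by rewrite divr_ge0// exprn_ge0// ltW.
have : 0 <= 1 / E ^+ 2 by rewrite divr_ge0// exprn_ge0// ltW.
lra.
Qed.

Let bound2 x y : `|x.1| * `|y.1| * (1 / E ^+ 2) <= cQ * `|x.1| * `|y.1|.
Proof.
have -> : cQ * `|x.1| * `|y.1| = `|x.1| * `|y.1| * cQ by ring.
rewrite ler_wpM2l ?mulr_ge0// /cQ.
have : 0 <= 3 / E ^+ 3 by rewrite divr_ge0// exprn_ge0// ltW.
have : 0 <= 1 / E by rewrite divr_ge0// ltW.
lra.
Qed.

Lemma Pk_bound x y : `|Pk e x y| <= cQ * `|x.1| * `|y.1|.
Proof.
apply: le_trans (bound2 x y); apply: angk => a; rewrite /gP.
apply: inv2; last by rewrite mulr_ge0.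
rewrite normrM normrM ler_wpM2l ?mulr_ge0//.
by have := sr y x a; rewrite /cyld sqdC.
Qed.

Lemma Zk_bound x y : `|Zk x y| <= cQ * `|x.1| * `|y.1|.
Proof.
apply: le_trans (bound2 x y); rewrite normrN /Nk mulrCA -angintZ; last exact: continuous_gN.
apply: angk => a; rewrite /gN mulrA; apply: inv2; last by rewrite mulr_ge0.
rewrite normrM mulrC !normrM -!mulrA ler_wpM2l// ler_wpM2l//.
by rewrite -[X in _ <= X]mul1r ler_pM.
Qed.

Lemma Gk_quad_r x y (h : R) :
  `|Gk e (x.1 + h, x.2) y - Gk e x y - h * Pk e x y| <= cQ * (1 + `|x.1|) * `|y.1| * h ^+ 2.
Proof.
rewrite Pk_raw//; pose x' : R * R := (x.1 + h, x.2); rewrite -/x'.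
pose g a := y.1 * cos a / cyld e x y a - x.1 * y.1 * cos a * (x.1 - y.1 * cos a) / cyld e x y a ^+ 3.
have cg : continuous g.
  move=> a; apply: cvgB.
    apply: (@continuous_divcyld _ e x y 1 (fun a => y.1 * cos a)) => // b.
    by apply: cvgM; [exact: cvg_cst|exact: continuous_cos].
  apply: (@continuous_divcyld _ e x y 3 (fun a => x.1 * y.1 * cos a * (x.1 - y.1 * cos a))) => // b.
  apply: cvgM; first by apply: cvgM; [exact: cvg_cst|exact: continuous_cos].
  apply: cvgB; first exact: cvg_cst.
  by apply: cvgM; [exact: cvg_cst|exact: continuous_cos].
have cG := continuous_gG (s x y); have cG' := continuous_gG (s x' y).
have chg : continuous (fun a => h * g a) by move=> a; apply: cvgM; [exact: cvg_cst|exact: cg].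
have cGG : continuous (fun a => gG e x' y a - gG e x y a) by move=> a; apply: cvgB; [exact: cG'|exact: cG].
have -> : Gk e x' y - Gk e x y - h * ((2 * pi)^-1 * angint g)
   = (2 * pi)^-1 * angint (fun a => gG e x' y a - gG e x y a - h * g a).
  by rewrite (angintB cGG chg) (angintB cG' cG) (angintZ _ cg) /Gk; ring.
apply: (@le_trans _ _ (`|y.1| * (`|x.1| * (3 / E ^+ 3 * h ^+ 2) + h ^+ 2 / E ^+ 2))); last first.
  have -> : cQ * (1 + `|x.1|) * `|y.1| * h ^+ 2 = `|y.1| * (cQ * (1 + `|x.1|) * h ^+ 2) by ring.
  rewrite ler_wpM2l//; have u0 : 0 <= 1 / E * (1 + `|x.1|) * h ^+ 2.
    apply: mulr_ge0 (sqr_ge0 _); apply: mulr_ge0; last exact: addr_ge0.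
    by rewrite divr_ge0// ltW.
  have u1 : 0 <= 3 / E ^+ 3 * h ^+ 2 by rewrite mulr_ge0 ?sqr_ge0// divr_ge0// exprn_ge0// ltW.
  have u2 := mulr_ge0 (mulr_ge0 iE2 (sqr_ge0 h)) (normr_ge0 x.1).
  rewrite /cQ; lra.
apply: angk => a.
set q := cyld e x y a; set q1 := cyld e x' y a; set t := x.1 - y.1 * cos a.
have Eq : q1 ^+ 2 = q ^+ 2 + 2 * h * t + h ^+ 2.
  by rewrite !cyld_sqr// /sqd /x' /t /=; ring.
have [b1 b2] := inv_sqrt_remainder E0 (qE x y a) (qE x' y a) Eq (sr x y a).
rewrite -/q -/q1 -/t in b1 b2.
have -> : gG e x' y a - gG e x y a - h * g a =
    y.1 * cos a * (x.1 * (q1^-1 - q^-1 + h * t / q ^+ 3) + h * (q1^-1 - q^-1)).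
  by rewrite /gG /g /x' /= -/q -/q1 -/t; ring.
rewrite normrM; apply: ler_pM => //; first by rewrite normrM ler_piMr.
apply: le_trans (ler_normD _ _) _; rewrite !normrM; apply: lerD; first exact: ler_wpM2l.
have -> : h ^+ 2 / E ^+ 2 = `|h| * (`|h| / E ^+ 2) by rewrite -(real_normK (num_real h)); ring.
exact: ler_wpM2l.
Qed.

Lemma Gk_quad_z x y (h : R) :
  `|Gk e (x.1, x.2 + h) y - Gk e x y - h * Zk x y| <= cQ * (1 + `|x.1|) * `|y.1| * h ^+ 2.
Proof.
pose x' : R * R := (x.1, x.2 + h); rewrite -/x'.
pose t := x.2 - y.2.
have cg := continuous_gN (s x y).
have cG := continuous_gG (s x y); have cG' := continuous_gG (s x' y).
have chg : continuous (fun a => h * t * gN e x y a) by move=> a; apply: cvgM; [exact: cvg_cst|exact: cg].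
have cGG : continuous (fun a => gG e x' y a - gG e x y a) by move=> a; apply: cvgB; [exact: cG'|exact: cG].
have -> : Gk e x' y - Gk e x y - h * Zk x y
   = (2 * pi)^-1 * angint (fun a => gG e x' y a - gG e x y a + h * t * gN e x y a).
  by rewrite (angintD cGG chg) (angintB cG' cG) (angintZ _ cg) /Gk /Zk /Nk -/t; ring.
apply: (@le_trans _ _ (`|x.1| * `|y.1| * (3 / E ^+ 3 * h ^+ 2))); last first.
  have -> : cQ * (1 + `|x.1|) * `|y.1| * h ^+ 2 = `|y.1| * (cQ * (1 + `|x.1|) * h ^+ 2) by ring.
  rewrite -mulrA mulrCA ler_wpM2l//.
  have u0 : 0 <= (1 / E ^+ 2 + 1 / E) * (1 + `|x.1|) * h ^+ 2.
    apply: mulr_ge0 (sqr_ge0 _); apply: mulr_ge0; last exact: addr_ge0.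
    exact: addr_ge0.
  have u1 : 0 <= 3 / E ^+ 3 * h ^+ 2 by rewrite mulr_ge0 ?sqr_ge0// divr_ge0// exprn_ge0// ltW.
  rewrite /cQ; lra.
apply: angk => a.
set q := cyld e x y a; set q1 := cyld e x' y a.
have Eq : q1 ^+ 2 = q ^+ 2 + 2 * h * t + h ^+ 2.
  by rewrite !cyld_sqr// /sqd /x' /t /=; ring.
have [b1 b2] := inv_sqrt_remainder E0 (qE x y a) (qE x' y a) Eq (sz x y a).
rewrite -/q -/q1 -/t in b1 b2.
have -> : gG e x' y a - gG e x y a + h * t * gN e x y a =
    x.1 * y.1 * cos a * (q1^-1 - q^-1 + h * t / q ^+ 3).
  by rewrite /gG /gN /x' /= -/q -/q1; ring.
rewrite normrM; apply: ler_pM => //; rewrite normrM; rewrite -[X in _ <= X]mulr1; apply: ler_pM => //.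
by rewrite normrM.
Qed.

Lemma measurable_Zk : meas2 Zk.
Proof.
have m12 : measurable_fun setT (fun q : pT * pT => q.1.2) by apply: measurableT_comp.
have m22 : measurable_fun setT (fun q : pT * pT => q.2.2) by apply: measurableT_comp.
have mN := @measurable_Nk R e.
by rewrite /meas2 /Zk; meas.
Qed.

Lemma quad_Gk_section y : quad_fun (fun x => Gk e x y) (fun x => Pk e x y) (fun x => Zk x y) (cQ * `|y.1|).
Proof.
have sec k : meas2 k -> measurable_fun setT ((fun x => k x y) : pT -> R).
  by move=> mk; have := measurableT_comp mk (measurable_pair2 y).
have w (u : R) x : u <= cQ * `|x.1| * `|y.1| -> u <= cQ * `|y.1| * (1 + `|x.1|).
  by move=> h; apply: (le_trans h); have := mulr_ge0 cQ0 (normr_ge0 y.1); lra.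
split.
- by rewrite mulr_ge0.
- by move=> x; apply: w; exact: Gk_bound.
- by move=> x; apply: w; exact: Pk_bound.
- by move=> x; apply: w; exact: Zk_bound.
- by move=> x h; rewrite (mulrAC cQ); exact: Gk_quad_r.
- by move=> x h; rewrite (mulrAC cQ); exact: Gk_quad_z.
- exact: sec (@measurable_Gk R e).
- exact: sec (@measurable_Pk R e).
- exact: sec measurable_Zk.
Qed.

Section potential.
Variables (c M : R) (f : R * R -> R).
Hypothesis gf : good c M f.

Lemma momint_section k x : meas2 k -> (forall y, `|k x y| <= cQ * (1 + `|x.1|) * `|y.1|) -> momint f (k x).
Proof.
move=> mk kb; have C0 : 0 <= cQ * (1 + `|x.1|) by rewrite mulr_ge0// addr_ge0.
apply: (momint_lin gf _ C0); first exact: meas2_section.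
move=> y y0; apply: (le_trans (kb y)); rewrite ler_wpM2l// (ger0_norm (ltW y0)) /lin lerDr//.
Qed.

Let wide x y (u : R) : u <= cQ * `|x.1| * `|y.1| -> u <= cQ * (1 + `|x.1|) * `|y.1|.
Proof.
by move=> h; apply: (le_trans h); have := mulr_ge0 cQ0 (normr_ge0 y.1); lra.
Qed.

Lemma momint_Gk x : momint f (Gk e x).
Proof. by apply: momint_section; [exact: measurable_Gk|move=> y; apply: wide; exact: Gk_bound]. Qed.
Lemma momint_Pk x : momint f (Pk e x).
Proof. by apply: momint_section; [exact: measurable_Pk|move=> y; apply: wide; exact: Pk_bound]. Qed.
Lemma momint_Zk x : momint f (Zk x).
Proof. by apply: momint_section; [exact: measurable_Zk|move=> y; apply: wide; exact: Zk_bound]. Qed.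

Let mom_kb (g : R * R -> R) (C : R) : 0 <= C -> (forall y, `|g y| <= C * `|y.1|) -> `|mom f g| <= C * M.
Proof.
move=> C0 gb; apply: (mom_bound gf (h := fun y => C * r1 y)).
  by move=> y y0; apply: (le_trans (gb y)); rewrite (ger0_norm (ltW y0)).
have i := momint_Z C (momint_id gf); rewrite (mom_EFin i) lee_fin (momZ _ (momint_id gf)).
by rewrite ler_wpM2l//; exact: mom_id_le gf.
Qed.

Lemma quad_potential :
  quad_fun (fun x => mom f (Gk e x)) (fun x => mom f (Pk e x)) (fun x => mom f (Zk x)) (cQ * M).
Proof.
have M0 := good_M_ge0 gf.
have C0 x : 0 <= cQ * (1 + `|x.1|) by rewrite mulr_ge0// addr_ge0.
split.
- by rewrite mulr_ge0.
- by move=> x; rewrite mulrAC; apply: mom_kb => // y; apply: wide; exact: Gk_bound.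
- by move=> x; rewrite mulrAC; apply: mom_kb => // y; apply: wide; exact: Pk_bound.
- by move=> x; rewrite mulrAC; apply: mom_kb => // y; apply: wide; exact: Zk_bound.
- move=> x h.
  have -> : mom f (Gk e (x.1 + h, x.2)) - mom f (Gk e x) - h * mom f (Pk e x) =
     mom f (fun y => Gk e (x.1 + h, x.2) y + -1 * Gk e x y + - h * Pk e x y).
    rewrite (momD (momint_D (momint_Gk _) (momint_Z _ (momint_Gk _))) (momint_Z _ (momint_Pk _))).
    rewrite (momD (momint_Gk _) (momint_Z _ (momint_Gk _))) (momZ _ (momint_Gk _)) (momZ _ (momint_Pk _)).
    by rewrite mulN1r mulNr.
  rewrite (_ : cQ * M * _ * _ = cQ * (1 + `|x.1|) * h ^+ 2 * M); last by ring.
  apply: mom_kb => [|y]; first by rewrite mulr_ge0 ?sqr_ge0.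
  rewrite mulN1r mulNr (mulrAC _ (h ^+ 2)); exact: Gk_quad_r.
- move=> x h.
  have -> : mom f (Gk e (x.1, x.2 + h)) - mom f (Gk e x) - h * mom f (Zk x) =
     mom f (fun y => Gk e (x.1, x.2 + h) y + -1 * Gk e x y + - h * Zk x y).
    rewrite (momD (momint_D (momint_Gk _) (momint_Z _ (momint_Gk _))) (momint_Z _ (momint_Zk _))).
    rewrite (momD (momint_Gk _) (momint_Z _ (momint_Gk _))) (momZ _ (momint_Gk _)) (momZ _ (momint_Zk _)).
    by rewrite mulN1r mulNr.
  rewrite (_ : cQ * M * _ * _ = cQ * (1 + `|x.1|) * h ^+ 2 * M); last by ring.
  apply: mom_kb => [|y]; first by rewrite mulr_ge0 ?sqr_ge0.
  rewrite mulN1r mulNr (mulrAC _ (h ^+ 2)); exact: Gk_quad_z.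
- exact: (measurable_mom_section gf (k := Gk e) (measurable_Gk e)).
- exact: (measurable_mom_section gf (k := Pk e) (measurable_Pk e)).
- exact: (measurable_mom_section gf (k := Zk) measurable_Zk).
Qed.

End potential.
End RegularisedKernels.

Section EnergyConservation.
Context {R : realType}.
Local Notation mu2 := (@plane_measure R).
Local Notation mu4 := (mu2 \x mu2)%E.
Local Notation pT := (measurableTypeR R * measurableTypeR R)%type.
Implicit Types (x y : R * R).

Lemma point_rect x : [set x] = ([set x.1] `*` [set x.2] : set pT).
Proof. by case: x => a b; apply/seteqP; split => [y -> //|[u w] [/= -> ->]]. Qed.

Lemma plane_measure_point x : mu2 ([set x] : set pT) = 0%E.
Proof.
rewrite point_rect plane_measure_rect//; try exact: measurable_set1.
by rewrite !lebesgue_measure_set1 mul0e.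
Qed.

(** A point is a null set, so the diagonal may be removed from the regularised kernels, which do not
    vanish there, before they are compared with the singular ones. *)
Lemma mom_offd (f g : R * R -> R) x : measurable_fun setT (f : pT -> R) ->
  measurable_fun setT (g : pT -> R) -> mom f (fun y => offd x y * g y) = mom f g.
Proof.
move=> mf mg; have mo : measurable_fun setT (offd x : pT -> R) by exact: (meas2_section x (@measurable_offd R)).
rewrite /mom /Rintegral; congr fine; apply: ae_eq_integral => //.
- by apply/measurable_EFinP; apply: measurable_funM => //; exact: measurable_funM.
- by apply/measurable_EFinP; exact: measurable_funM.
exists [set x]; split; [|exact: plane_measure_point|].
  rewrite point_rect.
  by apply: measurableX; exact: measurable_set1.
move=> y /=; apply: contra_notP => /eqP yx _.
by rewrite offd_neq 1?eq_sym// mul1r.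
Qed.

Section static.
Variables (c M : R) (f : R * R -> R).
Hypothesis gf : good c M f.
Let M0 : 0 <= M. Proof. exact: good_M_ge0 gf. Qed.
Let f0 := good_ge0 gf.
Let mf : measurable_fun setT (f : pT -> R) := good_meas gf.
Variables (e eta : R).
Hypotheses (e0 : 0 < e) (eta0 : 0 < eta) (eta1 : eta <= 1).

Lemma split_potential_le x (A B : R) : 0 < x.1 -> 0 <= A -> 0 <= B ->
  (\int[mu2]_y ((A * ((eucl_dist x y)^-1 * near eta x y) + B * (x.1 + y.1)) * f y)%:E
   <= (A * (M * (16 * eta)) + B * (x.1 * M + M))%:E)%E.
Proof.
move=> x0 A0 B0.
have mn := measurable_near x eta.
have md : measurable_fun setT ((fun y => (eucl_dist x y)^-1) : pT -> R).
  by apply: measurable_funV; exact: (meas2_section x (@measurable_eucl_dist R)).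
have mdn : measurable_fun setT ((fun y => (eucl_dist x y)^-1 * near eta x y) : pT -> R) by exact: measurable_funM.
have dn0 y : 0 <= (eucl_dist x y)^-1 * near eta x y by rewrite mulr_ge0 ?near_ge0// invr_ge0 sqrtr_ge0.
have m1 : measurable_fun setT ((fun y => B * (x.1 + y.1)) : pT -> R).
  by apply: measurable_funM => //; apply: measurable_funD => //; exact: measurable_fst.
have g0 y : 0 <= B * (x.1 + y.1) * f y.
  by apply: (good_weight_ge0 gf (g := fun y => B * (x.1 + y.1))) => y0; rewrite mulr_ge0// addr_ge0// ltW.
apply: (@le_trans _ _ (\int[mu2]_y ((A * M)%:E * ((eucl_dist x y)^-1 * near eta x y)%:E + (B * (x.1 + y.1) * f y)%:E))%E).
  apply: le_integral_nomeas => y _.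
    rewrite lee_fin mulrDl addr_ge0// mulr_ge0// mulr_ge0//.
  rewrite -EFinM -EFinD lee_fin mulrDl lerD2r -mulrA -(mulrA A M) ler_wpM2l// mulrC ler_wpM2r//.
  exact: good_M gf y.
rewrite ge0_integralD//=; last 4 first.
- by move=> y _; rewrite -EFinM lee_fin mulr_ge0// mulr_ge0.
- by under eq_fun do rewrite -EFinM; apply/measurable_EFinP; exact: measurable_funM.
- by move=> y _; rewrite lee_fin.
- by apply/measurable_EFinP; exact: measurable_funM.
rewrite EFinD; apply: leeD.
  rewrite ge0_integralZl_EFin//=; last 3 first.
  - by move=> y _; rewrite lee_fin.
  - exact/measurable_EFinP.
  - exact: mulr_ge0.
  rewrite (_ : A * (M * (16 * eta)) = A * M * (16 * eta)); last by ring.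
  rewrite (EFinM (A * M) (16 * eta)); apply: lee_wpmul2l; first by rewrite lee_fin mulr_ge0.
  exact: singular_integral.
have := @good_integral_le _ _ _ _ gf (fun y => B * (x.1 + y.1)) (B * x.1) B.
rewrite (_ : (B * x.1 + B) * M = B * (x.1 * M + M)); last by ring.
apply => //; last by rewrite mulr_ge0// ltW.
by move=> y y0; rewrite mulrDr lexx andbT addr_ge0// mulr_ge0// ltW.
Qed.

(** The term 12 eta = (3 / 4) 16 eta is the contribution of the distances below eta. The other one
    comes from beyond eta and tends to 0 with e once eta is fixed. *)
Definition eps_reg : R := 12 * eta + 2 * Num.sqrt e / eta ^+ 2.

Lemma regularised_diff (g : R * R -> R) x : 0 < x.1 ->
  (forall y, 0 < y.1 -> x != y -> `|g y| <= 3 / 4 * (gm x y / eucl_dist x y) /\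
     `|g y| <= 9 / 4 * Num.sqrt e * (gm x y / eucl_dist x y ^+ 2)) ->
  `|mom f (fun y => offd x y * g y)| <= (1 + x.1) * M * eps_reg.
Proof.
move=> x0 hg; have se : 0 <= Num.sqrt e by exact: sqrtr_ge0.
have e2 : 0 < eta ^+ 2 by rewrite exprn_gt0.
pose A := 3 / 4 * (1 + x.1); pose B := 2 * Num.sqrt e / eta ^+ 2.
have A0 : 0 <= A by rewrite mulr_ge0// addr_ge0// ltW.
have B0 : 0 <= B by rewrite divr_ge0 ?mulr_ge0// ltW.
apply: (@le_trans _ _ (A * (M * (16 * eta)) + B * (x.1 * M + M))); last first.
  by rewrite /eps_reg -/B /A; lra.
apply: (mom_bound gf (h := fun y => A * ((eucl_dist x y)^-1 * near eta x y) + B * (x.1 + y.1))); last first.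
  exact: split_potential_le.
move=> y y0; have xy0 : 0 < x.1 + y.1 by exact: addr_gt0.
have [xyE|xy] := eqVneq x y.
  have -> : offd x y = 0 by rewrite -xyE offd_eq.
  rewrite mul0r normr0; apply: addr_ge0; last by rewrite mulr_ge0// ltW.
  by rewrite !mulr_ge0 ?near_ge0// ?invr_ge0 ?sqrtr_ge0// addr_ge0// ltW.
rewrite (offd_neq xy) mul1r; have [h1 h2] := hg y y0 xy.
have d0 : 0 < eucl_dist x y by exact: eucl_dist_gt0.
have gx := gm_le_mean x0 y0.
rewrite /near; have [dl|dg] := ltP (eucl_dist x y) eta.
  rewrite mulr1; apply: (@le_trans _ _ (A / eucl_dist x y)); last by rewrite lerDl mulr_ge0// ltW.
  apply: (le_trans h1); rewrite (_ : A / _ = 3 / 4 * ((1 + x.1) / eucl_dist x y)); last by rewrite /A mulrA.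
  apply: ler_wpM2l => //; apply: ler_wpM2r; first by rewrite invr_ge0 ltW.
  by have := dist1_le x y; rewrite ler_norml => /andP[h _]; have := eta1; lra.
rewrite !mulr0 add0r; apply: (le_trans h2).
have : gm x y / eucl_dist x y ^+ 2 <= (x.1 + y.1) / 2 / eta ^+ 2.
  apply: ler_pM => //; first exact: gm_ge0.
    by rewrite invr_ge0 exprn_ge0// ltW.
  by rewrite lef_pV2 ?posrE ?exprn_gt0// lerXn2r ?nnegrE ?(ltW d0) ?(ltW eta0).
have s9 : 0 <= 9 / 4 * Num.sqrt e by rewrite mulr_ge0.
move=> /(ler_wpM2l s9) h; apply: (le_trans h).
have -> : 9 / 4 * Num.sqrt e * ((x.1 + y.1) / 2 / eta ^+ 2) = 9 / 16 * (B * (x.1 + y.1)).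
  by rewrite /B; field; rewrite gt_eqF.
by have := mulr_ge0 B0 (ltW xy0); lra.
Qed.

(* For e = 0 the left side vanishes, (vr, vz) being r^-1 times the rotated gradient
   of G0[f]. *)
Lemma flux_self x : 0 < x.1 ->
  `|mom f (Pk e x) * vr f x + mom f (Zk e x) * vz f x| <= 68 * M * ((1 + x.1) * M * eps_reg).
Proof.
move=> x0; have b1 := vr_bound gf x0; have b2 := vz_bound gf x0.
have mP := measurable_Pk e; have mN := measurable_Nk e; have mP0 := measurable_Pk 0; have mN0 := measurable_N0.
have iKR : momint f (KR x).
  apply: (good_integrable gf (h := fun y => 2 / eucl_dist x y) (B := 34 * M)).
  - exact: (meas2_section x (@measurable_KR R)).
  - by move=> y y0; exact: KR_bound.
  - exact: potential2_le gf x.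
have iKZ : momint f (KZ x).
  apply: (good_integrable gf (h := fun y => 2 / eucl_dist x y) (B := 34 * M)).
  - exact: (meas2_section x (@measurable_KZ R)).
  - by move=> y y0; exact: KZ_bound.
  - exact: potential2_le gf x.
have D1 : `|mom f (Pk e x) - x.1 * vz f x| <= (1 + x.1) * M * eps_reg.
  have -> : mom f (Pk e x) - x.1 * vz f x = mom f (fun y => Pk e x y + - x.1 * KZ x y).
    by rewrite (momD (momint_Pk e0 gf x) (momint_Z _ iKZ)) (momZ _ iKZ) mulNr.
  have mg : measurable_fun setT ((fun y => Pk e x y + - x.1 * KZ x y) : pT -> R).
    apply: measurable_funD; first exact: (meas2_section x mP).
    by apply: measurable_funM => //; exact: (meas2_section x (@measurable_KZ R)).
  rewrite -(mom_offd x mf mg); apply: regularised_diff => // y y0 xy.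
  have -> : Pk e x y + - x.1 * KZ x y = Pk e x y - Pk 0 x y.
    by rewrite /KZ offd_neq// mul1r; field; rewrite gt_eqF.
  exact: (Pk_regularised x0 y0 xy erefl erefl (ltW e0)).
have D2 : `|mom f (Zk e x) + x.1 * vr f x| <= (1 + x.1) * M * eps_reg.
  have -> : mom f (Zk e x) + x.1 * vr f x = mom f (fun y => Zk e x y + x.1 * KR x y).
    by rewrite (momD (momint_Zk e0 gf x) (momint_Z _ iKR)) (momZ _ iKR).
  have mg : measurable_fun setT ((fun y => Zk e x y + x.1 * KR x y) : pT -> R).
    apply: measurable_funD; first exact: (meas2_section x (measurable_Zk e)).
    by apply: measurable_funM => //; exact: (meas2_section x (@measurable_KR R)).
  rewrite -(mom_offd x mf mg); apply: regularised_diff => // y y0 xy.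
  have -> : Zk e x y + x.1 * KR x y = - ((x.2 - y.2) * Nk e x y - (x.2 - y.2) * Nk 0 x y).
    by rewrite /KR /N0 /Zk offd_neq// mul1r; field; rewrite gt_eqF.
  rewrite normrN; exact: (zNk_regularised x0 y0 xy erefl erefl (ltW e0)).
have -> : mom f (Pk e x) * vr f x + mom f (Zk e x) * vz f x =
  (mom f (Pk e x) - x.1 * vz f x) * vr f x + (mom f (Zk e x) + x.1 * vr f x) * vz f x.
  by move: (mom f _) (mom f _) (vr f x) (vz f x) => u1 u2 u3 u4; ring.
apply: le_trans (ler_normD _ _) _; rewrite !normrM.
set K := (1 + x.1) * M * eps_reg in D1 D2 *.
have -> : 68 * M * K = K * (34 * M) + K * (34 * M) by ring.
by apply: lerD; exact: ler_pM.
Qed.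

End static.
End EnergyConservation.

Section EnergyEvolution.
Context {R : realType}.
Local Notation mu2 := (@plane_measure R).
Local Notation mu4 := (mu2 \x mu2)%E.
Local Notation pT := (measurableTypeR R * measurableTypeR R)%type.
Implicit Types (x y : R * R).

Lemma good_add (c M : R) (f g : R * R -> R) : good c M f -> good c M g ->
  good (2 * c) (2 * M) (fun x => f x + g x).
Proof.
move=> gf gg; have mf := good_meas gf; have mg := good_meas gg.
have f0 := good_ge0 gf; have g0 := good_ge0 gg.
have M2 : (2 * M)%:E = (M%:E + M%:E)%E by rewrite -EFinD; congr EFin; ring.
have rf0 x : 0 <= x.1 * f x by apply: (good_weight_ge0 gf (g := fst)) => /ltW.
have rg0 x : 0 <= x.1 * g x by apply: (good_weight_ge0 gg (g := fst)) => /ltW.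
split.
- exact: measurable_funD.
- by move=> x; exact: addr_ge0.
- by move=> x x0; rewrite (good_out gf)// (good_out gg)// addr0.
- by move=> x x0; have := good_c gf x0; have := good_c gg x0; lra.
- by move=> x; have := good_M gf x; have := good_M gg x; lra.
- under eq_integral do rewrite EFinD.
  rewrite ge0_integralD//=; try by [move=> x _; rewrite lee_fin|exact/measurable_EFinP].
  by rewrite M2; apply: leeD; [exact: good_mass gf|exact: good_mass gg].
- under eq_integral do rewrite mulrDr EFinD.
  have mr : measurable_fun setT ((fun x => x.1) : pT -> R) by exact: measurable_fst.
  rewrite ge0_integralD//=; try by [move=> x _; rewrite lee_fin|apply/measurable_EFinP; exact: measurable_funM].
  by rewrite M2; apply: leeD; [exact: good_rmass gf|exact: good_rmass gg].
Qed.

Lemma good2_add (c M : R) (f g : R * R -> R) : good2 c M f -> good2 c M g ->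
  good2 (2 * c) (2 * M) (fun x => f x + g x).
Proof.
move=> gf gg; split; first exact: good_add gf gg.
have mf := good_meas gf; have mg := good_meas gg.
have M2 : (2 * M)%:E = (M%:E + M%:E)%E by rewrite -EFinD; congr EFin; ring.
under eq_integral do rewrite mulrDr EFinD.
have mr : measurable_fun setT ((fun x => x.1 ^+ 2) : pT -> R) by exact: measurable_r2.
have f0 x : 0 <= x.1 ^+ 2 * f x by rewrite mulr_ge0 ?sqr_ge0 ?(good_ge0 gf).
have g0 x : 0 <= x.1 ^+ 2 * g x by rewrite mulr_ge0 ?sqr_ge0 ?(good_ge0 gg).
rewrite ge0_integralD//=; try by [move=> x _; rewrite lee_fin|apply/measurable_EFinP; exact: measurable_funM].
by rewrite M2; apply: leeD; [exact: good2_r2 gf|exact: good2_r2 gg].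
Qed.

Lemma Gk_wt (e : R) x y : 0 < e -> 0 < x.1 -> 0 < y.1 -> `|Gk e x y| <= cQ e * (wt x * wt y).
Proof.
move=> e0 x0 y0; have C0 := quad_C (quad_potential e0 (c := 0) (M := 1) (f := fun=> 0) _).
apply: (le_trans (Gk_bound e0 x y)); rewrite !ger0_norm ?(ltW x0) ?(ltW y0)// -mulrA.
apply: ler_wpM2l.
  have E0 : 0 <= Num.sqrt e by exact: sqrtr_ge0.
  by rewrite /cQ !addr_ge0// divr_ge0// exprn_ge0.
rewrite /wt; have := sqr_ge0 (x.1 * y.1 - 1); have := sqr_ge0 x.1; have := sqr_ge0 y.1.
have := sqr_ge0 (x.1 - y.1); nra.
Qed.

Lemma Jint_Gk (e c M : R) (f : R * R -> R) : 0 < e -> good2 c M f -> Jint f (Gk e).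
Proof.
move=> e0 gf; apply: (Jint_dom gf (measurable_Gk e) _ (Jint_Z (cQ e) (Jint_wt gf))).
by move=> x y x0 y0; exact: Gk_wt.
Qed.

(** The mixed kernel is dominated by that of the density f + g, so Fubini applies and the symmetry
    of G exchanges the two densities. *)
Lemma cross_sym (e c M : R) (f g : R * R -> R) : 0 < e -> good2 c M f -> good2 c M g ->
  mom f (fun x => mom g (Gk e x)) = mom g (fun x => mom f (Gk e x)).
Proof.
move=> e0 gf gg; have gs := good2_add gf gg.
have f0 := good_ge0 gf; have g0 := good_ge0 gg.
have mf := good_meas gf; have mg := good_meas gg.
have ints : mu4.-integrable setT (EFin \o (fun p : (R * R) * (R * R) => Gk e p.1 p.2 * (f p.1 * g p.2))).
  have ig := Jint_Gk e0 gs.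
  apply: (@le_integrable _ _ R mu4 setT measurableT _
    (fun p : (R * R) * (R * R) => (Gk e p.1 p.2 * ((f p.1 + g p.1) * (f p.2 + g p.2)))%:E)); last exact: ig.
    apply/measurable_EFinP; apply: measurable_funM; first exact: measurable_Gk.
    by apply: measurable_funM; [exact: (measurable_p1 mf)|exact: (measurable_p2 mg)].
  move=> p _; rewrite /= lee_fin !normrM ler_wpM2l//.
  rewrite !ger0_norm ?addr_ge0//; apply: ler_pM => //; first by rewrite lerDl.
  by rewrite lerDr.
have iG h x : good2 c M h -> momint h (Gk e x) by move=> gh; exact: (momint_Gk e0 gh x).
have E1 : \int[mu4]_p (Gk e p.1 p.2 * (f p.1 * g p.2)) = mom f (fun x => mom g (Gk e x)).
  rewrite (@Rintegral_prod _ _ _ _ R mu2 mu2 (fun p => Gk e p.1 p.2 * (f p.1 * g p.2)))//=.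
    apply: eq_Rintegral => x _; rewrite mulrC -RintegralZl//; last exact: iG gg.
    by apply: eq_Rintegral => y _; rewrite mulrCA.
  move=> x; have := integrableZl measurableT (f x) (iG _ x gg).
  by congr (_.-integrable _ _); apply/funext => y /=; rewrite -EFinM mulrCA.
have ints' := integrable_swap ints.
rewrite -E1 (@Rintegral_swap _ _ R mu2 (fun p => Gk e p.1 p.2 * (f p.1 * g p.2)))//=.
rewrite (@Rintegral_prod _ _ _ _ R mu2 mu2 (fun p => Gk e p.2 p.1 * (f p.2 * g p.1)))//=.
  apply: eq_Rintegral => x _; rewrite mulrC -RintegralZl//; last exact: iG gf.
  by apply: eq_Rintegral => y _; rewrite Gk_sym; ring.
move=> x; have := integrableZl measurableT (g x) (iG _ x gf).
congr (_.-integrable _ _); apply/funext => y /=; rewrite -EFinM; congr EFin.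
by rewrite Gk_sym; ring.
Qed.

Definition Ereg (e : R) (f : R * R -> R) : R := mom f (fun x => mom f (Gk e x)).

Lemma Ereg_close (e c M : R) (f : R * R -> R) : 0 < e -> good2 c M f ->
  `|J f G0 - Ereg e f| <= Num.sqrt e * (3 / 4 * J f (fun x y => gm x y / eucl_dist x y)).
Proof.
move=> e0 gf; have mf := good_meas gf.
have mo : meas2 (fun x y => offd x y * Gk e x y).
  by apply: measurable_funM; [exact: measurable_offd|exact: measurable_Gk].
have o1 x y : `|offd x y| <= 1.
  have [->|xy] := eqVneq x y; first by rewrite offd_eq normr0.
  by rewrite offd_neq// normr1.
have io : Jint f (fun x y => offd x y * Gk e x y).
  apply: (Jint_dom gf mo _ (Jint_Z (cQ e) (Jint_wt gf))) => x y x0 y0.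
  apply: le_trans (Gk_wt e0 x0 y0); rewrite normrM; exact: ler_piMl.
have -> : Ereg e f = J f (fun x y => offd x y * Gk e x y).
  rewrite (J_iterated gf io).
    apply: (eq_mom gf) => x x0; rewrite -[LHS](mom_offd x mf)//.
    exact: (meas2_section x (measurable_Gk e)).
  move=> x x0; have iG := momint_Gk e0 gf x.
  apply: (@le_integrable _ _ R mu2 setT measurableT _ (fun y => (Gk e x y * f y)%:E)); last exact: iG.
    apply/measurable_EFinP; apply: measurable_funM => //.
    exact: (@meas2_section R (fun x y => offd x y * Gk e x y) x mo).
  move=> y _; rewrite /= lee_fin (normrM (offd x y * Gk e x y)) (normrM (offd x y)) (normrM (Gk e x y)).
  by rewrite ler_wpM2r// ler_piMl.
have iG := Jint_G0 gf; have im := Jint_gm_over_dist gf.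
have -> : J f G0 - J f (fun x y => offd x y * Gk e x y) = J f (fun x y => G0 x y + -1 * (offd x y * Gk e x y)).
  by rewrite (J_D iG (Jint_Z _ io)) (J_Z _ io) mulN1r.
rewrite mulrA -(J_Z _ im).
apply: (J_bound_dom gf _ (Jint_Z _ im)) => x y x0 y0.
have [->|xy] := eqVneq x y.
  rewrite /G0 offd_eq !mul0r mulr0 addr0 normr0 mulr_ge0 ?mulr_ge0 ?sqrtr_ge0//.
  by rewrite invr_ge0 sqrtr_ge0.
rewrite /G0 offd_neq// !mul1r mulN1r distrC (mulrC (Num.sqrt e)).
exact: (Gk_regularised x0 y0 xy erefl erefl (ltW e0)).
Qed.

Lemma difference_close (u0 u1 w0 w1 p r q l H1 H2 : R) : `|u1 - u0 - p| <= q -> `|w1 - w0 - r| <= q ->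
  `|w0 - u0| <= l -> `|w1 - u1| <= l -> 2 * l <= H1 -> 2 * q <= H2 -> `|r - p| <= H1 + H2.
Proof.
rewrite !ler_norml => /andP[? ?] /andP[? ?] /andP[? ?] /andP[? ?] ? ?.
by apply/andP; split; lra.
Qed.

(** Indices 1 and 3 stand for the gradient of the potential at the two ends of a time interval,
    index 2 for that at an intermediate time, whose product with the velocity (u1, u2) at this time
    is nearly 0. *)
Lemma product_close (p1 p2 p3 q1 q2 q3 u1 u2 B S N : R) :
  `|u1| <= B -> `|u2| <= B -> `|p2 - p1| <= S -> `|p3 - p2| <= S ->
  `|q2 - q1| <= S -> `|q3 - q2| <= S -> `|p2 * u1 + q2 * u2| <= N ->
  `|(p1 + p3) * u1 + (q1 + q3) * u2| <= 2 * N + 4 * (S * B).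
Proof.
move=> h1 h2 h3 h4 h5 h6 h7.
have -> : (p1 + p3) * u1 + (q1 + q3) * u2 = 2 * (p2 * u1 + q2 * u2)
   + ((p3 - p2) * u1 - (p2 - p1) * u1 + ((q3 - q2) * u2 - (q2 - q1) * u2)) by ring.
have m (y z : R) : `|y| <= S -> `|z| <= B -> `|y * z| <= S * B by move=> ? ?; rewrite normrM; exact: ler_pM.
move: h7 (m _ _ h3 h1) (m _ _ h4 h1) (m _ _ h5 h2) (m _ _ h6 h2).
rewrite !ler_norml => /andP[? ?] /andP[? ?] /andP[? ?] /andP[? ?] /andP[? ?].
by apply/andP; split; lra.
Qed.

Lemma momint_quad (phi phir phiz f : R * R -> R) (C c M : R) : quad_fun phi phir phiz C ->
  good c M f -> momint f phi.
Proof.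
move=> Q gf; apply: (momint_lin gf (quad_m Q) (quad_C Q)) => x x0.
by have := quad_b Q x; rewrite (ger0_norm (ltW x0)).
Qed.

Lemma flux_constant (M X E C w : R) :
  2 * (68 * M * ((1 + X) * M * E)) + 4 * (C * (1 + X) * w * (34 * M)) =
  136 * M * (M * E + C * w) * (1 + X).
Proof. ring. Qed.

Lemma cTime_space (Q X D P N : R) : 0 <= Q * N * X * D ->
  2 * (136 * P * Q * X * D) <= (272 * P * Q + 2 * (Q * N)) * X * D.
Proof. lra. Qed.

Lemma cTime_step (Q X D P N : R) : 0 <= 136 * P * Q * X * D ->
  2 * (Q * N * X * D) <= (272 * P * Q + 2 * (Q * N)) * X * D.
Proof. lra. Qed.

Lemma energy_rate (M E C d s k : R) : 0 <= 272 * M ^+ 2 * C -> 0 < s -> d <= s ^+ 2 ->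
  s <= k / (2 * (272 * M ^+ 2 * C + 1)) ->
  2 * M * (136 * M * (M * E + C * (d / s + s))) <= 272 * M ^+ 3 * E + k.
Proof.
move=> C0 s0 ds sk.
have ws : d / s + s <= 2 * s.
  have : d / s <= s by rewrite ler_pdivrMr// -expr2.
  lra.
have -> : 2 * M * (136 * M * (M * E + C * (d / s + s))) =
    272 * M ^+ 3 * E + 272 * M ^+ 2 * C * (d / s + s) by ring.
rewrite lerD2l; apply: (le_trans (ler_wpM2l C0 ws)).
have K0 : 0 < 2 * (272 * M ^+ 2 * C + 1) by lra.
move: sk; rewrite ler_pdivlMr// => sk; apply: le_trans sk.
by move: C0; move: (272 * M ^+ 2 * C) => q q0; have := s0; nra.
Qed.

Section fixed.
Variables (T c M : R) (v : R -> R * R -> R).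
Hypotheses (T0 : 0 <= T).
Hypothesis gv : forall t, - T <= t <= T -> good2 c M (v t).
Hypothesis wl : weak_evolution T v (C1w lin).

Let M0 : 0 <= M.
Proof. by apply: (good_M_ge0 (gv (_ : - T <= 0 <= T))); rewrite oppr_le0 T0. Qed.

Lemma lin_flux_bound (phir phiz : R * R -> R) (K t : R) : - T <= t <= T -> 0 <= K ->
  (forall x, 0 < x.1 -> `|phir x| <= K * lin x /\ `|phiz x| <= K * lin x) ->
  `|flux (v t) phir phiz| <= 136 * M ^+ 2 * K.
Proof.
move=> tT K0 hb; have gt := gv tT.
apply: (flux_bound gt hb).
have := @good_integral_le _ _ _ _ gt (fun x => 68 * M * (K * lin x)) (68 * M * K) (68 * M * K).
rewrite (_ : (68 * M * K + 68 * M * K) * M = 136 * M ^+ 2 * K); last by ring.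
have q : 0 <= 68 * M * K by rewrite !mulr_ge0.
apply=> // x x0; rewrite /lin (_ : 68 * M * (K * (1 + x.1)) = 68 * M * K + 68 * M * K * x.1); last by ring.
by rewrite lexx andbT addr_ge0// mulr_ge0// ltW.
Qed.

Variable e : R.
Hypothesis e0 : 0 < e.

Let cQ0 : 0 <= cQ e.
Proof.
have E0 : 0 <= Num.sqrt e by exact: sqrtr_ge0.
by rewrite /cQ !addr_ge0// divr_ge0// exprn_ge0.
Qed.

(** A section of the regularised kernel is an admissible test function, so the potential at a fixed
    point is Lipschitz in time. *)
Lemma Gk_time_lip x (a b : R) : - T <= a -> a <= b -> b <= T ->
  `|mom (v b) (Gk e x) - mom (v a) (Gk e x)| <= 136 * M ^+ 2 * (cQ e * `|x.1|) * (b - a).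
Proof.
move=> Ta ab bT; have Q := quad_Gk_section e0 x.
have K0 : 0 <= cQ e * `|x.1| by rewrite mulr_ge0.
have E t : mom (v t) (Gk e x) = mom (v t) (fun y => Gk e y x).
  by congr mom; apply/funext => y; exact: Gk_sym.
have := @wl _ _ _ (quad_C1w Q) a b 0 (136 * M ^+ 2 * (cQ e * `|x.1|)) Ta ab bT.
rewrite mul0r subr0 !E; apply => t /andP[t1 t2]; rewrite subr0.
have tT : - T <= t <= T by rewrite (le_trans Ta t1) (le_trans t2 bT).
apply: lin_flux_bound => // y y0.
have -> : lin y = 1 + `|y.1| by rewrite ger0_norm// ltW.
by split; [exact: quad_br Q y|exact: quad_bz Q y].
Qed.

Definition cTime : R := 272 * M ^+ 2 * cQ e + 2 * (cQ e * M).

(** The gradient of the potential is compared at two times through a difference quotient of step s: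
    the potential contributes (b - a) / s and the quadratic remainder s. This reduces the time
    regularity of the gradient to that of the potential itself. *)
Lemma grad_time_close (k : R * R -> R * R -> R) (sh : R * R -> R -> R * R) x (a b s : R) :
  (forall t, - T <= t <= T -> `|mom (v t) (Gk e (sh x s)) - mom (v t) (Gk e x) - s * mom (v t) (k x)|
      <= cQ e * M * (1 + `|x.1|) * s ^+ 2) ->
  `|(sh x s).1| <= 1 + `|x.1| -> 0 < s -> - T <= a -> a <= b -> b <= T ->
  `|mom (v b) (k x) - mom (v a) (k x)| <= cTime * (1 + `|x.1|) * ((b - a) / s + s).
Proof.
move=> hq xs s0 Ta ab bT.
have Tb : - T <= b <= T by rewrite bT (le_trans Ta ab).
have Ta' : - T <= a <= T by rewrite Ta (le_trans ab bT).
have q1 := hq a Ta'; have q2 := hq b Tb.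
have l1 := Gk_time_lip x Ta ab bT; have l2 := Gk_time_lip (sh x s) Ta ab bT.
have D0 : 0 <= b - a by rewrite subr_ge0.
have P0 : 0 <= 136 * M ^+ 2 * cQ e by rewrite !mulr_ge0 ?sqr_ge0.
have w (u z : R) : `|z| <= 1 + `|x.1| -> u <= 136 * M ^+ 2 * (cQ e * `|z|) * (b - a) ->
    u <= 136 * M ^+ 2 * cQ e * (1 + `|x.1|) * (b - a).
  move=> hz hu; apply: (le_trans hu); rewrite ler_wpM2r// mulrA ler_wpM2l//.
have l1' := w _ _ (_ : `|x.1| <= 1 + `|x.1|) l1; have l2' := w _ _ xs l2.
have {}l1' : `|mom (v b) (Gk e x) - mom (v a) (Gk e x)| <= 136 * M ^+ 2 * cQ e * (1 + `|x.1|) * (b - a).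
  by apply: l1'; rewrite lerDr.
rewrite -(ler_pM2l s0) -{1}(gtr0_norm s0) -normrM.
have -> : s * (cTime * (1 + `|x.1|) * ((b - a) / s + s)) = cTime * (1 + `|x.1|) * (b - a) + cTime * (1 + `|x.1|) * s ^+ 2.
  by field; rewrite gt_eqF.
have h1 : 2 * (136 * M ^+ 2 * cQ e * (1 + `|x.1|) * (b - a)) <= cTime * (1 + `|x.1|) * (b - a).
  move: (mulr_ge0 (mulr_ge0 (mulr_ge0 cQ0 M0) (addr_ge0 ler01 (normr_ge0 x.1))) D0).
  exact: cTime_space.
have h2 : 2 * (cQ e * M * (1 + `|x.1|) * s ^+ 2) <= cTime * (1 + `|x.1|) * s ^+ 2.
  move: (mulr_ge0 (mulr_ge0 P0 (addr_ge0 ler01 (normr_ge0 x.1))) (sqr_ge0 s)).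
  exact: cTime_step.
by rewrite mulrBr; exact: (difference_close q1 q2 l1' l2' h1 h2).
Qed.

Variable eta : R.
Hypotheses (eta0 : 0 < eta) (eta1 : eta <= 1).

Lemma Pk_time x (a b s : R) : 0 < x.1 -> 0 < s -> s <= 1 -> - T <= a -> a <= b -> b <= T ->
  `|mom (v b) (Pk e x) - mom (v a) (Pk e x)| <= cTime * (1 + x.1) * ((b - a) / s + s).
Proof.
move=> x0 s0 s1 Ta ab bT; rewrite -{1}(ger0_norm (ltW x0)).
apply: (@grad_time_close (Pk e) (fun x s => (x.1 + s, x.2))) => //.
  by move=> t tT; exact: (quad_r (quad_potential e0 (gv tT)) x s).
by apply: le_trans (ler_normD _ _) _; rewrite (gtr0_norm s0); lra.
Qed.

Lemma Zk_time x (a b s : R) : 0 < x.1 -> 0 < s -> s <= 1 -> - T <= a -> a <= b -> b <= T ->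
  `|mom (v b) (Zk e x) - mom (v a) (Zk e x)| <= cTime * (1 + x.1) * ((b - a) / s + s).
Proof.
move=> x0 s0 s1 Ta ab bT; rewrite -{1}(ger0_norm (ltW x0)).
apply: (@grad_time_close (Zk e) (fun x s => (x.1, x.2 + s))) => //.
  by move=> t tT; exact: (quad_z (quad_potential e0 (gv tT)) x s).
by rewrite lerDr.
Qed.

Lemma cTime_ge0 : 0 <= cTime.
Proof.
apply: addr_ge0; first exact: mulr_ge0 (mulr_ge0 (ler0n _ _) (sqr_ge0 _)) cQ0.
exact: mulr_ge0 (ler0n _ _) (mulr_ge0 cQ0 M0).
Qed.

Lemma eps_reg_ge0 : 0 <= eps_reg e eta.
Proof. by rewrite /eps_reg addr_ge0 ?mulr_ge0 ?invr_ge0 ?exprn_ge0 ?sqrtr_ge0 ?(ltW eta0). Qed.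

Lemma energy_flux (a b t s : R) : 0 < s -> s <= 1 -> - T <= a -> a <= t -> t <= b -> b <= T ->
  `|flux (v t) (fun x => mom (v a) (Pk e x) + mom (v b) (Pk e x))
               (fun x => mom (v a) (Zk e x) + mom (v b) (Zk e x))|
  <= 2 * M * (136 * M * (M * eps_reg e eta + cTime * ((b - a) / s + s))).
Proof.
move=> s0 s1 Ta at_ tb bT.
have tT : - T <= t <= T by rewrite (le_trans Ta at_) (le_trans tb bT).
have gt := gv tT; set w := (b - a) / s + s.
have ab : a <= b by exact: le_trans tb.
have w0 : 0 <= w by rewrite addr_ge0 ?divr_ge0 ?(ltW s0)// subr_ge0.
have E0 := eps_reg_ge0; have C0 := cTime_ge0.
pose K := 136 * M * (M * eps_reg e eta + cTime * w).
have K0 : 0 <= K by rewrite /K !mulr_ge0// addr_ge0// mulr_ge0.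
have wa : (t - a) / s + s <= w by rewrite lerD2r ler_pM2r ?invr_gt0//; lra.
have wb : (b - t) / s + s <= w by rewrite lerD2r ler_pM2r ?invr_gt0//; lra.
apply: (mom_bound gt (h := fun x => K * lin x)); last first.
  have := @good_integral_le _ _ _ _ gt (fun x => K * lin x) K K.
  rewrite (_ : (K + K) * M = 2 * M * K); last by ring.
  by apply=> // x x0; rewrite /lin mulrDr mulr1 lexx andbT addr_ge0// mulr_ge0// ltW.
move=> x x0; have x1 : 0 <= 1 + x.1 by rewrite addr_ge0// ltW.
have b1 := vr_bound gt x0; have b2 := vz_bound gt x0; have b3 := flux_self gt e0 eta0 eta1 x0.
have Cx : 0 <= cTime * (1 + x.1) by rewrite mulr_ge0.
have up (u z : R) : z <= w -> u <= cTime * (1 + x.1) * z -> u <= cTime * (1 + x.1) * w.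
  by move=> zw h; apply: (le_trans h); exact: ler_wpM2l.
have pa := up _ _ wa (Pk_time x0 s0 s1 Ta at_ (le_trans tb bT)).
have pb := up _ _ wb (Pk_time x0 s0 s1 (le_trans Ta at_) tb bT).
have za := up _ _ wa (Zk_time x0 s0 s1 Ta at_ (le_trans tb bT)).
have zb := up _ _ wb (Zk_time x0 s0 s1 (le_trans Ta at_) tb bT).
apply: (le_trans (product_close b1 b2 pa pb za zb b3)).
rewrite le_eqVlt; apply/orP; left; apply/eqP; rewrite /K /lin.
exact: flux_constant.
Qed.

(** By the symmetry of the bilinear form, the energy of v_b minus that of v_a is the increment from
    a to b of the linear functional given by the potential of v_a + v_b, an admissible test
    function. *)
Lemma Ereg_increment (a b : R) : - T <= a -> a <= b -> b <= T ->
  `|Ereg e (v b) - Ereg e (v a)| <= 272 * M ^+ 3 * eps_reg e eta * (b - a).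
Proof.
move: a b; apply: (@increment_partition _ (fun t => Ereg e (v t)) (- T) T) => k k0.
have C0 := cTime_ge0; have E0 := eps_reg_ge0.
pose K := 272 * M ^+ 2 * cTime + 1.
have CM : 0 <= 272 * M ^+ 2 * cTime by exact: mulr_ge0 (mulr_ge0 (ler0n _ _) (sqr_ge0 _)) C0.
have K0 : 0 < K by rewrite ltr_wpDl.
(* For b - a <= s^2 the temporal error (b - a) / s + s is at most 2 s, and s is chosen so small that
   this costs at most k. *)
pose s := Num.min 1 (k / (2 * K)).
have s0 : 0 < s by rewrite lt_min ltr01 divr_gt0// mulr_gt0.
have s1 : s <= 1 by rewrite ge_min lexx.
have sk : s <= k / (2 * K) by rewrite ge_min lexx orbT.
exists (s ^+ 2); first exact: exprn_gt0.
move=> a b Ta ab bT abs.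
have aT : - T <= a <= T by rewrite Ta (le_trans ab).
have bT' : - T <= b <= T by rewrite bT (le_trans Ta).
have ga := gv aT; have gb := gv bT'; have gs := good2_add ga gb.
have Q := quad_potential e0 gs.
pose phi x := mom (fun x => v a x + v b x) (Gk e x).
have momadd (k1 : R * R -> R) : momint (v a) k1 -> momint (v b) k1 ->
   mom (fun x => v a x + v b x) k1 = mom (v a) k1 + mom (v b) k1.
  move=> i1 i2; rewrite /mom -RintegralD//; apply: eq_Rintegral => x _; exact: mulrDr.
have C : C1w lin (fun x => mom (fun x => v a x + v b x) (Gk e x))
   (fun x => mom (v a) (Pk e x) + mom (v b) (Pk e x)) (fun x => mom (v a) (Zk e x) + mom (v b) (Zk e x)).
  have := quad_C1w Q; congr C1w; apply/funext => x.
    by rewrite (momadd _ (momint_Pk e0 ga x) (momint_Pk e0 gb x)).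
  by rewrite (momadd _ (momint_Zk e0 ga x) (momint_Zk e0 gb x)).
set S := 2 * M * (136 * M * (M * eps_reg e eta + cTime * ((b - a) / s + s))).
have := @wl _ _ _ C a b 0 S Ta ab bT; rewrite mul0r subr0 => H.
have {}H : `|mom (v b) phi - mom (v a) phi| <= S * (b - a).
  apply: H => t /andP[t1 t2]; rewrite subr0; exact: energy_flux.
have Qa := quad_potential e0 ga; have Qb := quad_potential e0 gb.
have E : Ereg e (v b) - Ereg e (v a) = mom (v b) phi - mom (v a) phi.
  have phiE : phi = (fun x => mom (v a) (Gk e x) + mom (v b) (Gk e x)).
    by apply/funext => x; rewrite /phi (momadd _ (momint_Gk e0 ga x) (momint_Gk e0 gb x)).
  rewrite phiE (momD (momint_quad Qa gb) (momint_quad Qb gb)) (momD (momint_quad Qa ga) (momint_quad Qb ga)).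
  have aux (p q r : R) : q - r = p + q - (r + p) by ring.
  rewrite (cross_sym e0 gb ga); exact: aux.
rewrite E; apply: (le_trans H); apply: ler_wpM2r; first by rewrite subr_ge0.
exact: energy_rate CM s0 abs sk.
Qed.
End fixed.

(** The parameter eta is fixed first and e = sg^2 afterwards, because [eps_reg] contains sqrt e /
    eta^2. The regularised energies at both times then differ from the true ones by O(sqrt e). *)
Theorem energy_conserved (T c M : R) (v : R -> R * R -> R) : 0 <= T ->
  (forall t, - T <= t <= T -> good2 c M (v t)) -> weak_evolution T v (C1w lin) ->
  forall t, - T <= t <= T -> J (v t) G0 = J (v 0) G0.
Proof.
move=> T0 gv wl t tT; have oT : - T <= 0 <= T by rewrite oppr_le0 T0.
have M0 : 0 <= M by exact: good_M_ge0 (gv 0 oT).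
apply/eqP; rewrite -subr_eq0 -normr_le0; apply/ler_addgt0Pr => d d0; rewrite add0r.
pose k f := 3 / 4 * J f (fun x y : R * R => gm x y / eucl_dist x y).
have k0 f : good2 c M f -> 0 <= k f.
  move=> gf; rewrite mulr_ge0//; apply: Rintegral_ge0 => q _.
  by rewrite mulr_ge0 ?mulr_ge0 ?(good_ge0 gf)// ?gm_ge0// invr_ge0 sqrtr_ge0.
pose B := 272 * M ^+ 3 * T.
have B0 : 0 <= B by exact: mulr_ge0 (mulr_ge0 (ler0n _ _) (exprn_ge0 3 M0)) T0.
have B1 : 0 < 24 * B + 1 by rewrite ltr_wpDl// mulr_ge0.
pose eta := Num.min 1 (d / (24 * B + 1)).
have eta0 : 0 < eta by rewrite lt_min ltr01 divr_gt0.
have eta1 : eta <= 1 by rewrite ge_min lexx.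
have etad : B * (12 * eta) <= d / 2.
  have : eta * (24 * B + 1) <= d by rewrite -ler_pdivlMr// ge_min lexx orbT.
  by have := eta0; lra.
pose L := k (v t) + k (v 0) + B * (2 / eta ^+ 2).
have L0 : 0 <= L.
  apply: addr_ge0; first by apply: addr_ge0; apply: k0; exact: gv.
  by apply: mulr_ge0 => //; rewrite divr_ge0// exprn_ge0// ltW.
have L1 : 0 < 2 * L + 1 by rewrite ltr_wpDl// mulr_ge0.
pose sg := d / (2 * L + 1).
have sg0 : 0 < sg by exact: divr_gt0.
have sgd : sg * L <= d / 2.
  have : sg * (2 * L + 1) = d by rewrite divfK// gt_eqF.
  by have := sg0; lra.
have e0 : 0 < sg ^+ 2 by exact: exprn_gt0.
have se : Num.sqrt (sg ^+ 2) = sg by rewrite sqrtr_sqr gtr0_norm.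
have h1 := Ereg_close e0 (gv t tT); have h2 := Ereg_close e0 (gv 0 oT).
rewrite se -/(k (v t)) in h1; rewrite se -/(k (v 0)) in h2.
have h3 : `|Ereg (sg ^+ 2) (v t) - Ereg (sg ^+ 2) (v 0)| <= B * (12 * eta + 2 * sg / eta ^+ 2).
  have E0 : 0 <= 272 * M ^+ 3 * eps_reg (sg ^+ 2) eta.
    apply: mulr_ge0 (eps_reg_ge0 _ eta0); exact: mulr_ge0 (ler0n _ _) (exprn_ge0 3 M0).
  have -> : B * (12 * eta + 2 * sg / eta ^+ 2) = 272 * M ^+ 3 * eps_reg (sg ^+ 2) eta * T.
    by rewrite /eps_reg se /B; ring.
  move: tT => /andP[t1 t2]; have [h|/ltW h] := leP 0 t.
    apply: (le_trans (Ereg_increment T0 gv wl e0 eta0 eta1 _ h t2)); first by rewrite oppr_le0.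
    by rewrite subr0 ler_wpM2l.
  rewrite distrC; apply: (le_trans (Ereg_increment T0 gv wl e0 eta0 eta1 t1 h T0)).
  by rewrite sub0r ler_wpM2l// lerNl.
have h4 : sg * k (v t) + sg * k (v 0) + B * (12 * eta + 2 * sg / eta ^+ 2) <= d.
  have : sg * L = sg * k (v t) + sg * k (v 0) + B * (2 * sg / eta ^+ 2) by rewrite /L; ring.
  by move: etad sgd; rewrite mulrDr; lra.
apply: le_trans h4; move: h1 h2 h3; clear.
move: (J _ _) (J _ _) (Ereg _ _) (Ereg _ _) (sg * _) (sg * _) (B * _) => a1 a2 a3 a4 a5 a6 a7.
rewrite !ler_norml => /andP[? ?] /andP[? ?] /andP[? ?].
by apply/andP; split; lra.
Qed.

End EnergyEvolution.

(** * Axial motion *)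

Section AxialWeight.
Context {R : realType}.
Local Notation mu2 := (@plane_measure R).
Local Notation pT := (measurableTypeR R * measurableTypeR R)%type.
Implicit Types (x y : R * R) (z : R).

Lemma lipschitz_of_derivative (g dg : R -> R) (C : R) : 0 <= C ->
  (forall z, is_derive z (1 : R) g (dg z)) -> (forall z, `|dg z| <= C) ->
  forall a b, `|g b - g a| <= C * `|b - a|.
Proof.
move=> C0 gd dC; have cg : continuous g.
  by move=> r; apply: differentiable_continuous; apply/derivable1_diffP; have [] := gd r.
have H a b : a <= b -> `|g b - g a| <= C * `|b - a|.
  move=> ab; have [|c _ ->] := MVT_segment ab (fun u _ => gd u); last by rewrite normrM ler_wpM2r.
  exact: continuous_subspaceT.
move=> a b; have [|/ltW] := leP a b; first exact: H.
by rewrite distrC (distrC b); exact: H.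
Qed.

Lemma remainder_of_derivative (g dg : R -> R) (C : R) : 0 <= C ->
  (forall z, is_derive z (1 : R) g (dg z)) -> (forall a b, `|dg b - dg a| <= C * `|b - a|) ->
  forall a b, `|g b - g a - (b - a) * dg a| <= C * (b - a) ^+ 2.
Proof.
move=> C0 gd dC; have cg : continuous g.
  by move=> r; apply: differentiable_continuous; apply/derivable1_diffP; have [] := gd r.
have H (a b e : R) : `|e - a| <= `|b - a| -> g b - g a = dg e * (b - a) ->
    `|g b - g a - (b - a) * dg a| <= C * (b - a) ^+ 2.
  move=> ea ->; have -> : dg e * (b - a) - (b - a) * dg a = (dg e - dg a) * (b - a) by ring.
  rewrite normrM -(real_normK (num_real (b - a))) expr2 mulrA ler_wpM2r//.
  by apply: (le_trans (dC _ _)); rewrite ler_wpM2l.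
move=> a b; have [ab|/ltW ab] := leP a b.
  have [|e] := MVT_segment ab (fun u _ => gd u); first exact: continuous_subspaceT.
  rewrite in_itv/= => /andP[ae eb]; apply: H; rewrite !ger0_norm ?subr_ge0//; lra.
have [|e] := MVT_segment ab (fun u _ => gd u); first exact: continuous_subspaceT.
rewrite in_itv/= => /andP[ae eb] E; apply: (H a b e); last by lra.
by rewrite !ler0_norm ?subr_le0//; lra.
Qed.

Section fixed.
Variables (n s : R).
Hypothesis n1 : 1 <= n.
Let n0 : 0 < n. Proof. exact: lt_le_trans n1. Qed.

Definition jap z : R := japanese (z - s).
Definition jap_dir z : R := (z - s) / jap z.
Definition jap_sat z : R := n / (n + jap z).
(** With j the Japanese bracket of z - s this is n j / (n + j), a truncation of j at height n whose
    first and second derivatives are bounded by 1 and 3, independently of n. *)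
Definition hax z : R := jap_sat z * jap z.
Definition dhax z : R := jap_sat z ^+ 2 * jap_dir z.
Definition ddhax z : R := jap_sat z ^+ 2 * (1 - jap_dir z ^+ 2) / jap z - 2 * jap_sat z ^+ 3 * jap_dir z ^+ 2 / n.

Lemma jap_sqr z : jap z ^+ 2 = 1 + (z - s) ^+ 2.
Proof. by rewrite sqr_sqrtr// addr_ge0// sqr_ge0. Qed.

Lemma jap_ge1 z : 1 <= jap z.
Proof. by rewrite -[X in X <= _]sqrtr1 ler_wsqrtr// lerDl sqr_ge0. Qed.

Let j0 z : 0 < jap z. Proof. exact: lt_le_trans (jap_ge1 z). Qed.
Let nj0 z : 0 < n + jap z. Proof. exact: addr_gt0. Qed.

Lemma jap_ge z : `|z - s| <= jap z.
Proof.
by rewrite -(@ler_pXn2r _ 2) ?nnegrE ?(ltW (j0 z))// jap_sqr real_normK ?num_real// lerDr.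
Qed.

Lemma jap_le z : jap z <= 1 + `|z - s|.
Proof.
rewrite -(@ler_pXn2r _ 2) ?nnegrE ?(ltW (j0 z)) ?addr_ge0// jap_sqr.
by have := normr_ge0 (z - s); rewrite -(real_normK (num_real (z - s))); nra.
Qed.

Lemma jap_dir_le1 z : `|jap_dir z| <= 1.
Proof. by rewrite normrM normfV (gtr0_norm (j0 z)) ler_pdivrMr// mul1r jap_ge. Qed.

Lemma jap_sat01 z : 0 < jap_sat z <= 1.
Proof. by rewrite divr_gt0//= ler_pdivrMr// mul1r lerDl ltW. Qed.

Lemma is_derive_jap z : is_derive z (1 : R) jap (jap_dir z).
Proof.
have h1 : is_derive z (1 : R) (fun z => 1 + (z - s) ^+ 2) (2 * (z - s)).
  apply: (@is_derive_quad _ _ _ _ 1) => h _.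
  by rewrite (_ : _ - _ - _ = h ^+ 2); [rewrite ger0_norm ?sqr_ge0// mul1r|ring].
have q0 : 0 < 1 + (z - s) ^+ 2 by rewrite ltr_pwDl// sqr_ge0.
have h2 := @is_derive1_comp _ Num.sqrt (fun z => 1 + (z - s) ^+ 2) z _ _ (is_derive1_sqrt q0) h1.
apply: is_derive_eq; rewrite /jap_dir -[Num.sqrt _]/(jap z).
by field; rewrite gt_eqF.
Qed.

Lemma is_derive_jap_sat z : is_derive z (1 : R) jap_sat (- (jap_sat z ^+ 2 * jap_dir z / n)).
Proof.
have h1 : is_derive z (1 : R) (fun z => n + jap z) _ := is_deriveD (is_derive_cst n z 1) (is_derive_jap z).
have h2 : is_derive z (1 : R) (fun z => (n + jap z)^-1) _ :=
  @is_deriveV _ (fun z => n + jap z) z _ 1 (lt0r_neq0 (nj0 z)) h1.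
have h3 : is_derive z (1 : R) jap_sat _ := is_deriveM (is_derive_cst n z 1) h2.
apply: is_derive_eq; rewrite /jap_sat /GRing.scale/= mulr0 addr0 add0r.
by field; rewrite !gt_eqF.
Qed.

Lemma is_derive_jap_dir z : is_derive z (1 : R) jap_dir ((1 - jap_dir z ^+ 2) / jap z).
Proof.
have h1 : is_derive z (1 : R) (fun z => z - s) (1 - 0) := is_deriveB (is_derive_id z 1) (is_derive_cst s z 1).
have h2 : is_derive z (1 : R) (fun z => (jap z)^-1) _ :=
  @is_deriveV _ jap z _ 1 (lt0r_neq0 (j0 z)) (is_derive_jap z).
have h3 : is_derive z (1 : R) jap_dir _ := is_deriveM h1 h2.
apply: is_derive_eq; rewrite /jap_dir /GRing.scale/=.
by field; rewrite gt_eqF.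
Qed.

Lemma is_derive_hax z : is_derive z (1 : R) hax (dhax z).
Proof.
have h : is_derive z (1 : R) hax _ := is_deriveM (is_derive_jap_sat z) (is_derive_jap z).
apply: is_derive_eq; rewrite /dhax /jap_sat /GRing.scale/=.
by field; rewrite !gt_eqF.
Qed.

Lemma is_derive_dhax z : is_derive z (1 : R) dhax (ddhax z).
Proof.
have h1 : is_derive z (1 : R) (fun z => jap_sat z * jap_sat z) _ := is_deriveM (is_derive_jap_sat z) (is_derive_jap_sat z).
have h2 : is_derive z (1 : R) (fun z => jap_sat z * jap_sat z * jap_dir z) _ := is_deriveM h1 (is_derive_jap_dir z).
have -> : dhax = fun z => jap_sat z * jap_sat z * jap_dir z by apply/funext => w; rewrite /dhax expr2.
apply: is_derive_eq; rewrite /ddhax /GRing.scale/=.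
by field; rewrite !gt_eqF.
Qed.

Let cderiv (g dg : R -> R) : (forall z, is_derive z (1 : R) g (dg z)) -> continuous g.
Proof.
by move=> gd r; apply: differentiable_continuous; apply/derivable1_diffP; have [] := gd r.
Qed.

Lemma continuous_dhax : continuous dhax. Proof. exact: cderiv is_derive_dhax. Qed.

Lemma continuous_ddhax : continuous ddhax.
Proof.
have cs := cderiv is_derive_jap_sat; have cd := cderiv is_derive_jap_dir; have cj := cderiv is_derive_jap.
have cp (g : R -> R) k : continuous g -> continuous (fun z => g z ^+ k).
  by move=> cg z; exact: (@continuous_comp _ _ _ g (fun u : R => u ^+ k) z (cg z) (@exprn_continuous _ k _)).
move=> z; apply: cvgB; apply: cvgM.
- apply: cvgM; first exact: cp cs z.
  by apply: cvgB; [exact: cvg_cst|exact: cp cd z].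
- by apply: cvgV; [rewrite gt_eqF|exact: cj].
- apply: cvgM; last exact: cp cd z.
  by apply: cvgM; [exact: cvg_cst|exact: cp cs z].
- exact: cvg_cst.
Qed.

Lemma hax_ge0 z : 0 <= hax z.
Proof. by have /andP[/ltW u0 _] := jap_sat01 z; rewrite mulr_ge0// ltW. Qed.

Lemma hax_le_jap z : hax z <= jap z.
Proof. by have /andP[_ u1] := jap_sat01 z; rewrite ler_piMl// ltW. Qed.

Lemma hax_le z : hax z <= n.
Proof. by rewrite /hax /jap_sat mulrAC ler_pdivrMr// ler_pM2l// lerDr ltW. Qed.

Lemma hax_ge z : jap z <= n -> jap z / 2 <= hax z.
Proof.
move=> jn; rewrite /hax (mulrC (jap_sat z)) ler_pM2l// /jap_sat ler_pdivlMr//; lra.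
Qed.

Lemma dhax_le1 z : `|dhax z| <= 1.
Proof.
have /andP[/ltW u0 u1] := jap_sat01 z.
rewrite normrM (ger0_norm (sqr_ge0 _)) mulr_ile1 ?sqr_ge0 ?jap_dir_le1//.
exact: exprn_ile1.
Qed.

Lemma ddhax_le z : `|ddhax z| <= 3.
Proof.
have /andP[/ltW u0 u1] := jap_sat01 z; have w1 := jap_dir_le1 z.
have w2 : jap_dir z ^+ 2 <= 1 by rewrite -(real_normK (num_real _)) exprn_ile1.
have q0 := sqr_ge0 (jap_dir z).
have t1 : 0 <= jap_sat z ^+ 2 * (1 - jap_dir z ^+ 2) / jap z <= 1.
  apply/andP; split.
    by apply: divr_ge0 (ltW (j0 z)); apply: mulr_ge0; rewrite ?sqr_ge0 ?subr_ge0.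
  rewrite ler_pdivrMr// mul1r (le_trans _ (jap_ge1 z))// mulr_ile1 ?sqr_ge0 ?subr_ge0//.
    exact: exprn_ile1.
  lra.
have t2 : 0 <= 2 * jap_sat z ^+ 3 * jap_dir z ^+ 2 / n <= 2.
  have u3 : 0 <= jap_sat z ^+ 3 by exact: exprn_ge0.
  apply/andP; split; first by apply: divr_ge0 (ltW n0); exact: mulr_ge0 (mulr_ge0 _ u3) q0.
  rewrite ler_pdivrMr// -mulrA ler_pM2l// (le_trans _ n1)// mulr_ile1//.
  exact: exprn_ile1.
by move: t1 t2; rewrite /ddhax => /andP[? ?] /andP[? ?]; rewrite ler_norml; apply/andP; split; lra.
Qed.

Lemma hax_lip z z' : `|hax z - hax z'| <= `|z - z'|.
Proof. by have := lipschitz_of_derivative ler01 is_derive_hax dhax_le1 z' z; rewrite mul1r. Qed.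

Lemma dhax_lip z z' : `|dhax z - dhax z'| <= 3 * `|z - z'|.
Proof. exact: lipschitz_of_derivative (ler0n _ _) is_derive_dhax ddhax_le z' z. Qed.

Lemma hax_remainder a b : `|hax b - hax a - (b - a) * dhax a| <= 3 * (b - a) ^+ 2.
Proof.
by apply: remainder_of_derivative => // [|c d]; [exact: is_derive_hax|exact: dhax_lip].
Qed.

Lemma measurable_hax : measurable_fun setT (hax : measurableTypeR R -> R).
Proof. exact: continuous_measurable_fun (cderiv is_derive_hax). Qed.

Lemma measurable_dhax : measurable_fun setT (dhax : measurableTypeR R -> R).
Proof. exact: continuous_measurable_fun continuous_dhax. Qed.

End fixed.

(** Moving the centre from s to s' amounts to translating z by s - s', so this is the Taylor
    remainder of [hax]. *)
Lemma hax_center (n s s' : R) z : 1 <= n ->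
  `|hax n s' z - hax n s z + (s' - s) * dhax n s z| <= 3 * (s' - s) ^+ 2.
Proof.
move=> n1; have := hax_remainder s n1 z (z - (s' - s)).
have -> : hax n s (z - (s' - s)) = hax n s' z.
  by rewrite /hax /jap_sat /jap; congr (_ / (_ + japanese _) * japanese _); ring.
have -> : z - (s' - s) - z = - (s' - s) by ring.
by rewrite mulNr opprK sqrrN.
Qed.

End AxialWeight.

Section AxialDrift.
Context {R : realType}.
Local Notation mu2 := (@plane_measure R).
Local Notation pT := (measurableTypeR R * measurableTypeR R)%type.
Implicit Types (x y : R * R) (z : R) (phir phiz : R * R -> R).

Section tests.
Variable n : R.
Hypothesis n1 : 1 <= n.
Let n0 : 0 < n. Proof. exact: lt_le_trans n1. Qed.

Definition axial s x : R := rsq n x.1 * hax n s x.2.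
Definition axial_z s x : R := rsq n x.1 * dhax n s x.2.
Definition cAxial : R := 3 * n ^+ 3.

Let n23 : n ^+ 2 <= n ^+ 3. Proof. by rewrite [leRHS]exprSr ler_peMr// exprn_ge0// ltW. Qed.
Lemma cAxial_ge0 : 0 <= cAxial. Proof. by rewrite /cAxial mulr_ge0// exprn_ge0// ltW. Qed.
Let K := cAxial.
Let K0 := cAxial_ge0.

Lemma C1w_separated (k dk : R -> R) : (forall z, is_derive z (1 : R) k (dk z)) -> continuous dk ->
  (forall z, `|k z| <= n) -> (forall z, `|dk z| <= 3) ->
  [/\ C1w lin (fun x => rsq n x.1 * k x.2) (fun x => drsq n x.1 * k x.2) (fun x => rsq n x.1 * dk x.2)
    & forall x, 0 < x.1 -> `|drsq n x.1 * k x.2| <= K /\ `|rsq n x.1 * dk x.2| <= K].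
Proof.
move=> kd cdk kn dk3.
have b x : 0 < x.1 -> [/\ `|rsq n x.1 * k x.2| <= K, `|drsq n x.1 * k x.2| <= K & `|rsq n x.1 * dk x.2| <= K].
  move=> x0; have /andP[a0 a1] := rsq_le n1 x.1; have /andP[b0 b1] := drsq_le n1 (ltW x0).
  have p3 : 0 <= n ^+ 3 by exact: exprn_ge0 (ltW n0).
  have e3 : n ^+ 3 = n ^+ 2 * n by rewrite exprSr.
  have h (p q a b : R) : 0 <= p -> p <= a -> `|q| <= b -> a * b <= K -> `|p * q| <= K.
    by move=> p0 pa qb; apply: le_trans; rewrite normrM (ger0_norm p0); apply: ler_pM.
  split; [apply: (h _ _ (n ^+ 2) n)|apply: (h _ _ n n)|apply: (h _ _ (n ^+ 2) 3)] => //; rewrite /K /cAxial.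
  - by rewrite -e3; lra.
  - by rewrite -expr2; have := n23; lra.
  - by have := n23; lra.
split; last by move=> x /b[].
split; first exact: (C1_separated (is_derive_rsq n1) (@continuous_drsq _ n) kd cdk).
exists K; split => // x x0; have [h1 h2 h3] := b x x0.
by split; apply: (@le_trans _ _ K) => //; rewrite ler_peMr// lin_ge1.
Qed.

Lemma axial_test s :
  [/\ C1w lin (axial s) (fun x => drsq n x.1 * hax n s x.2) (axial_z s)
    & forall x, 0 < x.1 -> `|drsq n x.1 * hax n s x.2| <= K /\ `|axial_z s x| <= K].
Proof.
apply: C1w_separated => [z||z|z].
- exact: is_derive_hax.
- exact: continuous_dhax.
- by rewrite ger0_norm ?hax_ge0// hax_le.
- by apply: le_trans (dhax_le1 s n1 z) _; lra.
Qed.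

Lemma axial_z_test s :
  [/\ C1w lin (axial_z s) (fun x => drsq n x.1 * dhax n s x.2) (fun x => rsq n x.1 * ddhax n s x.2)
    & forall x, 0 < x.1 -> `|drsq n x.1 * dhax n s x.2| <= K /\ `|rsq n x.1 * ddhax n s x.2| <= K].
Proof.
apply: C1w_separated => [z||z|z].
- exact: is_derive_dhax.
- exact: continuous_ddhax.
- by apply: le_trans (dhax_le1 s n1 z) n1.
- exact: ddhax_le.
Qed.

(** Where neither truncation is active, each costs a factor 2: rho >= 1 / 2 because x.1 <= n, and
    [hax] is at least half the bracket, itself at least |xs.2 - s| - 1 at distance below 1 from
    xs. *)
Lemma axial_ge s xs x : 0 < x.1 -> eucl_dist xs x < 1 -> xs.1 + 1 <= n -> `|xs.2 - s| + 2 <= n ->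
  1 <= `|xs.2 - s| -> (`|xs.2 - s| - 1) / 4 * r2 x <= axial s x.
Proof.
move=> x0 d1; have := le_lt_trans (dist1_le xs x) d1; have := le_lt_trans (dist2_le xs x) d1.
rewrite !ltr_norml => /andP[z1 z2] /andP[x1 x2].
have zE : x.2 - s = (xs.2 - s) - (xs.2 - x.2) by ring.
have zz : `|xs.2 - s| - 1 <= `|x.2 - s|.
  by rewrite zE; apply: le_trans (lerB_dist _ _); rewrite lerD2l lerN2 ler_norml !ltW.
have zz' : `|x.2 - s| <= `|xs.2 - s| + 1.
  by rewrite zE; apply: le_trans (ler_normB _ _) _; rewrite lerD2l ler_norml !ltW.
move: zz zz'; move: `|xs.2 - s| => Z zz zz' xn zn Z1 {zE d1 z1 z2 x2}.
have xn' : x.1 <= n by move: x1 xn; lra.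
have jn : jap s x.2 <= n by apply: le_trans (jap_le _ _) _; move: zz' zn; lra.
have h1 := hax_ge n1 jn; have h2 := jap_ge s x.2.
have nn : 0 < n ^+ 2 by exact: exprn_gt0.
have q : x.1 ^+ 2 / n ^+ 2 <= 1 by rewrite ler_pdivrMr// mul1r lerXn2r ?nnegrE ?(ltW x0) ?(ltW n0).
have q0 : 0 <= x.1 ^+ 2 / n ^+ 2 by rewrite divr_ge0 ?sqr_ge0.
have rho2 : 2^-1 <= rho n x.1.
  by rewrite /rho; move: q q0; move: (_ / _) => b b1 b0; rewrite lef_pV2 ?posrE; move: b1 b0; lra.
have hz : (Z - 1) / 2 <= hax n s x.2 by move: zz h1 h2; lra.
rewrite mulrC /axial /rsq /r2 -mulrA ler_wpM2l ?sqr_ge0//.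
have -> : (Z - 1) / 4 = 2^-1 * ((Z - 1) / 2) by field.
by apply: ler_pM => //; rewrite divr_ge0// subr_ge0.
Qed.

End tests.

Section fixed.
Variables (T c M n zeta C : R) (v : R -> R * R -> R).
Hypotheses (T0 : 0 <= T) (n1 : 1 <= n).
Hypothesis gv : forall t, - T <= t <= T -> good2 c M (v t).
Hypothesis wl : weak_evolution T v (C1w lin).
Hypothesis drift : forall t s, - T <= t <= T ->
  `|J (v t) (flux_kernel n (hax n s) (dhax n s)) - zeta * mom (v t) (fun x => chi n (dhax n s) x * x.1 ^+ 2)| <= C.

Let n0 : 0 < n. Proof. exact: lt_le_trans n1. Qed.
Let M0 : 0 <= M.
Proof. by apply: (good_M_ge0 (gv (_ : - T <= 0 <= T))); rewrite oppr_le0 T0. Qed.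
Let C0 : 0 <= C.
Proof. by apply: le_trans (drift 0 (_ : - T <= 0 <= T)); rewrite ?oppr_le0 ?T0. Qed.

Let K := cAxial n.
Let K0 : 0 <= K. Proof. exact: cAxial_ge0. Qed.

Lemma momint_test t phi phir phiz : - T <= t <= T -> C1w lin phi phir phiz -> momint (v t) phi.
Proof.
move=> tT [Cp [B [B0 hB]]]; apply: (momint_lin (gv tT) (C1_meas Cp) B0) => x x0.
by have [] := hB x x0.
Qed.

(** It lets the leading part of the flux, zeta times this moment, be replaced on a short interval by
    its value at the right end. *)
Lemma axial_z_increment s a b : - T <= a -> a <= b -> b <= T ->
  `|mom (v b) (axial_z n s) - mom (v a) (axial_z n s)| <= 68 * M * K * M * (b - a).
Proof.
move=> Ta ab bT; have [Ct bt] := axial_z_test n1 s.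
have := @wl _ _ _ Ct a b 0 (68 * M * K * M) Ta ab bT; rewrite mul0r subr0; apply=> t /andP[t1 t2].
have tT : - T <= t <= T by rewrite (le_trans Ta t1) (le_trans t2 bT).
have gt := gv tT; rewrite subr0.
apply: (flux_bound gt bt); have B0 : 0 <= 68 * M * K by exact: mulr_ge0 (mulr_ge0 (ler0n _ _) M0) K0.
have := @good_integral_le _ _ _ _ gt (fun=> 68 * M * K) (68 * M * K) 0.
by rewrite addr0; apply => // x x0; rewrite mul0r addr0 lexx B0.
Qed.

Lemma axial_flux s t : - T <= t <= T ->
  `|flux (v t) (fun x => drsq n x.1 * hax n s x.2) (axial_z n s) - zeta * mom (v t) (axial_z n s)| <= C.
Proof.
move=> tT; have gt := gv tT; have [[Ct _] bt] := axial_test n1 s.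
have [_ ->] := flux_kernel_integral gt K0 (C1_measr Ct) (C1_measz Ct) bt.
have := drift s tT.
have -> : J (v t) (flux_kernel n (hax n s) (dhax n s)) =
    J (v t) (fun x y => drsq n x.1 * hax n s x.2 * KR x y + axial_z n s x * KZ x y).
  apply: (eq_J gt) => x y x0 y0; rewrite /flux_kernel /chi /axial_z /rsq /drsq /KR.
  by field; rewrite gt_eqF.
have -> // : mom (v t) (fun x => chi n (dhax n s) x * x.1 ^+ 2) = mom (v t) (axial_z n s).
by apply: (eq_mom gt) => x x0; rewrite /chi /axial_z /rsq; ring.
Qed.

(* Moving the centre at speed zeta removes the leading part zeta * mom axial_z of
   the flux. *)
Lemma axial_drift a b : - T <= a -> a <= b -> b <= T ->
  `|mom (v b) (axial n (zeta * b)) - mom (v a) (axial n (zeta * a))| <= C * (b - a).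
Proof.
move: a b; apply: (@increment_partition _ (fun t => mom (v t) (axial n (zeta * t))) (- T) T) => eta eta0.
pose D := `|zeta| * (68 * M * K * M) + 3 * zeta ^+ 2 * n ^+ 2 * M.
have D0 : 0 <= D.
  apply: addr_ge0; first by apply: mulr_ge0 => //; exact: mulr_ge0 (mulr_ge0 (mulr_ge0 (ler0n _ _) M0) K0) M0.
  exact: mulr_ge0 (mulr_ge0 (mulr_ge0 (ler0n _ _) (sqr_ge0 _)) (sqr_ge0 _)) M0.
have D1 : 0 < D + 1 by rewrite ltr_wpDl.
exists (eta / (D + 1)); first exact: divr_gt0.
move=> a b Ta ab bT abh; have ab0 : 0 <= b - a by rewrite subr_ge0.
have aT : - T <= a <= T by rewrite Ta (le_trans ab).
have bT' : - T <= b <= T by rewrite bT (le_trans Ta).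
have ga := gv aT; have gb := gv bT'.
have [Ca _] := axial_test n1 (zeta * a); have [Cb _] := axial_test n1 (zeta * b).
have [Cz _] := axial_z_test n1 (zeta * a).
have i1 := momint_test bT' Ca; have i2 := momint_test bT' Cb; have i3 := momint_test bT' Cz.
pose kappa := zeta * mom (v b) (axial_z n (zeta * a)).
have step1 : `|mom (v b) (axial n (zeta * a)) - mom (v a) (axial n (zeta * a)) - kappa * (b - a)|
    <= (C + `|zeta| * (68 * M * K * M) * (b - a)) * (b - a).
  apply: (wl Ca) => // t /andP[t1 t2].
  have tT : - T <= t <= T by rewrite (le_trans Ta t1) (le_trans t2 bT).
  have h1 := axial_flux (zeta * a) tT; have h2 := axial_z_increment (zeta * a) (le_trans Ta t1) t2 bT.
  rewrite /kappa; move: (flux _ _ _) (mom (v t) _) (mom (v b) _) h1 h2 => F p q h1 h2.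
  have -> : F - zeta * q = (F - zeta * p) - zeta * (q - p) by ring.
  apply: le_trans (ler_normB _ _) _; apply: lerD => //.
  rewrite normrM -mulrA ler_wpM2l//; apply: (le_trans h2); apply: ler_wpM2l.
    exact: mulr_ge0 (mulr_ge0 (mulr_ge0 (ler0n _ _) M0) K0) M0.
  by lra.
(* Recentring the weight at the final time produces - kappa (b - a) to first order, which cancels
   the main term of the first step; the remainder is quadratic in b - a. *)
have step2 : `|mom (v b) (axial n (zeta * b)) - mom (v b) (axial n (zeta * a)) + kappa * (b - a)|
    <= 3 * zeta ^+ 2 * n ^+ 2 * M * (b - a) ^+ 2.
  have -> : mom (v b) (axial n (zeta * b)) - mom (v b) (axial n (zeta * a)) + kappa * (b - a) =
     mom (v b) (fun x => axial n (zeta * b) x + (-1 * axial n (zeta * a) x + zeta * (b - a) * axial_z n (zeta * a) x)).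
    rewrite (momD i2 (momint_D (momint_Z _ i1) (momint_Z _ i3))) (momD (momint_Z _ i1) (momint_Z _ i3)).
    by rewrite (momZ _ i1) (momZ _ i3) mulN1r addrA /kappa mulrAC.
  pose B := n ^+ 2 * (3 * (zeta * b - zeta * a) ^+ 2).
  have B0 : 0 <= B by exact: mulr_ge0 (sqr_ge0 _) (mulr_ge0 (ler0n _ _) (sqr_ge0 _)).
  have -> : 3 * zeta ^+ 2 * n ^+ 2 * M * (b - a) ^+ 2 = B * M by rewrite /B; ring.
  apply: (mom_bound gb (h := fun=> B)) => [x x0|].
    have /andP[r0 r1] := rsq_le n1 x.1.
    rewrite /axial /axial_z (_ : _ + _ = rsq n x.1 * (hax n (zeta * b) x.2 - hax n (zeta * a) x.2
       + (zeta * b - zeta * a) * dhax n (zeta * a) x.2)); last by ring.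
    rewrite normrM (ger0_norm r0); apply: ler_pM => //; exact: hax_center.
  have := @good_integral_le _ _ _ _ gb (fun=> B) B 0.
  by rewrite addr0; apply => // x x0; rewrite mul0r addr0 lexx B0.
have hD : D * (b - a) <= eta.
  have : (D + 1) * (b - a) <= eta by rewrite mulrC -ler_pdivlMr.
  by have := ab0; lra.
have -> : mom (v b) (axial n (zeta * b)) - mom (v a) (axial n (zeta * a)) =
  (mom (v b) (axial n (zeta * a)) - mom (v a) (axial n (zeta * a)) - kappa * (b - a)) +
  (mom (v b) (axial n (zeta * b)) - mom (v b) (axial n (zeta * a)) + kappa * (b - a)).
  by move: (mom _ _) (mom _ _) (mom _ _) (kappa * _) => *; ring.
apply: le_trans (ler_normD _ _) _; apply: (le_trans (lerD step1 step2)).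
have -> : (C + `|zeta| * (68 * M * K * M) * (b - a)) * (b - a) + 3 * zeta ^+ 2 * n ^+ 2 * M * (b - a) ^+ 2
  = (C + D * (b - a)) * (b - a) by rewrite /D; ring.
by rewrite ler_wpM2r// lerD2l.
Qed.

Lemma axial_growth t : - T <= t <= T ->
  mom (v t) (axial n (zeta * t)) <= mom (v 0) (axial n 0) + C * `|t|.
Proof.
move=> /andP[t1 t2].
have H : `|mom (v t) (axial n (zeta * t)) - mom (v 0) (axial n (zeta * 0))| <= C * `|t|.
  have [t0|/ltW t0] := leP 0 t.
    have := @axial_drift 0 t; rewrite subr0 (ger0_norm t0) oppr_le0; exact.
  have := @axial_drift t 0 t1 t0 T0; rewrite sub0r distrC (ler0_norm t0); exact.
by move: H; rewrite mulr0 ler_norml => /andP[_]; lra.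
Qed.

End fixed.

(** The vorticity in the ball has a second moment of at least m, and there the weight is at least
    (|xs.2 - zeta t| - 1) r^2 / 4. The weighted integral, on the other hand, has grown by at most C
    |t|. *)
Theorem axial_position (T c1 M n zeta C A m O : R) (v : R -> R * R -> R) (t eps : R) (xs : R * R) :
  0 <= T -> (forall t, - T <= t <= T -> good2 (c1 * eps ^- 2) M (v t)) -> weak_evolution T v (C1w lin) ->
  - T <= t <= T -> 0 < xs.1 -> 0 < eps -> eps < 1 -> xs.1 + 1 <= n -> `|xs.2 - zeta * t| + 2 <= n ->
  (forall t s, - T <= t <= T ->
     `|J (v t) (flux_kernel n (hax n s) (dhax n s)) - zeta * mom (v t) (fun x => chi n (dhax n s) x * x.1 ^+ 2)| <= C) ->
  mom (v 0) (axial n 0) <= A ->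
  mom (v t) (fun y => (1 + y.1 ^+ 2) * far (Num.sqrt eps) xs y) <= O -> 0 <= m -> m <= mom (v t) r2 - O ->
  (`|xs.2 - zeta * t| - 1) * m <= 4 * (A + C * `|t|).
Proof.
move=> T0 gv wl tT xs0 e0 e1 xn zn hdrift hA hO m0 hm.
have gt := gv t tT; have n1 : 1 <= n by have := xs0; lra.
have n0 : 0 < n by lra.
have C0 : 0 <= C by apply: le_trans (hdrift t 0 tT).
have oT : - T <= 0 <= T by rewrite oppr_le0 T0.
have A0 : 0 <= A.
  apply: le_trans hA; apply: (mom_ge0 (gv 0 oT)) => x x0; have /andP[r0 _] := rsq_le n1 x.1.
  by rewrite mulr_ge0// hax_ge0.
have growth := axial_growth T0 n1 gv wl hdrift tT.
have [Ca _] := axial_test n1 (zeta * t).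
have ia := momint_test gv tT Ca.
move: zn; set Z : R := `|xs.2 - zeta * t| => zn.
have B0 : 0 <= 4 * (A + C * `|t|) by rewrite mulr_ge0// addr_ge0// mulr_ge0.
have [Z1|Z1] := leP Z 1; first by apply: le_trans B0; rewrite mulr_le0_ge0// subr_le0.
have ifar := momint_r2_far gt xs.
have i2 := momint_r2 gt.
have Zq : 0 <= (Z - 1) / 4 by rewrite divr_ge0// subr_ge0 ltW.
have t1 : Num.sqrt eps <= 1 by rewrite -sqrtr1 ler_wsqrtr// ltW.
have low : mom (v t) (fun x => (Z - 1) / 4 * (r2 x + -1 * ((1 + x.1 ^+ 2) * far (Num.sqrt eps) xs x)))
    <= mom (v t) (axial n (zeta * t)).
  apply: (mom_le gt (momint_Z _ (momint_D i2 (momint_Z _ ifar))) ia) => x x0.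
  have /andP[r0 _] := rsq_le n1 x.1; have h0 := hax_ge0 (zeta * t) n1 x.2.
  have a0 : 0 <= axial n (zeta * t) x by exact: mulr_ge0.
  rewrite /far; case: (leP (Num.sqrt eps) (eucl_dist xs x)) => d.
    apply: le_trans a0; rewrite mulr_ge0_le0// mulr1 mulN1r /r2; lra.
  rewrite !mulr0 addr0; apply: (axial_ge n1 x0 (lt_le_trans d t1) xn zn); exact: ltW.
move: low; rewrite (momZ _ (momint_D i2 (momint_Z _ ifar))) (momD i2 (momint_Z _ ifar)) (momZ _ ifar).
move: growth hA hm hO; set a := mom (v 0) _; set b := mom (v t) (axial _ _); set d := mom (v t) r2.
set e := mom (v t) _ => growth hA hm hO low.
have : (Z - 1) / 4 * m <= (Z - 1) / 4 * (d + -1 * e) by rewrite ler_wpM2l//; lra.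
lra.
Qed.

End AxialDrift.

Section VortexMotion.
Context {R : realType}.
Local Notation mu2 := (@plane_measure R).
Local Notation pT := (measurableTypeR R * measurableTypeR R)%type.
Implicit Types (x y : R * R).
Lemma half_moment (a b m q : R) : a + b <= q / 2 -> - a <= m - q -> q / 2 <= m - b.
Proof. lra. Qed.

Variables (p mu c1 c2 c3 c4 : R).
Hypotheses (p0 : 0 < p) (mu0 : 0 < mu) (hc1 : 0 < c1) (hc2 : 0 < c2) (hc3 : 0 < c3) (hc4 : 0 < c4).

(** [cM2] bounds the two-sided error of the second moment at all times, [cSmall] is the lower bound
    imposed on L, [cDrift] the speed of the axial functional in the moving frame, and [cAxis] the
    constant in the position of the centre. *)
Definition cM2 : R := c3 + 4 * p ^+ 3 * (cK p mu c1 c2 c3 c4 / (p * mu)) + 3 * p ^+ 4 * c2.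
Definition cSmall : R := cLam p mu c1 c2 c3 c4 + 2 * (cM2 + cO p mu c1 c2 c3 c4) / (p ^+ 4 * mu).
Definition cDrift : R := cFlux p mu c1 c4 cM2 (cA p mu c2 c3) (cO p mu c1 c2 c3 c4).
Definition cAxis : R := 1 + 8 * (1 + cDrift) / (p ^+ 4 * mu).

Let p4 : 0 < p ^+ 4. Proof. exact: exprn_gt0. Qed.
Let p3 : 0 < p ^+ 3. Proof. exact: exprn_gt0. Qed.
Let pmu : 0 < p ^+ 4 * mu. Proof. exact: mulr_gt0. Qed.
Let k0 : 0 < cK p mu c1 c2 c3 c4. Proof. exact: cK_gt0. Qed.
Let o0 : 0 < cO p mu c1 c2 c3 c4. Proof. exact: cO_gt0. Qed.
Let a0 : 0 < cA p mu c2 c3. Proof. exact: cA_gt0. Qed.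

Lemma cM2_gt0 : 0 < cM2.
Proof.
rewrite /cM2; apply: addr_gt0; last exact: mulr_gt0 (mulr_gt0 _ p4) hc2.
apply: addr_gt0 => //; apply: mulr_gt0; first exact: mulr_gt0 _ p3.
by apply: divr_gt0 => //; exact: mulr_gt0.
Qed.

Lemma cDrift_ge0 : 0 <= cDrift.
Proof.
have m2 := cM2_gt0; have pp := pi_gt0 R.
rewrite /cDrift /cFlux; move: (cA _ _ _ _) (cO _ _ _ _ _ _) cM2 a0 o0 m2 => A O m A0 O0 m0.
rewrite !addr_ge0//.
- exact: mulr_ge0 _ (sqr_ge0 _).
- apply: mulr_ge0 => //; apply: mulr_ge0 => //; apply: addr_ge0; last exact: ltW.
  exact: mulr_ge0 (sqr_ge0 _) (sqr_ge0 _).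
- apply: mulr_ge0; last exact: ltW.
  by apply: addr_ge0; apply: mulr_ge0 => //; exact: ltW.
- exact: divr_ge0 (ltW hc4) _.
- apply: mulr_ge0.
    apply: divr_ge0 (ltW mu0) _; exact: mulr_ge0 (mulr_ge0 _ (ltW pp)) (sqr_ge0 _).
  by apply: addr_ge0; last exact: ltW; apply: addr_ge0; apply: mulr_ge0 => //; exact: ltW.
Qed.

Lemma cSmall_gt0 : 0 < cSmall.
Proof.
apply: (lt_le_trans ltr01); apply: le_trans (cLam_ge1 p0 mu0 hc1 hc2 hc3 hc4) _.
rewrite lerDl; apply: divr_ge0 (ltW pmu); apply: mulr_ge0 => //; apply: addr_ge0 (ltW o0); exact: ltW cM2_gt0.
Qed.

Lemma cAxis_gt0 : 0 < cAxis.
Proof.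
rewrite /cAxis ltr_wpDr//; apply: divr_ge0 (ltW pmu); apply: mulr_ge0 => //; apply: addr_ge0 => //.
exact: cDrift_ge0.
Qed.

Variables (eps M T : R) (v : R -> R * R -> R).
Hypotheses (T0 : 0 <= T) (e0 : 0 < eps) (e1 : eps < 1).
Let L := - ln eps.
Let l := L^-1.
Let c := c1 * eps ^- 2.
Hypothesis small : cSmall * l <= 1.
Hypothesis gv : forall t, - T <= t <= T -> good c M (v t).
Hypothesis wv : weak_evolution T v C1c.
Hypothesis g20 : good2 c M (v 0).
Hypothesis hm0 : `|mom (v 0) one - mu| <= c2 * l.
Hypothesis hm2 : `|mom (v 0) r2 - p ^+ 4 * mu| <= c3 * l.
Hypothesis hE : `|J (v 0) G0 - p ^+ 2 * mu ^+ 2 / (2 * pi) * L| <= c4.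

Let L0 : 0 < L. Proof. by rewrite oppr_gt0 ln_lt0// e0. Qed.
Let l0 : 0 < l. Proof. by rewrite invr_gt0. Qed.
Let c0 : 0 <= c. Proof. by rewrite /c mulr_ge0 ?(ltW hc1)// invr_ge0 exprn_ge0// ltW. Qed.
Let M0 : 0 <= M. Proof. exact: good_M_ge0 g20. Qed.

Let small1 : cLam p mu c1 c2 c3 c4 * l <= 1.
Proof.
apply: le_trans small; rewrite ler_wpM2r ?(ltW l0)// /cSmall lerDl.
by apply: divr_ge0 (ltW pmu); rewrite mulr_ge0// addr_ge0 ?(ltW cM2_gt0)// ltW.
Qed.

(** It leaves at least half of p^4 mu of the second moment inside the ball. *)
Let small2 : (cM2 + cO p mu c1 c2 c3 c4) * l <= p ^+ 4 * mu / 2.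
Proof.
have : 2 * (cM2 + cO p mu c1 c2 c3 c4) / (p ^+ 4 * mu) * l <= 1.
  apply: le_trans small; rewrite ler_wpM2r ?(ltW l0)// /cSmall lerDr.
  by rewrite (le_trans ler01)// cLam_ge1.
rewrite mulrAC ler_pdivrMr//; lra.
Qed.

Let g2 t : - T <= t <= T -> good2 c M (v t).
Proof.
move=> tT; split; first exact: gv.
exact: (second_moment_le T0 c0 gv wv tT (good2_r2 g20)).
Qed.

Let wl : weak_evolution T v (C1w lin).
Proof. exact: (weak_lin T0 c0 gv wv M0 (good2_r2 g20)). Qed.

Let mass t : - T <= t <= T -> mom (v t) one = mom (v 0) one.
Proof. exact: (mass_conserved T0 c0 gv wv). Qed.

Let energy t : - T <= t <= T -> J (v t) G0 = J (v 0) G0.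
Proof. exact: (energy_conserved T0 g2 wl). Qed.

Let m2_le t : - T <= t <= T -> mom (v t) r2 <= mom (v 0) r2.
Proof.
move=> tT; rewrite -lee_fin -(mom_EFin (momint_r2 (g2 tT))).
apply: (second_moment_le T0 c0 gv wv tT); rewrite -(mom_EFin (momint_r2 g20)); exact: lexx.
Qed.

Let m0t t : - T <= t <= T -> `|mom (v t) one - mu| <= c2 * l.
Proof. by move=> /mass ->. Qed.

Let m2t t : - T <= t <= T -> mom (v t) r2 <= p ^+ 4 * mu + c3 * l.
Proof. by move=> /m2_le; move: hm2; rewrite ler_norml => /andP[_]; lra. Qed.

Let Et t : - T <= t <= T -> `|J (v t) G0 - p ^+ 2 * mu ^+ 2 / (2 * pi) * L| <= c4.
Proof. by move=> /energy ->. Qed.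

Let Elow t : - T <= t <= T -> p ^+ 2 * mu ^+ 2 / (2 * pi) * L - c4 <= J (v t) G0.
Proof. by move=> /Et; rewrite ler_norml => /andP[+ _]; lra. Qed.

(** The variance is nonnegative, so the second moment is at least 4 p^3 S - 3 p^4 times the mass,
    and the conserved energy bounds S from below. This supplies the lower bound that monotonicity in
    time does not give. *)
Let m2t' t : - T <= t <= T -> `|mom (v t) r2 - p ^+ 4 * mu| <= cM2 * l.
Proof.
move=> tT; have gt := g2 tT.
have [_ hS _] := moment_concentration p0 mu0 hc1 hc2 hc3 hc4 e0 e1 small1 gt (m0t tT) (m2t tT) (Elow tT).
have V0 : 0 <= mom (v t) (fun x => (x.1 - p ^+ 2) ^+ 2) by apply: (mom_ge0 gt) => x _; exact: sqr_ge0.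
have := variance_le gt p0; have := m0t tT; have := m2t tT.
rewrite -/L -/l in hS; move: V0 hS; rewrite /cM2; move: (mom _ _) (mom _ sqr) (mom _ r2) (mom _ one) => V S m2 m V0.
set k := cK _ _ _ _ _ _ / _ => hS hm2' /[!ler_norml]/andP[h1 h2] hV.
have h3 := ler_wpM2l (ltW p3) hS; have h4 := ler_wpM2l (ltW p4) h2.
have k1 : 0 <= 4 * p ^+ 3 * k * l.
  apply: mulr_ge0 (ltW l0); apply: mulr_ge0; first exact: mulr_ge0 _ (ltW p3).
  by apply: divr_ge0; [exact: ltW|exact: ltW (mulr_gt0 _ _)].
have k2 : 0 <= 3 * p ^+ 4 * c2 * l.
  apply: mulr_ge0 (ltW l0); apply: mulr_ge0 (ltW hc2); exact: mulr_ge0 _ (ltW p4).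
have k3 := mulr_gt0 hc3 l0.
have e4 : p ^+ 3 * (p * mu) = p ^+ 4 * mu by ring.
rewrite mulrBr e4 in h3.
by apply/andP; split; lra.
Qed.

Let drift n t s x : 1 <= n -> - T <= t <= T -> 0 < x.1 ->
  mom (v t) (fun y => (1 + y.1 ^+ 2) * far (Num.sqrt eps) x y) <= cO p mu c1 c2 c3 c4 * l ->
  `|J (v t) (flux_kernel n (hax n s) (dhax n s))
    - mu / (4 * pi * p ^+ 2) * L * mom (v t) (fun x => chi n (dhax n s) x * x.1 ^+ 2)| <= cDrift.
Proof.
move=> n1 tT x0 hO; have gt := g2 tT.
have l1 : l <= 1 by exact: (small_l1 p0 mu0 hc1 hc2 hc3 hc4 e0 e1 small1).
have hA : mom (v t) wt <= cA p mu c2 c3.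
  rewrite (mom_wt gt) /cA; have := m2t tT; have := m0t tT; rewrite ler_norml => /andP[_].
  by have := ler_piMr (ltW hc2) l1; have := ler_piMr (ltW hc3) l1; lra.
apply: (static_velocity n1 _ (hax_lip s n1) (dhax_le1 s n1) (dhax_lip s n1) (measurable_hax s n1)
  (measurable_dhax s n1) p0 mu0 hc1 hc4 a0 o0 e0 e1 l1 gt hA (m2t' tT) (Et tT) x0 hO).
by move=> z; rewrite ger0_norm ?hax_ge0// hax_le.
Qed.

Theorem vortex_motion t : - T <= t <= T -> exists x,
  [/\ 0 < x.1, `|x.1 - p ^+ 2| <= cRad p mu c1 c2 c3 c4 * l,
      mom (v t) (fun y => (1 + y.1 ^+ 2) * far (Num.sqrt eps) x y) <= cO p mu c1 c2 c3 c4 * l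
    & forall A, (\int[mu2]_y (japanese y.2 * y.1 ^+ 2 * v 0 y)%:E <= A%:E)%E ->
      `|x.2 - mu / (4 * pi * p ^+ 2) * L * t| <= cAxis * (1 + A + `|t|)].
Proof.
move=> tT.
have P s : - T <= s <= T -> exists x, [/\ 0 < x.1, `|x.1 - p ^+ 2| <= cRad p mu c1 c2 c3 c4 * l
    & mom (v s) (fun y => (1 + y.1 ^+ 2) * far (Num.sqrt eps) x y) <= cO p mu c1 c2 c3 c4 * l].
  move=> sT; exact: (concentration p0 mu0 hc1 hc2 hc3 hc4 e0 e1 small1 (g2 sT) (m0t sT) (m2t sT) (Elow sT)).
have [x [x0 x1 x2]] := P t tT; exists x; split => // A hA.
set zeta := mu / (4 * pi * p ^+ 2) * L.
(* The cutoff parameter is chosen after the centre x, large enough for both truncations to be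
   inactive around it; the drift bound is uniform in n. *)
pose n := Num.max (x.1 + 1) (`|x.2 - zeta * t| + 2).
have n1 : 1 <= n by rewrite le_max; apply/orP; left; lra.
(* At each time r the drift estimate uses a centre y found for that time; no relation between the
   centres at different times is required. *)
have hdrift r s : - T <= r <= T -> `|J (v r) (flux_kernel n (hax n s) (dhax n s))
    - zeta * mom (v r) (fun x => chi n (dhax n s) x * x.1 ^+ 2)| <= cDrift.
  by move=> rT; have [y [y0 _ y2]] := P r rT; exact: (drift s n1 rT y0 y2).
have hA0 : mom (v 0) (axial n 0) <= A.
  have oT : - T <= 0 <= T by rewrite oppr_le0 T0.
  have [Ca _] := axial_test n1 (0 : R).
  rewrite -lee_fin -(mom_EFin (momint_test g2 oT Ca)); apply: le_trans hA.
  apply: le_integral_nomeas => y _.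
    have /andP[r0 _] := rsq_le n1 y.1.
    by rewrite lee_fin mulr_ge0 ?(good_ge0 g20)// mulr_ge0// hax_ge0.
  rewrite lee_fin ler_wpM2r ?(good_ge0 g20)// /axial mulrC; apply: ler_pM.
  - exact: hax_ge0.
  - by have /andP[] := rsq_le n1 y.1.
  - by apply: (le_trans (hax_le_jap _ _ _)) => //; rewrite /jap subr0.
  - by rewrite /rsq ler_piMr ?sqr_ge0 ?rho_le1.
have hm : p ^+ 4 * mu / 2 <= mom (v t) r2 - cO p mu c1 c2 c3 c4 * l.
  have := m2t' tT; rewrite ler_norml => /andP[h _]; move: small2; rewrite mulrDl => h'.
  exact: half_moment h' h.
have H : (`|x.2 - zeta * t| - 1) * (p ^+ 4 * mu / 2) <= 4 * (A + cDrift * `|t|).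
  apply: (axial_position T0 g2 wl tT x0 e0 e1 _ _ hdrift hA0 x2 _ hm).
  - by rewrite le_max lexx.
  - by rewrite le_max lexx orbT.
  - by rewrite divr_ge0// ltW.
have A0 : 0 <= A.
  rewrite -lee_fin; apply: le_trans hA; apply: integral_ge0 => y _.
  by rewrite lee_fin mulr_ge0 ?(good_ge0 g20)// mulr_ge0 ?sqr_ge0// sqrtr_ge0.
have d0 := cDrift_ge0; have tt := normr_ge0 t.
move: H; move: (`|x.2 - _|) => Z H.
rewrite /cAxis; move: cDrift d0 H => D D0 H.
have q0 : 0 <= 8 * (1 + D) / (p ^+ 4 * mu).
  by apply: divr_ge0 (ltW pmu); rewrite mulr_ge0// addr_ge0.
have Z1 : Z - 1 <= 8 * (1 + D) / (p ^+ 4 * mu) * (1 + A + `|t|).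
  rewrite mulrAC ler_pdivlMr//; have := mulr_ge0 D0 A0; have := mulr_ge0 D0 tt.
  by lra.
by rewrite mulrDl mul1r; lra.
Qed.

End VortexMotion.

(** * Truncation of the solution *)

Section AlmostEverywhere.
Context d (T : measurableType d) (R : realType).
Variable mu : {measure set T -> \bar R}.
Local Open Scope ereal_scope.
Import HBNNSimple.

(** A simple function below f keeps its integral when it is set to 0 on N, and it is then below g.
    The argument works with the defining supremum and so covers nonmeasurable f and g. *)
Lemma ge0_le_integral_off_null (f g : T -> \bar R) (N : set T) : measurable N -> mu N = 0 ->
  (forall x, 0 <= f x) -> (forall x, 0 <= g x) -> (forall x, ~ N x -> f x <= g x) ->
  \int[mu]_x f x <= \int[mu]_x g x.
Proof.
move=> mN N0 f0 g0 fg; rewrite !ge0_integralTE//; apply: ub_ereal_sup => _ [h /= hf <-].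
have mC : measurable (~` N) by exact: measurableC.
rewrite -integralT_nnsfun.
have -> : \int[mu]_x (h x)%:E = sintegral mu (proj_nnsfun h mC).
  rewrite -integralT_nnsfun; apply: ae_eq_integral => //.
  - by apply/measurable_EFinP.
  - by apply/measurable_EFinP.
  exists N; split => // x /=; apply: contra_notP => Nx _.
  by rewrite mindicE mem_set// mulr1.
apply: ereal_sup_ubound; exists (proj_nnsfun h mC) => // x /=.
rewrite mindicE; have [Nx|Nx] := pselect (N x).
  by rewrite memNset ?mulr0//; exact.
by rewrite mem_set// mulr1; apply: le_trans (fg x Nx).
Qed.

Lemma eq_integral_off_null (f g : T -> \bar R) (N : set T) : measurable N -> mu N = 0 ->
  (forall x, ~ N x -> f x = g x) -> \int[mu]_x f x = \int[mu]_x g x.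
Proof.
move=> mN N0 fg; rewrite integralE [RHS]integralE; congr (_ - _); apply: le_anti; apply/andP; split;
  apply: (ge0_le_integral_off_null mN N0) => x; rewrite ?funepos_ge0 ?funeneg_ge0// => /fg.
- by rewrite !funeposE => ->.
- by rewrite !funeposE => ->.
- by rewrite !funenegE => ->.
- by rewrite !funenegE => ->.
Qed.

End AlmostEverywhere.

Section Truncation.
Context {R : realType}.
Local Notation mu2 := (@plane_measure R).
Local Notation mu4 := (mu2 \x mu2)%E.
Local Notation pT := (measurableTypeR R * measurableTypeR R)%type.
Implicit Types (x y : R * R) (P Q : R * R -> Prop) (f g v phi phir phiz : R * R -> R).

Definition off_null P : Prop := exists N : set pT,
  [/\ measurable N, mu2 N = 0 & forall x, 0 < x.1 -> ~ N x -> P x].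

Lemma off_null_ae P : {ae leb2, forall x, halfplane x -> P x} -> off_null P.
Proof.
case=> N [mN N0 PN]; exists N; split => // x x0 Nx.
by apply: contrapT => nP; apply/Nx/PN => /= h; apply: nP; exact: h.
Qed.

Lemma off_null_and P Q : off_null P -> off_null Q -> off_null (fun x => P x /\ Q x).
Proof.
move=> [N [mN N0 hN]] [N' [mN' N0' hN']]; exists (N `|` N'); split.
- exact: measurableU.
- by rewrite measureU0.
- by move=> x x0 /not_orP[? ?]; split; [exact: hN|exact: hN'].
Qed.

Lemma off_null_sub P Q : (forall x, 0 < x.1 -> P x -> Q x) -> off_null P -> off_null Q.
Proof. by move=> PQ [N [mN N0 hN]]; exists N; split => // x x0 /(hN x x0); exact: PQ. Qed.

Lemma off_null_neq y : off_null (fun x => x != y).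
Proof.
exists [set y]; split; [|exact: plane_measure_point|].
  by rewrite point_rect; apply: measurableX; exact: measurable_set1.
by move=> x _; apply: contra_notN => /eqP ->.
Qed.

Lemma measurable_halfplane : measurable (@halfplane R : set pT).
Proof.
have -> : @halfplane R = `]0, +oo[%classic `*` setT.
  by apply/seteqP; split => x; rewrite /halfplane/= in_itv/= andbT => // -[].
by apply: measurableX => //; exact: measurable_itv.
Qed.

Lemma halfplane_integral (F G : R * R -> \bar R) : off_null (fun x => F x = G x) ->
  (forall x, ~ (0 < x.1) -> G x = 0%E) ->
  (\int[leb2]_(x in halfplane) F x = \int[mu2]_x G x)%E.
Proof.
move=> [N [mN N0 hN]] G0; rewrite integral_mkcond.
apply: (@eq_integral_off_null _ pT R mu2 _ _ N mN N0) => x Nx.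
rewrite /patch; case: ifPn => [/set_mem x0|/negP h]; first exact: hN.
by rewrite G0// => x0; apply: h; rewrite inE.
Qed.

Lemma halfplane_Rintegral f g : off_null (fun x => f x = g x) -> (forall x, ~ (0 < x.1) -> g x = 0) ->
  \int[leb2]_(x in halfplane) f x = \int[mu2]_x g x.
Proof.
move=> fg g0; rewrite /Rintegral; congr fine; apply: halfplane_integral.
  by apply: (off_null_sub _ fg) => x _ /= ->.
by move=> x /g0 /= ->.
Qed.

(** A value violating one of the bounds is replaced by 0. The condition is pointwise in f, so no
    exceptional null set has to be chosen and measurability is kept. *)
Definition truncation (c M : R) f x : R :=
  if [&& 0 < x.1, 0 <= f x, f x <= c * x.1 & f x <= M] then f x else 0.

Lemma measurable_truncation (c M : R) f : measurable_fun (@halfplane R : set pT) (f : pT -> R) ->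
  measurable_fun setT (truncation c M f : pT -> R).
Proof.
move=> /(measurable_restrictT f measurable_halfplane); set g := f \_ _ => mg.
pose b x := [&& 0 < x.1, 0 <= g x, g x <= c * x.1 & g x <= M].
have -> : truncation c M f = fun x => (b x)%:R * g x.
  apply/funext => x; rewrite /truncation /b /g /patch.
  have [x0|x0] := ltP 0 x.1; last by rewrite /= mul0r.
  by rewrite mem_set//; case: ifP => _; rewrite ?mul1r ?mul0r.
have m1 : measurable_fun setT ((fun x => x.1) : pT -> R) by exact: measurable_fst.
apply: measurable_funM => //; apply: measurable_fun_bool_nat.
by apply: measurable_and; [apply: measurable_fun_ltr|apply: measurable_and; [apply: measurable_fun_ler|
  apply: measurable_and; apply: measurable_fun_ler]] => //; exact: measurable_funM.
Qed.

Lemma truncation_ge0 (c M : R) f x : 0 <= truncation c M f x.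
Proof. by rewrite /truncation; case: ifP => // /and4P[]. Qed.

Lemma truncation_out (c M : R) f x : ~ (0 < x.1) -> truncation c M f x = 0.
Proof. by rewrite /truncation => /negP/negbTE ->. Qed.

Lemma truncation_weight (c M : R) f (g F : R * R -> R) (B : R) :
  (forall x, 0 < x.1 -> 0 <= g x) -> (forall x, 0 < x.1 -> 0 <= f x -> g x * f x <= F x) ->
  (forall x, 0 < x.1 -> 0 <= F x) ->
  (\int[leb2]_(x in halfplane) (F x)%:E <= B%:E)%E ->
  (\int[mu2]_x (g x * truncation c M f x)%:E <= B%:E)%E.
Proof.
move=> g0 gF F0; apply: le_trans; rewrite [leRHS]integral_mkcond; apply: le_integral_nomeas => x _.
  have [x0|x0] := ltP 0 x.1; first by rewrite lee_fin mulr_ge0 ?g0 ?truncation_ge0.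
  by rewrite truncation_out ?mulr0//; apply/negP; rewrite -leNgt.
rewrite /patch; case: ifPn => [/set_mem x0|h]; last first.
  by rewrite truncation_out ?mulr0// => x0; move: h; rewrite mem_set.
rewrite lee_fin /truncation; case: ifP => [/and4P[_ f0 _ _]|_]; first exact: gF.
by rewrite mulr0 F0.
Qed.

(** Because of the volume element 2 pi r, the L1 norm of f / r controls the mass in the half-plane,
    and that of f the first moment. *)
Lemma good_truncation (c M M1 M2 : R) f : 0 <= c -> M1 <= M -> M2 <= M -> measurable_fun (@halfplane R : set pT) (f : pT -> R) ->
  L1_Linfty_le f M1 -> L1_Linfty_le (fun x => f x / x.1) M2 ->
  good c M (truncation c M f).
Proof.
move=> c0 le1 le2 mf [h1 _] [h2 _].
have p1 : 1 <= 2 * pi :> R by have := @pi_ge2 R; lra.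
have M1M : (M1%:E <= M%:E)%E by rewrite lee_fin.
have M2M : (M2%:E <= M%:E)%E by rewrite lee_fin.
have M0 : 0 <= M.
  rewrite -lee_fin; apply: le_trans M1M; apply: le_trans h1; apply: integral_ge0 => x /= x0.
  by rewrite lee_fin; apply: mulr_ge0 => //; apply: mulr_ge0 (ltW x0); lra.
have q0 x : 0 < x.1 -> 0 <= 2 * pi * x.1 by move=> x0; apply: mulr_ge0 (ltW x0); lra.
split.
- exact: measurable_truncation.
- by move=> x; exact: truncation_ge0.
- by move=> x; exact: truncation_out.
- by move=> x x0; rewrite /truncation; case: ifP => [/and4P[]//|_]; rewrite mulr_ge0// ltW.
- by move=> x; rewrite /truncation; case: ifP => [/and4P[]|].
- under eq_integral do rewrite -[truncation _ _ _ _]mul1r.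
  apply: (@truncation_weight c M f (fun=> 1) (fun x => 2 * pi * x.1 * `|f x / x.1|) _ _ _ _ (le_trans h2 M2M)) => // x x0.
    move=> f0; rewrite normrM normfV (gtr0_norm x0) (ger0_norm f0) mul1r.
    have -> : 2 * pi * x.1 * (f x / x.1) = 2 * pi * f x by field; rewrite gt_eqF.
    by rewrite ler_peMl.
  exact: mulr_ge0 (q0 x x0) (normr_ge0 _).
- apply: (@truncation_weight c M f fst (fun x => 2 * pi * x.1 * `|f x|) _ _ _ _ (le_trans h1 M1M)) => [x /ltW//|x x0 f0|x x0].
    by rewrite (ger0_norm f0) -[2 * pi * _ * _]mulrA ler_peMl// mulr_ge0// ltW.
  exact: mulr_ge0 (q0 x x0) (normr_ge0 _).
Qed.

(** The inner and the outer integral are both modified on null sets only; for fixed x the diagonal y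
    = x is one of them, so the elliptic kernel may be replaced by [G0]. *)
Lemma energy_truncation (c M : R) f v : good2 c M v -> off_null (fun x => f x = v x) ->
  energy f = (J v G0)%:E.
Proof.
move=> gv fv; have mv := good_meas gv; have v0 := good_ge0 gv.
rewrite -(Jb_EFin (Jint_G0 gv)) /Jb.
have mk : measurable_fun setT (fun p : pT * pT => (G0 p.1 p.2 * (v p.1 * v p.2))%:E).
  apply/measurable_EFinP; apply: measurable_funM; first exact: measurable_G0.
  by apply: measurable_funM; [exact: (measurable_p1 mv)|exact: (measurable_p2 mv)].
have k0 (p : pT * pT) : (0 <= (G0 p.1 p.2 * (v p.1 * v p.2))%:E)%E.
  rewrite lee_fin; have [->|/(good_halfplane gv) h1] := eqVneq (v p.1) 0; first by rewrite mul0r mulr0.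
  have [->|/(good_halfplane gv) h2] := eqVneq (v p.2) 0; first by rewrite !mulr0.
  by rewrite mulr_ge0 ?G0_ge0// mulr_ge0.
rewrite (@ge0_integral_prod _ _ _ _ R mu2 mu2 _ mk k0) /energy.
apply: halfplane_integral; last first.
  by move=> x x0; apply: integral0_eq => y _; rewrite (good_out gv)// mul0r mulr0.
apply: (off_null_sub _ fv) => x x0 fx /=; apply: halfplane_integral; last first.
  by move=> y y0; rewrite (good_out gv y0) !mulr0.
apply: (off_null_sub _ (off_null_and fv (off_null_neq x))) => y y0 [fy yx].
have xy : x != y by rewrite eq_sym.
by rewrite fx fy (Fell_Gk x0 y0 xy erefl) /G0 offd_neq// mul1r mulrA.
Qed.

Lemma velocity_truncation (c M : R) f v x : good c M v -> off_null (fun x => f x = v x) -> 0 < x.1 ->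
  velr f x = vr v x /\ velz f x = vz v x.
Proof.
move=> gv fv x0; split; apply: halfplane_Rintegral; try by move=> y y0; rewrite (good_out gv y0) mulr0.
  apply: (off_null_sub _ (off_null_and fv (off_null_neq x))) => y y0 [-> yx].
  by rewrite (KR_Kr x0 y0)// eq_sym.
apply: (off_null_sub _ (off_null_and fv (off_null_neq x))) => y y0 [-> yx].
by rewrite (KZ_Kz x0 y0)// eq_sym.
Qed.

Lemma flux_truncation (c M : R) f v phi phir phiz : good c M v -> off_null (fun x => f x = v x) ->
  C1 phi phir phiz ->
  \int[leb2]_(x in halfplane) (f x * (velr f x * dr phi x + velz f x * dz phi x)) = flux v phir phiz.
Proof.
move=> gv fv Cp; apply: halfplane_Rintegral; last by move=> x x0; rewrite (good_out gv x0) mulr0.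
apply: (off_null_sub _ fv) => x x0 ->; have [-> ->] := velocity_truncation gv fv x0.
have -> : dr phi x = phir x by rewrite /dr derive1E; have [_ ->] := C1_r Cp x.
have -> : dz phi x = phiz x by rewrite /dz derive1E; have [_ ->] := C1_z Cp x.
by rewrite mulrC [vr v x * _]mulrC [vz v x * _]mulrC.
Qed.

Lemma C1c_test phi phir phiz : C1c phi phir phiz -> C1c_halfplane phi.
Proof.
move=> [Cp [A [cA Ah hA]]].
have rE : dr phi = phir by apply/funext => x; rewrite /dr derive1E; have [_ ->] := C1_r Cp x.
have zE : dz phi = phiz by apply/funext => x; rewrite /dz derive1E; have [_ ->] := C1_z Cp x.
split.
- by move=> x; split; [have [] := C1_r Cp x|have [] := C1_z Cp x].
- by rewrite rE; exact: C1_contr Cp.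
- by rewrite zE; exact: C1_contz Cp.
- by exists A.
Qed.

Lemma weak_euler_truncation (T c M : R) (w v : R -> R * R -> R) : weak_euler w ->
  (forall t, - T <= t <= T -> good c M (v t) /\ off_null (fun x => w t x = v t x)) ->
  weak_evolution T v C1c.
Proof.
move=> we wv phi phir phiz Ct t1 t2 kappa S Tt1 t12 t2T hS; have [Cp _] := Ct.
have E := we _ (C1c_test Ct) _ _ t12.
have momE t : - T <= t <= T -> \int[leb2]_(x in halfplane) (phi x * w t x) = mom (v t) phi.
  move=> /wv[gt ft]; apply: halfplane_Rintegral; last by move=> x x0; rewrite (good_out gt x0) mulr0.
  by apply: (off_null_sub _ ft) => x _ ->.
rewrite !momE ?Tt1 ?t2T ?andbT ?(le_trans Tt1)// in E; last by rewrite (le_trans t12).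
rewrite E.
have mD : measurable (`[t1, t2]%classic : set (measurableTypeR R)) by exact: measurable_itv.
have DE : lebesgue_measure (`[t1, t2]%classic : set (measurableTypeR R)) = (t2 - t1)%:E.
  rewrite lebesgue_measure_itv/= lte_fin; case: ltP => [_|t21]; first by rewrite -EFinB.
  by rewrite (le_anti (introT andP (conj t12 t21))) subrr.
have Dfin : (lebesgue_measure (`[t1, t2]%classic : set (measurableTypeR R)) < +oo)%E by rewrite DE ltry.
have -> : t2 - t1 = fine (lebesgue_measure (`[t1, t2]%classic : set (measurableTypeR R))) by rewrite DE.
apply: (@Rintegral_cst_bound _ _ R lebesgue_measure _ _ kappa S mD Dfin).
move=> t /=; rewrite in_itv/= => /andP[a1 a2].
have tT : - T <= t <= T by rewrite (le_trans Tt1 a1) (le_trans a2 t2T).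
have [gt ft] := wv t tT; rewrite (flux_truncation gt ft Cp); apply: hS; exact/andP.
Qed.

Lemma solution_truncation (c T : R) (w0 : R * R -> R) (w : R -> R * R -> R) : 0 < c ->
  euler_solution w0 w -> off_null (fun x => 0 <= w0 x / x.1 /\ w0 x / x.1 < c) ->
  exists M, forall M', M <= M' -> forall t, - T <= t <= T ->
    good c M' (truncation c M' (w t)) /\ off_null (fun x => w t x = truncation c M' (w t) x).
Proof.
move=> c0 [mw [b1 b2] _ _ [X [_ Xb _] tr]] [N [mN N0 hN]].
have [M1 h1] := b1 T; have [M2 h2] := b2 T; exists (Num.max M1 M2) => M' MM t tT.
have mwt : measurable_fun (@halfplane R : set pT) (w t : pT -> R).
  have := @measurable_comp _ _ _ pT (measurableTypeR R * pT)%type (measurableTypeR R)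
    (setT `*` @halfplane R) (fun p => w p.1 p.2) (@halfplane R) (fun x => (t, x)).
  apply => //.
  - by apply: measurableX => //; exact: measurable_halfplane.
  - by move=> _ [x xh <-].
  - by apply: measurable_funTS; exact: pair1_measurable.
have tT' : `|t| <= T by rewrite ler_norml.
have le1 : M1 <= M' by apply: le_trans MM; rewrite le_max lexx.
have le2 : M2 <= M' by apply: le_trans MM; rewrite le_max lexx orbT.
split; first exact: (good_truncation (ltW c0) le1 le2 mwt (h1 t tT') (h2 t tT')).
(* Transport holds for every representative of w0 / r. Taking one with 0 <= q < c everywhere, the
   bounds pass to all times by surjectivity of the flow map, without following null sets along the
   flow. *)
pose q x := if (0 <= w0 x / x.1) && (w0 x / x.1 < c) then w0 x / x.1 else 0.
have hq : {ae leb2, forall x, halfplane x -> q x = w0 x / x.1}.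
  exists N; split => // x /= nq; apply: contrapT => Nx; apply: nq => x0.
  by have [a b] := hN x x0 Nx; rewrite /q a b.
have q01 x : 0 <= q x < c by rewrite /q; case: ifP => // _; rewrite lexx.
apply: (off_null_sub _ (off_null_and (off_null_ae (tr q hq t)) (off_null_ae (h1 t tT').2))).
move=> y y0 [hy hM]; have [_ _ /(_ y y0)[x x0 xy]] := Xb t.
have /andP[qx0 qxc] := q01 x; have wq := hy x x0 xy.
have wE : w t y = q x * y.1 by rewrite -wq divfK// gt_eqF.
have w1 : 0 <= w t y by rewrite wE; exact: mulr_ge0 qx0 (ltW y0).
have w2 : w t y <= c * y.1 by rewrite wE ler_pM2r// ltW.
by rewrite /truncation y0 w1 w2 (le_trans (le_trans (ler_norm _) hM) le1).
Qed.

End Truncation.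

Theorem theorem1p1 (R : realType) (r0 mu c1 c2 c3 c4 : R)
    (hr0 : 0 < r0) (hmu : 0 < mu)
    (hc1 : 0 < c1) (hc2 : 0 < c2) (hc3 : 0 < c3) (hc4 : 0 < c4) :
  exists eps0 C0 : R, 0 < eps0 /\ 0 < C0 /\
  forall eps : R, 0 < eps -> eps <= eps0 ->
  forall w0 : R * R -> R,
    in_Linfty w0 ->
    {ae leb2, forall x : R * R, halfplane x ->
       0 <= w0 x / x.1 /\ w0 x / x.1 < c1 * eps ^- 2} ->
    (`|M0 w0 - mu%:E| < (c2 * `|ln eps|^-1)%:E)%E ->
    (`|M2 w0 - (r0 ^+ 2 * mu)%:E| < (c3 * `|ln eps|^-1)%:E)%E ->
    (`|energy w0 - (r0 * mu ^+ 2 / (2 * pi) * `|ln eps|)%:E| < c4%:E)%E ->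
  forall w : R -> R * R -> R, euler_solution w0 w ->
  exists xstar : R -> R * R,
    (forall t : R,
      [/\ halfplane (xstar t),
          `|(xstar t).1 - r0| <= C0 * `|ln eps|^-1 &
          (\int[leb2]_(x in halfplane `&`
                            [set x | (Num.sqrt eps <= eucl_dist x (xstar t))%R])
             ((1 + x.1 ^+ 2) * w t x)%:E <= (C0 * `|ln eps|^-1)%:E)%E]) /\
    ((A0 w0 < +oo)%E ->
     forall t : R,
       (`|(xstar t).2 - mu / (4 * pi * r0) * `|ln eps| * t|%:E
        <= C0%:E * (1 + A0 w0 + `|t|%:E))%E).
Proof.
pose p := Num.sqrt r0; have p0 : 0 < p by rewrite sqrtr_gt0.
have p2 : p ^+ 2 = r0 by rewrite sqr_sqrtr// ltW.
have p4 : p ^+ 4 = r0 ^+ 2 by rewrite -p2 -exprM.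
pose cs := cSmall p mu c1 c2 c3 c4.
pose Rd := cRad p mu c1 c2 c3 c4; pose O := cO p mu c1 c2 c3 c4; pose Ax := cAxis p mu c1 c2 c3 c4.
have Rd0 : 0 < Rd by exact: cRad_gt0.
have O0 : 0 < O by exact: cO_gt0.
have Ax0 : 0 < Ax by exact: cAxis_gt0.
have cs0 : 0 < cs by exact: cSmall_gt0.
(* The condition eps <= exp (- cs) says cs <= L, which is the smallness required by all the
   estimates. *)
exists (expR (- cs)), (Rd + O + Ax); split; first exact: expR_gt0.
split; first exact: addr_gt0 (addr_gt0 Rd0 O0) Ax0.
move=> eps e0 epscs w0 _ hw0 hM0 hM2 hEn w sol.
have e1 : eps < 1 by apply: le_lt_trans epscs _; rewrite -expR0 ltr_expR oppr_lt0.
have L0 : 0 < - ln eps by rewrite oppr_gt0 ln_lt0// e0.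
have Labs : `|ln eps| = - ln eps by rewrite ltr0_norm// -oppr_gt0.
rewrite Labs in hM0 hM2 hEn *.
have small : cs * (- ln eps)^-1 <= 1.
  rewrite ler_pdivrMr// mul1r lerNr -(expRK (- cs)) ler_ln// posrE expR_gt0.
  done.
set l := (- ln eps)^-1 in hM0 hM2 hEn small *.
have l0 : 0 < l by rewrite invr_gt0.
pose c := c1 * eps ^- 2.
have c0 : 0 < c by rewrite mulr_gt0// invr_gt0 exprn_gt0.
have off0 := off_null_ae hw0.
(* Each t is treated on its own interval [- |t|, |t|]. The truncated solution depends on t, the
   constants do not, and the centres are collected by choice. *)
have key t : exists x : R * R, [/\ 0 < x.1, `|x.1 - r0| <= Rd * l,
    (\int[leb2]_(y in halfplane `&` [set y | (Num.sqrt eps <= eucl_dist y x)%R])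
       ((1 + y.1 ^+ 2) * w t y)%:E <= (O * l)%:E)%E
  & (A0 w0 < +oo)%E -> (`|x.2 - mu / (4 * pi * r0) * (- ln eps) * t|%:E
        <= Ax%:E * (1 + A0 w0 + `|t|%:E))%E].
  have T0 : 0 <= `|t| by [].
  have oT : - `|t| <= 0 <= `|t| by rewrite oppr_le0 T0.
  have tT : - `|t| <= t <= `|t| by rewrite -ler_norml.
  have [M hM] := solution_truncation `|t| c0 sol off0.
  (* The level also dominates the initial second moment, so that the truncated datum satisfies
     [good2] with the same constant. *)
  pose M' := Num.max M (fine (M2 w0)).
  have MM' : M <= M' by rewrite le_max lexx.
  pose v s := truncation c M' (w s).
  have gv s : - `|t| <= s <= `|t| -> good c M' (v s) by move=> /(hM M' MM')[].
  have wv s : - `|t| <= s <= `|t| -> off_null (fun x => w s x = v s x) by move=> /(hM M' MM')[].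
  have [_ _ w00 we _] := sol.
  have w0v : off_null (fun x => w0 x = v 0 x).
    by apply: (off_null_sub _ (off_null_and (off_null_ae w00) (wv 0 oT))) => x _ [<-].
  have init (g : R * R -> R) : (\int[leb2]_(x in halfplane) (g x * w0 x)%:E
      = \int[plane_measure (R := R)]_x (g x * v 0 x)%:E)%E.
    apply: halfplane_integral; first by apply: (off_null_sub _ w0v) => x _ ->.
    by move=> x x0; rewrite (good_out (gv 0 oT) x0) mulr0.
  have M2v := init (fun x => x.1 ^+ 2); rewrite -/(M2 w0) in M2v.
  have M2fin : M2 w0 \is a fin_num.
    by move: hM2; case: (M2 w0).
  have g20 : good2 c M' (v 0).
    split; first exact: gv.
    by rewrite -M2v -(fineK M2fin) lee_fin le_max lexx orbT.
  have M2E : M2 w0 = (mom (v 0) r2)%:E by rewrite M2v -(mom_EFin (momint_r2 g20)).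
  have M0E : M0 w0 = (mom (v 0) one)%:E.
    rewrite -(mom_EFin (momint_one g20)) -(init one) /M0; apply: eq_integral => x _.
    by rewrite mul1r.
  have hm0 : `|mom (v 0) one - mu| <= c2 * l.
    by move: hM0; rewrite M0E -EFinB abse_EFin lte_fin => /ltW.
  have hm2 : `|mom (v 0) r2 - p ^+ 4 * mu| <= c3 * l.
    by rewrite p4; move: hM2; rewrite M2E -EFinB abse_EFin lte_fin => /ltW.
  have hE : `|J (v 0) G0 - p ^+ 2 * mu ^+ 2 / (2 * pi) * (- ln eps)| <= c4.
    by rewrite p2; move: hEn; rewrite (energy_truncation g20 w0v) -EFinB abse_EFin lte_fin => /ltW.
  have wev : weak_evolution `|t| v C1c.
    by apply: (weak_euler_truncation we) => s sT; split; [exact: gv|exact: wv].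
  have [x [x0 x1 x2 x3]] := vortex_motion p0 hmu hc1 hc2 hc3 hc4 T0 e0 e1 small gv wev g20 hm0 hm2 hE tT.
  exists x; split => //; first by rewrite -p2.
    rewrite integral_mkcondr.
    have -> : (\int[leb2]_(y in halfplane) ((fun y => ((1 + y.1 ^+ 2) * w t y)%:E) \_
        [set y | (Num.sqrt eps <= eucl_dist y x)%R]) y =
      \int[plane_measure (R := R)]_y ((1 + y.1 ^+ 2) * far (Num.sqrt eps) x y * v t y)%:E)%E.
      apply: halfplane_integral; last by move=> y y0; rewrite (good_out (gv t tT) y0) mulr0.
      apply: (off_null_sub _ (wv t tT)) => y _ wy; rewrite /patch /far eucl_distC.
      case: ifPn => [/set_mem/= ->|]; first by rewrite mulr1 wy.
      by rewrite notin_setE/= => /negP/negbTE ->; rewrite mulr0 mul0r.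
    have gt : good2 c M' (v t).
      split; first exact: gv.
      exact: (second_moment_le T0 (ltW c0) gv wev tT (good2_r2 g20)).
    by rewrite (mom_EFin (momint_r2_far gt x)) lee_fin.
  move=> A0fin; have A0v := init (fun x => japanese x.2 * x.1 ^+ 2); rewrite -/(A0 w0) in A0v.
  have A0ge : (0 <= A0 w0)%E.
    rewrite A0v; apply: integral_ge0 => y _; rewrite lee_fin mulr_ge0 ?(good_ge0 g20)//.
    by rewrite mulr_ge0 ?sqr_ge0// sqrtr_ge0.
  have Af : A0 w0 \is a fin_num by rewrite ge0_fin_numE.
  have -> : (Ax%:E * (1 + A0 w0 + `|t|%:E) = (Ax * (1 + fine (A0 w0) + `|t|))%:E)%E.
    by rewrite EFinM !EFinD fineK.
  by have := x3 (fine (A0 w0)); rewrite p2 lee_fin; apply; rewrite -A0v (fineK Af).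
have C1' : Rd <= Rd + O + Ax by rewrite -addrA lerDl; exact: addr_ge0 (ltW O0) (ltW Ax0).
have C2' : O <= Rd + O + Ax by rewrite addrAC lerDr; exact: addr_ge0 (ltW Rd0) (ltW Ax0).
have C3' : Ax <= Rd + O + Ax by rewrite lerDr; exact: addr_ge0 (ltW Rd0) (ltW O0).
have [xs hxs] := choice key; exists xs; split => [t|A0fin t].
  have [h1 h2 h3 _] := hxs t; split => //.
    by apply: (le_trans h2); rewrite ler_pM2r.
  by apply: (le_trans h3); rewrite lee_fin ler_pM2r.
have [_ _ _ h4] := hxs t; apply: (le_trans (h4 A0fin)).
apply: lee_wpmul2r; last by rewrite lee_fin.
(* That 1 + A0 w0 + |t| is nonnegative is read off from [h4], whose left side is an absolute
   value. *)
rewrite -(@pmule_rge0 _ Ax%:E) ?lte_fin//; apply: le_trans (h4 A0fin).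
by rewrite lee_fin.
Qed.
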